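(* Let $d\ge 1$ be an integer and let $\phi:(0,\infty)\to(0,\infty)$ be a complete Bernstein function for which there are constants $0<\delta_1\le\delta_2<1$, $0<\delta_3\le\delta_4<1$ and $a_1,a_2,a_3,a_4>0$ such that $a_1\lambda^{\delta_1}\phi(t)\le\phi(\lambda t)\le a_2\lambda^{\delta_2}\phi(t)$ for all $\lambda\ge 1$, $t\ge 1$, and $a_3\lambda^{\delta_4}\phi(t)\le\phi(\lambda t)\le a_4\lambda^{\delta_3}\phi(t)$ for all $0<\lambda\le 1$, $0<t\le 1$. Assume $d>2(\delta_2\vee\delta_4)$ and let $X$ be a rotationally invariant L\'evy process in $\mathbb{R}^d$ with characteristic exponent $\phi(|\xi|^2)$. Let $\kappa\in(0,1/2]$, let $D\subset\mathbb{R}^d$ be an open set which is $\kappa$-fat at infinity with characteristics $(R,\kappa)$, $R>1$, and fix $x_0\in D\cap\overline{B}(0,R)^c$. Let $M_D(x,y)=G_D(x,y)/G_D(x_0,y)$ for $x,y\in D$, $y\ne x_0$. Then for each $x\in D$ there exists the limit $$M_D(x,\infty):=\lim_{y\in D,\ |y|\to\infty}M_D(x,y).$$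
   Context: Notation: $s\vee t=\max\{s,t\}$; $B(x,r)$ is the open ball in $\mathbb{R}^d$, and $\overline{B}(0,r)^c=\{y\in\mathbb{R}^d:|y|>r\}$. A complete Bernstein function is a function of the form $\phi(\lambda)=k+b\lambda+\int_0^\infty(1-e^{-\lambda t})\mu(t)\,dt$ with $k,b\ge 0$ and a completely monotone density $\mu(t)$ satisfying $\int_0^\infty(1\wedge t)\mu(t)\,dt<\infty$. The process $X=(X_t,\mathbb{P}_x)$ satisfies $\mathbb{E}_x[e^{i\xi\cdot(X_t-X_0)}]=e^{-t\phi(|\xi|^2)}$ (it is a subordinate Brownian motion); under the assumptions it is transient. An open set $D$ is $\kappa$-fat at infinity with characteristics $(R,\kappa)$ if $R>0$ and for every $r\in[R,\infty)$ there exists $A_r\in\mathbb{R}^d$ with $B(A_r,\kappa r)\subset D\cap\overline{B}(0,r)^c$ and $|A_r|<\kappa^{-1}r$. For an open set $D$, $\tau_D=\inf\{t>0:X_t\notin D\}$; $X^D$ is the process killed upon exiting $D$, with transition density $p_D(t,x,y)=p(t,x,y)-\mathbb{E}_x[p(t-\tau_D,X_{\tau_D},y);t>\tau_D]$, where $p$ is the transition density of $X$; $G_D(x,y)=\int_0^\infty p_D(t,x,y)\,dt$, $x,y\in D$, is the Green function. *)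

(* Defs.v *)
From HB Require Import structures.
From mathcomp Require Import all_boot all_order all_algebra.
From mathcomp Require Import all_classical all_reals all_analysis.

Set Implicit Arguments.
Unset Strict Implicit.
Unset Printing Implicit Defensive.

Import Order.TTheory GRing.Theory Num.Theory.
Import numFieldNormedType.Exports.

Local Open Scope classical_set_scope.
Local Open Scope ring_scope.

(* The library's norm on ['rV[R]_d] is the sup norm; it induces the same
   topology as [enorm], but balls and |y| below are Euclidean. *)
Definition dot (R : realType) (d : nat) (x y : 'rV[R]_d) : R :=
  \sum_(i < d) x 0 i * y 0 i.

Definition enorm (R : realType) (d : nat) (x : 'rV[R]_d) : R :=
  Num.sqrt (dot x x).

Definition eball (R : realType) (d : nat) (x : 'rV[R]_d) (r : R)
  : set 'rV[R]_d := [set y | enorm (y - x) < r].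

Definition enorm_pinfty (R : realType) (d : nat) : set_system 'rV[R]_d :=
  filter_from [set: R] (fun r => [set y | r < enorm y]).

Definition kappa_fat_at_infinity (R : realType) (d : nat) (D : set 'rV[R]_d)
    (R0 kappa : R) : Prop :=
  0 < R0 /\
  forall r : R, R0 <= r ->
    exists A : 'rV[R]_d,
      eball A (kappa * r) `<=` D `&` [set y | r < enorm y] /\
      enorm A < kappa^-1 * r.

Definition borelRd (R : realType) (d : nat) :=
  g_sigma_algebraType (@open 'rV[R]_d).

Fixpoint lebesgue_tuple (R : realType) (n : nat)
    : set (n.-tuple (measurableTypeR R)) -> \bar R :=
  match n with
  | 0 => \d_([tuple] : 0.-tuple (measurableTypeR R))
  | n.+1 =>
      pushforward (@lebesgue_measure R \x @lebesgue_tuple R n)%E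
        (fun xt : measurableTypeR R * n.-tuple (measurableTypeR R) =>
           [tuple of xt.1 :: xt.2] : n.+1.-tuple (measurableTypeR R))
  end.

Definition row_of_tuple (R : realType) (d : nat)
    (t : d.-tuple (measurableTypeR R)) : borelRd R d :=
  \row_(i < d) tnth t i.

Definition lebesgueRd (R : realType) (d : nat) : set (borelRd R d) -> \bar R :=
  pushforward (@lebesgue_tuple R d) (@row_of_tuple R d).

Section lebesgueRd_measure.
Variable R : realType.
Local Notation RT := (measurableTypeR R).

Lemma lebesgue_tuple_sfin (n : nat) :
  exists mu : {sigma_finite_measure set (n.-tuple RT) -> \bar R},
    (mu : set (n.-tuple RT) -> \bar R) = @lebesgue_tuple R n.
Proof.
elim: n => [|n [mu IH]]; first by eexists (\d_([tuple] : 0.-tuple RT)).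
pose f (xt : RT * n.-tuple RT) : n.+1.-tuple RT := [tuple of xt.1 :: xt.2].
have mf : measurable_fun setT f by exact: measurable_cons.
pose g (t : n.+1.-tuple RT) : RT * n.-tuple RT :=
  (thead t, [tuple of behead t]).
have mg : measurable_fun setT g.
  apply: measurable_fun_pair; first exact: measurable_tnth.
  exact: measurable_behead.
have gK xt : g (f xt) = xt.
  case: xt => x t; rewrite /g /f; congr (_, _).
  exact: val_inj.
pose nu := measure_function_pushforward__canonical__measure_function_Measure
  (@lebesgue_measure R \x mu)%E mf.
have snu : sigma_finite setT nu.
  have [F TF Foo] : sigma_finite setT (@lebesgue_measure R \x mu)%E.
    have /sigma_finiteP[F [TF ndF Foo]] := sigma_finiteT (@lebesgue_measure R).
    have /sigma_finiteP[G [TG ndG Goo]] := sigma_finiteT mu.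
    exists (fun n => F n `*` G n).
      rewrite -setXTT TF TG predeqE => -[x y]; split.
        move=> [/= [k _ Fkx] [l _ Gly]]; exists (maxn k l) => //; split.
          by move: x Fkx; exact/subsetPset/ndF/leq_maxl.
        by move: y Gly; exact/subsetPset/ndG/leq_maxr.
      by move=> [k _ []/= ? ?]; split; exists k.
    move=> k; have [? ?] := Foo k; have [? ?] := Goo k.
    split; first exact: measurableX.
    by rewrite product_measure1E// lte_mul_pinfty// ge0_fin_numE.
  exists (fun k => g @^-1` (F k)).
    by rewrite -preimage_bigcup -TF preimage_setT.
  move=> k; have [mFk Fk] := Foo k; split.
    by rewrite -[X in measurable X]setTI; exact: mg.
  rewrite /nu /= /pushforward.
  rewrite (_ : _ @^-1` _ = F k)//; apply/seteqP.
  by split=> xt /=; rewrite -/(f xt) gK.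
pose H := Measure_isSigmaFinite.Build _ _ _ nu snu.
pose nu' : {sigma_finite_measure set (n.+1.-tuple RT) -> \bar R} :=
  HB.pack (nu : set _ -> \bar R) (Measure.on nu) H.
by exists nu'; rewrite /= -IH.
Qed.

Lemma lebesgue_tuple0 n : @lebesgue_tuple R n set0 = 0%E.
Proof. by have [mu <-] := lebesgue_tuple_sfin n; exact: measure0. Qed.

Lemma lebesgue_tuple_ge0 n A : (0 <= @lebesgue_tuple R n A)%E.
Proof. by have [mu <-] := lebesgue_tuple_sfin n; exact: measure_ge0. Qed.

Lemma lebesgue_tuple_sigma_additive n :
  semi_sigma_additive (@lebesgue_tuple R n).
Proof.
by have [mu <-] := lebesgue_tuple_sfin n; exact: measure_semi_sigma_additive.
Qed.

HB.instance Definition _ n := isMeasure.Build _ _ _ (@lebesgue_tuple R n)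
  (lebesgue_tuple0 n) (@lebesgue_tuple_ge0 n) (@lebesgue_tuple_sigma_additive n).

Lemma measurable_row_of_tuple d : measurable_fun setT (@row_of_tuple R d).
Proof.
refine (@measurability _ _ _ (borelRd R d) _ _ (@open _) erefl _).
move=> _ [U oU <-]; rewrite setTI.
pose box (qk : 'rV[rat]_d * nat) : set 'rV[R]_d :=
  [set x | forall i, ball (ratr (qk.1 0 i) : R) (qk.2.+1%:R^-1) (x 0 i)].
have -> : U = \bigcup_qk [set x | box qk `<=` U /\ box qk x].
  apply/seteqP; split; last by move=> x [qk _ /= [+ bx]]; exact.
  move=> x Ux.
  have /nbhs_ballP[e /= e0 eU] : nbhs x U by exact: open_nbhs_nbhs.
  have [k ke] : exists k : nat, k.+1%:R^-1 < e / 2.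
    have [k _ /(_ _ (leqnn _)) ke] := near_infty_natSinv_lt (PosNum (divr_gt0 e0 (ltr0Sn R 1))).
    by exists k.
  have q_ i : {q : rat | ball (ratr q : R) (k.+1%:R^-1) (x 0 i)}.
    apply: cid.
    have [|q] := @rat_in_itvoo R (x 0 i - k.+1%:R^-1) (x 0 i + k.+1%:R^-1).
      by rewrite ltrD2l gtrN // invr_gt0.
    rewrite in_itv /= => /andP[q1 q2]; exists q.
    by rewrite /ball /= ltr_distlC ltrBlDr q2 -ltrBlDr q1.
  exists (\row_i sval (q_ i), k) => //=; split.
    move=> y yb; apply: eU; split => // j i; rewrite ord1.
    have := yb i; rewrite /= mxE; have := svalP (q_ i).
    rewrite /ball /= => xq yq.
    apply: (@le_lt_trans _ _ (`|ratr (sval (q_ i)) - x 0 i| + `|ratr (sval (q_ i)) - y 0 i|)).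
      by rewrite (distrC (ratr _) (x 0 i)); exact: ler_distD.
    by rewrite [e]splitr; apply: ltrD; exact: lt_trans ke.
  by move=> i /=; rewrite mxE; exact: (svalP (q_ i)).
rewrite preimage_bigcup; apply: countable_bigcupT_measurable => // qk.
have [bU|nbU] := pselect (box qk `<=` U); last first.
  by rewrite (_ : _ @^-1` _ = set0)// -subset0 => t [].
rewrite (_ : _ @^-1` _ = \bigcap_(i in [set: 'I_d])
    ((@tnth d RT)^~ i @^-1` (ball (ratr (qk.1 0 i) : R) (qk.2.+1%:R^-1)))).
  apply: fin_bigcap_measurable => // i _.
  rewrite -[X in measurable X]setTI; apply: measurable_tnth => //.
  by rewrite ball_itv; exact: measurable_itv.
apply/seteqP; split=> t /=.
  by move=> [_ bt] i _; have := bt i; rewrite /row_of_tuple mxE.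
by move=> bt; split => // i; rewrite /row_of_tuple mxE; exact: bt.
Qed.

Let lebesgueRd_pushforward d :=
  measure_function_pushforward__canonical__measure_function_Measure
    (@lebesgue_tuple R d) (@measurable_row_of_tuple d).

HB.instance Definition _ d := isMeasure.Build _ _ _ (@lebesgueRd R d)
  (measure0 (lebesgueRd_pushforward d))
  (measure_ge0 (lebesgueRd_pushforward d))
  (@measure_semi_sigma_additive _ _ _ (lebesgueRd_pushforward d)).

Lemma lebesgueRd_box d (A : 'I_d -> set RT) :
  (forall i, measurable (A i)) ->
  lebesgueRd [set x : 'rV[R]_d | forall i, A i (x 0 i)] =
  (\prod_(i < d) @lebesgue_measure R (A i))%E.
Proof.
move=> mA; rewrite /lebesgueRd /pushforward.
rewrite (_ : _ @^-1` _ = [set t : d.-tuple RT | forall i, A i (tnth t i)]);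
  last first.
  by apply/seteqP; split=> t /= At i; have := At i; rewrite /row_of_tuple mxE.
elim: d A mA => [|d IH] A mA.
  by rewrite big_ord0 /= diracE mem_set// => -[].
rewrite big_ord_recl -IH => [|i]; last exact: mA.
have [mu muE] := lebesgue_tuple_sfin d.
rewrite /= /pushforward -muE -product_measure1E//; last first.
  rewrite (_ : [set _ | _] =
      \bigcap_(i in [set: 'I_d]) ((@tnth d RT)^~ i @^-1` A (lift ord0 i))).
    apply: fin_bigcap_measurable => // i _.
    by rewrite -[X in measurable X]setTI; exact: measurable_tnth.
  by apply/seteqP; split=> t /= At i; [move=> _; exact: At|exact: At].
congr product_measure1; apply/seteqP; split=> -[x t] /=.
  move=> At; split; first exact: (At ord0).
  by move=> i; have := At (lift ord0 i); rewrite tnthS.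
by move=> [Ax At] i; case: (unliftP ord0 i) => [j ->|->//]; rewrite tnthS.
Qed.

End lebesgueRd_measure.

Definition completely_monotone (R : realType) (mu : R -> R) : Prop :=
  forall (n : nat) (t : R), 0 < t ->
    derivable (derive1n n mu) t 1 /\ 0 <= (-1) ^+ n * derive1n n mu t.

(* Only the values on ]0, +oo[ of [phi] and of the density matter. *)
Definition complete_bernstein (R : realType) (phi : R -> R) : Prop :=
  exists (k b : R) (mu : R -> R),
    [/\ 0 <= k, 0 <= b, completely_monotone mu,
      (\int[@lebesgue_measure R]_(t in `]0%R, +oo[)
         (Num.min 1 t * mu t)%:E < +oo)%E
    & forall l : R, 0 < l ->
      (phi l)%:E = ((k + b * l)%:E +
        \int[@lebesgue_measure R]_(t in `]0%R, +oo[)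
          ((1 - expR (- (l * t))) * mu t)%:E)%E].

Section levy.
Context (R : realType) (d : nat).
Context (disp : measure_display) (Omega : measurableType disp).
Implicit Types (P : 'rV[R]_d -> probability Omega R) (X : R -> Omega -> 'rV[R]_d).

(* Only the values [X t] for [0 <= t] are meaningful; [P x] is the law under
   which the process starts from [x]. *)
Record levy_process P X : Prop := LevyProcess {
  levy_measurable : forall t : R, 0 <= t ->
    measurable_fun [set: Omega] (X t : Omega -> borelRd R d) ;
  levy_start : forall x, P x [set w | X 0 w = x] = 1%E ;
  levy_independent_increments :
    forall x (n : nat) (t : nat -> R) (B : nat -> set (borelRd R d)),
      0 <= t 0%N -> (forall i, t i <= t i.+1) -> (forall i, measurable (B i)) ->
      P x [set w | forall i, (i < n)%N -> B i (X (t i.+1) w - X (t i) w)] =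
      (\prod_(i < n) P x [set w | B i (X (t i.+1) w - X (t i) w)%R])%E ;
  levy_stationary_increments :
    forall x (s t : R) (B : set (borelRd R d)),
      0 <= s -> 0 <= t -> measurable B ->
      P x [set w | B (X (s + t) w - X s w)] =
      P x [set w | B (X t w - X 0 w)] ;
  levy_cadlag : forall x, {ae P x, forall w,
    (forall t : R, 0 <= t -> X^~ w @ t^'+ --> X t w) /\
    (forall t : R, 0 < t -> cvg (X^~ w @ t^'-))}
}.

Definition rotationally_invariant P X : Prop :=
  forall x (O : 'M[R]_d) (t : R) (B : set (borelRd R d)),
    O *m O^T = 1%:M -> 0 <= t -> measurable B ->
    P x [set w | B ((X t w - X 0 w) *m O)] = P x [set w | B (X t w - X 0 w)].

(* E_x[exp(i xi.(X_t - X_0))] = exp(- t phi(|xi|^2)), split into real and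
   imaginary parts. As [phi] lives on ]0, +oo[, xi = 0, where both sides are 1
   (with phi(0) := phi(0+) = 0), is left out. *)
Definition has_characteristic_exponent P X (phi : R -> R) : Prop :=
  forall x xi (t : R), xi != 0 -> 0 <= t ->
    (\int[P x]_w (cos (dot xi (X t w - X 0 w)))%:E =
      (expR (- (t * phi (enorm xi ^+ 2))))%:E)%E /\
    (\int[P x]_w (sin (dot xi (X t w - X 0 w)))%:E = 0)%E.

(* Continuity pins down the density pointwise. *)
Record transition_density P X (p : R -> 'rV[R]_d -> 'rV[R]_d -> R) : Prop :=
  TransitionDensity {
  density_ge0 : forall (t : R) x y, 0 < t -> 0 <= p t x y ;
  density_continuous : forall (t : R) x y, 0 < t ->
    {for (t, (x, y)), continuous
      (fun z : R * ('rV[R]_d * 'rV[R]_d) => p z.1 z.2.1 z.2.2)} ;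
  density_law : forall (t : R) x (B : set (borelRd R d)),
    0 < t -> measurable B ->
    P x [set w | B (X t w)] =
    (\int[@lebesgueRd R d]_(y in B) (p t x y)%:E)%E
}.

Definition exit_time X (D : set 'rV[R]_d) (w : Omega) : \bar R :=
  ereal_inf [set t%:E | t in [set t : R | 0 < t /\ ~ D (X t w)]].

(* On {tau_D < t} the exit time is finite, so that [fine] is harmless. *)
Definition killed_density P X (p : R -> 'rV[R]_d -> 'rV[R]_d -> R)
    (D : set 'rV[R]_d) (t : R) (x y : 'rV[R]_d) : \bar R :=
  ((p t x y)%:E -
   \int[P x]_(w in [set w | exit_time X D w < t%:E])
     (let tau := fine (exit_time X D w) in p (t - tau)%R (X tau w) y)%:E)%E.

Definition green P X p D (x y : 'rV[R]_d) : \bar R :=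
  (\int[@lebesgue_measure R]_(t in `]0%R, +oo[) killed_density P X p D t x y)%E.

Definition martin_kernel P X p D (x0 x y : 'rV[R]_d) : \bar R :=
  (green P X p D x y / green P X p D x0 y)%E.

End levy.

(* Main.v *)
(* Observe the process at the times k eps, eps = 2^-m, and kill it when it is
   found outside D_n, the points at distance at least 1/(n+1) from the complement
   of D. This is a walk with a symmetric kernel q, comparable at large distances
   with eps |x-y|^-d phi(|x-y|^-2), and all bounds below are uniform in eps and n.

   Let u_x be the Green function of the killed walk started at x, and
   I_x(r) = 1 + int_{|y|<r} u_x. Splitting paths at the last exit from the ball
   B_r, and using that q(w,z) hardly depends on z in B_r when |w| >= 2r, one finds
   u_x(y) comparable with I_x(r) H_r(y) for |y| >= 4r, where H_r does not depend
   on x. The fat balls make I_x(r) grow geometrically with r, so the visits to a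
   fixed ball become negligible, and each sufficiently large increase of the scale
   contracts the oscillation of u_x/u_x0 by a fixed factor. Thus y -> u_x/u_x0 is
   Cauchy at infinity, uniformly in eps and n. Written without quotients, the
   Cauchy condition passes to the limits eps -> 0 (right continuity of paths) and
   n -> oo (quasi-left continuity), that is, to the Green function of D.

   The density p(t,x,y) decreases in |x-y|: for a complete Bernstein function the
   jump density of X is a mixture of Gaussians, so exp(-t phi) preserves the radial
   monotonicity of Gaussian-smoothed laws. Combined with the values of
   E[1 - exp(-a|X_t-x|^2)], monotonicity yields two-sided bounds on p. *)

(* The obstacle is that [exit_time] and [killed_density] come with neither measurability nor a
   strong Markov property, and that nothing is known about the boundary of D. On a grid, killing is
   a finite iteration of kernels, the first exits form a countable family of disjoint events, and
   the Markov property at fixed times is enough. A grid detects an exit when the complement is open,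
   which is why D is first replaced by the closed sets D_n. Measurability of the killed density of
   D_n in t is then a by-product of convergence. No estimate is made near the boundary: balls about
   the origin are compared at larger and larger scales, and at infinity D enters only through the
   growth of I_x. Comparisons are kept in the form m u_2 <= u_1 <= M u_2, in extended reals, so that
   no quotient is formed before the limit. The condition on d enters through the on-diagonal bound
   of order t^(-d / (2 max(delta_2, delta_4))) for t > 1: it is integrable in t, which makes the
   Green functions finite and dominates the time integrals when the limits are taken. *)
From HB Require Import structures.
Require Import Defs.
From mathcomp Require Import all_boot all_order all_algebra.
From mathcomp Require Import all_classical all_reals all_analysis.
From mathcomp Require Import measurable_realfun.
From mathcomp Require Import ring lra zify.

Set Implicit Arguments.
Unset Strict Implicit.
Unset Printing Implicit Defensive.

Import Order.TTheory GRing.Theory Num.Theory.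
Import numFieldNormedType.Exports.

Local Open Scope classical_set_scope.
Local Open Scope ring_scope.

(** * Lebesgue measure on row vectors *)

Section lebesgue_rV.
Context (R : realType).
Local Notation RT := (measurableTypeR R).

Lemma continuous_measurable_rV d (f : 'rV[R]_d -> R) : continuous f ->
  measurable_fun [set: borelRd R d] (f : borelRd R d -> R).
Proof.
move=> cf.
apply: (measurability _ (RGenOInfty.measurableE R)) => _ [_ [a ->] <-].
rewrite setTI; apply: sub_sigma_algebra.
by apply: open_comp => [x _|]; [exact: cf|exact: interval_open].
Qed.

Lemma measurable_coord d (i : 'I_d) :
  measurable_fun [set: borelRd R d] (fun x : borelRd R d => x 0 i).
Proof. by apply: continuous_measurable_rV; exact: coord_continuous. Qed.

Lemma measurable_rowP d d' (T : measurableType d') (f : T -> borelRd R d) :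
  measurable_fun [set: T] f <->
  forall i, measurable_fun [set: T] (fun t => f t 0 i).
Proof.
split=> [mf i|mf]; first exact: measurableT_comp (measurable_coord i) mf.
have -> : f = @row_of_tuple R d \o (fun t => [tuple (f t 0 i : RT) | i < d]).
  by apply/funext => t; apply/rowP => i; rewrite !mxE tnth_mktuple.
apply: measurableT_comp; first exact: measurable_row_of_tuple.
apply/measurable_fun_tnthP => i.
by apply: eq_measurable_fun (mf i) => t _ /=; rewrite tnth_mktuple.
Qed.

Section rowops.
Context (d : nat) (d' : measure_display) (T : measurableType d').
Implicit Types f g : T -> borelRd R d.

Lemma measurable_rowD f g : measurable_fun [set: T] f ->
  measurable_fun [set: T] g -> measurable_fun [set: T] (fun t => f t + g t : borelRd R d).
Proof.
move=> /measurable_rowP mf /measurable_rowP mg; apply/measurable_rowP => i.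
under eq_fun do rewrite mxE.
exact: measurable_funD.
Qed.

Lemma measurable_rowN f : measurable_fun [set: T] f ->
  measurable_fun [set: T] (fun t => - f t : borelRd R d).
Proof.
move=> /measurable_rowP mf; apply/measurable_rowP => i.
under eq_fun do rewrite mxE.
exact: measurable_funN.
Qed.

Lemma measurable_rowB f g : measurable_fun [set: T] f ->
  measurable_fun [set: T] g -> measurable_fun [set: T] (fun t => f t - g t : borelRd R d).
Proof. by move=> mf mg; apply: measurable_rowD => //; exact: measurable_rowN. Qed.

Lemma measurable_dot f g : measurable_fun [set: T] f ->
  measurable_fun [set: T] g -> measurable_fun [set: T] (fun t => dot (f t) (g t)).
Proof.
move=> /measurable_rowP mf /measurable_rowP mg; rewrite /dot.
by apply: measurable_sum => i; exact: measurable_funM.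
Qed.

Lemma measurable_enorm f : measurable_fun [set: T] f ->
  measurable_fun [set: T] (fun t => enorm (f t)).
Proof.
move=> mf; apply: (measurableT_comp (f := @Num.sqrt R)); last exact: measurable_dot.
by apply: continuous_measurable_fun; exact: sqrt_continuous.
Qed.

End rowops.

Lemma sigma_finite_lebesgueRd d : sigma_finite setT (@lebesgueRd R d).
Proof.
exists (fun n : nat => [set x : 'rV[R]_d | forall i : 'I_d, `[- n%:R, n%:R]%classic (x 0 i)]).
  apply/seteqP; split=> // x _.
  have [n nx] : exists n : nat, forall i, `|x 0 i| <= n%:R.
    exists (\big[maxn/0%N]_(i < d) Num.trunc `|x 0 i|).+1 => i.
    rewrite (le_trans (ltW (truncnS_gt _)))// ler_nat ltnS.
    exact: (leq_bigmax i).
  by exists n => //= i; rewrite in_itv/= -ler_norml.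
move=> n; have mA : forall i : 'I_d, measurable (`[- n%:R, n%:R]%classic : set RT).
  by move=> i; exact: measurable_itv.
split.
  rewrite (_ : [set _ | _] =
      \bigcap_(i in [set: 'I_d]) ((fun x : borelRd R d => x 0 i) @^-1` `[- n%:R, n%:R]%classic)).
    apply: fin_bigcap_measurable => // i _.
    by rewrite -[X in measurable X]setTI; apply: measurable_coord.
  by apply/seteqP; split=> x /= xn i; [move=> _; exact: xn|exact: xn].
rewrite (lebesgueRd_box (A := fun=> `[- n%:R, n%:R]%classic))//.
under eq_bigr do rewrite lebesgue_measure_itv/=.
case: ifPn => _.
  rewrite -EFinB.
  by rewrite prodEFin ltry.
by rewrite (_ : 0 = 0%R%:E)%E// prodEFin ltry.
Qed.

HB.instance Definition _ d := Measure_isSigmaFinite.Build _ _ _ (@lebesgueRd R d)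
  (sigma_finite_lebesgueRd d).

Local Open Scope ereal_scope.

Lemma ge0_integral_lebesgueRd d (f : borelRd R d -> \bar R) :
  measurable_fun setT f -> (forall x, 0 <= f x) ->
  \int[@lebesgueRd R d]_x f x = \int[@lebesgue_tuple R d]_t f (row_of_tuple t).
Proof.
move=> mf f0.
rewrite -[RHS](ge0_integral_pushforward (measurable_row_of_tuple (d := d)) _ _ mf)//.
Qed.

(** Tonelli in the first coordinate. [lebesgue_tuple] itself only carries a measure structure, hence
    the detour through the sigma-finite [mu] that equals it. *)
Lemma ge0_integral_lebesgue_tupleS n (f : n.+1.-tuple RT -> \bar R) :
  measurable_fun setT f -> (forall x, 0 <= f x) ->
  \int[@lebesgue_tuple R n.+1]_t f t =
  \int[lebesgue_measure]_x \int[@lebesgue_tuple R n]_t f [tuple of x :: t].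
Proof.
move=> mf f0; have [mu muE] := lebesgue_tuple_sfin R n.
have mc : measurable_fun setT (fun xt : RT * n.-tuple RT => [tuple of xt.1 :: xt.2]).
  exact: measurable_cons.
transitivity (\int[pushforward (@lebesgue_measure R \x mu)
    (fun xt : RT * n.-tuple RT => [tuple of xt.1 :: xt.2])]_t f t).
  by apply: eq_measure_integral => A mA _ /=; rewrite muE.
rewrite (ge0_integral_pushforward mc) => [|//|//|t _]; last exact: f0.
rewrite preimage_setT fubini_tonelli1; last 2 first.
- exact: measurableT_comp mf mc.
- by move=> x; exact: f0.
apply: eq_integral => x _; rewrite /fubini_F/=.
apply: eq_measure_integral => A mA _; exact: (f_equal (fun m => m A) muE).
Qed.

Lemma ge0_integral_lebesgue_tuple0 (f : 0.-tuple RT -> \bar R) :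
  measurable_fun setT f -> (forall x, 0 <= f x) ->
  \int[@lebesgue_tuple R 0]_t f t = f [tuple].
Proof.
move=> mf f0; rewrite /= (eq_measure_integral (\d_([tuple] : 0.-tuple RT))) //.
by rewrite integral_dirac// diracT mul1e.
Qed.

Lemma lebesgue_measure_shift (c : R) (A : set RT) : measurable A ->
  lebesgue_measure A = pushforward lebesgue_measure (fun x : RT => (x + c)%R : RT) A.
Proof.
move=> mA.
have mf : measurable_fun setT (fun x : RT => (x + c)%R : RT) by exact: measurable_funD.
apply: (lebesgue_measure_unique (mu := measure_function_pushforward__canonical__measure_function_Measure lebesgue_measure mf)) => //.
move=> _ [[a b] _ <-] /=.
rewrite /pushforward (_ : _ @^-1` _ = `](a - c)%R, (b - c)%R]%classic); last first.
  by apply/seteqP; split => x /=; rewrite !in_itv/= ltrBlDr lerBrDr.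
rewrite !lebesgue_measure_itv/= !lte_fin ltrD2r; case: ifP => // _.
by rewrite -EFinB -EFinD; congr EFin; ring.
Qed.

Lemma ge0_integral_affine1 (s c : R) (f : RT -> \bar R) : (s = 1 \/ s = -1)%R ->
  measurable_fun setT f -> (forall x, 0 <= f x) ->
  \int[lebesgue_measure]_x f (s * x + c)%R = \int[lebesgue_measure]_x f x.
Proof.
move=> s1 mf f0.
have mshift : measurable_fun setT (fun x : RT => (x + c)%R : RT) by exact: measurable_funD.
have shiftE (g : RT -> \bar R) : measurable_fun setT g -> (forall x, 0 <= g x) ->
    \int[lebesgue_measure]_x g (x + c)%R = \int[lebesgue_measure]_x g x.
  move=> mg g0.
  rewrite -[LHS](ge0_integral_pushforward mshift _ _ mg)//.
  by apply: eq_measure_integral => A mA _; exact/esym/lebesgue_measure_shift.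
case: s1 => ->.
  by under eq_integral do rewrite mul1r; exact: shiftE.
have mN : measurable_fun setT (fun x : RT => (- x)%R : RT) by exact: measurable_funN.
transitivity (\int[lebesgue_measure]_x ((fun z : RT => f (z + c)%R) (- x)%R)).
  by apply: eq_integral => x _; rewrite mulN1r.
have mfc : measurable_fun setT (fun z : RT => f (z + c)%R) by exact: measurableT_comp mf mshift.
rewrite -[LHS](ge0_integral_pushforward mN _ _ mfc)//.
rewrite -[RHS]shiftE//.
apply: eq_measure_integral => A mA _; exact: lebesgue_measureN.
Qed.

Lemma ge0_integral_affine_tuple n (s : R) (c : 'I_n -> R) (f : n.-tuple RT -> \bar R) :
  (s = 1 \/ s = -1)%R -> measurable_fun setT f -> (forall x, 0 <= f x) ->
  \int[@lebesgue_tuple R n]_t f [tuple (s * tnth t i + c i)%R | i < n] =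
  \int[@lebesgue_tuple R n]_t f t.
Proof.
move=> s1; elim: n c f => [|n IH] c f mf f0.
  by apply: eq_integral => t _; congr f; rewrite [RHS]tuple0 tuple0.
have maff m (e : 'I_m -> R) :
    measurable_fun setT (fun t : m.-tuple RT => [tuple (s * tnth t i + e i)%R | i < m]).
  apply/measurable_fun_tnthP => i /=.
  rewrite (_ : _ \o _ = fun t : m.-tuple RT => (s * tnth t i + e i)%R); last first.
    by apply/funext => t /=; rewrite tnth_mktuple.
  by apply: measurable_funD => //; apply: measurable_funM => //; exact: measurable_tnth.
rewrite ge0_integral_lebesgue_tupleS; last 2 first.
- exact: measurableT_comp mf (maff _ _).
- by move=> t; exact: f0.
rewrite (ge0_integral_lebesgue_tupleS mf f0).
pose F (x : RT) := \int[@lebesgue_tuple R n]_t f [tuple of x :: t].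
transitivity (\int[lebesgue_measure]_x F (s * x + c ord0)%R).
  apply: eq_integral => x _; rewrite /F.
  rewrite -[RHS](IH (fun i => c (lift ord0 i)))//; last first.
    apply: measurableT_comp mf _.
    by apply: measurable_cons.
  apply: eq_integral => t _; congr f; apply: eq_from_tnth => i.
  rewrite tnth_mktuple; case: (unliftP ord0 i) => [j ->|->].
    by rewrite !tnthS tnth_mktuple.
  by rewrite !tnth0.
rewrite ge0_integral_affine1//; last first.
  by move=> x; exact: integral_ge0.
have [mu muE] := lebesgue_tuple_sfin R n.
rewrite (_ : F = fubini_F mu (fun xt => f [tuple of xt.1 :: xt.2])).
  apply: measurable_fun_fubini_tonelli_F => //.
  by apply: measurableT_comp mf _; exact: measurable_cons.
apply/funext => x; rewrite /F /fubini_F/=; apply: eq_measure_integral => A mA _.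
exact: (f_equal (fun m => m A) (esym muE)).
Qed.

(** With [s = -1] and [c = x + x] this is the reflection y -> 2 x - y, under which the law of one
    step from x is invariant. *)
Lemma ge0_integral_affineRd d (s : R) (c : 'rV[R]_d) (f : borelRd R d -> \bar R) :
  (s = 1 \/ s = -1)%R -> measurable_fun setT f -> (forall x, 0 <= f x) ->
  \int[@lebesgueRd R d]_x f (s *: x + c)%R = \int[@lebesgueRd R d]_x f x.
Proof.
move=> s1 mf f0.
have maff : measurable_fun setT (fun x : borelRd R d => (s *: x + c)%R : borelRd R d).
  apply/measurable_rowP => i; under eq_fun do rewrite !mxE.
  by apply: measurable_funD => //; apply: measurable_funM => //; exact: measurable_coord.
rewrite !ge0_integral_lebesgueRd//; last exact: measurableT_comp mf maff.
rewrite -[RHS](ge0_integral_affine_tuple (fun i => c 0%R i) s1)//; last first.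
  exact: measurableT_comp mf (measurable_row_of_tuple (d := d)).
apply: eq_integral => t _; congr f; apply/rowP => i.
by rewrite !mxE tnth_mktuple.
Qed.

Lemma ge0_integral_shiftRd d (c : 'rV[R]_d) (f : borelRd R d -> \bar R) :
  measurable_fun setT f -> (forall x, 0 <= f x) ->
  \int[@lebesgueRd R d]_x f (x + c)%R = \int[@lebesgueRd R d]_x f x.
Proof.
move=> mf f0; rewrite -[RHS](@ge0_integral_affineRd _ 1 c)//; last by left.
by under [RHS]eq_integral do rewrite scale1r.
Qed.

End lebesgue_rV.

(** * Gaussians and their Fourier transforms *)

Lemma dominated_cvg_R (R : realType) (disp : measure_display) (T : measurableType disp)
    (mu : {measure set T -> \bar R}) (f_ : nat -> T -> R) (f g : T -> R) :
  (forall n, measurable_fun setT (f_ n)) -> (forall x, f_ n x @[n --> \oo] --> f x) ->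
  mu.-integrable setT (EFin \o g) -> (forall n x, `|f_ n x| <= g x) ->
  mu.-integrable setT (EFin \o f) /\
  (\int[mu]_x (f_ n x)%:E)%E @[n --> \oo] --> (\int[mu]_x (f x)%:E)%E.
Proof.
move=> mf_ cf ig fg.
have mf : measurable_fun setT f by apply: (measurable_fun_cvg mf_) => x _; exact: cf.
have cE x : (f_ n x)%:E @[n --> \oo] --> (f x)%:E.
  by apply/fine_cvgP; split; [exact: nearW|exact: cf].
have [h1 _ h2] := @dominated_convergence _ _ _ mu setT measurableT
  (fun n => EFin \o f_ n) (EFin \o f) (EFin \o g)
  (fun n => (measurable_EFinP _ _).2 (mf_ n)) ((measurable_EFinP _ _).2 mf)
  (aeW _ (fun x _ => cE x)) ig
  (aeW _ (fun x n _ => fg n x)).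
by split.
Qed.

Section gauss1.
Context (R : realType).
Local Notation mu := (@lebesgue_measure R).

Definition gau (a : R) (s : R) : R := expR (- (a * s ^+ 2)).

Lemma gau_gt0 a s : 0 < gau a s. Proof. exact: expR_gt0. Qed.

Lemma continuous_gau a : continuous (gau a).
Proof.
have -> : gau a = expR \o (fun s => - (a * s ^+ 2)) by [].
move=> s; apply: continuous_comp; last exact: continuous_expR.
by apply: cvgN; apply: cvgMl_tmp; exact: exprn_continuous.
Qed.

Lemma measurable_gau a : measurable_fun setT (gau a).
Proof. exact: continuous_measurable_fun (@continuous_gau a). Qed.

Lemma integral_gau a : 0 < a ->
  (\int[mu]_s (gau a s)%:E = (Num.sqrt (pi / a))%:E)%E.
Proof.
move=> a0; pose s := Num.sqrt (2 * a)^-1.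
have s2 : s ^+ 2 = (2 * a)^-1 by rewrite sqr_sqrtr// invr_ge0 mulr_ge0// ltW.
have s0 : s != 0 by rewrite gt_eqF// sqrtr_gt0 invr_gt0 mulr_gt0.
have := integral_normal_pdf 0 s; rewrite normal_pdfE//.
have peak : normal_peak s = (Num.sqrt (pi / a))^-1.
  by rewrite /normal_peak s2; congr (Num.sqrt _)^-1; rewrite -mulr_natr; field; rewrite gt_eqF.
have pk0 : 0 < Num.sqrt (pi / a) by rewrite sqrtr_gt0 divr_gt0// pi_gt0.
have e : forall x, normal_fun 0 s x = gau a x.
  by move=> x; rewrite /normal_fun /gau s2 subr0 -mulr_natr; congr expR; field; rewrite gt_eqF.
under eq_integral do rewrite EFinM e peak.
rewrite ge0_integralZl//=; last 2 first.
- by apply/measurable_EFinP; exact: measurable_gau.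
- by move=> x _; rewrite lee_fin ltW// gau_gt0.
move=> h.
have : ((Num.sqrt (pi / a))%:E * ((Num.sqrt (pi / a))^-1%:E * \int[mu]_x (gau a x)%:E) = (Num.sqrt (pi / a))%:E * 1)%E.
  by rewrite h.
by rewrite muleA -EFinM divff ?gt_eqF// mul1e mule1.
Qed.

Lemma integrable_gau a : 0 < a -> mu.-integrable setT (EFin \o gau a).
Proof.
move=> a0; apply/integrableP; split; first by apply/measurable_EFinP; exact: measurable_gau.
under eq_integral do rewrite /= ger0_norm ?(ltW (gau_gt0 _ _))//.
by rewrite integral_gau// ltry.
Qed.

Lemma integrable_gau_bounded a (h : R -> R) : 0 < a -> measurable_fun setT h ->
  (forall s, `|h s| <= 1) -> mu.-integrable setT (EFin \o (fun s => gau a s * h s)).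
Proof.
move=> a0 mh h1; apply: le_integrable (integrable_gau a0) => //.
  by apply/measurable_EFinP; apply: measurable_funM => //; exact: measurable_gau.
move=> s _ /=; rewrite lee_fin normrM ler_piMr//.
Qed.

(** Half of the Gaussian absorbs the factor |s|. This makes |s| times the Gaussian integrable, the
    majorant for differentiating the Fourier integral under the integral sign. *)
Lemma abs_gau_le a s : 0 < a -> `|s| * gau a s <= (1 + 2 / a) * gau (a / 2) s.
Proof.
move=> a0.
have -> : gau a s = gau (a / 2) s * gau (a / 2) s.
  by rewrite /gau -expRD; congr expR; field.
rewrite mulrA ler_wpM2r ?(ltW (gau_gt0 _ _))//.
rewrite /gau expRN ler_pdivrMr ?expR_gt0//.
have e1 := expR_ge1Dx (a / 2 * s ^+ 2).
have : (1 + 2 / a) * (1 + a / 2 * s ^+ 2) <= (1 + 2 / a) * expR (a / 2 * s ^+ 2).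
  by rewrite ler_pM2l// addr_gt0// divr_gt0.
apply: le_trans.
have -> : (1 + 2 / a) * (1 + a / 2 * s ^+ 2) = 1 + 2 / a + a / 2 * s ^+ 2 + s ^+ 2.
  by field; rewrite gt_eqF.
have : 0 <= 2 / a by rewrite divr_ge0// ltW.
have : 0 <= a / 2 * s ^+ 2 by rewrite mulr_ge0 ?sqr_ge0// divr_ge0// ltW.
have : `|s| <= 1 + s ^+ 2.
  by rewrite -real_normK ?num_real//; have := normr_ge0 s; move: `|s| => u u0; nra.
by lra.
Qed.

Lemma integrable_abs_gau a : 0 < a -> mu.-integrable setT (EFin \o (fun s => `|s| * gau a s)).
Proof.
move=> a0.
have ig : mu.-integrable setT (EFin \o (fun s => (1 + 2 / a) * gau (a / 2) s)).
  by rewrite /comp; under eq_fun do rewrite EFinM; apply: integrableZl => //; apply: integrable_gau; rewrite divr_gt0.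
apply: le_integrable ig => //.
  by apply/measurable_EFinP; apply: measurable_funM; [exact: continuous_measurable_fun (@norm_continuous _ _)|exact: measurable_gau].
move=> s _ /=; rewrite lee_fin normrM normr_id (ger0_norm (ltW (gau_gt0 _ _))).
by apply: le_trans (ler_norm _); exact: abs_gau_le.
Qed.

Lemma cvg_gau0 a : 0 < a -> gau a n%:R @[n --> \oo] --> (0 : R).
Proof.
move=> a0; apply: (@squeeze_cvgr _ _ _ _ (fun=> 0 : R) (fun n : nat => a^-1 * n.+1%:R^-1 * 2)).
- near=> n; rewrite ltW ?gau_gt0//=.
  have n0 : (0 < n)%N by near: n; exact: nbhs_infty_gt.
  rewrite /gau expRN invf_ple ?posrE ?expR_gt0//; last first.
    by rewrite !mulr_gt0// invr_gt0.
  apply: le_trans (expR_ge1Dx _).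
  rewrite !invfM !invrK.
  have n1 : 1 <= n%:R :> R by rewrite ler1n.
  rewrite -natr1.
  have : a * 1 <= a * n%:R by rewrite ler_pM2l.
  have : a * n%:R <= a * n%:R ^+ 2 by rewrite ler_pM2l// expr2 ler_peMl//.
  lra.
- exact: cvg_cst.
- rewrite -[X in _ --> X](mul0r 2) -(mulr0 a^-1).
  by apply: cvgM; [apply: cvgM; [exact: cvg_cst|exact: cvg_harmonic]|exact: cvg_cst].
Unshelve. all: by end_near. Qed.

(** [k] is the derivative of [K] in s. Since [K] vanishes at both ends, the integral of [k] is 0: an
    integration by parts, whose outcome is the equation [FS]. *)
Let K a b x s : R := gau a s * sin (b + x * s).
Let k a b x s : R := gau a s * (x * cos (b + x * s)) - (2 * a * s) * (gau a s * sin (b + x * s)).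

Let is_derive_gau (a s : R) : is_derive s (1 : R) (gau a) (- (2 * a * s) * gau a s).
Proof.
have h : is_derive s (1 : R) (fun s => - (a * s ^+ 2)) (- (2 * a * s)).
  apply: is_derive_eq; rewrite /GRing.scale/=; ring.
have := @is_derive1_comp _ expR (fun s => - (a * s ^+ 2)) s _ _ (is_derive_expR _) h.
by move/is_derive_eq; apply; rewrite mulrC.
Qed.

Let is_derive_K (a b x s : R) : is_derive s (1 : R) (K a b x) (k a b x s).
Proof.
have h : is_derive s (1 : R) (fun s => b + x * s) x.
  by apply: is_derive_eq; rewrite /GRing.scale/=; ring.
have h2 := @is_derive1_comp _ sin (fun s => b + x * s) s _ _ (is_derive_sin _) h.
have h3 := is_derive_gau a s.
have h4 := @is_deriveM _ _ (gau a) (sin \o (fun s => b + x * s)) s 1 _ _ h3 h2.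
apply: is_derive_eq h4 _; rewrite /k /GRing.scale/=; ring.
Qed.

Lemma cvg_integral_symitv (f : R -> R) : mu.-integrable setT (EFin \o f) ->
  (\int[mu]_(s in `[(- n%:R)%R, n%:R]) (f s)%:E)%E @[n --> \oo] -->
  (\int[mu]_s (f s)%:E)%E.
Proof.
move=> intf.
have mf : measurable_fun setT f by apply/measurable_EFinP; exact: measurable_int intf.
pose f_ (n : nat) := f \_ `[(- n%:R)%R, n%:R].
have mf_ n : measurable_fun setT (f_ n).
  by apply/(measurable_restrictT _ _).1 => //; exact: measurable_funTS.
have f_f s : f_ ^~ s @ \oo --> f s.
  apply: cvg_near_cst; near=> n; rewrite /f_ patchE mem_set//= in_itv/= -ler_norml.
  by near: n; exact: nbhs_infty_ger.
have intn : mu.-integrable setT (EFin \o (fun s => `|f s|)) by exact: integrable_abse intf.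
have [|_] := @dominated_cvg_R _ _ _ mu f_ f _ mf_ f_f intn.
  by move=> n s; rewrite /f_ patchE; case: ifPn => // _; rewrite normr0.
by under [X in _ -> X @ _ --> _]eq_fun do rewrite integral_mkcond restrict_EFin.
Unshelve. all: by end_near. Qed.

Lemma abs_cos_le1 (x : R) : `|cos x| <= 1. Proof. by rewrite ler_norml cos_geN1 cos_le1. Qed.
Lemma abs_sin_le1 (x : R) : `|sin x| <= 1. Proof. by rewrite ler_norml sin_geN1 sin_le1. Qed.

Let cont_arg (b x : R) : continuous (fun s : R => b + x * s).
Proof. by move=> s; apply: cvgD; [exact: cvg_cst|apply: cvgMl_tmp; exact: cvg_id]. Qed.

Lemma continuous_cos_affine (b x : R) : continuous (fun s : R => cos (b + x * s)).
Proof.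
move=> s; apply: (@continuous_comp _ _ _ (fun s : R => b + x * s) cos); first exact: cont_arg.
exact: continuous_cos.
Qed.

Lemma continuous_sin_affine (b x : R) : continuous (fun s : R => sin (b + x * s)).
Proof.
move=> s; apply: (@continuous_comp _ _ _ (fun s : R => b + x * s) sin); first exact: cont_arg.
exact: continuous_sin.
Qed.

Let int_gcos a b x : 0 < a -> mu.-integrable setT (EFin \o (fun s => gau a s * cos (b + x * s))).
Proof.
move=> a0; apply: integrable_gau_bounded => // [|s]; last exact: abs_cos_le1.
exact: continuous_measurable_fun (@continuous_cos_affine b x).
Qed.

Let int_sgsin a b x : 0 < a -> mu.-integrable setT (EFin \o (fun s => s * (gau a s * sin (b + x * s)))).
Proof.
move=> a0; apply: le_integrable (integrable_abs_gau a0) => //.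
  apply/measurable_EFinP; apply: measurable_funM => //; apply: measurable_funM; first exact: measurable_gau.
  exact: continuous_measurable_fun (@continuous_sin_affine b x).
move=> s _ /=; rewrite lee_fin !normrM normr_id ler_pM//.
by rewrite ler_piMr// abs_sin_le1.
Qed.

Let int_k a b x : 0 < a -> mu.-integrable setT (EFin \o k a b x).
Proof.
move=> a0.
have -> : EFin \o k a b x = ((fun s => x%:E * (gau a s * cos (b + x * s))%:E) \- (fun s => (2 * a)%:E * (s * (gau a s * sin (b + x * s)))%:E))%E.
  by apply/funext => s; rewrite /k /= -!EFinM -EFinB; congr EFin; ring.
by apply: integrableB => //; apply: integrableZl => //; [exact: int_gcos|exact: int_sgsin].
Qed.

Let continuous_k a b x : continuous (k a b x).
Proof.
move=> s; apply: cvgB.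
  by apply: cvgM; [exact: continuous_gau|apply: cvgMl_tmp; exact: continuous_cos_affine].
apply: cvgM; first by apply: cvgMl_tmp; exact: cvg_id.
by apply: cvgM; [exact: continuous_gau|exact: continuous_sin_affine].
Qed.

Let integral_k a b x : 0 < a -> (\int[mu]_s (k a b x s)%:E = 0)%E.
Proof.
move=> a0.
have lim1 : (\int[mu]_(s in `[(- n.+1%:R)%R, n.+1%:R]) (k a b x s)%:E)%E @[n --> \oo] --> (\int[mu]_s (k a b x s)%:E)%E.
  by have := cvg_integral_symitv (int_k b x a0); rewrite -cvg_shiftS.
have e n : (\int[mu]_(s in `[(- n.+1%:R)%R, n.+1%:R]) (k a b x s)%:E =
    (K a b x n.+1%:R - K a b x (- n.+1%:R))%:E)%E.
  rewrite EFinB; apply: continuous_FTC2.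
  - by rewrite gtrN// ltr0n.
  - by apply: continuous_subspaceT; exact: continuous_k.
  - split.
    + by move=> s _; have [] := is_derive_K a b x s.
    + apply: cvg_at_right_filter.
      by apply: differentiable_continuous; apply/derivable1_diffP; have [] := is_derive_K a b x (- n.+1%:R).
    + apply: cvg_at_left_filter.
      by apply: differentiable_continuous; apply/derivable1_diffP; have [] := is_derive_K a b x (n.+1%:R).
  - by move=> s _; rewrite derive1E; have h := is_derive_K a b x s; exact: derive_val.
move: lim1; under eq_fun do rewrite e.
move=> lim1; apply: cvg_unique lim1 _ => //.
apply/fine_cvgP; split; first exact: nearW.
have c0 : gau a n.+1%:R @[n --> \oo] --> (0 : R) by have := cvg_gau0 a0; rewrite -(cvg_shiftS).
have c1 (u : nat -> R) : (forall n, `|u n| <= gau a n.+1%:R) -> u n @[n --> \oo] --> (0 : R).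
  move=> hu; apply: norm_cvg0; apply: (@squeeze_cvgr _ _ _ _ (fun=> 0) (fun n => gau a n.+1%:R)) => //.
    by near=> n; rewrite normr_ge0 hu.
  exact: cvg_cst.
rewrite -[X in _ --> X](subr0 0); apply: cvgB; apply: c1 => n; rewrite /K normrM (ger0_norm (ltW (gau_gt0 _ _))).
  by rewrite ler_piMr ?abs_sin_le1// ltW// gau_gt0.
by rewrite /gau sqrrN -/(gau a _) ler_piMr ?abs_sin_le1// ltW// expR_gt0.
Unshelve. all: by end_near. Qed.

Let F a b x := \int[mu]_s (gau a s * cos (b + x * s)).
Let S a b x := \int[mu]_s (s * (gau a s * sin (b + x * s))).

Let FS a b x : 0 < a -> x * F a b x = 2 * a * S a b x.
Proof.
move=> a0; apply/eqP; rewrite -subr_eq0; apply/eqP.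
have := integral_k b x a0.
have -> : (fun s => (k a b x s)%:E) = ((fun s => x%:E * (gau a s * cos (b + x * s))%:E) \- (fun s => (2 * a)%:E * (s * (gau a s * sin (b + x * s)))%:E))%E.
  by apply/funext => s; rewrite /k /= -!EFinM -EFinB; congr EFin; ring.
have i1 := int_gcos b x a0; have i2 := int_sgsin b x a0.
rewrite integralB//=; [|exact: integrableZl|exact: integrableZl].
rewrite !integralZl// -[X in (x%:E * X)%E]fineK; last exact: integrable_fin_num i1.
rewrite -[X in (_ - _ * X)%E]fineK; last exact: integrable_fin_num i2.
by rewrite -!EFinM -EFinB => -[].
Qed.

Let dF a b x : 0 < a -> is_derive x (1 : R) (F a b) (- S a b x).
Proof.
move=> a0; pose f x s := gau a s * cos (b + x * s).
have df y s : is_derive y (1 : R) (f ^~ s) (- (s * (gau a s * sin (b + y * s)))).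
  have h : is_derive y (1 : R) (fun y => b + y * s) s.
    by apply: is_derive_eq; rewrite /GRing.scale/=; ring.
  have h2 := @is_derive1_comp _ cos (fun y => b + y * s) y _ _ (is_derive_cos _) h.
  have h4 := @is_deriveM _ _ (cst (gau a s)) (cos \o (fun y => b + y * s)) y 1 _ _ (is_derive_cst _ _ _) h2.
  by apply: is_derive_eq h4 _; rewrite /GRing.scale/=; ring.
have Ix : `]x - 1, x + 1[%classic x by rewrite /= in_itv/= ltrBlDr ltrDl ltr01.
have i y : `]x - 1, x + 1[%classic y -> mu.-integrable setT (EFin \o f y) by move=> _; exact: int_gcos.
have d1 y s : `]x - 1, x + 1[%classic y -> setT s -> derivable (f ^~ s) y 1.
  by move=> _ _; have [] := df y s.
have G0 s : 0 <= `|s| * gau a s by rewrite mulr_ge0// ltW// gau_gt0.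
have pE y s : partial1of2 f y s = - (s * (gau a s * sin (b + y * s))).
  by rewrite partial1of2E; have h := df y s; exact: derive_val.
have Gub y s : `]x - 1, x + 1[%classic y -> setT s -> `|partial1of2 f y s| <= `|s| * gau a s.
  move=> _ _; rewrite pE normrN normrM ler_wpM2l// normrM (ger0_norm (ltW (gau_gt0 _ _))).
  by rewrite ler_piMr ?abs_sin_le1// ltW// gau_gt0.
have D := @derivable_under_integral _ _ _ mu f setT measurableT x (x-1) (x+1) Ix i d1 _ G0 (integrable_abs_gau a0) Gub.
have E := @differentiation_under_integral _ _ _ mu f setT measurableT x (x-1) (x+1) Ix i d1 _ G0 (integrable_abs_gau a0) Gub.
apply: DeriveDef; first exact: D.
rewrite -derive1E E /S.
under eq_Rintegral do rewrite pE -mulN1r.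
by rewrite RintegralZl ?mulN1r//; exact: int_sgsin.
Qed.

(** [F] satisfies F' = - S and x F = 2 a S, so F times exp(x^2 / (4 a)) has derivative zero and
    equals its value at x = 0. *)
Lemma integral_gau_cos a b x : 0 < a ->
  \int[mu]_s (gau a s * cos (b + x * s)) = Num.sqrt (pi / a) * expR (- (x ^+ 2 / (4 * a))) * cos b.
Proof.
move=> a0; rewrite -/(F a b x).
pose g y := F a b y * expR (y ^+ 2 / (4 * a)).
have dg y : is_derive y (1 : R) g 0.
  have h : is_derive y (1 : R) (fun y => y ^+ 2 / (4 * a)) (y / (2 * a)).
    apply: is_derive_eq; rewrite /GRing.scale/=; field; lra.
  have h2 := @is_derive1_comp _ expR (fun y => y ^+ 2 / (4 * a)) y _ _ (is_derive_expR _) h.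
  have h4 := @is_deriveM _ _ (F a b) (expR \o (fun y => y ^+ 2 / (4 * a))) y 1 _ _ (dF b y a0) h2.
  apply: is_derive_eq h4 _; rewrite /GRing.scale/=.
  have := FS b y a0 => fs.
  have -> : S a b y = y * F a b y / (2 * a) by rewrite fs; field; lra.
  by field; lra.
have := is_derive_0_is_cst x 0 dg.
rewrite /g expr0n/= mul0r expR0 mulr1 => gE.
have -> : F a b x = F a b 0 * expR (- (x ^+ 2 / (4 * a))).
  by rewrite -gE -mulrA -expRD subrr expR0 mulr1.
rewrite [RHS]mulrAC; congr (_ * _).
rewrite /F; under eq_Rintegral do rewrite mul0r addr0.
rewrite RintegralZr//; last exact: integrable_gau.
by rewrite /Rintegral (integral_gau a0).
Qed.

(** Adding 1 keeps the integrand nonnegative, so that Tonelli's theorem alone carries the formula to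
    several coordinates. *)
Lemma ge0_integral_gau_cos a B b x : 0 < a -> -1 <= B <= 1 ->
  (\int[mu]_s (gau a s * (1 + B * cos (b + x * s)))%:E =
   (Num.sqrt (pi / a) * (1 + B * (expR (- (x ^+ 2 / (4 * a))) * cos b)))%:E)%E.
Proof.
move=> a0 B1.
have i1 := int_gcos b x a0.
have -> : (fun s => (gau a s * (1 + B * cos (b + x * s)))%:E) = ((fun s => (gau a s)%:E) \+ (fun s => B%:E * (gau a s * cos (b + x * s))%:E))%E.
  by apply/funext => s; rewrite /= -EFinM -EFinD; congr EFin; ring.
rewrite integralD//=; [|exact: integrable_gau|exact: integrableZl].
rewrite integralZl// integral_gau// -[X in (_ * X)%E]fineK; last exact: integrable_fin_num i1.
rewrite -EFinM -EFinD; congr EFin.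
have := integral_gau_cos b x a0; rewrite /Rintegral => ->; ring.
Qed.

End gauss1.

(** * Gaussians in several dimensions *)

Section gauss_rV.
Context (R : realType).
Local Notation RT := (measurableTypeR R).

Lemma dot_ge0 d (x : 'rV[R]_d) : 0 <= dot x x.
Proof. by rewrite /dot sumr_ge0// => i _; rewrite -expr2 sqr_ge0. Qed.

Lemma enorm_sqr d (x : 'rV[R]_d) : enorm x ^+ 2 = dot x x.
Proof. by rewrite sqr_sqrtr// dot_ge0. Qed.

Lemma enorm_ge0 d (x : 'rV[R]_d) : 0 <= enorm x.
Proof. exact: sqrtr_ge0. Qed.

Definition Gau d (a : R) (x : 'rV[R]_d) : R := expR (- (a * dot x x)).

Lemma Gau_ge0 d a (x : 'rV[R]_d) : 0 <= Gau a x. Proof. exact: expR_ge0. Qed.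

Lemma Gau_le1 d a (x : 'rV[R]_d) : 0 <= a -> Gau a x <= 1.
Proof. by move=> a0; rewrite /Gau -expR0 ler_expR oppr_le0 mulr_ge0// dot_ge0. Qed.

Lemma GauD d a b (x : 'rV[R]_d) : Gau (a + b) x = Gau a x * Gau b x.
Proof. by rewrite /Gau -expRD; congr expR; ring. Qed.

Lemma measurable_Gau d a : measurable_fun setT (fun x : borelRd R d => Gau a x).
Proof.
apply: (measurableT_comp (f := @expR R)) => //; apply: measurable_funN => //.
by apply: measurable_funM => //; exact: measurable_dot.
Qed.

Lemma measurable_cos_dot d (c : 'rV[R]_d) b :
  measurable_fun setT (fun x : borelRd R d => cos (b + dot x c)).
Proof.
apply: (measurableT_comp (f := @cos R)); first exact: continuous_measurable_fun (@continuous_cos R).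
by apply: measurable_funD => //; apply: measurable_dot => //; exact: measurable_cst.
Qed.

Let mgt n a B b (c : 'I_n -> R) :
  measurable_fun setT (fun t : n.-tuple RT => ((\prod_(i < n) gau a (tnth t i)) *
     (1 + B * cos (b + \sum_(i < n) tnth t i * c i)))).
Proof.
apply: measurable_funM.
  apply: measurable_prod => i _.
  exact: measurableT_comp (@measurable_gau R a) (measurable_tnth i).
apply: measurable_funD => //; apply: measurable_funM => //.
apply: (measurableT_comp (f := @cos R)); first exact: continuous_measurable_fun (@continuous_cos R).
apply: measurable_funD => //; apply: measurable_sum => i.
by apply: measurable_funM => //; exact: measurable_tnth.
Qed.

Let ge0_1Bcos B (x : R) : -1 <= B <= 1 -> 0 <= 1 + B * cos x.
Proof.
move=> /andP[B1 B2]; have c1 := cos_le1 x; have c2 := cos_geN1 x.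
suff : `|B * cos x| <= 1 by rewrite ler_norml => /andP[]; lra.
by rewrite normrM mulr_ile1// ler_norml ?B1 ?B2 ?c1 ?c2.
Qed.

(** Integrating out coordinates shifts the phase b and multiplies B by a Gaussian factor at most 1;
    with B and b as parameters the statement is its own induction hypothesis. *)
Let gauss_tuple n a B b (c : 'I_n -> R) : 0 < a -> -1 <= B <= 1 ->
  (\int[@lebesgue_tuple R n]_t ((\prod_(i < n) gau a (tnth t i)) *
     (1 + B * cos (b + \sum_(i < n) tnth t i * c i)))%:E =
  (Num.sqrt (pi / a) ^+ n *
    (1 + B * (expR (- ((\sum_(i < n) c i ^+ 2) / (4 * a))) * cos b)))%:E)%E.
Proof.
move=> a0; elim: n B b c => [|n IH] B b c B1.
  rewrite ge0_integral_lebesgue_tuple0.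
  - by rewrite !big_ord0 expr0 mul0r oppr0 expR0 addr0 !mul1r.
  - by apply/measurable_EFinP; exact: mgt.
  - by move=> t; rewrite lee_fin mulr_ge0 ?ge0_1Bcos// prodr_ge0// => i _; exact/ltW/gau_gt0.
have K0 : 0 <= Num.sqrt (pi / a) ^+ n by rewrite exprn_ge0// sqrtr_ge0.
rewrite ge0_integral_lebesgue_tupleS; last 2 first.
- by apply/measurable_EFinP; exact: mgt.
- by move=> t; rewrite lee_fin mulr_ge0 ?ge0_1Bcos// prodr_ge0// => i _; exact/ltW/gau_gt0.
set E' := expR (- ((\sum_(i < n) c (lift ord0 i) ^+ 2) / (4 * a))).
have E'1 : 0 <= E' <= 1.
  rewrite expR_ge0 -expR0 ler_expR oppr_le0 divr_ge0//; last by rewrite mulr_ge0// ltW.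
  by rewrite sumr_ge0// => i _; exact: sqr_ge0.
have BE : -1 <= B * E' <= 1.
  by move: B1 E'1 => /andP[? ?] /andP[? ?]; rewrite -ler_norml normrM mulr_ile1// ?ler_norml; apply/andP; split; lra.
transitivity (\int[@lebesgue_measure R]_s ((Num.sqrt (pi / a) ^+ n)%:E * (gau a s * (1 + (B * E') * cos (b + c ord0 * s)))%:E))%E.
  apply: eq_integral => s _.
  transitivity (\int[lebesgue_tuple (n:=n)]_t ((gau a s)%:E * ((\prod_(i < n) gau a (tnth t i)) *
     (1 + B * cos ((b + s * c ord0) + \sum_(i < n) tnth t i * c (lift ord0 i))))%:E))%E.
    apply: eq_integral => t _; rewrite -EFinM; congr EFin.
    rewrite !big_ord_recl !tnth0.
    under eq_bigr do rewrite tnthS.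
    under [X in s * c ord0 + X]eq_bigr do rewrite tnthS.
    by rewrite addrA mulrA.
  rewrite ge0_integralZl//=; last 3 first.
  - by apply/measurable_EFinP; exact: (mgt a B (b + s * c ord0) (fun i => c (lift ord0 i))).
  - by move=> t _; rewrite lee_fin mulr_ge0 ?ge0_1Bcos// prodr_ge0// => i _; exact/ltW/gau_gt0.
  - by rewrite lee_fin; exact/ltW/gau_gt0.
  by rewrite (IH B (b + s * c ord0) (fun i => c (lift ord0 i)) B1) -!EFinM; congr EFin; rewrite -/E' (mulrC s); ring.
rewrite ge0_integralZl//=; last 2 first.
- apply/measurable_EFinP; apply: measurable_funM; first exact: measurable_gau.
  apply: measurable_funD => //; apply: measurable_funM => //.
  exact: continuous_measurable_fun (@continuous_cos_affine R b (c ord0)).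
- by move=> s _; rewrite lee_fin mulr_ge0 ?ge0_1Bcos//; exact/ltW/gau_gt0.
rewrite ge0_integral_gau_cos// -EFinM; congr EFin.
have -> : expR (- ((\sum_(i < n.+1) c i ^+ 2) / (4 * a))) = expR (- (c ord0 ^+ 2 / (4 * a))) * E'.
  by rewrite big_ord_recl mulrDl opprD expRD.
rewrite [Num.sqrt _ ^+ n.+1]exprSr; ring.
Qed.

Lemma ge0_integral_Gau_cos d a B b (c : 'rV[R]_d) : 0 < a -> -1 <= B <= 1 ->
  (\int[@lebesgueRd R d]_x (Gau a x * (1 + B * cos (b + dot x c)))%:E =
  (Num.sqrt (pi / a) ^+ d * (1 + B * (expR (- (dot c c / (4 * a))) * cos b)))%:E)%E.
Proof.
move=> a0 B1; rewrite ge0_integral_lebesgueRd; last 2 first.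
- apply/measurable_EFinP; apply: measurable_funM; first exact: measurable_Gau.
  by apply: measurable_funD => //; apply: measurable_funM => //; exact: measurable_cos_dot.
- by move=> x; rewrite lee_fin mulr_ge0 ?ge0_1Bcos//; exact: Gau_ge0.
rewrite /dot -(eq_bigr _ (fun i _ => expr2 (c 0 i))) -(gauss_tuple b (fun i => c 0 i) a0 B1).
apply: eq_integral => t _; congr EFin; congr (_ * (1 + B * cos (b + _))).
  rewrite /Gau /dot mulr_sumr -sumrN expR_sum; apply: eq_bigr => i _.
  by rewrite /gau !mxE expr2.
by apply: eq_bigr => i _; rewrite !mxE.
Qed.

Lemma integral_Gau d a : 0 < a ->
  (\int[@lebesgueRd R d]_x (Gau a x)%:E = (Num.sqrt (pi / a) ^+ d)%:E)%E.
Proof.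
move=> a0; have := @ge0_integral_Gau_cos d a 0 0 0 a0.
rewrite mul0r addr0 mulr1 => <-; last by apply/andP; split; lra.
by apply: eq_integral => x _; rewrite mul0r addr0 mulr1.
Qed.

Lemma integrable_Gau d a : 0 < a ->
  (@lebesgueRd R d).-integrable setT (EFin \o (@Gau d a)).
Proof.
move=> a0; apply/integrableP; split; first by apply/measurable_EFinP; exact: measurable_Gau.
under eq_integral do rewrite /= ger0_norm ?Gau_ge0//.
by rewrite integral_Gau// ltry.
Qed.

Lemma integrable_Gau_bounded d a M (h : borelRd R d -> R) : 0 < a -> measurable_fun setT h ->
  (forall s, `|h s| <= M) -> (@lebesgueRd R d).-integrable setT (EFin \o (fun s => Gau a s * h s)).
Proof.
move=> a0 mh h1.
have i1 : (@lebesgueRd R d).-integrable setT (fun s => M%:E * (Gau a s)%:E)%E.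
  by apply: integrableZl => //; exact: integrable_Gau.
apply: le_integrable i1 => //.
  by apply/measurable_EFinP; apply: measurable_funM => //; exact: measurable_Gau.
move=> s _ /=; rewrite lee_fin !normrM mulrC ler_wpM2r//.
by apply: le_trans (ler_norm _).
Qed.

Lemma integral_Gau_cos d a (c : 'rV[R]_d) : 0 < a ->
  \int[@lebesgueRd R d]_x (Gau a x * cos (dot x c)) =
  Num.sqrt (pi / a) ^+ d * expR (- (dot c c / (4 * a))).
Proof.
move=> a0; have := @ge0_integral_Gau_cos d a 1 0 c a0.
have m1 : measurable_fun setT (fun x : borelRd R d => cos (dot x c)).
  by have := measurable_cos_dot c 0; under eq_fun do rewrite add0r.
have i1 := integrable_Gau_bounded a0 m1 (fun s => abs_cos_le1 _).
have -> : (fun x : borelRd R d => (Gau a x * (1 + 1 * cos (0 + dot x c)))%:E) =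
  ((fun x => (Gau a x)%:E) \+ (fun x => (Gau a x * cos (dot x c))%:E))%E.
  by apply/funext => x /=; rewrite -EFinD; congr EFin; rewrite add0r; ring.
rewrite integralD//=; last exact: integrable_Gau.
rewrite integral_Gau// -[X in (_ + X)%E]fineK; last exact: integrable_fin_num i1.
rewrite -EFinD cos0 => /(_ _)/wrap[]; first by apply/andP; split; lra.
by move=> -[]; rewrite mul1r mulr1 mulrDr mulr1 => /addrI.
Qed.

End gauss_rV.

(** * Radially decreasing Fourier transforms *)

Section radmon.
Context (R : realType) (d : nat).
Local Notation V := (borelRd R d).
Local Notation mu := (@lebesgueRd R d).
Implicit Types (Psi Theta chi : V -> R).

Definition bmeas Psi := measurable_fun setT Psi /\ exists M, forall x, `|Psi x| <= M.

Definition Fint (a : R) (c : 'rV[R]_d) Psi : R :=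
  \int[mu]_x (Gau a x * (cos (dot x c) * Psi x)).

(* [Fint a c Psi] is, up to a constant, the density at [c] of the law with
   characteristic function [Psi] smoothed by a Gaussian. Asking that every such
   smoothing decreases in |c| is a condition stable under pointwise limits. *)
Definition radmon Psi := bmeas Psi /\ forall a c c', 0 < a -> dot c c <= dot c' c' ->
  Fint a c' Psi <= Fint a c Psi.

(** Multipliers of the class. Stability of [radmon] under products is not apparent, but multipliers
    are closed under products, sums and bounded limits, hence under exponentials. *)
Definition radmul Theta := bmeas Theta /\ forall chi, radmon chi ->
  radmon (fun x => Theta x * chi x).

Lemma measurable_cosdot (c : 'rV[R]_d) : measurable_fun setT (fun x : V => cos (dot x c)).
Proof. by have := measurable_cos_dot c 0; under eq_fun do rewrite add0r. Qed.

Lemma bmeasM Psi Theta : bmeas Psi -> bmeas Theta -> bmeas (fun x => Psi x * Theta x).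
Proof.
move=> [m1 [M1 b1]] [m2 [M2 b2]]; split; first exact: measurable_funM.
by exists (M1 * M2) => x; rewrite normrM ler_pM.
Qed.

Lemma bmeasD Psi Theta : bmeas Psi -> bmeas Theta -> bmeas (fun x => Psi x + Theta x).
Proof.
move=> [m1 [M1 b1]] [m2 [M2 b2]]; split; first exact: measurable_funD.
by exists (M1 + M2) => x; rewrite (le_trans (ler_normD _ _))// lerD.
Qed.

Lemma bmeas_cst k : bmeas (fun=> k).
Proof. by split=> //; exists `|k|. Qed.

Lemma bmeas_Gau s : 0 <= s -> bmeas (fun x => Gau s x).
Proof.
move=> s0; split; first exact: measurable_Gau.
by exists 1 => x; rewrite ger0_norm ?Gau_ge0// Gau_le1.
Qed.

Lemma bmeas_cos (c : 'rV[R]_d) Psi : bmeas Psi -> bmeas (fun x => cos (dot x c) * Psi x).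
Proof.
move=> h; apply: bmeasM => //; split; first exact: measurable_cosdot.
by exists 1 => x; exact: abs_cos_le1.
Qed.

Lemma integrable_Fint a c Psi : 0 < a -> bmeas Psi ->
  mu.-integrable setT (EFin \o (fun x => Gau a x * (cos (dot x c) * Psi x))).
Proof.
move=> a0 /(bmeas_cos c)[m [M b]].
exact: (integrable_Gau_bounded a0 m b).
Qed.

Lemma FintD a c Psi Theta : 0 < a -> bmeas Psi -> bmeas Theta ->
  Fint a c (fun x => Psi x + Theta x) = Fint a c Psi + Fint a c Theta.
Proof.
move=> a0 b1 b2; rewrite /Fint -RintegralD//; [|exact: integrable_Fint..].
by apply: eq_Rintegral => x _; ring.
Qed.

Lemma FintZ a c k Psi : 0 < a -> bmeas Psi ->
  Fint a c (fun x => k * Psi x) = k * Fint a c Psi.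
Proof.
move=> a0 b1; rewrite /Fint -RintegralZl//; [|exact: integrable_Fint..].
by apply: eq_Rintegral => x _; ring.
Qed.

Lemma FintGau a c s Psi : Fint a c (fun x => Gau s x * Psi x) = Fint (a + s) c Psi.
Proof. by apply: eq_Rintegral => x _; rewrite GauD; ring. Qed.

Lemma eq_Fint a c Psi Theta : Psi =1 Theta -> Fint a c Psi = Fint a c Theta.
Proof. by move=> e; apply: eq_Rintegral => x _; rewrite e. Qed.

Lemma Fint_cvg a c (Psi_ : nat -> V -> R) Psi M : 0 < a ->
  (forall n, measurable_fun setT (Psi_ n)) -> (forall n x, `|Psi_ n x| <= M) ->
  (forall x, Psi_ n x @[n --> \oo] --> Psi x) ->
  Fint a c (Psi_ n) @[n --> \oo] --> Fint a c Psi.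
Proof.
move=> a0 mP bP cP.
have iM : mu.-integrable setT (EFin \o (fun x => Gau a x * M)).
  by apply: (@integrable_Gau_bounded _ _ _ `|M|) => //.
have [||||iF cF] := @dominated_cvg_R _ _ _ mu (fun n x => Gau a x * (cos (dot x c) * Psi_ n x))
  (fun x => Gau a x * (cos (dot x c) * Psi x)) (fun x => Gau a x * M).
- move=> n; apply: measurable_funM; first exact: measurable_Gau.
  by apply: measurable_funM => //; exact: measurable_cosdot.
- by move=> x; apply: cvgMl_tmp; apply: cvgMl_tmp; exact: cP.
- by [].
- move=> n x; rewrite normrM ger0_norm ?Gau_ge0// ler_wpM2l ?Gau_ge0// normrM.
  by rewrite -[leRHS]mul1r ler_pM// abs_cos_le1.
by apply: fine_cvg; rewrite fineK//; exact: integrable_fin_num iF.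
Qed.

Lemma bmeas_lim (Psi_ : nat -> V -> R) Psi M :
  (forall n, measurable_fun setT (Psi_ n)) -> (forall n x, `|Psi_ n x| <= M) ->
  (forall x, Psi_ n x @[n --> \oo] --> Psi x) -> bmeas Psi.
Proof.
move=> mP bP cP; split; first by apply: (measurable_fun_cvg mP) => x _; exact: cP.
exists M => x; have c : `|Psi_ n x| @[n --> \oo] --> `|Psi x| by apply: cvg_norm; exact: cP.
by apply: cvgr_to_le c _; apply: nearW => n; exact: bP.
Qed.

Lemma radmon_lim (Psi_ : nat -> V -> R) Psi M :
  (forall n, radmon (Psi_ n)) -> (forall n x, `|Psi_ n x| <= M) ->
  (forall x, Psi_ n x @[n --> \oo] --> Psi x) -> radmon Psi.
Proof.
move=> rP bP cP.
have mP n : measurable_fun setT (Psi_ n) by have [[]] := rP n.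
split; first exact: bmeas_lim bP cP.
move=> a c c' a0 cc'.
have c1 := @Fint_cvg a c _ _ _ a0 mP bP cP; have c2 := @Fint_cvg a c' _ _ _ a0 mP bP cP.
apply: ler_cvg_to c2 c1 _.
by apply: nearW => n; have [_] := rP n; apply.
Qed.

Lemma radmul_lim (Theta_ : nat -> V -> R) Theta M :
  (forall n, radmul (Theta_ n)) -> (forall n x, `|Theta_ n x| <= M) ->
  (forall x, Theta_ n x @[n --> \oo] --> Theta x) -> radmul Theta.
Proof.
move=> rP bP cP.
have mP n : measurable_fun setT (Theta_ n) by have [[]] := rP n.
split; first exact: bmeas_lim bP cP.
move=> chi rchi; have [[mchi [N bchi]] _] := rchi.
apply: (@radmon_lim (fun n x => Theta_ n x * chi x) _ (M * N)).
- by move=> n; have [_] := rP n; apply.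
- by move=> n x; rewrite normrM ler_pM.
- by move=> x; apply: cvgMr_tmp; exact: cP.
Qed.

Lemma radmon1 : radmon (fun=> 1).
Proof.
split; first exact: bmeas_cst.
move=> a c c' a0 cc'; rewrite /Fint.
under eq_Rintegral do rewrite mulr1.
under [leRHS]eq_Rintegral do rewrite mulr1.
rewrite !integral_Gau_cos// ler_wpM2l ?exprn_ge0 ?sqrtr_ge0// ler_expR lerN2.
by rewrite ler_wpM2r// invr_ge0 mulr_ge0// ltW.
Qed.

(** A Gaussian factor only changes the smoothing parameter from a to a + s, and [radmon] quantifies
    over all parameters. *)
Lemma radmul_Gau s : 0 <= s -> radmul (fun x => Gau s x).
Proof.
move=> s0; split; first exact: bmeas_Gau.
move=> chi [bchi rchi]; split; first exact: bmeasM (bmeas_Gau s0) bchi.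
by move=> a c c' a0 cc'; rewrite !FintGau; apply: rchi => //; rewrite ltr_wpDr.
Qed.

Lemma radmul_cst k : 0 <= k -> radmul (fun=> k).
Proof.
move=> k0; split; first exact: bmeas_cst.
move=> chi [bchi rchi]; split; first exact: bmeasM (bmeas_cst k) bchi.
by move=> a c c' a0 cc'; rewrite !FintZ// ler_wpM2l// rchi.
Qed.

Lemma radmulM T1 T2 : radmul T1 -> radmul T2 -> radmul (fun x => T1 x * T2 x).
Proof.
move=> [b1 r1] [b2 r2]; split; first exact: bmeasM.
move=> chi rchi; have := r1 _ (r2 _ rchi).
by congr radmon; apply/funext => x; rewrite mulrA.
Qed.

Lemma radmulD T1 T2 : radmul T1 -> radmul T2 -> radmul (fun x => T1 x + T2 x).
Proof.
move=> [b1 r1] [b2 r2]; split; first exact: bmeasD.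
move=> chi rchi; have [bchi _] := rchi.
split; first by apply: bmeasM => //; exact: bmeasD.
have e a c : 0 < a -> Fint a c (fun x => (T1 x + T2 x) * chi x) =
  Fint a c (fun x => T1 x * chi x) + Fint a c (fun x => T2 x * chi x).
  move=> a0; rewrite -FintD//; [|exact: bmeasM..].
  by apply: eq_Fint => x; rewrite mulrDl.
move=> a c c' a0 cc'; rewrite !e// lerD//.
  by have [_] := r1 _ rchi; apply.
by have [_] := r2 _ rchi; apply.
Qed.

Lemma radmul_radmon T1 : radmul T1 -> radmon T1.
Proof.
move=> [_ /(_ _ radmon1)]; congr radmon; apply/funext => x; exact: mulr1.
Qed.

Lemma radmulX T1 n : radmul T1 -> radmul (fun x => T1 x ^+ n).
Proof.
move=> r1; elim: n => [|n IH]; first exact: (radmul_cst ler01).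
by have := radmulM r1 IH; congr radmul; apply/funext => x; rewrite exprS.
Qed.

(** The partial sums of the exponential series are multipliers, bounded by [expR M] where M bounds
    T1. *)
Lemma radmul_expR T1 : radmul T1 -> radmul (fun x => expR (T1 x)).
Proof.
move=> r1; have [[m1 [M b1]] _] := r1.
pose S n x := series (exp_coeff (T1 x)) n.
have M0 : 0 <= M by exact: le_trans (normr_ge0 _) (b1 0).
apply: (@radmul_lim S _ (expR M)).
- elim=> [|n IH].
    have := radmul_cst (lexx 0); congr radmul; apply/funext => x.
    by rewrite /S /series/= big_geq.
  have : radmul (fun x => S n x + n`!%:R^-1 * T1 x ^+ n).
    by apply: radmulD => //; apply: radmulM; [apply: radmul_cst; rewrite invr_ge0|exact: radmulX].
  by congr radmul; apply/funext => x; rewrite /S !seriesEnat/= big_nat_recr//= mulrC.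
- move=> n x; rewrite /S.
  apply: (@le_trans _ _ (series (exp_coeff M) n)).
    rewrite !seriesEnat/= (le_trans (ler_norm_sum _ _ _))// ler_sum// => i _.
    rewrite /exp_coeff/= normrM normrX (ger0_norm (_ : 0 <= i`!%:R^-1)) ?invr_ge0//.
    by rewrite ler_wpM2r ?invr_ge0// lerXn2r ?nnegrE.
  rewrite /expR; apply: nondecreasing_cvgn_le; last exact: is_cvg_series_exp_coeff.
  apply/nondecreasing_seqP => k; rewrite !seriesEnat/= big_nat_recr//= lerDl.
  by rewrite /exp_coeff/= divr_ge0// exprn_ge0.
- by move=> x; rewrite /expR; exact: is_cvg_series_exp_coeff.
Qed.

Section mixture.
Variable m : R -> R.
Local Notation leb := (@lebesgue_measure R).
Hypothesis mm : measurable_fun setT m.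
Hypothesis m0 : forall s, 0 <= m s.
Hypothesis mneg : forall s, s < 0 -> m s = 0.
Hypothesis im : leb.-integrable setT (EFin \o m).

Definition mixt : V -> R := fun x => \int[leb]_s (Gau s x * m s).

Lemma measurable_Gau2 : measurable_fun setT
  (fun z : V * measurableTypeR R => Gau z.2 z.1 : R).
Proof.
apply: (measurableT_comp (f := @expR R)) => //; apply: measurable_funN.
apply: measurable_funM => //.
by apply: measurable_dot; exact: measurable_fst.
Qed.

Lemma Gau_m_le (x : V) s : Gau s x * m s <= m s.
Proof.
have [s0|s0] := ltP s 0; first by rewrite mneg// mulr0.
by rewrite ler_piMl// Gau_le1.
Qed.

Lemma integrable_mixt (x : V) : leb.-integrable setT (EFin \o (fun s => Gau s x * m s)).
Proof.
apply: le_integrable im => //.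
  apply/measurable_EFinP; apply: measurable_funM => //.
  exact: (measurable_fun_pair2 x measurable_Gau2).
by move=> s _ /=; rewrite lee_fin ger0_norm ?mulr_ge0 ?Gau_ge0// (ger0_norm (m0 _)) Gau_m_le.
Qed.

Lemma mixt_le x : mixt x <= \int[leb]_s m s.
Proof. by apply: le_Rintegral => //; [exact: integrable_mixt|move=> s _; exact: Gau_m_le]. Qed.

Lemma mixt_ge0 x : 0 <= mixt x.
Proof. by apply: Rintegral_ge0 => s _; rewrite mulr_ge0 ?Gau_ge0. Qed.

Lemma bmeas_mixt : bmeas mixt.
Proof.
split; last first.
  by exists (\int[leb]_s m s) => x; rewrite ger0_norm ?mixt_ge0// mixt_le.
have : measurable_fun setT (fubini_F leb (fun z : V * measurableTypeR R => (Gau z.2 z.1 * m z.2)%:E)).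
  apply: measurable_fun_fubini_tonelli_F.
    apply/measurable_EFinP; apply: measurable_funM; first exact: measurable_Gau2.
    exact: measurableT_comp mm measurable_snd.
  by move=> z; rewrite lee_fin mulr_ge0 ?Gau_ge0.
move=> h; have := measurableT_comp (@fine_measurable R setT measurableT) h.
by apply.
Qed.

(** By Fubini, [Fint] of the product is the integral over s, with weight m, of the [Fint] of [Gau s]
    times chi, and each of these decreases in |c|. *)
Lemma radmul_mixt : radmul mixt.
Proof.
split; first exact: bmeas_mixt.
move=> chi rchi; have [bchi _] := rchi.
split; first exact: bmeasM bmeas_mixt bchi.
have [mchi [N bN]] := bchi.
have N0 : 0 <= N by exact: le_trans (normr_ge0 _) (bN 0).
have key a c : 0 < a ->
    leb.-integrable setT (EFin \o (fun s => m s * Fint a c (fun x => Gau s x * chi x))) /\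
    Fint a c (fun x => mixt x * chi x) = \int[leb]_s (m s * Fint a c (fun x => Gau s x * chi x)).
  move=> a0.
  pose f (z : V * measurableTypeR R) := (Gau a z.1 * (cos (dot z.1 c) * chi z.1)) * (Gau z.2 z.1 * m z.2).
  have mf : measurable_fun setT f.
    apply: measurable_funM.
      apply: (measurableT_comp (f := fun x : V => Gau a x * (cos (dot x c) * chi x))); last exact: measurable_fst.
      apply: measurable_funM; first exact: measurable_Gau.
      by apply: measurable_funM => //; exact: measurable_cosdot.
    apply: measurable_funM; first exact: measurable_Gau2.
    exact: measurableT_comp mm measurable_snd.
  have intf : (mu \x leb)%E.-integrable setT (EFin \o f).
    apply/integrable12ltyP; first exact/measurable_EFinP.
    have i1 : mu.-integrable setT (EFin \o (fun x => Gau a x * (N * \int[leb]_s m s))).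
      apply: (@integrable_Gau_bounded _ _ _ (N * \int[leb]_s m s)) => // x.
      by rewrite ger0_norm// mulr_ge0// Rintegral_ge0.
    apply: (@le_lt_trans _ _ (\int[mu]_x (Gau a x * (N * \int[leb]_s m s))%:E)%E); last first.
      by move/integrableP : i1 => [_]; under eq_integral do rewrite /= ger0_norm ?mulr_ge0 ?Gau_ge0// ?Rintegral_ge0//.
    apply: ge0_le_integral => //.
    - by move=> x _; exact: integral_ge0.
    - apply: (@measurable_fun_fubini_tonelli_F _ _ _ _ _ leb (fun z => `|(f z)%:E|%E)) => //.
      by apply: measurableT_comp => //; exact/measurable_EFinP.
    - apply/measurable_EFinP; apply: measurable_funM => //; exact: measurable_Gau.
    move=> x _.
    apply: (@le_trans _ _ (\int[leb]_s ((Gau a x * N)%:E * (m s)%:E))%E).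
      apply: ge0_le_integral => //.
      - apply: measurableT_comp => //; apply/measurable_EFinP.
        exact: (measurable_fun_pair2 x mf).
      - by apply/measurable_EFinP; apply: measurable_funM.
      move=> s _; rewrite /f/= -EFinM lee_fin !normrM (ger0_norm (Gau_ge0 _ _)) -!mulrA ler_wpM2l ?Gau_ge0//.
      rewrite mulrA ler_pM ?mulr_ge0//.
        by rewrite -[leRHS]mul1r ler_pM// abs_cos_le1.
      by rewrite -normrM ger0_norm ?mulr_ge0 ?Gau_ge0// Gau_m_le.
    rewrite ge0_integralZl//; last 3 first.
    - exact/measurable_EFinP.
    - by move=> s _; rewrite lee_fin.
    - by rewrite lee_fin mulr_ge0 ?Gau_ge0.
    rewrite -[X in (_ * X <= _)%E]fineK; last exact: integrable_fin_num im.
    by rewrite -EFinM mulrA.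
  have fub := Fubini intf.
  have eG s : (\int[mu]_x (EFin \o f) (x, s) = (m s * Fint a c (fun x => Gau s x * chi x))%:E)%E.
    have [/eqP ms|ms] := boolP (m s == 0).
      rewrite ms mul0r; apply: integral0_eq => x _; by rewrite /f/= ms !mulr0.
    have s0 : 0 <= s by rewrite leNgt; apply/negP => /mneg ms'; rewrite ms' eqxx in ms.
    have isx : mu.-integrable setT (EFin \o (fun x => Gau a x * (cos (dot x c) * (Gau s x * chi x)))).
      by apply: integrable_Fint => //; exact: bmeasM (bmeas_Gau s0) bchi.
    rewrite EFinM fineK; last exact: integrable_fin_num isx.
    rewrite -integralZl//; apply: eq_integral => x _ /=.
    by rewrite /f/= -EFinM; congr EFin; ring.
  have eF x : (\int[leb]_s (EFin \o f) (x, s) = (Gau a x * (cos (dot x c) * (mixt x * chi x)))%:E)%E.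
    have -> : Gau a x * (cos (dot x c) * (mixt x * chi x)) = (Gau a x * (cos (dot x c) * chi x)) * mixt x by ring.
    rewrite EFinM fineK; last exact: integrable_fin_num (integrable_mixt x).
    have ix := integrable_mixt x.
    by rewrite -integralZl//; apply: eq_integral => s _; rewrite /= -EFinM.
  split.
    apply/integrableP; split.
      have := measurable_fubini_G intf; congr (measurable_fun _ _).
      by apply/funext => s; rewrite /fubini_G eG.
    have mfE : measurable_fun setT (EFin \o f) by exact/measurable_EFinP.
    have [h21 _] := integrable21ltyP mu leb mfE.
    apply: (le_lt_trans _ (h21 intf)).
    apply: ge0_le_integral => //.
    - apply: measurableT_comp => //.
      have := measurable_fubini_G intf; congr (measurable_fun _ _).
      by apply/funext => s; rewrite /fubini_G eG.
    - apply: (@measurable_fun_fubini_tonelli_G _ _ _ _ _ mu (fun z => `|(f z)%:E|%E)) => //.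
      by apply: measurableT_comp => //; exact/measurable_EFinP.
    move=> s _; rewrite [(EFin \o _) s]/= -eG; apply: le_abse_integral => //.
    by apply/measurable_EFinP; exact: (measurable_fun_pair1 s mf).
  rewrite /Fint /Rintegral; congr fine.
  transitivity (\int[mu]_x \int[leb]_y (EFin \o f) (x, y))%E; first by apply: eq_integral => x _; rewrite eF.
  by rewrite fub; apply: eq_integral => s _; rewrite eG.
move=> a c c' a0 cc'.
have [i1 ->] := key a c a0; have [i2 ->] := key a c' a0.
apply: le_Rintegral => // s _.
have [/eqP ms|ms] := boolP (m s == 0); first by rewrite ms !mul0r.
have s0 : 0 <= s by rewrite leNgt; apply/negP => /mneg ms'; rewrite ms' eqxx in ms.
rewrite ler_wpM2l//.
by have [_ /(_ _ rchi)[_]] := radmul_Gau s0; apply.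
Qed.

End mixture.

Lemma dot_gt0 (x : 'rV[R]_d) : x != 0 -> 0 < dot x x.
Proof.
move=> x0; rewrite lt_def dot_ge0 andbT; apply: contra_neq x0 => /eqP.
rewrite /dot psumr_eq0 => [/allP h|i _]; last by rewrite -expr2 sqr_ge0.
apply/rowP => i; rewrite mxE; apply/eqP.
by have := h i (mem_index_enum _); rewrite mulf_eq0 orbb.
Qed.

Lemma dot0 : dot (0 : 'rV[R]_d) 0 = 0.
Proof. by rewrite /dot big1// => i _; rewrite mxE mul0r. Qed.

(** With the density nu cut off below 1/(n+1), its mass I is finite and the exponent is k + b l + I
    - mixt. So exp(-t phi) becomes a constant times [Gau (t b)] times the exponential of a
    multiplier, and the cut-off is removed by monotone convergence. At x = 0 no value of phi is
    available, and e0 is the limit of the approximants there. *)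
Lemma radmon_exp_bernstein (phi : R -> R) (t : R) : complete_bernstein phi -> 0 <= t ->
  exists e0, radmon (fun x : V => if x == 0 then e0 else expR (- (t * phi (dot x x)))).
Proof.
move=> [k [b [nu [k0 b0 cm inu phiE]]]] t0.
have nu0 s : 0 < s -> 0 <= nu s by move=> s0; have [_] := cm 0%N s s0; rewrite expr0 mul1r.
have cnu s : 0 < s -> {for s, continuous nu}.
  by move=> s0; have [d0 _] := cm 0%N s s0; apply: differentiable_continuous; apply/derivable1_diffP.
have mnu : measurable_fun (`]0, +oo[ : set (measurableTypeR R)) nu.
  apply: open_continuous_measurable_fun; first exact: interval_open.
  by move=> s; rewrite inE/= in_itv/= andbT => /cnu.
pose F (n : nat) : set R := [set` `]n.+1%:R^-1, +oo[].
have F0 n s : F n s -> 0 < s by rewrite /F/= in_itv/= andbT; apply: lt_trans; rewrite invr_gt0.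
have mF n : measurable (F n : set (measurableTypeR R)) by exact: measurable_itv.
have mS d' (T' : sigmaRingType d') (g : R -> T') : measurable_fun (`]0, +oo[ : set (measurableTypeR R)) g ->
    forall n, measurable_fun (F n : set (measurableTypeR R)) g.
  move=> mg n; apply: (@measurable_funS _ _ _ _ (`]0, +oo[ : set (measurableTypeR R))) => //.
  by move=> s /F0 s0 /=; rewrite in_itv/= s0.
pose m : nat -> R -> R := fun n => nu \_ (F n).
have mm n : measurable_fun setT (m n).
  have h := mS _ _ nu mnu n.
  by apply/(measurable_restrictT _ _).1 => //; exact: (mF n).
have m0 n s : 0 <= m n s.
  by rewrite /m patchE; case: ifPn => // /set_mem /F0; exact: nu0.
have mneg n s : s < 0 -> m n s = 0.
  by move=> s0; rewrite /m patchE; case: ifPn => // /set_mem /F0; rewrite ltNge (ltW s0).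
(* Above the cut-off min(1, s) is at least 1/(n+1), so the integrability condition on nu gives
   finite mass. *)
have im n : (@lebesgue_measure R).-integrable setT (EFin \o m n).
  apply/integrableP; split; first by apply/measurable_EFinP; exact: mm.
  under eq_integral do rewrite /= ger0_norm//.
  have mmin : measurable_fun (`]0, +oo[ : set (measurableTypeR R)) (fun s : R => Num.min 1 s * nu s).
    apply: measurable_funM => //; apply: measurable_minr => //.
  apply: (@le_lt_trans _ _ (\int[@lebesgue_measure R]_(s in `]0%R, +oo[) ((n.+1%:R)%:E * (Num.min 1 s * nu s)%:E))%E).
    rewrite [leRHS]integral_mkcond; apply: ge0_le_integral => //.
    - by move=> s _; rewrite lee_fin.
    - by apply/measurable_EFinP; exact: mm.
    - apply/(measurable_restrictT _ _).1 => //; apply: emeasurable_funM => //; exact/measurable_EFinP.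
    move=> s _; rewrite patchE /m patchE.
    case: ifPn => [/set_mem Fs|_]; last first.
      case: ifPn => // /set_mem; rewrite /= in_itv/= andbT => s0.
      by rewrite -EFinM lee_fin !mulr_ge0// ?nu0// le_min ler01 ltW.
    have s0 := F0 _ _ Fs.
    rewrite mem_set/=; last by rewrite in_itv/= s0.
    rewrite -EFinM lee_fin mulrA ler_peMl ?nu0//.
    have n1 : 1 <= n.+1%:R :> R by rewrite ler1n.
    rewrite minr_pMr// mulr1 le_min n1/=.
    by move: Fs; rewrite /F/= in_itv/= andbT => /ltW; rewrite -ler_pdivrMl// mulr1.
  rewrite ge0_integralZl//; last 2 first.
  - exact/measurable_EFinP.
  - move=> s; rewrite /= in_itv/= andbT => s0.
    by rewrite lee_fin mulr_ge0// ?nu0// le_min ler01 ltW.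
  by rewrite lte_mul_pinfty// ?lee_fin.
pose I n := \int[@lebesgue_measure R]_s m n s.
pose e n x := (expR (- (t * k)) * Gau (t * b) x) * (expR (- (t * I n)) * expR (t * mixt (m n) x)).
have eE n x : e n x = expR (- (t * (k + b * dot x x + (I n - mixt (m n) x)))).
  by rewrite /e /Gau -!expRD; congr expR; ring.
have IJ n x : 0 <= I n - mixt (m n) x.
  by rewrite subr_ge0 /I; apply: mixt_le => // s; exact: mneg.
exists (expR (- (t * k))); apply: (@radmon_lim e _ 1).
- move=> n; apply: radmul_radmon; apply: radmulM; apply: radmulM.
  + by apply: radmul_cst; exact: expR_ge0.
  + by apply: radmul_Gau; rewrite mulr_ge0.
  + by apply: radmul_cst; exact: expR_ge0.
  + apply: radmul_expR; apply: radmulM; first exact: radmul_cst.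
    by apply: radmul_mixt => // s; exact: mneg.
- move=> n x; rewrite eE ger0_norm ?expR_ge0// -expR0 ler_expR oppr_le0.
  by rewrite mulr_ge0// addr_ge0// addr_ge0// mulr_ge0// dot_ge0.
move=> x; case: eqVneq => [->|xn0].
  apply: cvg_near_cst; apply: nearW => n; rewrite eE dot0 mulr0 addr0.
  rewrite (_ : mixt _ _ = I n) ?subrr ?addr0//.
  by apply: eq_Rintegral => s _; rewrite /Gau dot0 mulr0 oppr0 expR0 mul1r.
have l0 := dot_gt0 xn0; move: l0; set l := dot x x => l0.
under eq_fun do rewrite eE.
pose g s := (1 - expR (- (l * s))) * nu s.
have g0 s : 0 < s -> 0 <= g s.
  by move=> s0; rewrite mulr_ge0 ?nu0// subr_ge0 -expR0 ler_expR oppr_le0 mulr_ge0// ltW.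
have mg : measurable_fun (`]0, +oo[ : set (measurableTypeR R)) g.
  apply: measurable_funM => //; apply: measurable_funB => //.
  apply: (measurableT_comp (f := @expR R)) => //; apply: measurable_funN.
  exact: measurable_funM.
have JE n : ((I n - mixt (m n) x)%:E = \int[@lebesgue_measure R]_(s in F n) (g s)%:E)%E.
  have ix : (@lebesgue_measure R).-integrable setT (EFin \o (fun s => Gau s x * m n s)).
    by apply: integrable_mixt => // s; exact: mneg.
  rewrite /I /mixt -RintegralB//.
  have igm : (@lebesgue_measure R).-integrable setT (EFin \o (fun s => m n s - Gau s x * m n s)).
    rewrite (_ : EFin \o _ = (EFin \o m n \- (EFin \o (fun s => (Gau s x * m n s)%R)))%E); last first.
      by apply/funext => s; rewrite /= EFinB.
    by apply: integrableB.
  rewrite fineK; last exact: integrable_fin_num igm.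
  rewrite [RHS]integral_mkcond; apply: eq_integral => s _.
  rewrite patchE /m patchE; case: ifPn => _; last by rewrite mulr0 subr0.
  by congr EFin; rewrite /g /Gau -/l (mulrC l); ring.
have UF : \bigcup_n F n = `]0%R, +oo[%classic.
  apply/seteqP; split => s; first by move=> [n _ /F0 s0] /=; rewrite in_itv/= s0.
  rewrite /= in_itv/= andbT => s0.
  have [n _ /(_ _ (leqnn n)) /=ns] := near_infty_natSinv_lt (PosNum s0).
  by exists n => //; rewrite /F/= in_itv/= ns.
have cJ : (\int[@lebesgue_measure R]_(s in F n) (g s)%:E)%E @[n --> \oo] -->
    (\int[@lebesgue_measure R]_(s in `]0%R, +oo[) (g s)%:E)%E.
  rewrite -UF; apply: ge0_nondecreasing_set_cvg_integral => //.
  - move=> i j ij; apply/subsetPset => s; rewrite /F/= !in_itv/= !andbT; apply: le_lt_trans.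
    by rewrite lef_pV2 ?posrE// ler_nat.
  - by move=> n; apply/measurable_EFinP; exact: mS.
  - by move=> n s /F0 s0; rewrite lee_fin g0.
have gE : (\int[@lebesgue_measure R]_(s in `]0%R, +oo[) (g s)%:E = (phi l - (k + b * l))%:E)%E.
  have := phiE l l0; rewrite /g.
  move: (\int[@lebesgue_measure R]_(s in `]0%R, +oo[) ((1 - expR (- (l * s))) * nu s)%:E)%E => J.
  case: J => [r| |]//.
  by rewrite -EFinD => -[->]; congr EFin; ring.
have cJr : I n - mixt (m n) x @[n --> \oo] --> phi l - (k + b * l).
  by move: cJ; rewrite gE; under eq_fun do rewrite -JE; exact: fine_cvg.
have h : - (t * (k + b * l + (I n - mixt (m n) x))) @[n --> \oo] --> - (t * phi l).
  apply: cvgN; apply: cvgMl_tmp.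
  by rewrite (_ : phi l = k + b * l + (phi l - (k + b * l))); [apply: cvgD => //; exact: cvg_cst|ring].
by apply: (cvg_comp _ _ h); exact: continuous_expR.
Qed.

End radmon.

(** * Potential theory of a symmetric kernel *)

Section kernel_potential.
Local Open Scope ereal_scope.
Context (R : realType) (disp : measure_display) (T : measurableType disp).
Variable mu : {sigma_finite_measure set T -> \bar R}.
Variable q : T -> T -> R.
Hypothesis mq : measurable_fun setT (fun z : T * T => q z.1 z.2).
Hypothesis q0 : forall x y, (0 <= q x y)%R.
Hypothesis qsym : forall x y, q x y = q y x.
Implicit Types (U A B : set T) (f g h : T -> \bar R).

Definition nnm f := measurable_fun setT f /\ forall x, 0 <= f x.

Lemma nnm_cst (k : \bar R) : 0 <= k -> nnm (fun=> k).
Proof. by move=> k0; split. Qed.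

Lemma nnmD f g : nnm f -> nnm g -> nnm (fun x => f x + g x).
Proof. by move=> [mf f0] [mg g0]; split=> [|x]; [exact: emeasurable_funD|exact: adde_ge0]. Qed.

Lemma nnmZ (k : R) f : (0 <= k)%R -> nnm f -> nnm (fun x => k%:E * f x).
Proof. by move=> k0 [mf f0]; split=> [|x]; [exact: emeasurable_funM|exact: mule_ge0]. Qed.

Lemma nnm_restr U f : measurable U -> nnm f -> nnm (f \_ U).
Proof.
move=> mU [mf f0]; split; last by move=> x; rewrite patchE; case: ifP.
by apply/(measurable_restrictT _ _).1 => //; exact: measurable_funTS.
Qed.

Lemma nnm_intZ (k : \bar R) f : 0 <= k -> nnm f ->
  \int[mu]_x (k * f x) = k * \int[mu]_x f x.
Proof. by move=> k0 [mf f0]; exact: ge0_integralZl. Qed.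

Lemma nnm_q x : nnm (fun y => (q x y)%:E).
Proof.
split; last by move=> y; rewrite lee_fin.
by apply/measurable_EFinP; exact: (measurable_fun_pair2 x mq).
Qed.

(* [QU U] is the kernel [q] killed outside [U]; [RU U f] below is the least
   nonnegative solution of [h = f + QU U h], hence bounded by supersolutions. *)
Definition QU U f (y : T) := \int[mu]_(w in U) ((q y w)%:E * f w).

Lemma nnm_qf y f : nnm f -> nnm (fun w => (q y w)%:E * f w).
Proof.
move=> [mf f0]; have [m1 _] := nnm_q y.
by split=> [|w]; [exact: emeasurable_funM|rewrite mule_ge0// lee_fin].
Qed.

Lemma QUE U f y : QU U f y = \int[mu]_w ((q y w)%:E * (f \_ U) w).
Proof.
rewrite /QU integral_mkcond.
by apply: eq_integral => w _; rewrite !patchE; case: ifP => // _; rewrite mule0.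
Qed.

Lemma nnm_QU U f : measurable U -> nnm f -> nnm (QU U f).
Proof.
move=> mU nf; split; last first.
  by move=> y; apply: integral_ge0 => w _; have [_] := nnm_qf y nf; exact.
have [mf f0] := nnm_restr mU nf.
have := @measurable_fun_fubini_tonelli_F _ _ T T R mu (fun z => (q z.1 z.2)%:E * (f \_ U) z.2).
rewrite (_ : fubini_F mu _ = QU U f); last first.
  by apply/funext => y; rewrite /fubini_F/= QUE.
apply.
  apply: emeasurable_funM; first exact/measurable_EFinP.
  exact: measurableT_comp mf measurable_snd.
by move=> z; rewrite mule_ge0// lee_fin.
Qed.

Lemma QU_le U f g y : measurable U -> nnm f -> nnm g -> (forall w, U w -> f w <= g w) ->
  QU U f y <= QU U g y.
Proof.
move=> mU nf ng fg; have [m1 p1] := nnm_qf y nf; have [m2 p2] := nnm_qf y ng.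
apply: ge0_le_integral => //; [exact: measurable_funTS..|].
by move=> w Uw; rewrite lee_wpmul2l// ?lee_fin// fg.
Qed.

Lemma eq_QU U f g y : (forall w, U w -> f w = g w) -> QU U f y = QU U g y.
Proof. by move=> fg; apply: eq_integral => w /set_mem /fg ->. Qed.

Lemma QUD U f g y : measurable U -> nnm f -> nnm g ->
  QU U (fun w => f w + g w) y = QU U f y + QU U g y.
Proof.
move=> mU nf ng; have [m1 p1] := nnm_qf y nf; have [m2 p2] := nnm_qf y ng.
rewrite /QU -ge0_integralD//; [|exact: measurable_funTS..].
by apply: eq_integral => w _; rewrite ge0_muleDr//; [case: nf|case: ng].
Qed.

Lemma QUZ U (k : R) f y : measurable U -> nnm f -> (0 <= k)%R ->
  QU U (fun w => k%:E * f w) y = k%:E * QU U f y.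
Proof.
move=> mU nf k0; have [m1 p1] := nnm_qf y nf.
rewrite /QU -ge0_integralZl//; [|exact: measurable_funTS].
by apply: eq_integral => w _; rewrite muleCA.
Qed.

Lemma QUS U A f y : measurable U -> measurable A -> nnm f -> U `<=` A -> QU U f y <= QU A f y.
Proof.
move=> mU mA nf UA; have [m1 p1] := nnm_qf y nf.
by apply: ge0_subset_integral => //; exact: measurable_funTS.
Qed.

Lemma QU_setU A B f y : measurable A -> measurable B -> nnm f -> [disjoint A & B] ->
  QU (A `|` B) f y = QU A f y + QU B f y.
Proof.
move=> mA mB nf dAB; have [m1 p1] := nnm_qf y nf.
by rewrite /QU ge0_integral_setU//; [exact: measurable_funTS].
Qed.

Fixpoint QUn U (k : nat) f := if k is k'.+1 then QU U (QUn U k' f) else f.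

Definition RUn U (n : nat) f (y : T) := \sum_(0 <= k < n) QUn U k f y.

Definition RU U f (y : T) := \sum_(0 <= k <oo) QUn U k f y.

Section fixU.
Variable U : set T.
Hypothesis mU : measurable U.

Lemma nnm_QUn k f : nnm f -> nnm (QUn U k f).
Proof. by move=> nf; elim: k => //= k IH; exact: nnm_QU. Qed.

Lemma nnm_RUn n f : nnm f -> nnm (RUn U n f).
Proof.
move=> nf; split; first by apply: emeasurable_sum => k; have [] := nnm_QUn k nf.
by move=> y; apply: sume_ge0 => k _; have [_] := nnm_QUn k nf; exact.
Qed.

Lemma nnm_RU f : nnm f -> nnm (RU U f).
Proof.
move=> nf; split; last first.
  by move=> y; apply: nneseries_ge0 => k _ _; have [_] := nnm_QUn k nf; exact.
apply: ge0_emeasurable_sum => k.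
  by move=> x _ _; have [_] := nnm_QUn k nf; exact.
by move=> _; have [] := nnm_QUn k nf.
Qed.

Lemma QUn_le k f g y : nnm f -> nnm g -> (forall w, U w -> f w <= g w) -> U y ->
  QUn U k f y <= QUn U k g y.
Proof.
move=> nf ng fg; elim: k y => [|k IH] y Uy /=; first exact: fg.
by apply: QU_le => //; exact: nnm_QUn.
Qed.

Lemma RU_le f g y : nnm f -> nnm g -> (forall w, U w -> f w <= g w) -> U y ->
  RU U f y <= RU U g y.
Proof.
move=> nf ng fg Uy; apply: lee_nneseries => k _.
  by have [_] := nnm_QUn k nf; exact.
by apply: QUn_le.
Qed.

Lemma QUnD k f g y : nnm f -> nnm g ->
  QUn U k (fun w => f w + g w) y = QUn U k f y + QUn U k g y.
Proof.
move=> nf ng; elim: k y => [//|k IH] y /=.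
rewrite -QUD//; [|exact: nnm_QUn..].
by apply: eq_QU => w _; rewrite IH.
Qed.

Lemma RUD f g y : nnm f -> nnm g -> RU U (fun w => f w + g w) y = RU U f y + RU U g y.
Proof.
move=> nf ng; rewrite /RU -nneseriesD; last 2 first.
- by move=> k _ _; have [_] := nnm_QUn k nf; exact.
- by move=> k _ _; have [_] := nnm_QUn k ng; exact.
by apply: eq_eseriesr => k _; exact: QUnD.
Qed.

Lemma QUnZ n (k : R) f y : nnm f -> (0 <= k)%R ->
  QUn U n (fun w => k%:E * f w) y = k%:E * QUn U n f y.
Proof.
move=> nf k0; elim: n y => [//|n IH] y /=.
rewrite -QUZ//; last exact: nnm_QUn.
by apply: eq_QU => w _; rewrite IH.
Qed.

Lemma RUZ (k : R) f y : nnm f -> (0 <= k)%R ->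
  RU U (fun w => k%:E * f w) y = k%:E * RU U f y.
Proof.
move=> nf k0; rewrite /RU -nneseriesZl//; last first.
  by move=> n _; have [_] := nnm_QUn n nf; exact.
by apply: eq_eseriesr => n _; exact: QUnZ.
Qed.

Lemma QUnSr k f y : QUn U k.+1 f y = QUn U k (QU U f) y.
Proof. by elim: k y => [//|k IH] y /=; apply: eq_QU => w _; exact: IH. Qed.

Lemma RUnS n f y : nnm f -> RUn U n.+1 f y = f y + QU U (RUn U n f) y.
Proof.
move=> nf; rewrite /RUn big_nat_recl//=; congr (_ + _).
rewrite /QU -ge0_integral_sum//; last 2 first.
- by move=> k; apply: measurable_funTS; have [] := nnm_qf y (nnm_QUn k nf).
- by move=> k w _; have [_] := nnm_qf y (nnm_QUn k nf); exact.
apply: eq_integral => w _; rewrite ge0_sume_distrr// => k _.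
by have [_] := nnm_QUn k nf; exact.
Qed.

Lemma RUE f y : nnm f -> RU U f y = f y + QU U (RU U f) y.
Proof.
move=> nf; rewrite /RU nneseries_recl//; last first.
  by move=> k _; have [_] := nnm_QUn k nf; exact.
congr (_ + _); rewrite /QU.
transitivity (\int[mu]_(w in U) \sum_(0 <= k <oo) ((q y w)%:E * QUn U k f w)).
  rewrite integral_nneseries//.
  - rewrite -(nneseries_addn 1); last by move=> k; have [_] := nnm_QUn k nf; exact.
    by apply: eq_eseriesr => k _; rewrite addn1.
  - by move=> k; apply: measurable_funTS; have [] := nnm_qf y (nnm_QUn k nf).
  - by move=> k w _; have [_] := nnm_qf y (nnm_QUn k nf); exact.
apply: eq_integral => w _; rewrite nneseriesZl// ?lee_fin// => k _.
by have [_] := nnm_QUn k nf; exact.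
Qed.

Lemma RUn_super n f h y : nnm f -> nnm h -> (forall w, U w -> f w + QU U h w <= h w) ->
  U y -> RUn U n f y <= h y.
Proof.
move=> nf nh sup; elim: n y => [|n IH] y Uy.
  by rewrite /RUn big_geq//; case: nh.
rewrite RUnS//; apply: le_trans (sup _ Uy); rewrite leeD2l//.
by apply: QU_le => //; exact: nnm_RUn.
Qed.

Lemma RU_super f h y : nnm f -> nnm h -> (forall w, U w -> f w + QU U h w <= h w) ->
  U y -> RU U f y <= h y.
Proof.
move=> nf nh sup Uy; apply: lime_le.
  by apply: is_cvg_nneseries => k _ _; have [_] := nnm_QUn k nf; exact.
by apply: nearW => n; exact: RUn_super.
Qed.

Lemma RUn_le_RU n f y : nnm f -> RUn U n f y <= RU U f y.
Proof.
move=> nf; apply: nneseries_lim_ge => k _.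
by have [_] := nnm_QUn k nf; exact.
Qed.

(** Unlike for supersolutions, the remainder [QUn U n f] has to be kept: a subsolution is bounded by
    what is left after n steps plus the sources met on the way. *)
Lemma iter_sub n f g y : nnm f -> nnm g -> (forall w, U w -> f w <= g w + QU U f w) -> U y ->
  f y <= QUn U n f y + RUn U n g y.
Proof.
move=> nf ng sub; elim: n y => [|n IH] y Uy.
  by rewrite /RUn big_geq// adde0.
have -> : RUn U n.+1 g y = g y + QU U (RUn U n g) y by exact: RUnS.
apply: (le_trans (sub _ Uy)); rewrite (addeCA (QUn U n.+1 f y)); apply: leeD2l => /=.
rewrite -QUD//; [|exact: nnm_QUn|exact: nnm_RUn].
by apply: QU_le => //; apply: nnmD; [exact: nnm_QUn|exact: nnm_RUn].
Qed.

Hypothesis q_sub : forall y, QU U (fun=> 1) y <= 1.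

Lemma QU_cst (k : R) y : (0 <= k)%R -> QU U (fun=> k%:E) y <= k%:E.
Proof.
move=> k0; rewrite (_ : (fun=> k%:E) = (fun w : T => k%:E * 1)); last by apply/funext => w; rewrite mule1.
have n1 : nnm (fun=> 1) by apply: nnm_cst.
rewrite (QUZ y mU n1 k0).
by rewrite -[leRHS]mule1 lee_wpmul2l// lee_fin.
Qed.

(** Here h is a supersolution up to an error e per step; [q_sub] keeps the accumulated error below n
    e. *)
Lemma RUn_drift n f h (e : R) y : nnm f -> nnm h -> (0 <= e)%R ->
  (forall w, U w -> f w + QU U h w <= h w + e%:E) -> U y ->
  RUn U n f y <= h y + (n%:R * e)%:E.
Proof.
move=> nf nh e0 sup; elim: n y => [|n IH] y Uy.
  by rewrite /RUn big_geq// mul0r adde0; case: nh.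
have ne0 : (0 <= n%:R * e)%R by rewrite mulr_ge0.
have nc : nnm (fun=> (n%:R * e)%:E) by apply: nnm_cst; rewrite lee_fin.
rewrite RUnS//; apply: (@le_trans _ _ (f y + (QU U h y + (n%:R * e)%:E))).
  rewrite leeD2l//; apply: (@le_trans _ _ (QU U (fun w => h w + (n%:R * e)%:E) y)).
    by apply: QU_le => //; [exact: nnm_RUn|exact: nnmD].
  by rewrite QUD// leeD2l// QU_cst.
rewrite addeA -natr1 mulrDl mul1r EFinD [in leRHS]addeCA [in leRHS]addeC.
by rewrite (addeC _ e%:E) addeA leeD2r// -?addeA ?[e%:E + _]addeC// sup.
Qed.

(** As h is at most 1 and loses at most e per step, it bounds from below the probability of
    surviving k steps in U. *)
Lemma QUn_drift k h (e : R) y : nnm h -> (0 <= e)%R -> (forall w, U w -> h w <= 1) ->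
  (forall w, U w -> h w <= QU U h w + e%:E) -> U y ->
  h y <= QUn U k (fun=> 1) y + (k%:R * e)%:E.
Proof.
move=> nh e0 h1 sub; elim: k y => [|k IH] y Uy.
  by rewrite mul0r adde0 /=; exact: h1.
have ne0 : (0 <= k%:R * e)%R by rewrite mulr_ge0.
have nc : nnm (fun=> (k%:R * e)%:E) by apply: nnm_cst; rewrite lee_fin.
have n1 : nnm (fun=> 1) by apply: nnm_cst.
apply: (le_trans (sub _ Uy)).
rewrite -natr1 mulrDl mul1r EFinD addeA leeD2r//=.
apply: (@le_trans _ _ (QU U (fun w => QUn U k (fun=> 1) w + (k%:R * e)%:E) y)).
  by apply: QU_le => //; apply: nnmD => //; exact: nnm_QUn.
by rewrite QUD//; [rewrite leeD2l// QU_cst|exact: nnm_QUn].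
Qed.

End fixU.

(** When f is q(x, .), this is the decomposition at the last exit from A, after which the path stays
    in U. One inequality is minimality on U; for the other, gluing [RU D f] on A to v on U gives a
    supersolution on D. Nothing is subtracted, as values may be infinite. *)
Lemma RU_split (D A U : set T) f y : measurable D -> measurable A -> measurable U -> nnm f ->
  D = A `|` U -> [disjoint A & U] -> U y ->
  RU D f y = RU U (fun w => f w + QU A (RU D f) w) y.
Proof.
move=> mD mA mU nf DAU dAU.
have nR := nnm_RU mD nf.
have ng : nnm (fun w => f w + QU A (RU D f) w) by apply: nnmD => //; exact: nnm_QU.
set v := RU U _; have nv : nnm v by exact: nnm_RU.
have RE w : RU D f w = f w + (QU A (RU D f) w + QU U (RU D f) w).
  by rewrite -QU_setU// -DAU -RUE.
have vu w : U w -> v w <= RU D f w.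
  by apply: RU_super => // z _; rewrite -addeA -RE.
move=> Uy; apply/eqP; rewrite eq_le vu// andbT.
pose h w := ((RU D f) \_ A) w + (v \_ U) w.
have nh : nnm h by apply: nnmD; exact: nnm_restr.
have AU w : A w -> U w -> False by move=> Aw Uw; have /disj_setPS/(_ w) := dAU; apply.
have hA w : A w -> h w = RU D f w.
  by move=> Aw; rewrite /h !patchE mem_set// memNset ?adde0// => /(AU _ Aw).
have hU w : U w -> h w = v w.
  by move=> Uw; rewrite /h !patchE [w \in U]mem_set// memNset ?add0e// => /AU; exact.
rewrite -hU//; apply: RU_super => //; last by rewrite DAU; right.
move=> w; rewrite [X in X w -> _]DAU => DUw.
have -> : QU D h w = QU A (RU D f) w + QU U v w.
  have -> : QU D h w = QU (A `|` U) h w by rewrite -DAU.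
  by rewrite QU_setU//; congr (_ + _); apply: eq_QU.
case: DUw => [Aw|Uw]; last by rewrite hU// addeA -RUE.
by rewrite hA// [leRHS]RE leeD2l// leeD2l// QU_le.
Qed.

Lemma QU_dual A B f g : measurable A -> measurable B -> nnm f -> nnm g ->
  \int[mu]_(y in A) (g y * QU B f y) = \int[mu]_(w in B) (QU A g w * f w).
Proof.
move=> mA mB nf ng.
have [mf f0] := nnm_restr mB nf; have [mg g0] := nnm_restr mA ng.
pose F (z : T * T) := (g \_ A) z.1 * ((q z.1 z.2)%:E * (f \_ B) z.2).
have mF : measurable_fun setT F.
  apply: emeasurable_funM; first exact: measurableT_comp mg measurable_fst.
  apply: emeasurable_funM; first exact/measurable_EFinP.
  exact: measurableT_comp mf measurable_snd.
have F0 z : 0 <= F z by rewrite !mule_ge0// lee_fin.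
have nqB y : nnm (fun w => (q y w)%:E * (f \_ B) w) by apply: nnm_qf; exact: nnm_restr.
have nqA y : nnm (fun w => (q y w)%:E * (g \_ A) w) by apply: nnm_qf; exact: nnm_restr.
have := fubini_tonelli F mF F0 (m1 := mu) (m2 := mu).
rewrite /fubini_F /fubini_G /F/= => FT.
transitivity (\int[mu]_x \int[mu]_y ((g \_ A) x * ((q x y)%:E * (f \_ B) y))).
  rewrite [LHS]integral_mkcond; apply: eq_integral => y _.
  rewrite (nnm_intZ (g0 y) (nqB y)) !patchE; case: ifP => _; last by rewrite mul0e.
  by congr (_ * _); exact: QUE.
rewrite FT [RHS]integral_mkcond; apply: eq_integral => w _.
transitivity (\int[mu]_x ((f \_ B) w * ((q w x)%:E * (g \_ A) x))).
  by apply: eq_integral => x _; rewrite muleCA muleA (muleC (_ * _)) qsym.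
rewrite (nnm_intZ (f0 w) (nqA w)) muleC !patchE; case: ifP => _; last by rewrite mule0.
by congr (_ * _); exact/esym/QUE.
Qed.

Lemma QUn_dual U k f g : measurable U -> nnm f -> nnm g ->
  \int[mu]_(y in U) (g y * QUn U k f y) = \int[mu]_(y in U) (QUn U k g y * f y).
Proof.
move=> mU nf ng; elim: k f nf g ng => [//|k IH] f nf g ng.
under eq_integral do rewrite QUnSr.
rewrite IH//; last exact: nnm_QU.
by rewrite QU_dual//; exact: nnm_QUn.
Qed.

End kernel_potential.

(** * Euclidean balls and a cut-off function *)

Section euclid.
Context (R : realType) (d : nat).
Implicit Types x y z : 'rV[R]_d.

Lemma dotC x y : dot x y = dot y x.
Proof. by apply: eq_bigr => i _; rewrite mulrC. Qed.

Lemma dotDl x y z : dot (x + y) z = dot x z + dot y z.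
Proof. by rewrite /dot -big_split; apply: eq_bigr => i _; rewrite mxE mulrDl. Qed.

Lemma dotDr x y z : dot z (x + y) = dot z x + dot z y.
Proof. by rewrite !(dotC z) dotDl. Qed.

Lemma dotNl x y : dot (- x) y = - dot x y.
Proof. by rewrite /dot -sumrN; apply: eq_bigr => i _; rewrite mxE mulNr. Qed.

Lemma dotNr x y : dot x (- y) = - dot x y.
Proof. by rewrite dotC dotNl dotC. Qed.

Lemma dotZl (k : R) x y : dot (k *: x) y = k * dot x y.
Proof. by rewrite /dot mulr_sumr; apply: eq_bigr => i _; rewrite mxE mulrA. Qed.

Lemma dotZr (k : R) x y : dot x (k *: y) = k * dot x y.
Proof. by rewrite dotC dotZl dotC. Qed.

Lemma dot00 : dot (0 : 'rV[R]_d) 0 = 0.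
Proof. by rewrite /dot big1// => i _; rewrite mxE mul0r. Qed.

Lemma dotDD x y : dot (x + y) (x + y) = dot x x + 2 * dot x y + dot y y.
Proof. by rewrite dotDl !dotDr (dotC y x); ring. Qed.

Lemma dotBB x y : dot (x - y) (x - y) = dot x x - 2 * dot x y + dot y y.
Proof. by rewrite dotDD dotNr dotNl dotNr; ring. Qed.

Lemma dot_eq0 x : dot x x = 0 -> x = 0.
Proof.
move=> /eqP; rewrite /dot psumr_eq0 => [/allP h|i _]; last by rewrite -expr2 sqr_ge0.
apply/rowP => i; rewrite mxE; apply/eqP.
by have := h i (mem_index_enum _); rewrite mulf_eq0 orbb.
Qed.

Lemma cauchy_schwarz x y : dot x y ^+ 2 <= dot x x * dot y y.
Proof.
have [/dot_eq0 ->|y0] := eqVneq (dot y y) 0.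
  rewrite -(scale0r 0) !dotZr !mul0r expr0n mulr0//.
have yy : 0 < dot y y by rewrite lt_def y0 dot_ge0.
have := dot_ge0 (dot y y *: x - dot x y *: y).
rewrite !(dotDl, dotDr, dotNl, dotNr, dotZl, dotZr) (dotC y x) => h.
rewrite -(ler_pM2l yy); nra.
Qed.

Lemma enorm0 : enorm (0 : 'rV[R]_d) = 0.
Proof. by rewrite /enorm dot00 sqrtr0. Qed.

Lemma enormN x : enorm (- x) = enorm x.
Proof. by rewrite /enorm dotNl dotNr opprK. Qed.

Lemma enormB x y : enorm (x - y) = enorm (y - x).
Proof. by rewrite -enormN opprB. Qed.

Lemma enorm_le_sqr x (r : R) : 0 <= r -> (enorm x <= r) = (dot x x <= r ^+ 2).
Proof. by move=> r0; rewrite -enorm_sqr ler_sqr// nnegrE// enorm_ge0. Qed.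

Lemma enorm_triangle x y : enorm (x + y) <= enorm x + enorm y.
Proof.
have ex := enorm_ge0 x; have ey := enorm_ge0 y.
rewrite enorm_le_sqr ?addr_ge0// dotDl !dotDr (dotC y x) -!enorm_sqr.
have := cauchy_schwarz x y; rewrite -!enorm_sqr -exprMn => h.
have : dot x y <= enorm x * enorm y.
  apply: (le_trans (ler_norm _)).
  by rewrite -ler_sqr ?nnegrE ?mulr_ge0// real_normK ?num_real.
by nra.
Qed.

Lemma enormB_triangle x y z : enorm (x - z) <= enorm (x - y) + enorm (y - z).
Proof. by rewrite -[x - z](_ : (x - y) + (y - z) = _) ?enorm_triangle// addrA subrK. Qed.

Lemma enorm_le_sub x y : enorm x <= enorm y + enorm (x - y).
Proof. by rewrite -{1}[x](subrK y) addrC enorm_triangle. Qed.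

Lemma enorm_eq0 x : enorm x = 0 -> x = 0.
Proof. by move=> h; apply: dot_eq0; rewrite -enorm_sqr h expr0n. Qed.

Lemma enorm_gt0 x : x != 0 -> 0 < enorm x.
Proof. by move=> x0; rewrite lt_def enorm_ge0 andbT; apply: contra_neq x0; exact: enorm_eq0. Qed.

Lemma coord_le_enorm x i : `|x 0 i| <= enorm x.
Proof.
rewrite -ler_sqr ?nnegrE ?enorm_ge0// enorm_sqr real_normK ?num_real// /dot (bigD1 i)//=.
by rewrite -expr2 lerDl sumr_ge0// => j _; rewrite -expr2 sqr_ge0.
Qed.

Lemma measurable_enormB (z : 'rV[R]_d) :
  measurable_fun setT (fun y : borelRd R d => enorm (y - z)).
Proof. by apply: measurable_enorm; apply: measurable_rowB => //; exact: measurable_cst. Qed.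

Lemma measurable_eball (z : 'rV[R]_d) r : measurable (eball z r : set (borelRd R d)).
Proof.
have := measurable_enormB z measurableT (measurable_itv `]-oo, r[); rewrite setTI.
by congr measurable; apply/seteqP; split => y; rewrite /eball/= in_itv.
Qed.

Lemma measurable_enorm_ge r : measurable ([set y | r <= enorm y] : set (borelRd R d)).
Proof.
have := measurable_enormB 0 measurableT (measurable_itv `[r, +oo[); rewrite setTI.
by congr measurable; apply/seteqP; split => y; rewrite /=  in_itv/= andbT subr0.
Qed.

Definition box (z : 'rV[R]_d) (r : R) : set (borelRd R d) :=
  [set x : 'rV[R]_d | forall i, `](z 0 i - r), (z 0 i + r)[%classic (x 0 i)].

Lemma lebesgue_cube (z : 'rV[R]_d) (r : R) : 0 < r ->
  lebesgueRd (box z r) = ((2 * r) ^+ d)%:E.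
Proof.
move=> r0; rewrite (lebesgueRd_box (A := fun i => `](z 0 i - r), (z 0 i + r)[%classic))//.
rewrite (eq_bigr (fun=> (2 * r)%:E)); last first.
  move=> i _; rewrite lebesgue_measure_itv/= lte_fin ltrD2l gtrN//.
  by rewrite -EFinB; congr EFin; ring.
by rewrite prodEFin prodr_const card_ord.
Qed.

Lemma measurable_box z r : measurable (box z r).
Proof.
rewrite (_ : box z r = \bigcap_(i in [set: 'I_d])
    ((fun x : borelRd R d => x 0 i) @^-1` `](z 0 i - r), (z 0 i + r)[%classic)).
  apply: fin_bigcap_measurable => // i _.
  by rewrite -[X in measurable X]setTI; apply: measurable_coord.
by apply/seteqP; split=> x /= xn i; [move=> _; exact: xn|exact: xn].
Qed.

Lemma lebesgue_eball_ub (z : 'rV[R]_d) (r : R) : 0 < r ->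
  (lebesgueRd (eball z r) <= ((2 * r) ^+ d)%:E)%E.
Proof.
move=> r0; rewrite -(lebesgue_cube z r0); apply: le_measure; rewrite ?inE.
- exact: measurable_eball.
- exact: measurable_box.
move=> x; rewrite /eball/= => xr i.
rewrite /= in_itv/= -ltr_distlC; apply: le_lt_trans xr.
by have := coord_le_enorm (x - z) i; rewrite !mxE distrC.
Qed.

Lemma lebesgue_eball_lb (z : 'rV[R]_d) (r : R) : 0 < r ->
  (((r / d.+1%:R) ^+ d)%:E <= lebesgueRd (eball z r))%E.
Proof.
(* The cube of half-side s lies in the ball: its points are within (d+1) s = r/2 of the centre. *)
move=> r0; pose s := r / (2 * d.+1%:R).
have s0 : 0 < s by rewrite divr_gt0// mulr_gt0.
have -> : r / d.+1%:R = 2 * s.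
  rewrite /s; have : (d.+1%:R : R) != 0 by rewrite pnatr_eq0.
  by move: (d.+1%:R) => k k0; field.
rewrite -(lebesgue_cube z s0); apply: le_measure; rewrite ?inE.
- exact: measurable_box.
- exact: measurable_eball.
move=> x /= xz.
have h i : (x - z) 0 i * (x - z) 0 i <= s ^+ 2.
  rewrite !mxE -expr2 -real_normK ?num_real// ler_sqr ?nnegrE ?(ltW s0)//.
  by have := xz i; rewrite /= in_itv/= -ltr_distlC distrC => /ltW.
apply: (@le_lt_trans _ _ (d.+1%:R * s)).
  rewrite enorm_le_sqr; last by rewrite mulr_ge0// ltW.
  rewrite exprMn.
  apply: (@le_trans _ _ (\sum_(i < d) s ^+ 2)); first exact: ler_sum.
  rewrite sumr_const card_ord -[leLHS]mulr_natl ler_wpM2r ?sqr_ge0// -natrX ler_nat.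
  by rewrite expnS expn1 (leq_trans (leqnSn _))// leq_pmulr.
have -> : d.+1%:R * s = r / 2.
  rewrite /s; have : (d.+1%:R : R) != 0 by rewrite pnatr_eq0.
  by move: (d.+1%:R) => k k0; field.
lra.
Qed.

(** The shell contains the ball of radius r/4 about e. The point e is an argument because its
    existence needs a nonzero dimension. *)
Lemma lebesgue_shell_lb (e : 'rV[R]_d) (r : R) : 0 < r -> enorm e = 3 / 4 * r ->
  (((r / (4 * d.+1%:R)) ^+ d)%:E <= lebesgueRd ([set y : 'rV[R]_d | (r / 2 <= enorm y)%R] `&` eball (0 : 'rV[R]_d) r))%E.
Proof.
move=> r0 er; have r4 : 0 < r / 4 by rewrite divr_gt0.
have := lebesgue_eball_lb e r4; rewrite -mulrA -invfM => h.
apply: (le_trans h); apply: le_measure; rewrite ?inE.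
- exact: measurable_eball.
- by apply: measurableI; [exact: measurable_enorm_ge|exact: measurable_eball].
move=> y; rewrite /eball/= subr0 => ye; split.
  have := enorm_le_sub e y; rewrite er enormB; lra.
have := enorm_le_sub y e; rewrite er; lra.
Qed.

(* The C^{1,1} bump ((1 - |w - z|^2 / s^2)^+)^2. *)
Definition bump (z : 'rV[R]_d) (s : R) (w : 'rV[R]_d) : R :=
  Num.max 0 (1 - dot (w - z) (w - z) / s ^+ 2) ^+ 2.

Lemma measurable_bump z s : measurable_fun setT (fun w : borelRd R d => bump z s w).
Proof.
apply: measurable_funX; apply: measurable_maxr => //.
apply: measurable_funB => //; apply: measurable_funM => //.
by apply: measurable_dot; apply: measurable_rowB => //; exact: measurable_cst.
Qed.

Lemma bump_ge0 z s w : 0 <= bump z s w. Proof. exact: sqr_ge0. Qed.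

Lemma bump_le1 z s w : bump z s w <= 1.
Proof.
rewrite /bump expr_le1// ?le_max ?lexx// ge_max ler01/=.
by rewrite gerBl divr_ge0 ?sqr_ge0// dot_ge0.
Qed.

Lemma bump_out z s w : 0 < s -> s <= enorm (w - z) -> bump z s w = 0.
Proof.
move=> s0 h; rewrite /bump max_l ?expr0n// subr_le0 -enorm_sqr.
by rewrite ler_pdivlMr ?exprn_gt0// mul1r ler_sqr// nnegrE ?enorm_ge0// ltW.
Qed.

Lemma bump_center z s : bump z s z = 1.
Proof. by rewrite /bump subrr dot00 mul0r subr0 max_r// expr1n. Qed.

Lemma bump_in z s w : 0 < s -> enorm (w - z) <= s / 2 -> 1 / 2 <= bump z s w.
Proof.
move=> s0 h; rewrite /bump.
have h1 : dot (w - z) (w - z) / s ^+ 2 <= 1 / 4.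
  rewrite -enorm_sqr ler_pdivrMr ?exprn_gt0//.
  have := enorm_ge0 (w - z); move: (enorm _) h => e h e0; nra.
rewrite max_r; last by rewrite subr_ge0; lra.
set u := dot _ _ / _ in h1 *.
have h3 : 3 / 4 <= 1 - u by lra.
nra.
Qed.

Let mp (t : R) := Num.max 0 (1 - t).

Let mpE t : (1 <= t /\ mp t = 0) \/ (t <= 1 /\ mp t = 1 - t).
Proof.
have [h|h] := leP 1 t; [left|right]; split => //.
- by rewrite /mp max_l// subr_le0.
- exact: ltW.
- by rewrite /mp max_r// subr_ge0 ltW.
Qed.

Let mp_ub t h : mp (t + h) ^+ 2 <= mp t ^+ 2 - 2 * mp t * h + h ^+ 2.
Proof. by case: (mpE t) => -[h1 ->]; case: (mpE (t + h)) => -[h2 ->]; nra. Qed.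

Let mp_lb t h : mp t ^+ 2 - 2 * mp t * h <= mp (t + h) ^+ 2.
Proof. by case: (mpE t) => -[h1 ->]; case: (mpE (t + h)) => -[h2 ->]; nra. Qed.

Let mp01 t : 0 <= t -> 0 <= mp t <= 1.
Proof. by move=> t0; rewrite /mp le_max lexx/= ge_max ler01/= gerBl. Qed.

(** Here t and u are |x - z|^2 / s^2 and |x - y|^2 / s^2, and b is minus the inner product of x - z
    and x - y, over s^2. The square of [mp] lies between its tangent and its tangent plus h^2, so
    the second difference is between -4 u and 2 u^2 + 8 b^2 <= 2 u^2 + 8 t u. For u < 1 and t <= 4
    this is at most 34 u; for u < 1 and t > 4 all three points lie outside the bump; for u >= 1 it
    suffices that the values are in [0, 1]. *)
Let mp_diff t u b : 0 <= t -> 0 <= u -> b ^+ 2 <= t * u ->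
  `|mp (t + (u + 2 * b)) ^+ 2 + mp (t + (u - 2 * b)) ^+ 2 - 2 * mp t ^+ 2| <= 34 * Num.min 1 u.
Proof.
move=> t0 u0 bu.
have a1 := mp_ub t (u + 2 * b); have a2 := mp_ub t (u - 2 * b).
have a3 := mp_lb t (u + 2 * b); have a4 := mp_lb t (u - 2 * b).
have /andP[m0 m1] := mp01 t0.
have p1 : 0 <= t + (u + 2 * b).
  have : 0 <= (t + u) ^+ 2 - (2 * b) ^+ 2 by have := sqr_ge0 (t - u); nra.
  by rewrite subr_ge0 -ler_sqrt ?sqr_ge0// !sqrtr_sqr (ger0_norm (addr_ge0 t0 u0)) ler_norml => /andP[]; lra.
have p2 : 0 <= t + (u - 2 * b).
  have : 0 <= (t + u) ^+ 2 - (2 * b) ^+ 2 by have := sqr_ge0 (t - u); nra.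
  by rewrite subr_ge0 -ler_sqrt ?sqr_ge0// !sqrtr_sqr (ger0_norm (addr_ge0 t0 u0)) ler_norml => /andP[]; lra.
have /andP[n0 n1] := mp01 p1; have /andP[l0 l1] := mp01 p2.
have [u1|u1] := leP 1 u.
  by rewrite ler_norml; apply/andP; split; nra.
have [t4|t4] := leP t 4.
  by rewrite ler_norml; apply/andP; split; nra.
have big (b' : R) : b' ^+ 2 <= t * u -> mp (t + (u + 2 * b')) = 0.
  move=> hb; rewrite /mp max_l// subr_le0.
  have : (2 * b') ^+ 2 <= (t + u - 1) ^+ 2 by have := sqr_ge0 (t - u - 3); nra.
  rewrite -ler_sqrt ?sqr_ge0// !sqrtr_sqr (ger0_norm (_ : 0 <= t + u - 1)); last by lra.
  by rewrite ler_norml => /andP[]; lra.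
rewrite big// (_ : u - 2 * b = u + 2 * (- b)); last by ring.
rewrite big ?sqrrN// /mp max_l; last by lra.
by rewrite expr0n/= mulr0 addr0 subr0 normr0 mulr_ge0.
Qed.

Lemma bump_diff z s x y : 0 < s ->
  `|bump z s y + bump z s (x + (x - y)) - 2 * bump z s x| <=
    34 * Num.min 1 (enorm (x - y) ^+ 2 / s ^+ 2).
Proof.
move=> s0; have s20 : 0 < s ^+ 2 by rewrite exprn_gt0.
pose t := dot (x - z) (x - z) / s ^+ 2.
pose u := enorm (x - y) ^+ 2 / s ^+ 2.
pose b := - dot (x - z) (x - y) / s ^+ 2.
have := @mp_diff t u b; rewrite /mp.
have -> : t + (u + 2 * b) = dot (y - z) (y - z) / s ^+ 2.
  have -> : y - z = (x - z) - (x - y) by apply/rowP => i; rewrite !mxE; ring.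
  by rewrite dotBB /t /u /b enorm_sqr !mulrDl; ring.
have -> : t + (u - 2 * b) = dot (x + (x - y) - z) (x + (x - y) - z) / s ^+ 2.
  have -> : x + (x - y) - z = (x - z) + (x - y) by rewrite addrAC.
  by rewrite dotDD /t /u /b enorm_sqr !mulrDl; ring.
apply.
- by rewrite divr_ge0 ?dot_ge0// ltW.
- by rewrite divr_ge0 ?sqr_ge0// ltW.
- rewrite /b /t /u enorm_sqr mulrACA exprMn sqrrN -expr2 exprVn ler_wpM2r ?invr_ge0 ?exprn_ge0 ?(ltW s0)//.
  exact: cauchy_schwarz.
Qed.

End euclid.

(** * Arithmetic of the oscillation argument *)

Section osc_arith.
Variables (R : realFieldType) (k K BB e m M : R).
Hypotheses (k1 : 1 <= k) (K1 : 1 <= K) (e0 : 0 <= e) (m0 : 0 <= m) (mM : m <= M) (MB : M <= BB).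
Let c := (2 * k * K)^-1.
(** X is the amount by which one round can raise m or lower M. Here k and K stand for [k2] and
    [k13], and e bounds the share of the mass that lies inside the old radius: X is half of the
    remaining gap, less the error, over the constants of the two-sided Green function bounds. *)
Let X := ((M - m) / 2 * (1 - e) - k ^+ 2 * BB * e) / (k * K).

Lemma osc_gain : (M - m) - X <= (1 - c) * (M - m) + (1 + k ^+ 2) * BB * e.
Proof.
have kk1 : 1 <= k * K by rewrite mulr_ege1.
have c0 : 0 <= c by rewrite /c -mulrA invr_ge0; lra.
have c1 : 2 * c <= 1 by rewrite /c -mulrA invfM mulrA mulfV// mul1r invf_le1//; lra.
have k20 : 0 <= k ^+ 2 by rewrite sqr_ge0.
have h2 : X = c * (M - m) - (c * (M - m) * e + 2 * c * k ^+ 2 * BB * e).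
  by rewrite /X /c; field; rewrite !gt_eqF// (lt_le_trans ltr01).
have h3 : c * (M - m) * e <= BB * e.
  apply: ler_wpM2r => //; apply: (@le_trans _ _ (1 * (M - m))); last by have := m0; have := MB; lra.
  by apply: ler_wpM2r; [rewrite subr_ge0|lra].
have h4 : 2 * c * k ^+ 2 * BB * e <= k ^+ 2 * BB * e.
  rewrite -!mulrA (mulrA 2); apply: ler_piMl => //.
  have B0 : 0 <= BB by rewrite (le_trans m0)// (le_trans mM).
  by rewrite mulrA -expr2; apply: mulr_ge0 => //; exact: mulr_ge0.
have h5 : (1 + k ^+ 2) * BB * e = BB * e + k ^+ 2 * BB * e by ring.
by rewrite h5; lra.
Qed.

Lemma osc_rhs_ge0 : 0 <= (1 - c) * (M - m) + (1 + k ^+ 2) * BB * e.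
Proof.
have kk1 : 1 <= k * K by rewrite mulr_ege1.
have c1 : c <= 1 by rewrite /c -mulrA invf_le1; lra.
have k20 : 0 <= k ^+ 2 by rewrite sqr_ge0.
have Mm : 0 <= M - m by rewrite subr_ge0.
have B0 : 0 <= BB by rewrite (le_trans m0)// (le_trans mM).
apply: addr_ge0; apply: mulr_ge0 => //; [lra|].
by apply: mulr_ge0 => //; lra.
Qed.

Lemma osc_key J i i0 : i0 <= e * i -> (M - m) * (i - i0) / 2 <= J ->
  k * K * X * i <= J - k ^+ 2 * BB * (e * i).
Proof.
move=> ii hJ; have h1 : (M - m) * i0 <= (M - m) * (e * i) by apply: ler_wpM2l => //; rewrite subr_ge0.
have -> : k * K * X * i = (M - m) * i / 2 - (M - m) * (e * i) / 2 - k ^+ 2 * BB * (e * i).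
  by rewrite /X; field; rewrite !gt_eqF// (lt_le_trans ltr01).
have h2 : (M - m) * (i - i0) / 2 = (M - m) * i / 2 - (M - m) * i0 / 2 by field.
by lra.
Qed.

End osc_arith.

Section small_arith.
Variable R : realFieldType.

Lemma gain_cancel (X Y W a b : R) : X + a <= Y + b -> W + b <= a -> X + W <= Y.
Proof. lra. Qed.

Lemma half_le (a b t : R) : a + b = t -> b <= a -> t / 2 <= a.
Proof. lra. Qed.

Lemma split_gap (M m h v a b : R) : M * h = 1 * v + b -> 1 * v = m * h + a ->
  a + b = (M - m) * h.
Proof. by rewrite mulrBl; lra. Qed.

Lemma bernoulli (c : R) n : 0 <= c -> 1 + n%:R * c <= (1 + c) ^+ n.
Proof.
move=> c0; elim: n => [|n IH]; first by rewrite mul0r addr0 expr0.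
rewrite exprS mulrDl mul1r -natr1.
have : c <= c * (1 + c) ^+ n by rewrite ler_peMr// exprn_ege1//; lra.
by move: IH; rewrite mulrDl mul1r; lra.
Qed.

(** K / c is the fixed point of x -> (1 - c) x + K. *)
Lemma osc_rec (c K B x y : R) N : 0 < c -> c <= 1 -> x <= (1 - c) ^+ N * B + K / c ->
  y <= (1 - c) * x + K -> y <= (1 - c) ^+ N.+1 * B + K / c.
Proof.
move=> c0 c1 hx hy; have : (1 - c) * x <= (1 - c) * ((1 - c) ^+ N * B + K / c) by apply: ler_wpM2l => //; lra.
have -> : (1 - c) * ((1 - c) ^+ N * B + K / c) = (1 - c) ^+ N.+1 * B + K / c - K.
  by rewrite exprS; field; rewrite gt_eqF.
by lra.
Qed.

End small_arith.

Lemma expr_unbounded (R : realType) (c t : R) : 0 < c -> exists n, t <= (1 + c) ^+ n.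
Proof.
move=> c0; exists (Num.truncn (t / c)).+1; apply: le_trans (bernoulli _ (ltW c0)).
by have : t <= (Num.truncn (t / c)).+1%:R * c; [rewrite -ler_pdivrMr// ltW// truncnS_gt|lra].
Qed.

(** * Green function of a killed walk *)

Section walk_def.
Context (R : realType) (d : nat).
Local Notation V := (borelRd R d).
Local Notation mu := (@lebesgueRd R d).

(** Modelled on r -> phi (r^-2): phi is almost increasing and grows at most linearly, and the power
    2 comes from r^-2. *)
Record scale (C : R) (ph : R -> R) : Prop := Scale {
  sc_C : 1 <= C ;
  sc_pos : forall r, 0 < r -> 0 < ph r ;
  sc_dec : forall r s, 0 < r -> r <= s -> ph s <= C * ph r ;
  sc_dbl : forall r s, 0 < r -> r <= s -> ph r <= C * (s / r) ^+ 2 * ph s }.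

Definition nu (ph : R -> R) (r : R) := ph r / r ^+ d.

(* [q] is the one-step kernel of a random walk comparable with [eps] times a jump
   kernel [nu]; [P n] bounds its [n]-step densities. *)
Record walk (C rmin : R) (ph : R -> R) (Ceta : R -> R) (eps : R)
    (q : V -> V -> R) (P : nat -> R) : Prop := Walk {
  w_eps : 0 < eps ;
  w_rmin : 0 < rmin ;
  w_meas : measurable_fun setT (fun z : V * V => q z.1 z.2) ;
  w_ge0 : forall x y, 0 <= q x y ;
  w_sym : forall x y, q x y = q y x ;
  w_int1 : forall x, (\int[mu]_y (q x y)%:E = 1)%E ;
  w_refl : forall x (f : V -> \bar R), nnm f ->
    (\int[mu]_y ((q x y)%:E * f (x + (x - y))%R) = \int[mu]_y ((q x y)%:E * f y))%E ;
  w_ub : forall x y, x != y -> q x y <= C * (eps * nu ph (enorm (x - y))) ;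
  w_lb : forall x y, rmin <= enorm (x - y) -> eps * nu ph (enorm (x - y)) <= C * q x y ;
  w_mom : forall x s, 0 < s -> (\int[mu]_y (q x y * Num.min 1 (enorm (x - y) ^+ 2 / s ^+ 2))%:E
    <= (C * (eps * ph s))%:E)%E ;
  w_iter : forall n (B : set V) f x, (0 < n)%N -> measurable B -> nnm f ->
    (QUn mu q B n f x <= (P n)%:E * \int[mu]_(y in B) f y)%E ;
  w_P : forall eta s n, 0 < eta -> 0 < s -> eta <= n%:R * (eps * ph s) ->
    P n * s ^+ d <= Ceta eta ;
  w_P0 : forall n, 0 <= P n }.

End walk_def.

(** * Estimates for a single pole, uniform in the step and the domain *)

Section walk1.
Context (R : realType) (d : nat).
Local Notation V := (borelRd R d).
Local Notation mu := (@lebesgueRd R d).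
Variables (C rmin : R) (ph : R -> R) (Ceta : R -> R) (eps : R) (q : V -> V -> R) (P : nat -> R).
Hypothesis sc : scale C ph.
Hypothesis W : walk C rmin ph Ceta eps q P.
Local Notation Q U f := (QU mu q U f).
Local Notation RR U f := (RU mu q U f).
Local Notation nu := (nu d ph).

Lemma C_ge1 : 1 <= C. Proof. exact: sc_C sc. Qed.
Lemma C_gt0 : 0 < C. Proof. exact: lt_le_trans ltr01 C_ge1. Qed.
Let mq := w_meas W.
Let q0 := w_ge0 W.
Let e0 := w_eps W.
Let nQ := nnm_QU mu mq q0.
Let QZ := QUZ mu mq q0.
Let QD := QUD mu mq q0.
Let Qle := QU_le mu mq q0.
Let nqf := nnm_qf mq q0.

Lemma nu_gt0 r : 0 < r -> 0 < nu r.
Proof. by move=> r0; rewrite divr_gt0 ?exprn_gt0// (sc_pos sc). Qed.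

(** For a <= b the doubling of [ph] costs (b/a)^2 and the volume (b/a)^d, whence the exponent d + 2;
    for b < a both factors are monotone up to C. *)
Lemma nu_le a b k : 0 < a -> 0 < b -> 1 <= k -> b <= k * a ->
  nu a <= C * k ^+ d.+2 * nu b.
Proof.
move=> a0 b0 k1 bka; rewrite /nu.
have pa := sc_pos sc a0; have pb := sc_pos sc b0; have c0 := C_gt0.
have [ab|ba] := leP a b.
  have h := sc_dbl sc a0 ab.
  have bk : b / a <= k by rewrite ler_pdivrMr.
  have b1 : 0 <= b / a by rewrite divr_ge0// ltW.
  rewrite ler_pdivrMr ?exprn_gt0//; apply: (le_trans h).
  have -> : C * k ^+ d.+2 * (ph b / b ^+ d) * a ^+ d = C * (k ^+ d.+2 / (b / a) ^+ d) * ph b.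
    by rewrite expr_div_n; field; rewrite !expf_neq0 ?gt_eqF.
  rewrite ler_pM2r// ler_pM2l// ler_pdivlMr ?exprn_gt0 ?divr_gt0//.
  by rewrite -exprD add2n lerXn2r// nnegrE ?(le_trans ler01).
have h := sc_dec sc b0 (ltW ba).
have ib : b ^+ d <= a ^+ d by rewrite lerXn2r ?nnegrE ?ltW.
apply: (@le_trans _ _ (C * (ph b / b ^+ d))).
  rewrite mulrA; apply: ler_pM; rewrite ?invr_ge0 ?exprn_ge0 ?(ltW a0) ?(ltW pa)//.
  by rewrite lef_pV2 ?posrE ?exprn_gt0.
rewrite ler_pM2r ?divr_gt0 ?exprn_gt0// ler_peMr ?(ltW c0)//.
by rewrite exprn_ege1.
Qed.

Definition kH := C ^+ 3 * 3 ^+ d.+2.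

Lemma q_harnack rho w z z' : rmin <= rho -> 2 * rho <= enorm w ->
  enorm z < rho -> enorm z' < rho -> q w z <= kH * q w z'.
Proof.
move=> r1 hw hz hz'; have r0 : 0 < rho by apply: lt_le_trans r1; exact: w_rmin W.
have h1 := enorm_le_sub w z; have h2 := enorm_le_sub w z'.
have h3 := enorm_triangle w (- z); have h4 := enorm_triangle w (- z').
rewrite enormN in h3; rewrite enormN in h4.
have a0 : 0 < enorm (w - z) by lra.
have b0 : 0 < enorm (w - z') by lra.
have wz : w != z by apply: contraTneq a0 => ->; rewrite subrr enorm0 ltxx.
have k1 : 1 <= 3 :> R by lra.
have ba : enorm (w - z') <= 3 * enorm (w - z) by lra.
have nn := nu_le a0 b0 k1 ba.
have lb : eps * nu (enorm (w - z')) <= C * q w z' by apply: (w_lb W); lra.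
apply: (le_trans (w_ub W wz)).
have c0 := C_gt0.
apply: (@le_trans _ _ (C * (eps * (C * 3 ^+ d.+2 * nu (enorm (w - z')))))).
  by rewrite ler_pM2l// ler_pM2l.
have -> : C * (eps * (C * 3 ^+ d.+2 * nu (enorm (w - z')))) = C * C * 3 ^+ d.+2 * (eps * nu (enorm (w - z'))) by ring.
have -> : kH * q w z' = C * C * 3 ^+ d.+2 * (C * q w z') by rewrite /kH; ring.
have p3 : 0 <= (3 : R) ^+ d.+2 by rewrite exprn_ge0.
have cc : 0 <= C * C by rewrite mulr_ge0 ?(ltW c0).
by apply: ler_wpM2l lb; exact: mulr_ge0.
Qed.

Local Notation Bl r := (eball (0 : 'rV[R]_d) r : set V).

Lemma BlE (r : R) (z : V) : Bl r z = (enorm z < r) :> Prop.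
Proof. by rewrite /eball/= subr0. Qed.

(** One-step probability of a jump from w into the ball. For |w| >= 2 rho it stands in for rho^d
    q(w, z) with any z in the ball, and so removes the dependence on z. *)
Definition theta (rho : R) := Q (Bl rho) (fun=> 1%E).

Lemma nnm1 : nnm (fun=> 1%E : \bar R) (T := V).
Proof. by apply: nnm_cst. Qed.

Lemma nnm_theta rho : nnm (theta rho).
Proof. by apply: nQ; [exact: measurable_eball|exact: nnm1]. Qed.

Lemma QU_setT_1 x : Q setT (fun=> 1%E) x = 1%E.
Proof. by rewrite -[RHS](w_int1 W x); apply: eq_integral => y _; exact: mule1. Qed.

Lemma QU1_le U x : measurable U -> (Q U (fun=> 1%E) x <= 1)%E.
Proof.
by move=> mU; rewrite -[leRHS](QU_setT_1 x); exact: (QUS mu mq q0 x mU measurableT nnm1).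
Qed.

Lemma kH_ge1 : 1 <= kH.
Proof. by rewrite /kH mulr_ege1// exprn_ege1 ?C_ge1//; lra. Qed.

Definition k2 := kH * (2 * d.+1%:R) ^+ d.

Lemma k2_ge1 : 1 <= k2.
Proof.
rewrite /k2 mulr_ege1 ?kH_ge1// exprn_ege1// mulr_ege1 ?ler1n//; lra.
Qed.

Lemma q_theta rho w z : rmin <= rho -> 2 * rho <= enorm w -> enorm z < rho ->
  ((rho ^+ d * q w z)%:E <= k2%:E * theta rho w)%E.
Proof.
move=> r1 hw hz; have r0 : 0 < rho by apply: lt_le_trans r1; exact: w_rmin W.
have kh := kH_ge1.
have mB : measurable (Bl rho) by exact: measurable_eball.
have h : ((q w z)%:E * lebesgueRd (Bl rho) <= kH%:E * theta rho w)%E.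
  rewrite -integral_cst// /theta -(QZ w mB nnm1); last by lra.
  apply: ge0_le_integral => //.
  - by move=> y _; rewrite lee_fin.
  - have [|m1 _] := nqf w (nnm_cst _ (_ : 0 <= kH%:E * 1)%E); last exact: measurable_funTS.
    by rewrite mule1 lee_fin; lra.
  move=> y; rewrite BlE => hy; rewrite mule1 -EFinM lee_fin mulrC.
  exact: (q_harnack r1).
have vB := lebesgue_eball_lb (0 : 'rV[R]_d) r0.
have dn : (0 : R) < d.+1%:R ^+ d by rewrite exprn_gt0.
have h2 : ((q w z * (rho / d.+1%:R) ^+ d)%:E <= kH%:E * theta rho w)%E.
  by apply: le_trans h; rewrite EFinM lee_wpmul2l// lee_fin.
have -> : rho ^+ d * q w z = d.+1%:R ^+ d * (q w z * (rho / d.+1%:R) ^+ d).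
  by rewrite expr_div_n; field; rewrite expf_neq0// pnatr_eq0.
apply: (@le_trans _ _ ((d.+1%:R ^+ d)%:E * (kH%:E * theta rho w))%E).
  by rewrite EFinM lee_wpmul2l// lee_fin ltW.
rewrite muleA -EFinM lee_wpmul2r//; first by case: (nnm_theta rho).
rewrite lee_fin /k2 mulrC ler_wpM2l ?(le_trans ler01)//.
by rewrite exprMn ler_peMl ?(ltW dn)// exprn_ege1//; lra.
Qed.

Lemma theta_q rho w z : rmin <= rho -> 2 * rho <= enorm w -> enorm z < rho ->
  (theta rho w <= (k2 * (rho ^+ d * q w z))%:E)%E.
Proof.
move=> r1 hw hz; have r0 : 0 < rho by apply: lt_le_trans r1; exact: w_rmin W.
have kh := kH_ge1.
have mB : measurable (Bl rho) by exact: measurable_eball.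
apply: (@le_trans _ _ ((kH * q w z)%:E * lebesgueRd (Bl rho))%E).
  rewrite -integral_cst// /theta; apply: ge0_le_integral => //.
  - by move=> y _; rewrite mule1 lee_fin.
  - by have [m1 _] := nqf w nnm1; exact: measurable_funTS.
  by move=> y; rewrite BlE => hy; rewrite mule1 lee_fin; exact: (q_harnack r1).
have kq : (0 <= (kH * q w z)%:E)%E by rewrite lee_fin mulr_ge0// (le_trans ler01).
apply: (le_trans (lee_wpmul2l kq (lebesgue_eball_ub (0 : 'rV[R]_d) r0))).
rewrite -EFinM lee_fin /k2.
have -> : kH * q w z * (2 * rho) ^+ d = (2 ^+ d) * (kH * (rho ^+ d * q w z)) by rewrite (exprMn_comm d (mulrC _ _)); ring.
have -> : kH * (2 * d.+1%:R) ^+ d * (rho ^+ d * q w z) = (2 * d.+1%:R) ^+ d * (kH * (rho ^+ d * q w z)) by ring.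
have rd : 0 <= rho ^+ d by rewrite exprn_ge0// ltW.
rewrite ler_wpM2r//; first by apply: mulr_ge0 (le_trans ler01 kh) _; exact: mulr_ge0.
by rewrite lerXn2r ?nnegrE// ler_peMr// ler1n.
Qed.

Lemma Q_theta_ub rho (A : set V) (f : V -> \bar R) w : rmin <= rho -> 2 * rho <= enorm w -> measurable A ->
  A `<=` Bl rho -> nnm f ->
  ((rho ^+ d)%:E * Q A f w <= k2%:E * (\int[mu]_(z in A) f z * theta rho w))%E.
Proof.
move=> r1 hw mA AB nf; have r0 : 0 < rho by apply: lt_le_trans r1; exact: w_rmin W.
have k20 : 0 <= k2 := le_trans ler01 k2_ge1.
have [mt t0] := nnm_theta rho; have [mf f0] := nf.
rewrite (muleC (\int[mu]_(z in A) f z)%E) muleA.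
have kt : (0 <= k2%:E * theta rho w)%E by rewrite mule_ge0 ?lee_fin.
rewrite -[X in (_ <= X)%E]ge0_integralZl//; last exact: measurable_funTS.
rewrite /QU -ge0_integralZl//; last 3 first.
- by have [m1 _] := nqf w nf; exact: measurable_funTS.
- by move=> z _; rewrite mule_ge0// lee_fin.
- by rewrite lee_fin exprn_ge0// ltW.
have [m1 p1] := nqf w nf.
apply: ge0_le_integral => //.
- by move=> z _; rewrite mule_ge0// ?lee_fin ?exprn_ge0// ltW.
- by apply: measurable_funTS; apply: emeasurable_funM.
- by apply: measurable_funTS; apply: emeasurable_funM.
move=> z /AB; rewrite BlE => hz; rewrite muleA lee_wpmul2r// -EFinM.
exact: q_theta.
Qed.

Lemma Q_theta_lb rho (A : set V) (f : V -> \bar R) w : rmin <= rho -> 2 * rho <= enorm w -> measurable A ->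
  A `<=` Bl rho -> nnm f ->
  ((\int[mu]_(z in A) f z) * theta rho w <= k2%:E * ((rho ^+ d)%:E * Q A f w))%E.
Proof.
move=> r1 hw mA AB nf; have r0 : 0 < rho by apply: lt_le_trans r1; exact: w_rmin W.
have k20 : 0 <= k2 := le_trans ler01 k2_ge1.
have [mt t0] := nnm_theta rho; have [mf f0] := nf.
have [m1 p1] := nqf w nf.
rewrite muleA -EFinM muleC -ge0_integralZl//; last exact: measurable_funTS.
rewrite /QU -ge0_integralZl//; last 2 first.
- exact: measurable_funTS.
- by rewrite lee_fin mulr_ge0// exprn_ge0// ltW.
apply: ge0_le_integral => //.
- by move=> z _; rewrite mule_ge0.
- by apply: measurable_funTS; apply: emeasurable_funM.
- by apply: measurable_funTS; apply: emeasurable_funM.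
move=> z /AB; rewrite BlE => hz; rewrite muleA lee_wpmul2r// -EFinM -mulrA.
exact: theta_q.
Qed.

(** By [w_refl], y and its mirror image 2 w - y are equally likely, so twice the mean of f is the
    mean of f(y) + f(2 w - y), which differs from 2 f(w) by a second difference. That difference has
    mean at most 34 times the truncated second moment [w_mom]; halving gives 17. *)
Lemma drift_ub (f : V -> R) s w : 0 < s -> measurable_fun setT f -> (forall y, 0 <= f y) ->
  (forall y, `|f y + f (w + (w - y)) - 2 * f w| <= 34 * Num.min 1 (enorm (w - y) ^+ 2 / s ^+ 2)) ->
  (Q setT (fun y => (f y)%:E) w <= (f w + 17 * (C * (eps * ph s)))%:E)%E /\
  ((f w)%:E <= Q setT (fun y => (f y)%:E) w + (17 * (C * (eps * ph s)))%:E)%E.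
Proof.
move=> s0 mf f0 hf.
have nf : nnm (fun y : V => (f y)%:E) by split=> [|y]; [exact/measurable_EFinP|rewrite lee_fin].
have mr : measurable_fun setT (fun y : V => w + (w - y) : V).
  apply: measurable_rowD => //; apply: measurable_rowB => //; exact: measurable_cst.
have nr : nnm (fun y : V => (f (w + (w - y)))%:E).
  split=> [|y]; last by rewrite lee_fin.
  by apply/measurable_EFinP; exact: measurableT_comp mf mr.
pose g (y : V) := 34 * Num.min 1 (enorm (w - y) ^+ 2 / s ^+ 2).
have g0 y : 0 <= g y by rewrite mulr_ge0// le_min ler01 divr_ge0 ?sqr_ge0.
have mg : measurable_fun setT (fun y : V => Num.min 1 (enorm (w - y) ^+ 2 / s ^+ 2)).
  apply: measurable_minr => //; apply: measurable_funM => //; apply: measurable_funX.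
  by apply: measurable_enorm; apply: measurable_rowB => //; exact: measurable_cst.
have ng : nnm (fun y : V => (g y)%:E).
  split=> [|y]; last by rewrite lee_fin.
  by apply/measurable_EFinP; apply: measurable_funM.
have Qg : (Q setT (fun y => (g y)%:E) w <= (34 * (C * (eps * ph s)))%:E)%E.
  have n1 : nnm (fun y : V => (Num.min 1 (enorm (w - y) ^+ 2 / s ^+ 2))%:E).
    split=> [|y]; first exact/measurable_EFinP.
    by rewrite lee_fin le_min ler01 divr_ge0 ?sqr_ge0.
  have -> : (fun y => (g y)%:E) = (fun y => 34%:E * (Num.min 1 (enorm (w - y) ^+ 2 / s ^+ 2))%:E)%E.
    by apply/funext => y; rewrite -EFinM.
  rewrite (QZ w measurableT n1); last by lra.
  rewrite (EFinM 34); apply: lee_wpmul2l; first by rewrite lee_fin; lra.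
  apply: le_trans (w_mom W w s0); rewrite /QU.
  by under eq_integral do rewrite -EFinM.
have Qr : Q setT (fun y => (f (w + (w - y)))%:E) w = Q setT (fun y => (f y)%:E) w.
  exact: (w_refl W w nf).
have c2 : nnm (fun=> (2 * f w)%:E) (T := V) by apply: nnm_cst; rewrite lee_fin mulr_ge0.
have Qc : Q setT (fun=> (2 * f w)%:E) w = (2 * f w)%:E.
  have -> : (fun=> (2 * f w)%:E) = (fun y : V => (2 * f w)%:E * 1)%E.
    by apply/funext => y; rewrite mule1.
  by rewrite (QZ w measurableT nnm1) ?mulr_ge0// QU_setT_1 mule1.
have S1 : (Q setT (fun y => (f y)%:E) w + Q setT (fun y => (f y)%:E) w <= (2 * f w)%:E + Q setT (fun y => (g y)%:E) w)%E.
  rewrite -{2}Qr -(QD w measurableT nf nr) -{1}Qc -(QD w measurableT c2 ng); apply: Qle => //; [exact: nnmD..|].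
  by move=> y _; rewrite -!EFinD lee_fin; have := hf y; rewrite -/(g y) ler_norml => /andP[]; lra.
have S2 : ((2 * f w)%:E <= Q setT (fun y => (f y)%:E) w + Q setT (fun y => (f y)%:E) w + Q setT (fun y => (g y)%:E) w)%E.
  rewrite -{2}Qr -(QD w measurableT nf nr) -(QD w measurableT (nnmD nf nr) ng).
  rewrite -{1}Qc; apply: Qle => //; [by apply: nnmD => //; exact: nnmD|].
  by move=> y _; rewrite -!EFinD lee_fin; have := hf y; rewrite -/(g y) ler_norml => /andP[]; lra.
have [_ qf0] := nQ (measurableT : measurable (setT : set V)) nf.
have [_ qg0] := nQ (measurableT : measurable (setT : set V)) ng.
move: S1 S2 Qg (qf0 w) (qg0 w).
case: (Q setT (fun y => (f y)%:E) w) => [a| |]; case: (Q setT (fun y => (g y)%:E) w) => [b| |]//=;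
  rewrite -?EFinD ?lee_fin => *; split; rewrite ?leey ?lee_fin//; lra.
Qed.

Lemma QU_supp (U A : set V) (f : V -> \bar R) y : A `<=` U -> (forall w, U w -> ~ A w -> f w = 0%E) ->
  Q U f y = Q A f y.
Proof.
move=> AU f0; rewrite !(QUE mu q); apply: eq_integral => w _; congr (_ * _)%E.
rewrite !patchE; have [Aw|nAw] := pselect (A w); first by rewrite !mem_set//; exact: AU.
by rewrite (memNset nAw); case: ifPn => // /set_mem Uw; rewrite f0.
Qed.

Lemma bump_drift z s w : 0 < s ->
  (Q setT (fun y => (bump z s y)%:E) w <= (bump z s w + 17 * (C * (eps * ph s)))%:E)%E /\
  ((bump z s w)%:E <= Q setT (fun y => (bump z s y)%:E) w + (17 * (C * (eps * ph s)))%:E)%E.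
Proof.
move=> s0; apply: drift_ub => //; first exact: measurable_bump.
- exact: bump_ge0.
- by move=> y; exact: bump_diff.
Qed.

Lemma nnm_bump z s : nnm (fun y : V => (bump z s y)%:E).
Proof.
split=> [|y]; last by rewrite lee_fin bump_ge0.
by apply/measurable_EFinP; exact: measurable_bump.
Qed.

Lemma exit_drift z s w : 0 < s ->
  (Q setT (fun y => (1 - bump z s y)%:E) w <= (1 - bump z s w + 17 * (C * (eps * ph s)))%:E)%E.
Proof.
move=> s0; have [|||//] := @drift_ub (fun y => 1 - bump z s y) s w s0.
- by apply: measurable_funB => //; exact: measurable_bump.
- by move=> y; rewrite subr_ge0 bump_le1.
move=> y; rewrite (_ : _ - _ = - (bump z s y + bump z s (w + (w - y)) - 2 * bump z s w)); last by ring.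
by rewrite normrN; exact: bump_diff.
Qed.

Lemma drift_gt0 s : 0 < s -> 0 < 17 * (C * (eps * ph s)).
Proof. by move=> s0; rewrite !mulr_gt0// ?C_gt0// (sc_pos sc). Qed.

(** Within s/2 of the centre the bump is at least 1/2, and it loses at most e per step, so the walk
    survives k <= 1/(4 e) steps with probability at least 1/4. Summing over these k gives 1/(16
    e). *)
Lemma RU_ball_lb z s y : 0 < s -> enorm (y - z) < s / 2 ->
  ((16 * (17 * (C * (eps * ph s))))^-1%:E <= RR (eball z s) (fun=> 1%E) y)%E.
Proof.
move=> s0 ys; set e := 17 * _.
have e_gt0 : 0 < e := drift_gt0 s0.
have mB : measurable (eball z s : set V) by exact: measurable_eball.
pose n := Num.truncn (4 * e)^-1.
have n1 : (4 * e)^-1 < n.+1%:R by rewrite truncnS_gt.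
have n0 : n%:R <= (4 * e)^-1 by rewrite truncn_le// invr_ge0 mulr_ge0// ltW.
have By : eball z s y by rewrite /eball/=; lra.
apply: (@le_trans _ _ (RUn mu q (eball z s) n.+1 (fun=> 1%E) y)); last first.
  by apply: RUn_le_RU => //; exact: nnm1.
have low k : (k <= n)%N -> ((1 / 4)%:E <= QUn mu q (eball z s) k (fun=> 1) y)%E.
  move=> kn; have := @QUn_drift _ _ _ mu q mq q0 _ mB _ k _ e y (nnm_bump z s) (ltW e_gt0).
  have hb : 1 / 2 <= bump z s y by rewrite bump_in// ltW.
  have ke : k%:R * e <= 1 / 4.
    rewrite -ler_pdivlMr// -mulrA mul1r -invfM mulrC (mulrC e); apply: le_trans n0.
    by rewrite ler_nat.
  have nn : nnm (QUn mu q (eball z s) k (fun=> 1%E)) by apply: nnm_QUn => //; exact: nnm1.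
  move=> H; have {}H : ((bump z s y)%:E <= QUn mu q (eball z s) k (fun=> 1) y + (k%:R * e)%:E)%E.
    apply: H => //.
    - by move=> w; apply: QU1_le.
    - by move=> w _; rewrite lee_fin bump_le1.
    move=> w Bw; have [_ h] := bump_drift z w s0; apply: (le_trans h); rewrite leeD2r//.
    rewrite (QU_supp (A := eball z s))// => t _ /negP; rewrite -leNgt => tz.
    by rewrite bump_out.
  move: H; case: (QUn _ _ _ _ _ _) => [a| |]//=; rewrite ?leey// -EFinD !lee_fin; lra.
rewrite /RUn; apply: (@le_trans _ _ (\sum_(0 <= k < n.+1) (1 / 4)%:E)%E).
  rewrite sumEFin lee_fin sumr_const_nat subn0 -(mulr_natl (1 / 4) n.+1).
  have -> : (16 * e)^-1 = (4 * e)^-1 * (1 / 4) by field; rewrite gt_eqF.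
  by rewrite ler_wpM2r// ltW.
rewrite big_nat [leRHS]big_nat; apply: lee_sum => k /andP[_ kn]; exact: low.
Qed.

Section domain.
Variables (D : set V) (x : V).
Hypothesis mD : measurable D.
Local Notation Ain r := (D `&` Bl r).
Local Notation Uout r := (D `&` [set y : V | r <= enorm y]).
Let u := RR D (fun y => (q x y)%:E).
(* The expected number of visits to [eball 0 r], the start included, of the walk
   from [x] killed outside [D]. *)
Definition Iu (r : R) := (1 + \int[mu]_(y in Ain r) u y)%E.

Lemma mA r : measurable (Ain r).
Proof. by apply: measurableI => //; exact: measurable_eball. Qed.

Lemma mU r : measurable (Uout r).
Proof. by apply: measurableI => //; exact: measurable_enorm_ge. Qed.

Lemma domain_split r : D = Ain r `|` Uout r.
Proof.
apply/seteqP; split=> y; last by move=> [[]|[]].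
by move=> Dy; have [yr|ry] := ltP (enorm y) r; [left|right]; split=> //; rewrite BlE.
Qed.

Lemma domain_disj r : [disjoint Ain r & Uout r].
Proof.
by apply/disj_setPS => y [[_ +] [_ /=]]; rewrite BlE => ? ?; lra.
Qed.

Let nq := nnm_q mq q0 x.
Lemma nnm_u : nnm u.
Proof. exact: nnm_RU. Qed.
Let mu_u : measurable_fun setT u. Proof. by have [] := nnm_u. Qed.
Let u0 y : (0 <= u y)%E. Proof. by have [_] := nnm_u. Qed.

Lemma Iu_ge1 r : (1 <= Iu r)%E.
Proof. by rewrite /Iu leeDl// integral_ge0. Qed.

Lemma Iu_le r r' : r <= r' -> (Iu r <= Iu r')%E.
Proof.
move=> rr; rewrite /Iu leeD2l//; apply: ge0_subset_integral => //; [exact: mA|exact: mA|exact: measurable_funTS|].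
by move=> y [Dy]; rewrite BlE => yr; split=> //; rewrite BlE; lra.
Qed.

Lemma Iu_split r r' : r <= r' ->
  Iu r' = (Iu r + \int[mu]_(y in Ain r' `&` Uout r) u y)%E.
Proof.
move=> rr; rewrite /Iu -addeA; congr (_ + _)%E; rewrite -ge0_integral_setU//.
- congr (integral _ _ _); apply/seteqP; split=> y.
    move=> [Dy yr']; have [yr|ry] := ltP (enorm y) r; [left|right]; split=> //.
    by rewrite BlE.
  by move=> [[Dy] | []//]; rewrite !BlE => yr; split=> //; rewrite BlE; lra.
- exact: mA.
- by apply: measurableI; [exact: mA|exact: mU].
- exact: measurable_funTS.
by apply/disj_setPS => y [[_ +] [_ [_ /=]]]; rewrite BlE => ? ?; lra.
Qed.

(** Density at w of the jumps made from the ball of radius r by the killed walk, the start x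
    counting as a point of the ball. *)
Definition inner r w := ((q x w)%:E + Q (Ain r) u w)%E.

Lemma nnm_inner r : nnm (inner r).
Proof. by apply: nnmD => //; apply: nQ; [exact: mA|exact: nnm_u]. Qed.

Lemma uE y : u y = ((q x y)%:E + Q D u y)%E.
Proof. exact: RUE. Qed.

Lemma u_split r y : Uout r y -> u y = RR (Uout r) (inner r) y.
Proof.
move=> Uy; rewrite /u (RU_split mu mq q0 mD (mA r) (mU r))//; first exact: domain_split.
exact: domain_disj.
Qed.

Lemma inner_ub rho r w : rmin <= rho -> r <= rho -> enorm x < r -> 2 * rho <= enorm w ->
  ((rho ^+ d)%:E * inner r w <= k2%:E * (Iu r * theta rho w))%E.
Proof.
move=> r1 rr xr hw; have [_ t0] := nnm_theta rho.
have Q0 : (0 <= Q (Ain r) u w)%E by have [_] := nQ (mA r) nnm_u; exact.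
have k20 : (0 <= k2)%R := le_trans ler01 k2_ge1.
have rd : (0 <= rho ^+ d)%R by rewrite exprn_ge0// ltW// (lt_le_trans (w_rmin W)).
have I0 : (0 <= \int[mu]_(y in Ain r) u y)%E by rewrite integral_ge0.
have xr' : enorm x < rho by lra.
have h1 := q_theta r1 hw xr'.
have AB : Ain r `<=` Bl rho by move=> z [_]; rewrite !BlE; lra.
have h2 := Q_theta_ub r1 hw (mA r) AB nnm_u.
move: h1 h2 (t0 w) Q0 I0; rewrite /inner /Iu (w_sym W x) EFinM.
move: (theta rho w) (Q (Ain r) u w) (\int[mu]_(y in Ain r) u y)%E => t a i h1 h2 t00 a0 i0.
rewrite ge0_muleDl// mul1e ge0_muleDr ?lee_fin// ge0_muleDr ?mule_ge0//.
exact: leeD.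
Qed.

Lemma inner_lb rho r w : rmin <= rho -> r <= rho -> enorm x < r -> 2 * rho <= enorm w ->
  (Iu r * theta rho w <= k2%:E * ((rho ^+ d)%:E * inner r w))%E.
Proof.
move=> r1 rr xr hw; have [_ t0] := nnm_theta rho.
have rho0 : 0 < rho by apply: lt_le_trans r1; exact: w_rmin W.
have rd : 0 <= rho ^+ d by rewrite exprn_ge0// ltW.
have Q0 : (0 <= Q (Ain r) u w)%E by have [_] := nQ (mA r) nnm_u; exact.
have I0 : (0 <= \int[mu]_(y in Ain r) u y)%E by rewrite integral_ge0.
have xr' : enorm x < rho by lra.
have h1 := theta_q r1 hw xr'.
have AB : Ain r `<=` Bl rho by move=> z [_]; rewrite !BlE; lra.
have h2 := Q_theta_lb r1 hw (mA r) AB nnm_u.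
move: h1 h2 (t0 w) Q0 I0; rewrite /inner /Iu (w_sym W x) !EFinM.
have qq : (0 <= (q w x)%:E)%E by rewrite lee_fin.
have k20 : (0 <= k2%:E)%E by rewrite lee_fin (le_trans ler01 k2_ge1).
move: (theta rho w) (Q (Ain r) u w) (\int[mu]_(y in Ain r) u y)%E => t a i h1 h2 t00 a0 i0.
rewrite ge0_muleDl// mul1e ge0_muleDr ?lee_fin// ge0_muleDr ?mule_ge0 ?lee_fin//.
exact: leeD.
Qed.

(* The factor of the Green function that does not depend on its pole: for
   [enorm y >= 4 * rho], [u y] is comparable with [rho ^- d * Iu rho * HH rho y]. *)
Definition HH rho := RR (Uout (2 * rho)) (theta rho).

Lemma nnm_HH rho : nnm (HH rho).
Proof. by apply: nnm_RU => //; [exact: mU|exact: nnm_theta]. Qed.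

(** The left side is the probability that the walk from y leaves U by a jump into A; the constant 1
    is a supersolution. *)
Lemma RU_super1 (U A : set V) y : measurable U -> measurable A -> [disjoint A & U] -> U y ->
  (RR U (Q A (fun=> 1%E)) y <= 1)%E.
Proof.
move=> mU' mA' dis Uy; have n1 := nnm1.
apply: (RU_super mq q0 mU' (nQ mA' n1) n1 _ Uy) => // w Uw.
by rewrite -(QU_setU mu mq q0) //; apply: QU1_le; exact: measurableU.
Qed.

Lemma HH_le1 rho y : 0 < rho -> Uout (2 * rho) y -> (HH rho y <= 1)%E.
Proof.
move=> r0 Uy; apply: RU_super1 => //; [exact: mU|exact: measurable_eball|].
by apply/disj_setPS => z [+ [_ /=]]; rewrite BlE => ? ?; lra.
Qed.

Definition k4 := 34 * C * (C ^+ 2 * 8 ^+ d.+2 * 4 ^+ d * k2) + 2 * 4 ^+ d * k2 ^+ 2.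

Lemma k4_ge0 : 0 <= k4.
Proof.
have c0 := C_gt0; have k20 : 0 <= k2 := le_trans ler01 k2_ge1.
apply: addr_ge0; apply: mulr_ge0 => //; rewrite ?exprn_ge0//; first by lra.
  by do 3 (apply: mulr_ge0 => //); rewrite ?exprn_ge0// ltW.
Qed.

(** The theta term absorbs the drift of twice the bump. For |w| < 8 rho the drift is at most 34 C
    eps ph(4 rho), which is bounded by a multiple of rho^d q(w, 0) and thus of theta. For |w| >= 8
    rho the mean of the bump is at most [theta (4 * rho)], itself bounded by a multiple of
    [theta rho]. *)
Lemma collar_step rho w : rmin <= rho -> 2 * rho <= enorm w ->
  (2%:E * Q setT (fun y => (bump 0 (4 * rho) y)%:E) w <=
    (2 * bump 0 (4 * rho) w)%:E + k4%:E * theta rho w)%E.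
Proof.
move=> r1 hw; have r0 : 0 < rho by apply: lt_le_trans r1; exact: w_rmin W.
have k20 : 0 <= k2 := le_trans ler01 k2_ge1.
have c0 := C_gt0; have [_ t0] := nnm_theta rho.
have rd : 0 < rho ^+ d by rewrite exprn_gt0.
have p8 : 0 < (8 : R) ^+ d.+2 by rewrite exprn_gt0.
have p4 : 0 < (4 : R) ^+ d by rewrite exprn_gt0.
pose ka := 34 * C * (C ^+ 2 * 8 ^+ d.+2 * 4 ^+ d * k2).
pose kb := 2 * 4 ^+ d * k2 ^+ 2.
have ka0 : 0 <= ka.
  apply: mulr_ge0; first by lra.
  by do 3 (apply: mulr_ge0 => //); rewrite ?exprn_ge0// ltW.
have kb0 : 0 <= kb by apply: mulr_ge0; [rewrite mulr_ge0// ltW|rewrite exprn_ge0].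
have k4E : (k4%:E * theta rho w = ka%:E * theta rho w + kb%:E * theta rho w)%E.
  by rewrite -ge0_muleDl ?lee_fin.
rewrite k4E; have [w8|w8] := leP (8 * rho) (enorm w).
  have bs : (Q setT (fun y => (bump 0 (4 * rho) y)%:E) w <= theta (4 * rho) w)%E.
    rewrite (QU_supp (A := Bl (4 * rho)))//; last first.
      by move=> z _; rewrite BlE => /negP; rewrite -leNgt => hz; rewrite bump_out ?subr0//; lra.
    apply: Qle; [exact: measurable_eball|exact: nnm_bump|exact: nnm1|].
    by move=> z _; rewrite lee_fin bump_le1.
  have z0 : enorm (0 : 'rV[R]_d) < rho by rewrite enorm0.
  have r4 : rmin <= 4 * rho by lra.
  have hw4 : 2 * (4 * rho) <= enorm w by lra.
  have z4 : enorm (0 : 'rV[R]_d) < 4 * rho by rewrite enorm0; lra.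
  have t1 := theta_q r4 hw4 z4.
  have t2 := q_theta r1 hw z0.
  have E1 : (k2 * ((4 * rho) ^+ d * q w 0))%:E = ((4 ^+ d * k2)%:E * (rho ^+ d * q w 0)%:E)%E.
    by rewrite -EFinM; congr EFin; rewrite (exprMn_comm d (mulrC _ _)); ring.
  have bt : (Q setT (fun y => (bump 0 (4 * rho) y)%:E) w <= (4 ^+ d * k2)%:E * (k2%:E * theta rho w))%E.
    apply: (le_trans bs); apply: (le_trans t1); rewrite E1; apply: lee_wpmul2l t2.
    by rewrite lee_fin mulr_ge0// ltW.
  apply: (@le_trans _ _ (kb%:E * theta rho w)%E).
    have -> : (kb%:E * theta rho w = 2%:E * ((4 ^+ d * k2)%:E * (k2%:E * theta rho w)))%E.
      by rewrite !muleA -!EFinM; congr (_%:E * _)%E; rewrite /kb; ring.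
    by apply: lee_wpmul2l bt; rewrite lee_fin.
  have nb : (0 <= (2 * bump 0 (4 * rho) w)%:E)%E by rewrite lee_fin mulr_ge0// bump_ge0.
  have na : (0 <= ka%:E * theta rho w)%E by rewrite mule_ge0.
  by rewrite addeA leeDr// adde_ge0.
have s4 : 0 < 4 * rho by lra.
have [h _] := bump_drift 0 w s4.
apply: (@le_trans _ _ (2%:E * (bump 0 (4 * rho) w + 17 * (C * (eps * ph (4 * rho))))%:E)%E).
  by apply: lee_wpmul2l h; rewrite lee_fin.
have z0 : enorm (0 : 'rV[R]_d) < rho by rewrite enorm0.
have t2 := q_theta r1 hw z0.
rewrite -EFinM mulrDr EFinD leeD2l//.
apply: (@le_trans _ _ (ka%:E * theta rho w)%E); last first.
  by rewrite leeDl// mule_ge0// lee_fin.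
have b0 : 0 < enorm w by lra.
have k8 : 1 <= 8 :> R by lra.
have hw8 : enorm w <= 8 * (4 * rho) by lra.
have nn := nu_le s4 b0 k8 hw8.
have lb : eps * nu (enorm w) <= C * q w 0 by have := w_lb W (x := w) (y := 0); rewrite subr0; apply; lra.
have E0 : ph (4 * rho) = 4 ^+ d * rho ^+ d * nu (4 * rho).
  by rewrite /nu (exprMn_comm d (mulrC _ _)); field; rewrite !gt_eqF.
have m1 : eps * ph (4 * rho) <= (C ^+ 2 * 8 ^+ d.+2 * 4 ^+ d) * (rho ^+ d * q w 0).
  rewrite E0; have c1 : 0 < 4 ^+ d * rho ^+ d by rewrite mulr_gt0.
  have -> : eps * (4 ^+ d * rho ^+ d * nu (4 * rho)) = (4 ^+ d * rho ^+ d) * (eps * nu (4 * rho)) by ring.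
  have -> : C ^+ 2 * 8 ^+ d.+2 * 4 ^+ d * (rho ^+ d * q w 0) =
     (4 ^+ d * rho ^+ d) * (C * 8 ^+ d.+2 * (C * q w 0)) by ring.
  rewrite ler_pM2l//.
  apply: (@le_trans _ _ (C * 8 ^+ d.+2 * (eps * nu (enorm w)))).
    have -> : C * 8 ^+ d.+2 * (eps * nu (enorm w)) = eps * (C * 8 ^+ d.+2 * nu (enorm w)) by ring.
    by rewrite ler_pM2l.
  by apply: ler_wpM2l lb; rewrite mulr_ge0 ?(ltW c0)// ltW.
have E2 : (ka%:E * theta rho w = (34 * C * (C ^+ 2 * 8 ^+ d.+2 * 4 ^+ d))%:E * (k2%:E * theta rho w))%E.
  by rewrite muleA -EFinM; congr (_%:E * _)%E; rewrite /ka; ring.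
rewrite E2.
have nn34 : 0 <= C ^+ 2 * 8 ^+ d.+2 * 4 ^+ d.
  by do 2 (apply: mulr_ge0 => //); rewrite ?exprn_ge0// ltW.
apply: (@le_trans _ _ ((34 * C * (C ^+ 2 * 8 ^+ d.+2 * 4 ^+ d))%:E * (rho ^+ d * q w 0)%:E)%E); last first.
  by apply: lee_wpmul2l t2; rewrite lee_fin mulr_ge0//; lra.
rewrite -EFinM lee_fin.
have -> : 2 * (17 * (C * (eps * ph (4 * rho)))) = 34 * C * (eps * ph (4 * rho)) by ring.
have -> : 34 * C * (C ^+ 2 * 8 ^+ d.+2 * 4 ^+ d) * (rho ^+ d * q w 0) =
  34 * C * (C ^+ 2 * 8 ^+ d.+2 * 4 ^+ d * (rho ^+ d * q w 0)) by ring.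
by apply: ler_wpM2l m1; lra.
Qed.

(** From |y| >= 4 rho, entering the ball of radius 2 rho at all is, up to the factor k4, no more
    likely than jumping from outside it into the smaller ball of radius rho, which is what [HH]
    measures. The supersolution is twice the bump plus k4 [HH]: the bump is at least 1/2 on the ball
    of radius 2 rho and vanishes at y. *)
Lemma collar rho y : rmin <= rho -> Uout (4 * rho) y ->
  (RR (Uout (2 * rho)%R) (Q (Ain (2 * rho)%R) (fun=> 1)) y <= k4%:E * HH rho y)%E.
Proof.
move=> r1 [Dy /= y4]; have r0 : 0 < rho by apply: lt_le_trans r1; exact: w_rmin W.
have Uy : Uout (2 * rho) y by split=> //=; lra.
have b0 : bump 0 (4 * rho) y = 0 by apply: bump_out; rewrite ?subr0//; lra.
have n1 := nnm1; have nb := nnm_bump 0 (4 * rho); have nH := nnm_HH rho.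
have nb2 : nnm (fun w : V => 2%:E * (bump 0 (4 * rho) w)%:E)%E by apply: nnmZ.
have kH := nnmZ k4_ge0 nH.
pose h w := (2%:E * (bump 0 (4 * rho) w)%:E + k4%:E * HH rho w)%E.
have -> : (k4%:E * HH rho y = h y)%E by rewrite /h b0 mule0 add0e.
have mU2 := mU (2 * rho); have mA2 := mA (2 * rho).
apply: (RU_super mq q0 mU2 (nQ mA2 n1) (nnmD nb2 kH) _ Uy) => // w [Dw /= w2].
rewrite (QD w mU2 nb2 kH) (QZ w mU2 nH k4_ge0) addeA.
have HE : HH rho w = (theta rho w + Q (Uout (2 * rho)%R) (HH rho) w)%E.
  by rewrite {1}/HH (RUE mu mq q0 mU2)//; exact: nnm_theta.
have [_ t0] := nnm_theta rho; have [_ q0'] := nQ mU2 nH.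
rewrite /h HE (ge0_muleDr k4%:E (t0 w) (q0' w)) [leRHS]addeA; apply: leeD => //.
rewrite -EFinM; apply: le_trans (collar_step r1 w2).
rewrite (QZ w mU2 nb)//.
apply: (@le_trans _ _ (2%:E * Q (Ain (2 * rho)%R) (fun y => (bump 0 (4 * rho) y)%:E) w +
   2%:E * Q (Uout (2 * rho)%R) (fun y => (bump 0 (4 * rho) y)%:E) w)%E).
  rewrite leeD2r// -(QZ w mA2 nb)//; apply: Qle => // z [_]; rewrite BlE => z2.
  rewrite -EFinM lee_fin; have : 1 / 2 <= bump 0 (4 * rho) z by apply: bump_in; rewrite ?subr0//; lra.
  by lra.
have [_ qa0] := nQ mA2 nb; have [_ qu0] := nQ mU2 nb.
rewrite -ge0_muleDr// -(QU_setU mu mq q0)//; last exact: domain_disj.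
rewrite -domain_split; apply: lee_wpmul2l; first by rewrite lee_fin.
exact: QUS.
Qed.

Hypothesis Ifin : forall r, Iu r \is a fin_num.
Definition iu r := fine (Iu r).

Lemma iuE r : Iu r = (iu r)%:E.
Proof. by rewrite fineK. Qed.

Lemma iu_ge1 r : 1 <= iu r.
Proof. by rewrite -lee_fin -iuE Iu_ge1. Qed.

Lemma iu_le r r' : r <= r' -> iu r <= iu r'.
Proof. by move=> rr; rewrite -lee_fin -!iuE Iu_le. Qed.

Lemma iu_gt0 r : 0 < iu r.
Proof. exact: lt_le_trans ltr01 (iu_ge1 r). Qed.

Definition k5 := C ^+ 2 * 2 ^+ d.+2.

Lemma k5_gt0 : 0 < k5.
Proof. by rewrite /k5 mulr_gt0 ?exprn_gt0// C_gt0. Qed.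

(** Points w and z with |z| < rho are at least rho/2 apart, so q(w, z) is bounded by a multiple of
    the jump kernel at distance rho. *)
Lemma inner_near rho w : 0 < rho -> enorm x < rho -> 3 / 2 * rho <= enorm w ->
  (inner rho w <= (k5 * (eps * nu rho) * iu rho)%:E)%E.
Proof.
move=> r0 xr wr; have c0 := C_gt0.
have qb z : enorm z < rho -> q w z <= k5 * (eps * nu rho).
  move=> zr; have h1 := enorm_le_sub w z.
  have a0 : 0 < enorm (w - z) by lra.
  have wz : w != z by apply: contraTneq a0 => ->; rewrite subrr enorm0 ltxx.
  apply: (le_trans (w_ub W wz)).
  have k1 : 1 <= 2 :> R by lra.
  have ba : rho <= 2 * enorm (w - z) by lra.
  have nn := nu_le a0 r0 k1 ba.
  have -> : k5 * (eps * nu rho) = C * (eps * (C * 2 ^+ d.+2 * nu rho)) by rewrite /k5; ring.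
  by rewrite ler_pM2l// ler_pM2l.
set k := k5 * (eps * nu rho) in qb *.
have k0 : 0 <= k := ltW (mulr_gt0 k5_gt0 (mulr_gt0 e0 (nu_gt0 r0))).
rewrite EFinM -iuE /Iu /inner ge0_muleDr ?integral_ge0// mule1; apply: leeD.
  by rewrite lee_fin (w_sym W); exact: qb.
rewrite -(ge0_integralZl _ (mA rho))//; last exact: measurable_funTS.
have [m1 p1] := nqf w nnm_u.
apply: ge0_le_integral => //; first exact: mA.
- exact: measurable_funTS.
- by apply: measurable_funTS; exact: emeasurable_funM.
by move=> z [_]; rewrite BlE => zr; apply: lee_wpmul2r => //; rewrite lee_fin qb.
Qed.

(** The equation of u is iterated for about eta / (eps ph rho) steps inside B, the part of D within
    rho/2 of z. Paths that stay contribute at most P n times the mass of u on B; the inner ball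
    contributes at most cst per step; on leaving B elsewhere u <= S, but this has probability at
    most n e, a multiple of eta. The factor 136 is 17 * 4 * 2: the drift, the doubling of ph between
    rho/2 and rho, and n <= 2 eta / (eps ph rho). *)
Lemma annulus_bound eta rho S z : 0 < eta -> 0 < rho -> enorm x < rho -> 0 <= S ->
  eps * ph rho <= eta -> (forall y, Uout rho y -> (u y <= S%:E)%E) ->
  D z -> 2 * rho <= enorm z <= 4 * rho ->
  (u z <= ((Ceta eta + 2 * eta * k5) / rho ^+ d * iu (5 * rho) + 136 * C ^+ 2 * eta * S)%:E)%E.
Proof.
move=> eta0 r0 xr S0 epe uS Dz /andP[z2 z4]; have c0 := C_gt0.
have p0 := sc_pos sc r0.
have ep0 : 0 < eps * ph rho by rewrite mulr_gt0.
pose B := (D `&` eball z (rho / 2) : set V).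
have mB : measurable B by apply: measurableI => //; exact: measurable_eball.
have r20 : 0 < rho / 2 by lra.
have Bz w : B w -> enorm (w - z) < rho / 2 by case.
have BU : B `<=` Uout (3 / 2 * rho).
  by move=> w Bw; have wz := Bz w Bw; case: Bw => Dw _; split=> //=; have := enorm_le_sub z w; rewrite (enormB z w); lra.
have BA : B `<=` Ain (5 * rho).
  by move=> w Bw; have wz := Bz w Bw; case: Bw => Dw _; split=> //; rewrite BlE; have := enorm_le_sub w z; lra.
pose E := (Uout rho `\` B : set V).
have mE : measurable E by apply: measurableD => //; exact: mU.
have n1 := nnm1; have nu' := nnm_u.
pose b w := 1 - bump z (rho / 2) w.
have b0 w : 0 <= b w by rewrite subr_ge0 bump_le1.
have nb : nnm (fun w : V => (b w)%:E).
  split=> [|w]; last by rewrite lee_fin.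
  by apply/measurable_EFinP; apply: measurable_funB => //; exact: measurable_bump.
pose cst := k5 * (eps * nu rho) * iu rho.
have cst0 : 0 <= cst := ltW (mulr_gt0 (mulr_gt0 k5_gt0 (mulr_gt0 e0 (nu_gt0 r0))) (iu_gt0 _)).
have ncst : nnm (fun=> cst%:E : \bar R) (T := V) by apply: nnm_cst; rewrite lee_fin.
pose g w := (cst%:E + S%:E * Q E (fun=> 1%E) w)%E.
have ng : nnm g by apply: nnmD => //; apply: nnmZ => //; exact: nQ.
have DE : D = Ain rho `|` (E `|` B).
  have -> : E `|` B = Uout rho; last exact: domain_split.
  apply/seteqP; split=> w; first by move=> [[]//|/BU[Dw /= h]]; split=> //=; lra.
  by move=> Uw; have [Bw|Bw] := pselect (B w); [right|left].
have dEB : [disjoint E & B] by apply/disj_setPS => w [[_ nB] Bw].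
have dA : [disjoint Ain rho & E `|` B].
  apply/disj_setPS => w [[Dw wr] EB]; move: wr; rewrite BlE => wr.
  by case: EB => [[[_ /=]]|/BU[_ /=]]; lra.
have sub w : B w -> (u w <= g w + Q B u w)%E.
  move=> Bw; rewrite uE {1}DE (QU_setU mu mq q0 w (mA rho) (measurableU _ _ mE mB) nu' dA).
  rewrite (QU_setU mu mq q0 w mE mB nu' dEB) (addeA (q x w)%:E) -/(inner rho w) (addeA (inner rho w)).
  apply: leeD => //; apply: leeD.
    by apply: inner_near => //; case: (BU _ Bw).
  rewrite -(QZ w mE n1 S0); apply: Qle => //; first exact: nnmZ.
  by move=> y [Uy _]; rewrite mule1; exact: uS.
pose e := 17 * (C * (eps * ph (rho / 2))).
have e_gt0 : 0 < e := drift_gt0 r20.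
have drift w : B w -> (g w + Q B (fun w => S%:E * (b w)%:E) w <= S%:E * (b w)%:E + (cst + S * e)%:E)%E.
  move=> Bw; rewrite /g -addeA (QZ w mB nb S0).
  have [_ qe0] := nQ mE n1; have [_ qb0] := nQ mB nb.
  have key : (S%:E * Q E (fun=> 1%E) w + S%:E * Q B (fun w => (b w)%:E) w <= S%:E * (b w + e)%:E)%E.
    rewrite -ge0_muleDr//; apply: lee_wpmul2l; first by rewrite lee_fin.
    apply: le_trans (exit_drift z w r20).
    rewrite (_ : Q E _ w = Q E (fun w => (b w)%:E) w); last first.
      apply: eq_QU => y [[Dy /= yr] nB]; rewrite /b bump_out ?subr0// leNgt.
      by apply/negP => yz; apply: nB.
    by rewrite -(QU_setU mu mq q0 w mE mB nb dEB); apply: QUS => //; exact: measurableU.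
  apply: (le_trans (leeD2l _ key)); rewrite -!EFinM -!EFinD lee_fin le_eqVlt.
  by apply/orP; left; apply/eqP; ring.
pose n := (Num.truncn (eta / (eps * ph rho))).+1.
have n_gt : eta <= n%:R * (eps * ph rho).
  by rewrite -ler_pdivrMr// ltW// truncnS_gt.
have n_le : n%:R * (eps * ph rho) <= 2 * eta.
  rewrite /n -natr1 mulrDl mul1r.
  have : (Num.truncn (eta / (eps * ph rho)))%:R <= eta / (eps * ph rho).
    by rewrite truncn_le// divr_ge0// ltW.
  by rewrite ler_pdivlMr//; lra.
have Bzz : B z by split=> //; rewrite /eball/= subrr enorm0.
have q1 w : (Q B (fun=> 1%E) w <= 1)%E by exact: QU1_le.
have I1 := iter_sub mq q0 mB n nu' ng sub Bzz.
have I2 : (RUn mu q B n g z <= S%:E * (b z)%:E + (n%:R * (cst + S * e))%:E)%E.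
  apply: (RUn_drift mq q0 mB q1 n ng _ _ drift Bzz); first exact: nnmZ.
  by rewrite addr_ge0// mulr_ge0// ltW.
have bz : b z = 0 by rewrite /b bump_center subrr.
have I3 : (QUn mu q B n u z <= (P n * iu (5 * rho))%:E)%E.
  apply: (le_trans (w_iter W z (isT : (0 < n)%N) mB nu')).
  rewrite EFinM -iuE; apply: lee_wpmul2l; first by rewrite lee_fin (w_P0 W).
  apply: (@le_trans _ _ (\int[mu]_(y in Ain (5 * rho)) u y)%E).
    by apply: ge0_subset_integral => //; [exact: mA|exact: measurable_funTS].
  by rewrite /Iu leeDr.
have I4 := w_P W eta0 r0 n_gt.
apply: (le_trans I1); apply: (le_trans (leeD I3 I2)).
rewrite bz mule0 add0e -EFinD lee_fin.
have rd : 0 < rho ^+ d by rewrite exprn_gt0.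
have i5 := iu_gt0 (5 * rho).
have I5 : P n * iu (5 * rho) <= Ceta eta / rho ^+ d * iu (5 * rho).
  by rewrite ler_pM2r// ler_pdivlMr.
have i15 : iu rho <= iu (5 * rho) by apply: iu_le; rewrite ler_peMl ?ler1n// ltW.
have I6 : n%:R * cst <= 2 * eta * k5 / rho ^+ d * iu (5 * rho).
  have -> : n%:R * cst = (n%:R * (eps * ph rho)) * (k5 / rho ^+ d * iu rho) by rewrite /cst /nu; ring.
  have -> : 2 * eta * k5 / rho ^+ d * iu (5 * rho) = (2 * eta) * (k5 / rho ^+ d * iu (5 * rho)) by ring.
  have kr : 0 < k5 / rho ^+ d by rewrite divr_gt0// k5_gt0.
  apply: ler_pM => //; first by rewrite mulr_ge0// ltW.
    by rewrite ltW// mulr_gt0// iu_gt0.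
  by rewrite ler_pM2l.
have I7 : n%:R * (S * e) <= 136 * C ^+ 2 * eta * S.
  have h2 : ph (rho / 2) <= C * 4 * ph rho.
    have := sc_dbl sc r20 (_ : rho / 2 <= rho); rewrite (_ : rho / (rho / 2) = 2) ?expr2; last first.
      by field; rewrite gt_eqF.
    by move=> H; rewrite (_ : C * 4 * ph rho = C * (2 * 2) * ph rho); [apply: H; rewrite ler_pdivrMr// ler_peMr ?ler1n// ltW|ring].
  have -> : n%:R * (S * e) = 17 * C * S * (n%:R * (eps * ph (rho / 2))) by rewrite /e; ring.
  have -> : 136 * C ^+ 2 * eta * S = 17 * C * S * (4 * C * (2 * eta)) by ring.
  apply: ler_wpM2l; first by rewrite mulr_ge0// mulr_ge0// ltW.
  apply: (@le_trans _ _ (4 * C * (n%:R * (eps * ph rho)))); last by rewrite ler_pM2l// mulr_gt0.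
  have -> : 4 * C * (n%:R * (eps * ph rho)) = n%:R * (eps * (C * 4 * ph rho)) by ring.
  by apply: ler_wpM2l => //; rewrite ler_pM2l.
have -> : (Ceta eta + 2 * eta * k5) / rho ^+ d * iu (5 * rho) =
  Ceta eta / rho ^+ d * iu (5 * rho) + 2 * eta * k5 / rho ^+ d * iu (5 * rho) by ring.
by rewrite mulrDr addrA; apply: lerD I7; exact: lerD I5 I6.
Qed.

Lemma le_cancel (r : R) (a b : \bar R) : 0 < r -> (r%:E * a <= r%:E * b)%E -> (a <= b)%E.
Proof. by move=> r0; rewrite lee_pmul2l// lte_fin. Qed.

(** For |y| >= 2 rho the source splits into jumps from the ball of radius rho, at most k2 rho^-d iu
    rho times theta, and jumps from the annulus up to 2 rho, where u <= M. Both come weighted by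
    hitting probabilities, at most 1. *)
Lemma outside_bound rho M y : rmin <= rho -> enorm x < rho -> 0 <= M ->
  (forall z, D z -> rho <= enorm z <= 2 * rho -> (u z <= M%:E)%E) -> Uout rho y ->
  (u y <= (k2 / rho ^+ d * iu rho + M)%:E)%E.
Proof.
move=> r1 xr M0 uM [Dy /= yr]; have r0 : 0 < rho by apply: lt_le_trans r1; exact: w_rmin W.
have k20 : 0 < k2 := lt_le_trans ltr01 k2_ge1.
have rd : 0 < rho ^+ d by rewrite exprn_gt0.
have c0 : 0 <= k2 / rho ^+ d * iu rho by rewrite ltW// mulr_gt0 ?divr_gt0// iu_gt0.
have [y2|y2] := ltP (enorm y) (2 * rho).
  by apply: (le_trans (uM y Dy _)); [rewrite yr ltW|rewrite lee_fin lerDr].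
have Uy : Uout (2 * rho) y by [].
pose E := (Ain (2 * rho) `&` Uout rho : set V).
have mE : measurable E by apply: measurableI; [exact: mA|exact: mU].
have n1 := nnm1; have nt := nnm_theta rho.
rewrite (u_split Uy).
have mU2 := mU (2 * rho).
have nc := nnmZ c0 nt; have nm := nnmZ M0 (nQ mE n1).
apply: (@le_trans _ _ (RR (Uout (2 * rho)%R) (fun w => (k2 / rho ^+ d * iu rho)%:E * theta rho w + M%:E * Q E (fun=> 1) w) y)%E).
  apply: (RU_le mu mq q0 mU2 (nnm_inner (2 * rho)) (nnmD nc nm) _ Uy) => w [Dw /= w2].
  have -> : inner (2 * rho) w = (inner rho w + Q E u w)%E.
    rewrite /inner -addeA -(QU_setU mu mq q0 w (mA rho) mE nnm_u); last first.
      by apply/disj_setPS => z [[_ +] [_ [_ /=]]]; rewrite BlE => ? ?; lra.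
    congr (_ + Q _ _ _)%E; apply/seteqP; split=> z.
      move=> [Dz z2]; have [zr|zr] := ltP (enorm z) rho; [left|right]; split=> //.
      by rewrite BlE.
    by move=> [[Dz]|[]//]; rewrite BlE => zr; split=> //; rewrite BlE; lra.
  apply: leeD.
    have h := inner_ub r1 (lexx rho) xr w2.
    apply: (le_cancel rd); apply: (le_trans h); rewrite iuE !muleA -!EFinM.
    by rewrite (_ : rho ^+ d * _ = k2 * iu rho)//; field; rewrite gt_eqF.
  rewrite -(QZ w mE n1 M0); apply: (Qle w mE nnm_u (nnmZ M0 n1)).
  move=> z [[Dz z2] [_ /= zr]]; rewrite mule1; apply: uM => //; rewrite zr/=.
  by move: z2; rewrite BlE => /ltW.
rewrite (RUD mu mq q0 mU2 y nc nm) EFinD; apply: leeD.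
  rewrite (RUZ mu mq q0 mU2 y nt c0) -[leRHS]mule1; apply: lee_wpmul2l; first by rewrite lee_fin.
  exact: HH_le1.
rewrite (RUZ mu mq q0 mU2 y (nQ mE n1) M0) -[leRHS]mule1; apply: lee_wpmul2l; first by rewrite lee_fin.
apply: RU_super1 => //.
by apply/disj_setPS => z [[[_ +] _] [_ /=]]; rewrite BlE => ? ?; lra.
Qed.

Definition Keta eta := Ceta eta + 2 * eta * k5 + k2.

(** The old bound S enters the new one with the factor 136 C^2 eta, to be made small enough to beat
    the loss of 2^d in rho^-d when rho doubles. *)
Lemma sup_step eta rho S y : 0 < eta -> rmin <= rho -> enorm x < rho -> 0 <= S ->
  0 <= Ceta eta ->
  eps * ph rho <= eta -> (forall y, Uout rho y -> (u y <= S%:E)%E) ->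
  Uout (2 * rho) y ->
  (u y <= (Keta eta / rho ^+ d * iu (5 * rho) + 136 * C ^+ 2 * eta * S)%:E)%E.
Proof.
move=> eta0 r1 xr S0 Ce epe uS Uy; have r0 : 0 < rho by apply: lt_le_trans r1; exact: w_rmin W.
have k20 : 0 < k2 := lt_le_trans ltr01 k2_ge1.
have rd : 0 < rho ^+ d by rewrite exprn_gt0.
have rr : rho <= 2 * rho by rewrite ler_peMl ?ler1n// ltW.
have r21 := le_trans r1 rr; have x2 := lt_le_trans xr rr.
have c0 := C_gt0; have k50 := k5_gt0.
pose M := (Ceta eta + 2 * eta * k5) / rho ^+ d * iu (5 * rho) + 136 * C ^+ 2 * eta * S.
have M0 : 0 <= M.
  apply: addr_ge0; apply: mulr_ge0 => //; [|by rewrite ltW// iu_gt0|].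
    apply: divr_ge0 (ltW rd); apply: addr_ge0 => //.
    by apply: mulr_ge0 (ltW k50); lra.
  by apply: mulr_ge0 (ltW eta0); apply: mulr_ge0 => //; exact: exprn_ge0 (ltW c0).
apply: (le_trans (outside_bound r21 x2 M0 _ Uy)).
  by move=> z Dz /andP[za zb]; apply: annulus_bound => //; lra.
have h1 : k2 / (2 * rho) ^+ d * iu (2 * rho) <= k2 / rho ^+ d * iu (5 * rho).
  apply: ler_pM; [by rewrite divr_ge0 ?exprn_ge0//; lra|by rewrite ltW// iu_gt0| |by apply: iu_le; lra].
  rewrite ler_pM2l// lef_pV2 ?posrE ?exprn_gt0 ?(lt_le_trans r0 rr)//.
  by apply: lerXn2r => //; rewrite nnegrE ?(ltW (lt_le_trans r0 rr)) ?ltW.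
have -> : Keta eta / rho ^+ d * iu (5 * rho) = k2 / rho ^+ d * iu (5 * rho) +
  (Ceta eta + 2 * eta * k5) / rho ^+ d * iu (5 * rho) by rewrite /Keta; ring.
by rewrite lee_fin /M; lra.
Qed.

Definition kL (L : R) := C ^+ 2 * (2 * L) ^+ d.+2.
Definition cg (L kappa : R) := kappa ^+ d.+2 / (272 * C ^+ 2 * (2 * d.+1%:R) ^+ d * kL L).

Lemma kL_gt0 L : 0 < L -> 0 < kL L.
Proof. by move=> L0; rewrite /kL mulr_gt0 ?exprn_gt0 ?C_gt0// mulr_gt0. Qed.

Lemma cg_gt0 L kappa : 0 < L -> 0 < kappa -> 0 < cg L kappa.
Proof.
move=> L0 k0; have c2 : 0 < C ^+ 2 by rewrite exprn_gt0// C_gt0.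
have p2 : 0 < (2 * d.+1%:R : R) ^+ d by apply: exprn_gt0; rewrite mulr_gt0.
have kd : 0 < kappa ^+ d.+2 by rewrite exprn_gt0.
apply: (divr_gt0 kd); apply: mulr_gt0 (kL_gt0 L0); apply: mulr_gt0 p2.
by apply: mulr_gt0 c2; rewrite ltr0n.
Qed.

(** Every point of the fat ball receives from the inner ball a jump density of order eps nu(rho) iu
    rho, and a walk there stays for about 1 / (eps ph s) steps: eps cancels. So the concentric ball
    of half the radius gathers a fixed fraction of iu rho. In [cg], 272 is 16 * 17 from
    [RU_ball_lb], and kappa^(d+2) is the volume kappa^d times kappa^2 from the ratio ph rho / ph
    s. *)
Lemma iu_growth rho kappa L a : rmin <= rho -> enorm x < rho -> 0 < kappa <= 1 -> 1 <= L ->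
  eball a (kappa * rho) `<=` Uout (2 * rho) -> enorm a + kappa * rho <= L * rho ->
  (1 + cg L kappa) * iu rho <= iu (L * rho).
Proof.
move=> r1 xr /andP[k0 k1] L1 Bs aL; have r0 : 0 < rho by apply: lt_le_trans r1; exact: w_rmin W.
set s := kappa * rho in Bs aL; have s0 : 0 < s by rewrite mulr_gt0.
have c0 := C_gt0; have L0 : 0 < L by lra.
have kL0 := kL_gt0 L0; have nu0 := nu_gt0 r0; have i0 := iu_gt0 rho.
pose B := (eball a s : set V); have mB : measurable B by exact: measurable_eball.
have BD : B `<=` D by move=> z /Bs[].
have Bn w : B w -> 2 * rho <= enorm w by move=> /Bs[_].
have BL w : B w -> enorm w < L * rho.
  by move=> Bw; have := enorm_le_sub w a; move: Bw; rewrite /B /eball/=; lra.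
have n1 := nnm1; have nu_ := nnm_u; have ni := nnm_inner rho.
have qb w z : B w -> enorm z < rho -> eps * nu rho <= kL L * q w z.
  move=> Bw zr; have h1 := enorm_le_sub w z.
  have h3 := enorm_triangle w (- z); rewrite enormN in h3.
  have w2 := Bn w Bw; have wL := BL w Bw.
  have b0 : 0 < enorm (w - z) by lra.
  have kk : 1 <= 2 * L by lra.
  have Lr : rho <= L * rho by rewrite ler_peMl// ltW.
  have ba : enorm (w - z) <= (2 * L) * rho by rewrite -mulrA; lra.
  have nn := nu_le r0 b0 kk ba.
  have lb : eps * nu (enorm (w - z)) <= C * q w z by apply: (w_lb W); lra.
  have pL : 0 < C * (2 * L) ^+ d.+2 by rewrite mulr_gt0 ?exprn_gt0// mulr_gt0.
  apply: (@le_trans _ _ (eps * (C * (2 * L) ^+ d.+2 * nu (enorm (w - z))))); first by rewrite ler_pM2l.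
  have -> : eps * (C * (2 * L) ^+ d.+2 * nu (enorm (w - z))) = C * (2 * L) ^+ d.+2 * (eps * nu (enorm (w - z))) by ring.
  have -> : kL L * q w z = C * (2 * L) ^+ d.+2 * (C * q w z) by rewrite /kL; ring.
  by rewrite ler_pM2l.
pose c := eps * nu rho * iu rho.
have c_gt0 : 0 < c := mulr_gt0 (mulr_gt0 e0 nu0) i0.
have ilb w : B w -> (c%:E <= (kL L)%:E * inner rho w)%E.
  move=> Bw; rewrite /c EFinM -iuE /Iu /inner ge0_muleDr ?integral_ge0// mule1.
  have [_ qa] := nQ (mA rho) nu_.
  rewrite (ge0_muleDr (kL L)%:E _ (qa w)) ?lee_fin//; apply: leeD.
    by rewrite -EFinM lee_fin (w_sym W); exact: qb.
  have en0 : 0 <= eps * nu rho by rewrite mulr_ge0// ltW.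
  rewrite -(ge0_integralZl _ (mA rho))//; last exact: measurable_funTS.
  have [m1 p1] := nqf w (nnmZ (ltW kL0) nu_).
  rewrite -(QZ w (mA rho) nu_ (ltW kL0)).
  apply: ge0_le_integral => //; first exact: mA.
  - by move=> z _; rewrite mule_ge0// lee_fin.
  - by apply: measurable_funTS; exact: emeasurable_funM.
  - exact: measurable_funTS.
  move=> z [_]; rewrite BlE => zr; rewrite muleA -EFinM; apply: lee_wpmul2r => //.
  by rewrite lee_fin (mulrC (q w z)) qb.
have uB w : B w -> (RR B (inner rho) w <= u w)%E.
  move=> Bw; apply: (RU_super mq q0 mB ni nu_ _ Bw) => z Bz.
  rewrite [leRHS]uE /inner -addeA leeD2l// -(QU_setU mu mq q0 z (mA rho) mB nu_).
    apply: (QUS mu mq q0 z (measurableU _ _ (mA rho) mB) mD nu_) => t [[]//|]; exact: BD.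
  by apply/disj_setPS => t [[_ +] /Bn]; rewrite BlE; lra.
pose H := (eball a (s / 2) : set V).
have HB : H `<=` B by move=> z; rewrite /H /B /eball/=; lra.
pose t := (16 * (17 * (C * (eps * ph s))))^-1.
have pS := sc_pos sc s0.
have t0 : 0 < t by rewrite invr_gt0 !mulr_gt0.
have uH w : H w -> ((c * t / kL L)%:E <= u w)%E.
  move=> Hw; have Bw := HB _ Hw; apply: (le_cancel kL0).
  apply: le_trans (_ : _ <= (kL L)%:E * RR B (inner rho) w)%E _; last first.
    by apply: lee_wpmul2l (uB _ Bw); rewrite lee_fin ltW.
  rewrite -(RUZ mu mq q0 mB w ni (ltW kL0)).
  apply: (@le_trans _ _ (RR B (fun=> c%:E * 1)%E w)); last first.
    apply: (RU_le mu mq q0 mB (nnmZ (ltW c_gt0) n1) (nnmZ (ltW kL0) ni) _ Bw) => z Bz.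
    by rewrite mule1; exact: ilb.
  rewrite (RUZ mu mq q0 mB w n1 (ltW c_gt0)) -EFinM.
  have -> : kL L * (c * t / kL L) = c * t by field; rewrite gt_eqF.
  rewrite EFinM; apply: lee_wpmul2l; first by rewrite lee_fin ltW.
  exact: RU_ball_lb.
have ct0 : 0 <= c * t / kL L := divr_ge0 (mulr_ge0 (ltW c_gt0) (ltW t0)) (ltW kL0).
have rL : rho <= L * rho by rewrite ler_peMl// ltW.
have mH : measurable H by exact: measurable_eball.
rewrite -lee_fin -[leRHS]iuE (Iu_split rL) iuE (mulrDl 1 (cg L kappa) (iu rho)) (mul1r (iu rho)) EFinD leeD2l//.
apply: (@le_trans _ _ (\int[mu]_(y in H) u y)%E); last first.
  apply: ge0_subset_integral => //; first by apply: measurableI; [exact: mA|exact: mU].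
    exact: measurable_funTS.
  move=> z /HB Bz; have := Bn _ Bz; have := BL _ Bz; have := BD _ Bz.
  by split; split=> //=; [rewrite BlE|lra].
apply: (@le_trans _ _ (\int[mu]_(y in H) (c * t / kL L)%:E)%E); last first.
  by apply: ge0_le_integral => //; exact: measurable_funTS.
rewrite integral_cst//.
have s20 : 0 < s / 2 by lra.
apply: (@le_trans _ _ ((c * t / kL L)%:E * ((s / 2 / d.+1%:R) ^+ d)%:E)%E); last first.
  by apply: lee_wpmul2l; [rewrite lee_fin|exact: lebesgue_eball_lb].
rewrite -EFinM lee_fin.
have hs : ph s <= C * (rho / s) ^+ 2 * ph rho by apply: (sc_dbl sc) => //; rewrite /s ler_piMl// ltW.
have rs : rho / s = kappa^-1 by rewrite /s; field; rewrite !gt_eqF.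
rewrite rs in hs.
have dn : (d.+1%:R : R) != 0 by rewrite pnatr_eq0.
have p0 := sc_pos sc r0.
have -> : (s / 2 / d.+1%:R) ^+ d = kappa ^+ d * rho ^+ d / (2 * d.+1%:R) ^+ d.
  by rewrite -(mulrA s) -invfM expr_div_n /s (exprMn_comm d (mulrC _ _)).
have p2 : 0 < (2 * d.+1%:R : R) ^+ d by rewrite exprn_gt0 ?mulr_gt0.
have rd : 0 < rho ^+ d by rewrite exprn_gt0.
have kd : 0 < kappa ^+ d by rewrite exprn_gt0.
have -> : c * t / kL L * (kappa ^+ d * rho ^+ d / (2 * d.+1%:R) ^+ d) =
   (kappa ^+ d * iu rho / (272 * C * (2 * d.+1%:R) ^+ d * kL L)) * (ph rho / ph s).
  rewrite /c /t /nu; field; rewrite !gt_eqF//.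
have -> : cg L kappa * iu rho =
   (kappa ^+ d * iu rho / (272 * C * (2 * d.+1%:R) ^+ d * kL L)) * (kappa ^+ 2 / C).
  rewrite /cg -(addn2 d) exprD; field; rewrite !gt_eqF//.
rewrite ler_pM2l; last first.
  have p272 : 0 < 272 * C by apply: mulr_gt0 c0; rewrite ltr0n.
  exact: divr_gt0 (mulr_gt0 kd i0) (mulr_gt0 (mulr_gt0 p272 p2) kL0).
rewrite ler_pdivlMr// mulrAC ler_pdivrMr//.
apply: (@le_trans _ _ (kappa ^+ 2 * (C * kappa^-1 ^+ 2 * ph rho))).
  by rewrite ler_pM2l// exprn_gt0.
by rewrite le_eqVlt; apply/orP; left; apply/eqP; field; rewrite gt_eqF.
Qed.

Variables (rho0 A0 : R).
Hypothesis rmin_rho0 : rmin <= rho0.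
Hypothesis x_rho0 : enorm x < rho0.
Hypothesis Ceta_ge0 : forall eta, 0 < eta -> 0 <= Ceta eta.
(** Makes the factor 136 C^2 eta of [sup_step] equal to 2^-(d+1): doubling rho costs 2^d, and a
    factor 1/2 is left for the induction. *)
Definition eta0 := (2 ^+ d.+1 * (136 * C ^+ 2))^-1.
Hypothesis eps_small : C * (eps * ph rho0) <= eta0.
Hypothesis u_base : forall y, Uout rho0 y -> (u y <= (A0 / rho0 ^+ d * iu (5 * rho0))%:E)%E.
Definition AA := Num.max A0 (2 ^+ d.+1 * Keta eta0).
Definition rk (k : nat) := 2 ^+ k * rho0.

Lemma eta0_gt0 : 0 < eta0.
Proof. by rewrite invr_gt0 !mulr_gt0 ?exprn_gt0// C_gt0. Qed.

Lemma rho0_gt0 : 0 < rho0.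
Proof. exact: lt_le_trans (w_rmin W) rmin_rho0. Qed.

Lemma rkS k : rk k.+1 = 2 * rk k.
Proof. by rewrite /rk exprS mulrA. Qed.

Lemma rk_ge k : rho0 <= rk k.
Proof. by rewrite ler_peMl ?exprn_ege1//; [exact: ltW rho0_gt0|lra]. Qed.

Lemma rk_gt0 k : 0 < rk k.
Proof. exact: lt_le_trans rho0_gt0 (rk_ge k). Qed.

Lemma Keta_gt0 : 0 < Keta eta0.
Proof.
have := Ceta_ge0 eta0_gt0; have := k2_ge1; have := mulr_gt0 eta0_gt0 k5_gt0.
by rewrite /Keta; lra.
Qed.

Lemma AA_gt0 : 0 < AA.
Proof. by rewrite lt_max mulr_gt0 ?exprn_gt0 ?orbT// Keta_gt0. Qed.

Lemma eps_rk k : eps * ph (rk k) <= eta0.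
Proof.
apply: le_trans eps_small; rewrite mulrCA ler_pM2l//.
by apply: (sc_dec sc) (rk_ge k); exact: rho0_gt0.
Qed.

(** At each doubling the constant a in u <= a rho^-d iu(5 rho) passes to at most 2^d Keta + a/2, and
    [AA] is at least twice 2^d Keta. *)
Lemma u_rk k y : Uout (rk k) y -> (u y <= (AA / rk k ^+ d * iu (5 * rk k))%:E)%E.
Proof.
elim: k y => [|k IH] y.
  rewrite /rk expr0 mul1r => /u_base h; apply: (le_trans h); rewrite lee_fin.
  by rewrite ler_pM2r ?iu_gt0// ler_pM2r ?invr_gt0 ?exprn_gt0 ?rho0_gt0// le_max lexx.
rewrite rkS => Uy; have r0 := rk_gt0 k; have rd : 0 < rk k ^+ d by rewrite exprn_gt0.
have r1 : rmin <= rk k := le_trans rmin_rho0 (rk_ge k).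
have xr : enorm x < rk k := lt_le_trans x_rho0 (rk_ge k).
have a0 := AA_gt0; have i5 := iu_gt0 (5 * rk k).
pose T := iu (5 * rk k) / rk k ^+ d.
have T0 : 0 < T by rewrite divr_gt0.
have S0 : 0 <= AA / rk k ^+ d * iu (5 * rk k) by rewrite ltW// mulr_gt0// divr_gt0.
apply: (le_trans (sup_step eta0_gt0 r1 xr S0 (Ceta_ge0 eta0_gt0) (eps_rk k) IH Uy)).
have p2 : 0 < (2 : R) ^+ d by rewrite exprn_gt0.
have c0 := C_gt0.
rewrite lee_fin (_ : Keta eta0 / _ * _ + _ = T * (Keta eta0 + AA / (2 * 2 ^+ d))); last first.
  rewrite /T /eta0 exprS; field; rewrite !gt_eqF//.
rewrite (_ : AA / _ * _ = AA / 2 ^+ d * (iu (5 * (2 * rk k)) / rk k ^+ d)); last first.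
  by rewrite (exprMn_comm d (mulrC _ _)); field; rewrite !gt_eqF.
apply: (@le_trans _ _ (AA / 2 ^+ d * T)); last first.
  rewrite ler_pM2l ?divr_gt0// ler_pM2r ?invr_gt0//; apply: iu_le; lra.
rewrite mulrC ler_pM2r//.
have K1 : Keta eta0 <= AA / (2 * 2 ^+ d).
  by rewrite ler_pdivlMr ?mulr_gt0// mulrC -exprS le_max lexx orbT.
have -> : AA / 2 ^+ d = AA / (2 * 2 ^+ d) + AA / (2 * 2 ^+ d) by field; rewrite gt_eqF.
by rewrite lerD2r.
Qed.

Definition k12 := 1 + AA * 80 ^+ d.

Lemma k12_ge1 : 1 <= k12.
Proof. by rewrite lerDl mulr_ge0 ?(ltW AA_gt0)// exprn_ge0. Qed.

(** [u_rk] bounds u at scale s by the mass in the ball of radius 5 s. Three doublings lower, at s =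
    rk k / 8, that ball lies inside the one of radius rk k, so the mass added up to 5 rk k is
    controlled by iu (rk k). The factor 80 = 2 * 5 * 8 is the side of the enclosing cube in units of
    s. *)
Lemma iu_dbl k : (3 <= k)%N -> iu (5 * rk k) <= k12 * iu (rk k).
Proof.
move=> k3; pose j := (k - 3)%N; have kj : k = (j + 3)%N by rewrite subnK.
pose s := rk j; have s0 : 0 < s := rk_gt0 j.
have rs : rk k = 8 * s by rewrite kj addn3 !rkS -/s; ring.
have a0 := AA_gt0; have sd : 0 < s ^+ d by rewrite exprn_gt0.
have r5 : 8 * s <= 5 * (8 * s) by lra.
have r0' : 0 < 5 * (8 * s) by lra.
have i5 := iu_gt0 (5 * s).
have iA : iu (5 * s) <= iu (8 * s) by apply: iu_le; lra.
rewrite rs -lee_fin -iuE (Iu_split r5) iuE /k12 (mulrDl 1 (AA * 80 ^+ d)) (mul1r (iu (8 * s))) EFinD leeD2l//.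
set E := _ `&` _; have mE : measurable E by apply: measurableI; [exact: mA|exact: mU].
have c0 : 0 <= AA / s ^+ d * iu (5 * s) by rewrite ltW// mulr_gt0// divr_gt0.
apply: (@le_trans _ _ (\int[mu]_(y in E) (AA / s ^+ d * iu (5 * s))%:E)%E).
  apply: ge0_le_integral => //; first exact: measurable_funTS.
  by move=> y [_ [Dy /= ys]]; apply: (@u_rk j); split=> //; change (s <= enorm y); lra.
rewrite integral_cst//; apply: (@le_trans _ _ ((AA / s ^+ d * iu (5 * s))%:E * (80 ^+ d * s ^+ d)%:E)%E).
  apply: lee_wpmul2l; first by rewrite lee_fin.
  apply: (le_trans (_ : _ <= mu (Bl (5 * (8 * s))))%E).
    by apply: le_measure; rewrite ?inE//; [exact: measurable_eball|move=> y [[]]].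
  apply: (le_trans (lebesgue_eball_ub _ r0')); rewrite lee_fin -(exprMn_comm d (mulrC _ _)).
  by rewrite (_ : 2 * _ = 80 * s)//; ring.
have E1 : AA / s ^+ d * iu (5 * s) * (80 ^+ d * s ^+ d) = AA * 80 ^+ d * iu (5 * s) by field; rewrite gt_eqF.
rewrite -EFinM lee_fin E1.
by rewrite ler_pM2l// mulr_gt0// exprn_gt0.
Qed.

Definition k10 := k2 + AA * k4.
Definition k13 := k10 * k12.

Lemma k10_ge1 : 1 <= k10.
Proof. by have := k2_ge1; have := mulr_ge0 (ltW AA_gt0) k4_ge0; rewrite /k10; lra. Qed.

Lemma k13_ge1 : 1 <= k13.
Proof. by rewrite mulr_ege1 ?k10_ge1 ?k12_ge1. Qed.

(** Jumps into |w| >= 2 r start either in the ball of radius r, where [inner_ub] applies, or in the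
    collar between r and 2 r, where [u_rk] bounds u and [collar] compares the resulting hitting
    probability with [HH]. *)
Lemma u_ub k y : (3 <= k)%N -> Uout (4 * rk k) y ->
  ((rk k ^+ d)%:E * u y <= (k13 * iu (rk k))%:E * HH (rk k) y)%E.
Proof.
move=> k3 Uy4; have [Dy /= y4] := Uy4.
set r := rk k in Uy4 y4 *; have r0 : 0 < r := rk_gt0 k; have rd : 0 < r ^+ d by rewrite exprn_gt0.
have r1 : rmin <= r := le_trans rmin_rho0 (rk_ge k).
have xr : enorm x < r := lt_le_trans x_rho0 (rk_ge k).
have Uy : Uout (2 * r) y by split=> //=; lra.
have a0 := AA_gt0; have k20 : 0 < k2 := lt_le_trans ltr01 k2_ge1.
have i5 := iu_gt0 (5 * r); have i1 := iu_gt0 r.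
have mU2 := mU (2 * r); have mA2 := mA (2 * r); have n1 := nnm1; have nt := nnm_theta r.
pose c := AA * iu (5 * r); have c0 : 0 <= c by rewrite ltW// mulr_gt0.
pose a := k2 * iu r; have a0' : 0 <= a by rewrite ltW// mulr_gt0.
have ni := nnm_inner (2 * r); have nqa := nQ mA2 n1.
rewrite (u_split Uy) -(RUZ mu mq q0 mU2 y ni (ltW rd)).
apply: (@le_trans _ _ (RR (Uout (2 * r)%R) (fun w => a%:E * theta r w + c%:E * Q (Ain (2 * r)%R) (fun=> 1) w) y)%E).
  apply: (RU_le mu mq q0 mU2 (nnmZ (ltW rd) ni) (nnmD (nnmZ a0' nt) (nnmZ c0 nqa)) _ Uy) => w [Dw /= w2].
  pose E := (Ain (2 * r) `&` Uout r : set V).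
  have mE : measurable E by apply: measurableI; [exact: mA|exact: mU].
  have -> : inner (2 * r) w = (inner r w + Q E u w)%E.
    rewrite /inner -addeA -(QU_setU mu mq q0 w (mA r) mE nnm_u); last first.
      by apply/disj_setPS => z [[_ +] [_ [_ /=]]]; rewrite BlE => ? ?; lra.
    congr (_ + Q _ _ _)%E; apply/seteqP; split=> z.
      move=> [Dz z2]; have [zr|zr] := ltP (enorm z) r; [left|right]; split=> //.
      by rewrite BlE.
    by move=> [[Dz]|[]//]; rewrite BlE => zr; split=> //; rewrite BlE; lra.
  have nE := nQ mE nnm_u; have [_ in0] := nnm_inner r; have [_ E0] := nE.
  rewrite (ge0_muleDr (r ^+ d)%:E (in0 w) (E0 w)); apply: leeD.
    by have := inner_ub r1 (lexx r) xr w2; rewrite iuE muleA -EFinM.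
  apply: (@le_trans _ _ (c%:E * Q E (fun=> 1) w)%E); last first.
    by apply: lee_wpmul2l; [rewrite lee_fin|apply: QUS => // z []].
  rewrite -(QZ w mE nnm_u (ltW rd)) -(QZ w mE n1 c0).
  apply: (Qle w mE (nnmZ (ltW rd) nnm_u) (nnmZ c0 n1)) => z [_ Uz].
  have := u_rk Uz; rewrite mule1 -/r => h.
  apply: (@le_trans _ _ ((r ^+ d)%:E * (AA / r ^+ d * iu (5 * r))%:E)%E).
    by apply: lee_wpmul2l h; rewrite lee_fin ltW.
  have -> : c = r ^+ d * (AA / r ^+ d * iu (5 * r)) by rewrite /c; field; rewrite gt_eqF.
  by rewrite EFinM.
have [_ H0] := nnm_HH r.
rewrite (RUD mu mq q0 mU2 y (nnmZ a0' nt) (nnmZ c0 nqa)) (RUZ mu mq q0 mU2 y nt a0').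
rewrite (RUZ mu mq q0 mU2 y nqa c0) -/(HH r).
apply: (@le_trans _ _ (a%:E * HH r y + c%:E * (k4%:E * HH r y))%E).
  by rewrite leeD2l//; apply: lee_wpmul2l; [rewrite lee_fin|exact: collar].
have ck : 0 <= c * k4 := mulr_ge0 c0 k4_ge0.
rewrite muleA -EFinM -ge0_muleDl ?lee_fin//.
rewrite -EFinD; apply: lee_wpmul2r; [exact: H0|rewrite lee_fin].
apply: (@le_trans _ _ (k10 * iu (5 * r))).
  rewrite /k10 mulrDl /a /c (mulrAC AA) lerD2r ler_pM2l//; apply: iu_le; lra.
rewrite /k13 -mulrA ler_pM2l ?(lt_le_trans ltr01 k10_ge1)//; exact: iu_dbl.
Qed.

Lemma u_lb rho y : rmin <= rho -> enorm x < rho -> Uout (2 * rho) y ->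
  ((iu rho)%:E * HH rho y <= (k2 * rho ^+ d)%:E * u y)%E.
Proof.
move=> r1 xr Uy; have r0 : 0 < rho by apply: lt_le_trans r1; exact: w_rmin W.
have k20 : 0 < k2 := lt_le_trans ltr01 k2_ge1.
have kr : 0 <= k2 * rho ^+ d by rewrite mulr_ge0 ?exprn_ge0// ltW.
have mU2 := mU (2 * rho); have nt := nnm_theta rho; have i0 := ltW (iu_gt0 rho).
have ni := nnm_inner (2 * rho).
rewrite (u_split Uy) -(RUZ mu mq q0 mU2 y ni kr) -(RUZ mu mq q0 mU2 y nt i0).
apply: (RU_le mu mq q0 mU2 (nnmZ i0 nt) (nnmZ kr ni) _ Uy) => w [Dw /= w2].
have := inner_lb r1 (lexx rho) xr w2; rewrite iuE muleA -EFinM => h; apply: (le_trans h).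
apply: lee_wpmul2l; first by rewrite lee_fin.
rewrite leeD2l//; apply: (QUS mu mq q0 w (mA rho) (mA (2 * rho)) nnm_u).
by move=> z [Dz]; rewrite !BlE => zr; split=> //; rewrite BlE; lra.
Qed.

End domain.

End walk1.

(** * Oscillation of ratios at infinity *)

Section walk2.
Context (R : realType) (d : nat).
Local Notation V := (borelRd R d).
Local Notation mu := (@lebesgueRd R d).
Variables (C rmin : R) (ph : R -> R) (Ceta : R -> R) (eps : R) (q : V -> V -> R) (P : nat -> R).
Hypothesis sc : scale C ph.
Hypothesis W : walk C rmin ph Ceta eps q P.
Local Notation Q U f := (QU mu q U f).
Local Notation RR U f := (RU mu q U f).
Local Notation nu := (nu d ph).
Local Notation Bl r := (eball (0 : 'rV[R]_d) r : set V).
Let mq := w_meas W.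
Let q0 := w_ge0 W.
Let e0 := w_eps W.
Let nQ := nnm_QU mu mq q0.
Let QZ := QUZ mu mq q0.
Let QD := QUD mu mq q0.
Let Qle := QU_le mu mq q0.
Let nqf := nnm_qf mq q0.
Local Notation k2 := (k2 d C).
Local Notation theta := (theta q).
Local Notation Iu D x := (Iu q D x).
Local Notation iu D x := (iu q D x).
Local Notation k12 A0 := (k12 d C Ceta A0).
Local Notation k10 A0 := (k10 d C Ceta A0).
Local Notation eta0 := (eta0 d C).
Local Notation cg := (cg d C).
Let k2_ge1 := k2_ge1 d sc.
Let k12_ge1 := k12_ge1 d sc (Ceta := Ceta).
Let k10_ge1 := k10_ge1 d sc (Ceta := Ceta).
Let k13_ge1 := k13_ge1 d sc (Ceta := Ceta).
Let cg_gt0 := cg_gt0 d sc.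
Let nnm_u := nnm_u W.
Let nnm_inner := nnm_inner W.
Let u_split := u_split W.
Let rho0_gt0 := rho0_gt0 W.
Let rk_ge := rk_ge W.
Let rk_gt0 := rk_gt0 W.
Let iu_gt0 := iu_gt0 W.
Let Iu_split := Iu_split W.
Let nnm_theta := nnm_theta W.
Let HH_le1 := HH_le1 W.
Let nnm_HH := nnm_HH W.
Let iu_le := iu_le W.
Let inner_ub := inner_ub sc W.
Let Q_theta_lb := Q_theta_lb sc W.
Let u_ub := u_ub sc W.
Let u_lb := u_lb sc W.
Let iu_dbl := iu_dbl sc W.
Let iu_growth := iu_growth sc W.
Section pair.
Variable D : set V.
Hypothesis mD : measurable D.
Local Notation Ain r := (D `&` Bl r).
Local Notation Uout r := (D `&` [set y : V | r <= enorm y]).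
Local Notation uu x := (RR D (fun y => (q x y)%:E)).

Lemma Uout_le (r r' : R) y : r <= r' -> Uout r' y -> Uout r y.
Proof. by move=> rr [Dy /= yr]; split=> //=; exact: le_trans yr. Qed.

Lemma inner_split x r r' w : r <= r' ->
  inner q D x r' w = (inner q D x r w + Q (Ain r' `&` Uout r) (uu x) w)%E.
Proof.
move=> rr; have mE : measurable (Ain r' `&` Uout r) by apply: measurableI; [exact: mA|exact: mU].
rewrite /inner -addeA -(QU_setU mu mq q0 w (mA mD r) mE (nnm_u x mD)); last first.
  by apply/disj_setPS => z [[_ +] [_ [_ /=]]]; rewrite BlE => ? ?; lra.
congr (_ + Q _ _ _)%E; apply/seteqP; split=> z.
  move=> [Dz z2]; have [zr|zr] := ltP (enorm z) r; [left|right]; split=> //.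
  by rewrite BlE.
by move=> [[Dz]|[]//]; rewrite BlE => zr; split=> //; rewrite BlE; lra.
Qed.

(** Outside the ball of radius r0 the comparison of the two Green functions is known, with gap f on
    the shell up to rho. Both are expanded at y over the last exit from the ball of radius 2 rho:
    the gap contributes J [HH], the collar beyond rho keeps the comparison, and only the jumps for
    x2 from the ball of radius r0, where nothing is known, are charged as an error. *)
Lemma ratio_transfer x1 x2 (a b r0 rho J : R) (f : V -> \bar R) y : 0 <= a -> 0 <= b ->
  (forall r, Iu D x2 r \is a fin_num) ->
  rmin <= rho -> r0 <= rho -> enorm x1 < r0 -> enorm x2 < r0 -> nnm f ->
  (forall w, Uout r0 w -> (b%:E * uu x2 w <= a%:E * uu x1 w)%E) ->
  (forall w, (Ain rho `&` Uout r0) w -> (a%:E * uu x1 w = b%:E * uu x2 w + f w)%E) ->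
  0 <= J -> (J%:E = \int[mu]_(w in Ain rho `&` Uout r0) f w)%E -> Uout (2 * rho) y ->
  ((k2 * rho ^+ d * b)%:E * uu x2 y + J%:E * HH q D rho y <=
   (k2 * rho ^+ d * a)%:E * uu x1 y + (k2 ^+ 2 * b * iu D x2 r0)%:E * HH q D rho y)%E.
Proof.
move=> a0 b0 If r1 rr x1r x2r nf ba fE J0 JE Uy.
have rho0 : 0 < rho by apply: lt_le_trans r1; exact: w_rmin W.
have rho2 : rho <= 2 * rho by rewrite ler_peMl ?ler1n// ltW.
have r02 : r0 <= 2 * rho := le_trans rr rho2.
have k20 : 0 < k2 := lt_le_trans ltr01 k2_ge1.
have rd : 0 < rho ^+ d by rewrite exprn_gt0.
have kr : 0 < k2 * rho ^+ d by rewrite mulr_gt0.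
have kra : 0 <= k2 * rho ^+ d * a := mulr_ge0 (ltW kr) a0.
have krb : 0 <= k2 * rho ^+ d * b := mulr_ge0 (ltW kr) b0.
have i0 := iu_gt0 mD If r0.
have kb0 : 0 <= k2 ^+ 2 * b * iu D x2 r0.
  by apply: mulr_ge0 (ltW i0); apply: mulr_ge0 b0; rewrite exprn_ge0// ltW.
have mU2 := mU mD (2 * rho); have nt := nnm_theta rho; have [_ t0] := nt.
have n1 := nnm_inner x1 mD (2 * rho); have n2 := nnm_inner x2 mD (2 * rho).
have nu1 := nnm_u x1 mD; have nu2 := nnm_u x2 mD.
rewrite (u_split x1 mD Uy) (u_split x2 mD Uy) /HH.
rewrite -(RUZ mu mq q0 mU2 y n1 kra) -(RUZ mu mq q0 mU2 y n2 krb) -!(RUZ mu mq q0 mU2 y nt)//.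
have nk1 := nnmZ kra n1; have nk2 := nnmZ krb n2; have ntJ := nnmZ J0 nt; have ntk := nnmZ kb0 nt.
have D1 := RUD mu mq q0 mU2 y nk2 ntJ; have D2 := RUD mu mq q0 mU2 y nk1 ntk.
rewrite -[X in (X <= _)%E]D1 -[X in (_ <= X)%E]D2.
apply: (RU_le mu mq q0 mU2 (nnmD nk2 ntJ) (nnmD nk1 ntk) _ Uy) => w [Dw /= w2].
pose E := (Ain rho `&` Uout r0 : set V); pose E' := (Ain (2 * rho) `&` Uout rho : set V).
have mE : measurable E by apply: measurableI; [exact: mA|exact: mU].
have mE' : measurable E' by apply: measurableI; [exact: mA|exact: mU].
rewrite !(inner_split _ _ rho2) !(inner_split _ _ rr) -/E -/E'.
have [_ nn1] := nnm_inner x1 mD r0; have [_ nn2] := nnm_inner x2 mD r0.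
have [_ p1] := nQ mE nu1; have [_ p2] := nQ mE nu2.
have [_ p1'] := nQ mE' nu1; have [_ p2'] := nQ mE' nu2.
have [_ pf] := nQ mE nf.
have h1 : ((rho ^+ d)%:E * inner q D x2 r0 w <= (k2 * iu D x2 r0)%:E * theta rho w)%E.
  by have := inner_ub mD r1 rr x2r w2; rewrite iuE// muleA -EFinM.
have EB : E `<=` Bl rho by move=> z [[]].
have h2 := Q_theta_lb r1 w2 mE EB nf.
rewrite -JE in h2.
have h3 : (a%:E * Q E (uu x1) w = b%:E * Q E (uu x2) w + Q E f w)%E.
  rewrite -(QZ w mE nu1 a0) -(QZ w mE nu2 b0) -(QD w mE (nnmZ b0 nu2) nf).
  by apply: eq_QU => z Ez; exact: fE.
have h4 : (b%:E * Q E' (uu x2) w <= a%:E * Q E' (uu x1) w)%E.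
  rewrite -(QZ w mE' nu1 a0) -(QZ w mE' nu2 b0).
  apply: (Qle w mE' (nnmZ b0 nu2) (nnmZ a0 nu1)) => z [_ [Dz /= zr]].
  by apply: ba; split=> //=; exact: le_trans zr.
move: h1 h2 h3 h4 (nn1 w) (nn2 w) (p1 w) (p2 w) (p1' w) (p2' w) (pf w) (t0 w).
move: (inner q D x1 r0 w) (inner q D x2 r0 w) (Q E (uu x1) w) (Q E (uu x2) w) (Q E' (uu x1) w) (Q E' (uu x2) w).
move: (Q E f w) (theta rho w) => qf th i1 i2 e1 e2 e1' e2' h1 h2 h3 h4 i10 i20 e10 e20 e10' e20' qf0 th0.
have kr0 : (0 <= (k2 * rho ^+ d)%:E)%E by rewrite lee_fin ltW.
have a0' : (0 <= a%:E)%E by rewrite lee_fin.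
have b0' : (0 <= b%:E)%E by rewrite lee_fin.
rewrite (EFinM (k2 * rho ^+ d) a) (EFinM (k2 * rho ^+ d) b) -!(muleA (k2 * rho ^+ d)%:E).
rewrite (ge0_muleDr a%:E (adde_ge0 i10 e10) e10') (ge0_muleDr b%:E (adde_ge0 i20 e20) e20').
rewrite (ge0_muleDr a%:E i10 e10) (ge0_muleDr b%:E i20 e20) h3.
have A1 : (0 <= b%:E * i2)%E := mule_ge0 b0' i20.
have A2 : (0 <= b%:E * e2)%E := mule_ge0 b0' e20.
have A3 : (0 <= b%:E * e2')%E := mule_ge0 b0' e20'.
have A4 : (0 <= a%:E * i1)%E := mule_ge0 a0' i10.
have A5 : (0 <= a%:E * e1')%E := mule_ge0 a0' e10'.
have B1 : ((k2 * rho ^+ d)%:E * (b%:E * i2) <= (k2 ^+ 2 * b * iu D x2 r0)%:E * th)%E.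
  rewrite (_ : (_ * (b%:E * i2) = (k2 * b)%:E * ((rho ^+ d)%:E * i2))%E); last first.
    by rewrite !muleA -!EFinM; congr (_%:E * _)%E; ring.
  rewrite (_ : ((k2 ^+ 2 * b * iu D x2 r0)%:E * th = (k2 * b)%:E * ((k2 * iu D x2 r0)%:E * th))%E); last first.
    by rewrite !muleA -!EFinM; congr (_%:E * _)%E; ring.
  by apply: lee_wpmul2l h1; rewrite lee_fin mulr_ge0// ltW.
have B2 : (J%:E * th <= (k2 * rho ^+ d)%:E * qf)%E by rewrite EFinM -muleA.
rewrite !(ge0_muleDr (k2 * rho ^+ d)%:E) ?adde_ge0//.
have B3 : ((k2 * rho ^+ d)%:E * (b%:E * e2') <= (k2 * rho ^+ d)%:E * (a%:E * e1'))%E.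
  exact: lee_wpmul2l.
move: B1 B2 B3.
have C4 : (0 <= (k2 * rho ^+ d)%:E * (a%:E * i1))%E := mule_ge0 kr0 A4.
move: ((k2 * rho ^+ d)%:E * (b%:E * i2))%E ((k2 * rho ^+ d)%:E * (b%:E * e2))%E ((k2 * rho ^+ d)%:E * (b%:E * e2'))%E.
move: C4.
move: ((k2 * rho ^+ d)%:E * (a%:E * i1))%E ((k2 * rho ^+ d)%:E * (a%:E * e1'))%E ((k2 * rho ^+ d)%:E * qf)%E.
move: (J%:E * th)%E (((k2 ^+ 2 * b * iu D x2 r0)%:E * th))%E => v1 v2 v3 v4 v5 C4 v6 v7 v8 B1 B2 B3.
apply: (@le_trans _ _ (v2 + v7 + v4 + v5)%E).
  by apply: leeD => //; apply: leeD => //; exact: leeD.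
have -> : (v3 + (v7 + v5) + v4 + v2 = v3 + (v2 + v7 + v4 + v5))%E.
  by rewrite -!addeA (addeC v4 v2) (addeCA v5) (addeCA v7 v2) (addeC v5).
by rewrite leeDr.
Qed.

Variables (x1 x2 : V).
Hypothesis If1 : forall r, Iu D x1 r \is a fin_num.
Hypothesis If2 : forall r, Iu D x2 r \is a fin_num.
Variables (rho0 A0 B0 : R).
Hypothesis rmin_rho0 : rmin <= rho0.
Hypothesis x1_rho0 : enorm x1 < rho0.
Hypothesis x2_rho0 : enorm x2 < rho0.
Hypothesis Ceta_ge0 : forall eta, 0 < eta -> 0 <= Ceta eta.
Hypothesis eps_small : C * (eps * ph rho0) <= eta0.
Hypothesis u_base1 : forall y, Uout rho0 y -> (uu x1 y <= (A0 / rho0 ^+ d * iu D x1 (5 * rho0))%:E)%E.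
Hypothesis u_base2 : forall y, Uout rho0 y -> (uu x2 y <= (A0 / rho0 ^+ d * iu D x2 (5 * rho0))%:E)%E.
Hypothesis B0_ge1 : 1 <= B0.
Hypothesis iu_base : iu D x1 (rk rho0 3) <= B0 * iu D x2 (rk rho0 3).

Let r0_gt0 := rho0_gt0 rmin_rho0.
Let ub1 := u_ub mD If1 rmin_rho0 x1_rho0 Ceta_ge0 eps_small u_base1.
Let ub2 := u_ub mD If2 rmin_rho0 x2_rho0 Ceta_ge0 eps_small u_base2.
Let rkg := rk_ge rmin_rho0.
Let rk0 := rk_gt0 rmin_rho0.
Local Notation rk := (rk rho0).
Local Notation K13 := (k13 d C Ceta A0).
Definition BB := k13 d C Ceta A0 * B0 * k2.

Let K13_ge1 : 1 <= K13.
Proof. exact: k13_ge1. Qed.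

Let u_fin x (If : forall r, Iu D x r \is a fin_num)
  (ub : forall k y, (2 < k)%N -> Uout (4 * rk k) y ->
     ((rk k ^+ d)%:E * uu x y <= (K13 * iu D x (rk k))%:E * HH q D (rk k) y)%E) k y :
  (3 <= k)%N -> Uout (4 * rk k) y ->
  exists v h : R, [/\ uu x y = v%:E, HH q D (rk k) y = h%:E, 0 <= v, 0 <= h &
    rk k ^+ d * v <= K13 * iu D x (rk k) * h].
Proof.
move=> k3 Uy; have r0 := rk0 k; have rd : 0 < rk k ^+ d by rewrite exprn_gt0.
have Uy2 : Uout (2 * rk k) y by case: Uy => Dy /= yr; split=> //=; lra.
have h1 := HH_le1 mD r0 Uy2; have [_ /(_ y) h0] := nnm_HH mD (rk k).
have [_ /(_ y) u0] := nnm_u x mD.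
have := ub k y k3 Uy; move: h0 h1 u0.
case: (HH q D (rk k) y) => [h| |]//= h0 h1.
case: (uu x y) => [v| |]//=.
  by move=> v0; rewrite -!EFinM !lee_fin => hh; exists v, h; split; rewrite -?lee_fin.
by move=> _; rewrite -EFinM gt0_muley ?lte_fin// leye_eq.
Qed.

(** [u_ub] for x1 and [u_lb] for x2 share the factor [HH], which does not depend on the pole. *)
Lemma initial_bound y : Uout (4 * rk 3) y -> (uu x1 y <= BB%:E * uu x2 y)%E.
Proof.
move=> Uy; have r0 := rk0 3; have rd : 0 < rk 3 ^+ d by rewrite exprn_gt0.
have Uy2 : Uout (2 * rk 3) y by case: Uy => Dy /= yr; split=> //=; lra.
have [v [h [v1 hE v0 h0 le1]]] := u_fin If1 ub1 (leqnn 3) Uy.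
have [w [h' [v2 hE' w0 _ _]]] := u_fin If2 ub2 (leqnn 3) Uy.
have x2r : enorm x2 < rk 3 := lt_le_trans x2_rho0 (rkg 3).
have r1 : rmin <= rk 3 := le_trans rmin_rho0 (rkg 3).
have := u_lb mD If2 r1 x2r Uy2; rewrite v2 v1 hE -!EFinM !lee_fin => lb.
have k13p : 0 < K13 := lt_le_trans ltr01 K13_ge1.
rewrite -(ler_pM2l rd); apply: (le_trans le1).
have -> : rk 3 ^+ d * (BB * w) = K13 * B0 * (k2 * rk 3 ^+ d * w) by rewrite /BB; ring.
apply: (@le_trans _ _ (K13 * B0 * (iu D x2 (rk 3) * h))).
  have -> : K13 * B0 * (iu D x2 (rk 3) * h) = K13 * (B0 * iu D x2 (rk 3)) * h by ring.
  by apply: ler_wpM2r => //; rewrite ler_pM2l.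
have B00 : 0 <= B0 := le_trans ler01 B0_ge1.
by apply: ler_wpM2l lb; exact: mulr_ge0 (ltW k13p) B00.
Qed.

Lemma BB_ge1 : 1 <= BB.
Proof. by rewrite /BB; apply: mulr_ege1 k2_ge1; exact: mulr_ege1. Qed.

(** Up to radius 4 rk 3 this is doubling and [iu_base]; beyond, [initial_bound] is integrated. *)
Lemma iu_ratio r : 4 * rk 3 <= r -> iu D x1 r <= BB * iu D x2 r.
Proof.
move=> hr; have r0 := rk0 3.
have BB1 := BB_ge1; have k21 := k2_ge1.
have mE : measurable (Ain r `&` Uout (4 * rk 3)) by apply: measurableI; [exact: mA|exact: mU].
have k12p : 1 <= k12 A0 by exact: k12_ge1.
have k10p : 1 <= k10 A0 by exact: k10_ge1.
have hb : iu D x1 (4 * rk 3) <= BB * iu D x2 (4 * rk 3).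
  apply: (@le_trans _ _ (iu D x1 (5 * rk 3))); first by apply: iu_le => //; lra.
  apply: (le_trans (iu_dbl mD If1 rmin_rho0 x1_rho0 Ceta_ge0 eps_small u_base1 (leqnn 3))).
  apply: (@le_trans _ _ (k12 A0 * (B0 * iu D x2 (rk 3)))).
    by rewrite ler_pM2l//; lra.
  have k12_0 : 0 <= k12 A0 by lra.
  have B00 : 0 <= B0 := le_trans ler01 B0_ge1.
  have B01 : 0 < B0 := lt_le_trans ltr01 B0_ge1.
  have K0 : 0 <= K13 := le_trans ler01 K13_ge1.
  rewrite mulrA; apply: ler_pM; [exact: mulr_ge0|exact: ltW (iu_gt0 mD If2 _)| |].
    rewrite /BB; apply: (@le_trans _ _ (K13 * B0)); last by rewrite ler_peMr//; exact: mulr_ge0.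
    by rewrite ler_pM2r// /k13 ler_peMl.
  by apply: iu_le => //; lra.
rewrite -lee_fin EFinM -!iuE// !(Iu_split _ mD hr) !iuE//.
have [mu2 p2] := nnm_u x2 mD; have [mu1 p1] := nnm_u x1 mD.
have J0 : (0 <= \int[mu]_(y in Ain r `&` Uout (4 * rk 3)%R) uu x2 y)%E by apply: integral_ge0.
have i20 := iu_gt0 mD If2 (4 * rk 3).
rewrite ge0_muleDr// ?lee_fin ?(ltW i20)//; apply: leeD; first by rewrite -EFinM lee_fin.
have B0' : 0 <= BB by lra.
rewrite -(ge0_integralZl _ mE)//; last exact: measurable_funTS.
have [m3 p3] := nnmZ B0' (nnm_u x2 mD).
apply: ge0_le_integral => //; [exact: measurable_funTS..|].
by move=> y [_ Uy]; exact: initial_bound.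
Qed.

Definition cc := (2 * k2 * K13)^-1.

(** With u_1, u_2 for the Green functions of x1, x2, the gaps u_1 - m u_2 and M u_2 - u_1 add up to
    (M - m) u_2, so one of them carries at least half of the mass on the shell between r0 and rho.
    By [ratio_transfer] that gap is felt beyond 4 rho as a multiple of [HH], hence by [u_ub] as a
    multiple dl of u_2: m is raised or M is lowered by dl. *)
Lemma oscillation_improve k r0 e m M : (3 <= k)%N -> 4 * rk 3 <= r0 -> r0 <= rk k ->
  0 <= m -> m <= M -> M <= BB -> 0 <= e -> iu D x2 r0 <= e * iu D x2 (rk k) ->
  (forall y, Uout r0 y -> (m%:E * uu x2 y <= uu x1 y)%E /\ (uu x1 y <= M%:E * uu x2 y)%E) ->
  exists m' M', [/\ 0 <= m', m' <= M', M' <= BB,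
    M' - m' <= (1 - cc) * (M - m) + (1 + k2 ^+ 2) * BB * e &
    forall y, Uout (4 * rk k) y -> (m'%:E * uu x2 y <= uu x1 y)%E /\ (uu x1 y <= M'%:E * uu x2 y)%E].
Proof.
move=> k3 hr0 rr m0 mM MB e_ge0 ie H; set rho := rk k in rr ie *.
have rho_gt0 : 0 < rho := rk0 k; have rd : 0 < rho ^+ d by rewrite exprn_gt0.
have k21 := k2_ge1; have k13p := K13_ge1; have BB1 := BB_ge1.
have k20 : 0 < k2 by lra.
have r3 := rk0 3.
have g3 := rkg 3.
have x1r : enorm x1 < r0 by have := x1_rho0; lra.
have x2r : enorm x2 < r0 by have := x2_rho0; lra.
have r1 : rmin <= rho := le_trans rmin_rho0 (rkg k).
pose E := (Ain rho `&` Uout r0 : set V).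
have mE : measurable E by apply: measurableI; [exact: mA|exact: mU].
have fin1 y : Uout r0 y -> exists v h : R, [/\ uu x1 y = v%:E, uu x2 y = h%:E, 0 <= v & 0 <= h].
  move=> [Dy /= yr]; have Uy : Uout (4 * rk 3) y by split=> //=; lra.
  have [v [h [v1 hE v0 h0 le1]]] := u_fin If1 ub1 (leqnn 3) Uy.
  have [w [h' [v2 hE' w0 _ _]]] := u_fin If2 ub2 (leqnn 3) Uy.
  by exists v, w.
have [mu1 p1] := nnm_u x1 mD; have [mu2 p2] := nnm_u x2 mD.
have mf1 : measurable_fun setT (fun w => fine (uu x1 w)).
  by apply: measurableT_comp => //; exact: fine_measurable.
have mf2 : measurable_fun setT (fun w => fine (uu x2 w)).
  by apply: measurableT_comp => //; exact: fine_measurable.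
pose f1 (w : V) := (Num.max 0 (fine (uu x1 w) - m * fine (uu x2 w)))%:E.
pose f2 (w : V) := (Num.max 0 (M * fine (uu x2 w) - fine (uu x1 w)))%:E.
have nf1 : nnm f1.
  split=> [|w]; last by rewrite lee_fin le_max lexx.
  apply/measurable_EFinP; apply: measurable_maxr => //; apply: measurable_funB => //.
  exact: measurable_funM.
have nf2 : nnm f2.
  split=> [|w]; last by rewrite lee_fin le_max lexx.
  apply/measurable_EFinP; apply: measurable_maxr => //; apply: measurable_funB => //.
  exact: measurable_funM.
have f1E w : E w -> (1%:E * uu x1 w = m%:E * uu x2 w + f1 w)%E.
  move=> [_ Uw]; have [v [h [v1 h1 v0 h0]]] := fin1 _ Uw.
  have [] := H _ Uw; rewrite v1 h1 -!EFinM !lee_fin => hm _.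
  by rewrite /f1 v1 h1/= max_r ?subr_ge0// -EFinD; congr EFin; ring.
have f2E w : E w -> (M%:E * uu x2 w = 1%:E * uu x1 w + f2 w)%E.
  move=> [_ Uw]; have [v [h [v1 h1 v0 h0]]] := fin1 _ Uw.
  have [] := H _ Uw; rewrite v1 h1 -!EFinM !lee_fin => _ hM.
  by rewrite /f2 v1 h1/= max_r ?subr_ge0// -EFinD; congr EFin; ring.
have i2E : (\int[mu]_(w in E) uu x2 w = (iu D x2 rho - iu D x2 r0)%:E)%E.
  have := Iu_split x2 mD rr; rewrite !iuE// -/E.
  have : (0 <= \int[mu]_(w in E) uu x2 w)%E by exact: integral_ge0.
  by case: (integral mu E _) => [z| |]//= _ [] ->; congr EFin; ring.
have i0 := iu_gt0 mD If2 rho.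
have Mm0 : 0 <= M - m by rewrite subr_ge0.
have JJ : (\int[mu]_(w in E) f1 w + \int[mu]_(w in E) f2 w = ((M - m) * (iu D x2 rho - iu D x2 r0))%:E)%E.
  have [q1 q1'] := nf1; have [q2 q2'] := nf2.
  rewrite EFinM -i2E -(ge0_integralZl _ mE)//; last exact: measurable_funTS.
  rewrite -ge0_integralD//; [|exact: measurable_funTS..].
  apply: eq_integral => w /set_mem Ew; have [_ Uw] := Ew.
  have [v [h [v1 h1 v0 h0]]] := fin1 _ Uw.
  have := f1E _ Ew; have := f2E _ Ew; rewrite /f1 /f2 v1 h1 -!EFinM -!EFinD => -[A2] [A1].
  by congr EFin; exact: split_gap A2 A1.
have [J1 [J2 [J1E J2E J10 J20 J12]]] : exists J1 J2 : R, [/\ (J1%:E = \int[mu]_(w in E) f1 w)%E,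
   (J2%:E = \int[mu]_(w in E) f2 w)%E, 0 <= J1, 0 <= J2 & J1 + J2 = (M - m) * (iu D x2 rho - iu D x2 r0)].
  have a1 : (0 <= \int[mu]_(w in E) f1 w)%E by apply: integral_ge0 => w _; case: nf1.
  have a2 : (0 <= \int[mu]_(w in E) f2 w)%E by apply: integral_ge0 => w _; case: nf2.
  move: JJ a1 a2; case: (integral mu E f1) => [z1| |]//; case: (integral mu E f2) => [z2| |]//.
  by rewrite -EFinD => -[] zz; rewrite !lee_fin => ? ?; exists z1, z2.
(* When the error exceeds the gain, dl is 0: then m and M are kept, and [dlb] still gives the bound
   on the oscillation. *)
pose dl := Num.max 0 (((M - m) / 2 * (1 - e) - k2 ^+ 2 * BB * e) / (k2 * K13)).
have dl0 : 0 <= dl by rewrite le_max lexx.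
have dlb : (M - m) - dl <= (1 - cc) * (M - m) + (1 + k2 ^+ 2) * BB * e.
  apply: le_trans (osc_gain k21 k13p e_ge0 m0 mM MB).
  by apply: lerB => //; rewrite le_max lexx orbT.
have rhs0 : 0 <= (1 - cc) * (M - m) + (1 + k2 ^+ 2) * BB * e.
  exact: (osc_rhs_ge0 k21 k13p e_ge0 m0 mM MB).
have key J : (M - m) * (iu D x2 rho - iu D x2 r0) / 2 <= J -> 0 < dl ->
    k2 * K13 * dl * iu D x2 rho <= J - k2 ^+ 2 * BB * (e * iu D x2 rho).
  move=> hJ; rewrite /dl lt_max ltxx/= => hd; rewrite max_r ?(ltW hd)//.
  exact: osc_key hJ.
have r24 : 2 * rho <= 4 * rho by rewrite ler_pM2r// ler_nat.
have r04 : r0 <= 4 * rho by apply: (le_trans rr); rewrite ler_peMl ?ler1n// ltW.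
have U42 y : Uout (4 * rho) y -> Uout (2 * rho) y by exact: Uout_le.
have U40 y : Uout (4 * rho) y -> Uout r0 y by exact: Uout_le.
have fin y : Uout (4 * rho) y -> exists v h g : R, [/\ uu x1 y = v%:E, uu x2 y = h%:E, HH q D rho y = g%:E,
     [/\ 0 <= v, 0 <= h & 0 <= g] & rho ^+ d * h <= K13 * iu D x2 rho * g].
  move=> Uy; have [v [h [v1 hE v0 h0 le1]]] := u_fin If1 ub1 k3 Uy.
  have [w [h' [v2 hE' w0 h0' le2]]] := u_fin If2 ub2 k3 Uy.
  by exists v, w, h'.
have fin_step J h g z : 0 <= g -> rho ^+ d * h <= K13 * iu D x2 rho * g -> 0 < dl ->
   (M - m) * (iu D x2 rho - iu D x2 r0) / 2 <= J -> z <= k2 ^+ 2 * BB * (e * iu D x2 rho) ->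
   k2 * rho ^+ d * (dl * h) + z * g <= J * g.
  move=> g0 hh d0 hJ hz; have hk := key J hJ d0.
  have h1 : k2 * rho ^+ d * (dl * h) <= k2 * K13 * dl * iu D x2 rho * g.
    have -> : k2 * rho ^+ d * (dl * h) = k2 * dl * (rho ^+ d * h) by ring.
    have -> : k2 * K13 * dl * iu D x2 rho * g = k2 * dl * (K13 * iu D x2 rho * g) by ring.
    by apply: ler_wpM2l hh; exact: mulr_ge0 (ltW k20) dl0.
  have h2 : (k2 * K13 * dl * iu D x2 rho + z) * g <= J * g by apply: ler_wpM2r => //; apply: (le_trans (lerD hk hz)); rewrite subrK.
  by rewrite mulrDl in h2; apply: le_trans h2; rewrite lerD2r.
have kr : 0 < k2 * rho ^+ d := mulr_gt0 k20 rd.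
have [dz|dp] := eqVneq dl 0.
  exists m, M; split=> //; first by move: dlb; rewrite dz subr0.
  by move=> y /U40; exact: H.
have {dp} d0 : 0 < dl by rewrite lt_def dp.
have [J12le|J21le] := leP J2 J1.
  have hJ : (M - m) * (iu D x2 rho - iu D x2 r0) / 2 <= J1 := half_le J12 J12le.
  (* It is not excluded that m + dl exceeds M, hence the minimum; the other case takes a maximum
     with m. *)
  have m'm : Num.min M (m + dl) <= m + dl by rewrite ge_min lexx orbT.
  have m'0 : 0 <= Num.min M (m + dl) by rewrite le_min (le_trans m0 mM) addr_ge0.
  have m'M : Num.min M (m + dl) <= M by rewrite ge_min lexx.
  exists (Num.min M (m + dl)), M; split => //.
    by rewrite minEle; case: ifP => _; [rewrite subrr|rewrite opprD addrA].
  move=> y Uy; split; last by have [] := H _ (U40 _ Uy).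
  have [v [h [g [v1 h1 g1 [v0 h0 g0] le2]]]] := fin _ Uy.
  have ba w : Uout r0 w -> (m%:E * uu x2 w <= 1%:E * uu x1 w)%E.
    by move=> /H[h' _]; rewrite mul1e.
  have T := ratio_transfer ler01 m0 If2 r1 rr x1r x2r nf1 ba f1E J10 J1E (U42 _ Uy).
  move: T; rewrite v1 h1 g1 -!EFinM -!EFinD !lee_fin => T.
  apply: (@le_trans _ _ ((m + dl) * h)); first by apply: ler_wpM2r.
  have hz : k2 ^+ 2 * m * iu D x2 r0 <= k2 ^+ 2 * BB * (e * iu D x2 rho).
    apply: ler_pM => //; [by rewrite mulr_ge0 ?exprn_ge0// ltW|exact: ltW (iu_gt0 mD If2 _)|].
    by apply: ler_wpM2l; [rewrite exprn_ge0// ltW|exact: le_trans MB].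
  have F := fin_step J1 h g _ g0 le2 d0 hJ hz.
  rewrite -(ler_pM2l kr).
  have E1 : k2 * rho ^+ d * ((m + dl) * h) = k2 * rho ^+ d * m * h + k2 * rho ^+ d * (dl * h) by ring.
  by rewrite E1; rewrite mulr1 in T; exact: gain_cancel T F.
have hJ : (M - m) * (iu D x2 rho - iu D x2 r0) / 2 <= J2.
  by rewrite addrC in J12; exact: half_le J12 (ltW J21le).
have Mm' : M - dl <= Num.max m (M - dl) by rewrite le_max lexx orbT.
have mM' : m <= Num.max m (M - dl) by rewrite le_max lexx.
exists m, (Num.max m (M - dl)); split => //.
- by rewrite ge_max (le_trans mM MB)/= (le_trans _ MB)// gerBl.
- by rewrite maxEle; case: ifP => _; [rewrite addrAC|rewrite subrr].
move=> y Uy; split; first by have [] := H _ (U40 _ Uy).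
have [v [h [g [v1 h1 g1 [v0 h0 g0] le2]]]] := fin _ Uy.
have ba w : Uout r0 w -> (1%:E * uu x1 w <= M%:E * uu x2 w)%E.
  by move=> /H[_ h']; rewrite mul1e.
have M0 : 0 <= M := le_trans m0 mM.
have T := ratio_transfer M0 ler01 If1 r1 rr x2r x1r nf2 ba f2E J20 J2E (U42 _ Uy).
move: T; rewrite v1 h1 g1 -!EFinM -!EFinD !lee_fin => T.
apply: (@le_trans _ _ ((M - dl) * h)); last by apply: ler_wpM2r.
have hz : k2 ^+ 2 * 1 * iu D x1 r0 <= k2 ^+ 2 * BB * (e * iu D x2 rho).
  rewrite mulr1 -mulrA; apply: ler_wpM2l; first by rewrite exprn_ge0// ltW.
  by apply: (le_trans (iu_ratio hr0)); apply: ler_wpM2l => //; exact: le_trans ler01 BB1.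
have F := fin_step J2 h g _ g0 le2 d0 hJ hz.
rewrite -(ler_pM2l kr).
have E1 : k2 * rho ^+ d * ((M - dl) * h) = k2 * rho ^+ d * M * h - k2 * rho ^+ d * (dl * h) by ring.
by rewrite E1 lerBrDr; rewrite mulr1 in T; exact: gain_cancel T F.
Qed.

Lemma k2_gt0 : 0 < k2. Proof. exact: lt_le_trans ltr01 k2_ge1. Qed.

Lemma cc_gt0 : 0 < cc.
Proof.
rewrite invr_gt0 -mulrA; apply: mulr_gt0 => //; apply: mulr_gt0; first exact: k2_gt0.
exact: lt_le_trans ltr01 K13_ge1.
Qed.

Lemma cc_le : cc <= 1 / 2.
Proof.
have kk1 : 1 <= k2 * K13 := mulr_ege1 k2_ge1 K13_ge1.
have kk0 : 0 < k2 * K13 := lt_le_trans ltr01 kk1.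
by rewrite /cc -mulrA invfM mul1r ler_piMr// invf_le1.
Qed.

(** Index of the scale after N rounds. Bounds from a round hold from four times its radius on, which
    costs 2 doublings; then j * l doublings leave room for j growth steps by the factor L <= 2^l. *)
Definition kN (j l N : nat) := (3 + N * (2 + j * l))%N.

Lemma oscillation_iterate L kappa j l e N : 0 < kappa <= 1 -> 1 <= L -> L <= 2 ^+ l ->
  (forall rho, rho0 <= rho -> exists a : 'rV[R]_d,
     eball a (kappa * rho) `<=` Uout (2 * rho) /\ enorm a + kappa * rho <= L * rho) ->
  0 < e -> 1 <= e * (1 + cg L kappa) ^+ j ->
  exists m M, [/\ 0 <= m, m <= M, M <= BB,
    M - m <= (1 - cc) ^+ N * BB + (1 + k2 ^+ 2) * BB * e / cc &
    forall y, Uout (4 * rk (kN j l N)) y -> (m%:E * uu x2 y <= uu x1 y)%E /\ (uu x1 y <= M%:E * uu x2 y)%E].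
Proof.
move=> kap L1 Ll fat e_gt0 ej.
have L0 : 0 < L := lt_le_trans ltr01 L1.
have cg0 : 0 < cg L kappa by case/andP: kap => k0 _; exact: cg_gt0.
have grow i r : rho0 <= r -> (1 + cg L kappa) ^+ i * iu D x2 r <= iu D x2 (L ^+ i * r).
  move=> hr; elim: i => [|i IH]; first by rewrite !expr0 !mul1r.
  have hL : 1 <= L ^+ i by rewrite exprn_ege1.
  have r_gt0 : 0 < r := lt_le_trans r0_gt0 hr.
  have hr' : rho0 <= L ^+ i * r by apply: (le_trans hr); rewrite ler_peMl// ltW.
  have [a [aB aL]] := fat _ hr'.
  have xr : enorm x2 < L ^+ i * r := lt_le_trans x2_rho0 hr'.
  have := iu_growth mD If2 (le_trans rmin_rho0 hr') xr kap L1 aB aL.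
  rewrite (exprS L i) -(mulrA L); apply: le_trans; rewrite exprS -mulrA.
  by rewrite ler_pM2l// addr_gt0.
have Ke : 0 <= (1 + k2 ^+ 2) * BB * e.
  apply: mulr_ge0 (ltW e_gt0); apply: mulr_ge0 (le_trans ler01 BB_ge1).
  by rewrite addr_ge0// sqr_ge0.
elim: N => [|N [m [M [m0 mM MB osc H]]]].
  exists 0, BB; rewrite expr0 mul1r subr0; split=> //; first exact: le_trans ler01 BB_ge1.
    by rewrite lerDl divr_ge0// ltW// cc_gt0.
  move=> y Uy; split; first by rewrite mul0e; case: (nnm_u x1 mD).
  exact: initial_bound.
have E1 : 4 * rk (kN j l N) = rk (kN j l N + 2) by rewrite addn2 !rkS; ring.
have E2 : rk (kN j l N.+1) = 2 ^+ (j * l) * (4 * rk (kN j l N)).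
  have -> : kN j l N.+1 = (j * l + (kN j l N + 2))%N by rewrite /kN mulSn; ring.
  by rewrite E1 /rk exprD mulrA.
have k3 : (3 <= kN j l N.+1)%N by rewrite /kN leq_addr.
have h4 : 4 * rk 3 <= 4 * rk (kN j l N).
  rewrite ler_pM2l// /rk ler_pM2r//; apply: ler_weXn2l; first by rewrite ler1n.
  by rewrite /kN leq_addr.
have rr : 4 * rk (kN j l N) <= rk (kN j l N.+1).
  rewrite E2 ler_peMl ?exprn_ege1 ?ler1n//; apply: mulr_ge0 => //; exact: ltW (rk0 _).
have ie : iu D x2 (4 * rk (kN j l N)) <= e * iu D x2 (rk (kN j l N.+1)).
  have g : rho0 <= 4 * rk (kN j l N) by rewrite E1.
  have i0 := iu_gt0 mD If2 (4 * rk (kN j l N)).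
  apply: (@le_trans _ _ (e * ((1 + cg L kappa) ^+ j * iu D x2 (4 * rk (kN j l N))))).
    by rewrite (mulrA e) ler_peMl// ltW.
  rewrite ler_pM2l//; apply: (le_trans (grow j _ g)); apply: iu_le => //.
  rewrite E2; apply: ler_wpM2r; first by apply: mulr_ge0 => //; exact: ltW (rk0 _).
  by rewrite mulnC exprM lerXn2r ?nnegrE ?exprn_ge0// ltW.
have [m' [M' [m'0 m'M' M'B osc' H']]] := oscillation_improve k3 h4 rr m0 mM MB (ltW e_gt0) ie H.
exists m', M'; split=> //.
have c1 : cc <= 1 by apply: (le_trans cc_le); rewrite ler_pdivrMr// mul1r ler1n.
exact: osc_rec cc_gt0 c1 osc osc'.
Qed.

Lemma iterate_eta L kappa eta l j N : 0 < kappa <= 1 -> 1 <= L -> L <= 2 ^+ l -> 0 < eta ->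
  (forall rho, rho0 <= rho -> exists a : 'rV[R]_d,
     eball a (kappa * rho) `<=` Uout (2 * rho) /\ enorm a + kappa * rho <= L * rho) ->
  2 * (1 + k2 ^+ 2) * BB <= eta * cc * (1 + cg L kappa) ^+ j ->
  2 * BB <= eta * (1 + cc) ^+ N ->
  exists m M, [/\ 0 <= m, m <= M, M <= BB, M - m <= eta &
    forall y, Uout (4 * rk (kN j l N)) y -> (m%:E * uu x2 y <= uu x1 y)%E /\ (uu x1 y <= M%:E * uu x2 y)%E].
Proof.
move=> kap L1 Ll eta_gt0 fat hj hN.
have c0 := cc_gt0; have c2 := cc_le; have B1 := BB_ge1.
have k1 : 0 < 1 + k2 ^+ 2 by rewrite ltr_pwDl// sqr_ge0.
have kB : 0 < 2 * (1 + k2 ^+ 2) * BB by apply: mulr_gt0; [exact: mulr_gt0|exact: lt_le_trans B1].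
(* The errors of all rounds sum to at most (1 + k2^2) BB e / cc, which this e makes eta / 2. *)
pose e := eta * cc / (2 * (1 + k2 ^+ 2) * BB).
have e_gt0 : 0 < e := divr_gt0 (mulr_gt0 eta_gt0 c0) kB.
have ej : 1 <= e * (1 + cg L kappa) ^+ j by rewrite /e mulrAC ler_pdivlMr// mul1r.
have [m [M [m0 mM MB osc H]]] := oscillation_iterate N kap L1 Ll fat e_gt0 ej.
exists m, M; split=> //; apply: (le_trans osc).
have BB0 : 0 < BB := lt_le_trans ltr01 B1.
have h1 : (1 + k2 ^+ 2) * BB * e / cc = eta / 2.
  by rewrite /e; field; rewrite !gt_eqF.
have c1 : 0 < 1 - cc by apply: lt_le_trans (_ : 1 - 1 / 2 <= _); [lra|rewrite lerB].
(* Trades the decay of (1 - cc)^N for the growth of (1 + cc)^N, for which [expr_unbounded] provides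
   N. *)
have h2 : (1 - cc) ^+ N * (1 + cc) ^+ N <= 1.
  rewrite -exprMn_comm; last exact: mulrC.
  apply: exprn_ile1; first by rewrite mulr_ge0 ?(ltW c1)// addr_ge0// ltW.
  have -> : (1 - cc) * (1 + cc) = 1 - cc ^+ 2 by ring.
  by rewrite gerBl sqr_ge0.
have h3 : (1 - cc) ^+ N * (2 * BB) <= eta.
  apply: (@le_trans _ _ ((1 - cc) ^+ N * (eta * (1 + cc) ^+ N))).
    by rewrite ler_pM2l// exprn_gt0.
  by rewrite mulrCA ler_piMr// ltW.
rewrite h1; apply: (@le_trans _ _ (eta / 2 + eta / 2)); last by rewrite -splitr.
by rewrite lerD2r ler_pdivlMr// -mulrA (mulrC BB).
Qed.

End pair.
End walk2.

(** The radius r is chosen before the step, the kernel, the domain and the poles, from the constants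
    alone; this is what lets the conclusion survive the limits in eps and in the domain. *)
Lemma chain_oscillation (R : realType) (d : nat) (C rho0 A0 B0 kappa L eta : R) (Ceta : R -> R) :
  1 <= C -> 1 <= B0 -> 0 < rho0 -> 0 < kappa <= 1 -> 1 <= L -> 0 < eta ->
  (forall eta, 0 < eta -> 0 <= Ceta eta) ->
  exists r : R, forall (rmin eps : R) (ph : R -> R) (q : borelRd R d -> borelRd R d -> R)
    (P : nat -> R) (D : set (borelRd R d)) (x1 x2 : borelRd R d),
  let mu := @lebesgueRd R d in
  let u x := RU mu q D (fun y => (q x y)%:E) in
  scale C ph -> walk C rmin ph Ceta eps q P -> measurable D ->
  (forall r, Iu q D x1 r \is a fin_num) -> (forall r, Iu q D x2 r \is a fin_num) ->
  rmin <= rho0 -> enorm x1 < rho0 -> enorm x2 < rho0 -> C * (eps * ph rho0) <= eta0 d C ->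
  (forall y, D y -> rho0 <= enorm y -> (u x1 y <= (A0 / rho0 ^+ d * iu q D x1 (5 * rho0))%:E)%E) ->
  (forall y, D y -> rho0 <= enorm y -> (u x2 y <= (A0 / rho0 ^+ d * iu q D x2 (5 * rho0))%:E)%E) ->
  iu q D x1 (8 * rho0) <= B0 * iu q D x2 (8 * rho0) ->
  (forall rho, rho0 <= rho -> exists a : 'rV[R]_d,
     [/\ eball a (kappa * rho) `<=` D, eball a (kappa * rho) `<=` [set y | 2 * rho <= enorm y] &
     enorm a + kappa * rho <= L * rho]) ->
  exists m M, [/\ 0 <= m, m <= M, M - m <= eta &
    forall y, D y -> r <= enorm y -> (m%:E * u x2 y <= u x1 y)%E /\ (u x1 y <= M%:E * u x2 y)%E].
Proof.
move=> C1 B01 r0 kap L1 eta_gt0 Ce.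
have L0 : 0 < L := lt_le_trans ltr01 L1.
have [l Ll] : exists l, L <= 2 ^+ l.
  by have [l h] := expr_unbounded L (@ltr01 R); exists l; rewrite -[2]/(1 + 1).
(* The exponents j and N must be fixed now, while positivity of c and of [cg] needs a [scale],
   introduced only afterwards. So a j is taken that works if any does. *)
have choice (Q : nat -> Prop) : exists j, (exists i, Q i) -> Q j.
  have [[j Qj]|nQ] := pselect (exists j, Q j); first by exists j.
  by exists 0%N => -[i Qi]; case: nQ; exists i.
pose kk := k2 d C; pose c := cc d C Ceta A0; pose B := BB d C Ceta A0 B0.
have [j hj] := choice (fun j => 2 * (1 + kk ^+ 2) * B <= eta * c * (1 + cg d C L kappa) ^+ j).
have [N hN] := choice (fun N => 2 * B <= eta * (1 + c) ^+ N).
exists (4 * rk rho0 (kN j l N)) => rmin eps ph q P D x1 x2 mu u sc W mD If1 If2 rr x1r x2r es ub1 ub2 iub fat.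
have c_gt0 : 0 < c by apply: cc_gt0; eassumption.
have kap0 : 0 < kappa by case/andP: kap.
have cg0 : 0 < cg d C L kappa by apply: cg_gt0; eassumption.
have {}hj : 2 * (1 + kk ^+ 2) * B <= eta * c * (1 + cg d C L kappa) ^+ j.
  apply: hj; have [i hi] := expr_unbounded (2 * (1 + kk ^+ 2) * B / (eta * c)) cg0.
  by exists i; rewrite -ler_pdivrMl ?mulr_gt0// mulrC.
have {}hN : 2 * B <= eta * (1 + c) ^+ N.
  apply: hN; have [i hi] := expr_unbounded (2 * B / eta) c_gt0.
  by exists i; rewrite -ler_pdivrMl// mulrC.
have rk3 : rk rho0 3 = 8 * rho0 by rewrite /rk; congr (_ * _); ring.
have ub1' y : (D `&` [set y | rho0 <= enorm y]) y -> (u x1 y <= (A0 / rho0 ^+ d * iu q D x1 (5 * rho0))%:E)%E.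
  by case; exact: ub1.
have ub2' y : (D `&` [set y | rho0 <= enorm y]) y -> (u x2 y <= (A0 / rho0 ^+ d * iu q D x2 (5 * rho0))%:E)%E.
  by case; exact: ub2.
have iub' : iu q D x1 (rk rho0 3) <= B0 * iu q D x2 (rk rho0 3) by rewrite rk3.
have fat' rho : rho0 <= rho -> exists a : 'rV[R]_d,
     eball a (kappa * rho) `<=` (D `&` [set y | 2 * rho <= enorm y]) /\ enorm a + kappa * rho <= L * rho.
  move=> hr; have [a [a1 a2 a3]] := fat _ hr; exists a; split=> // z az.
  by split; [exact: a1|exact: a2].
have [m [M [m0 mM _ osc H]]] := iterate_eta sc W mD If1 If2 rr x1r x2r Ce es ub1' ub2' B01 iub' kap L1 Ll eta_gt0 fat' hj hN.
by exists m, M; split=> // y Dy yr; exact: H.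
Qed.

(** * Radial monotonicity of the transition density *)

Lemma continuous_slice (T1 T2 T3 T4 : topologicalType) (f : T1 * (T2 * T3) -> T4) a b c :
  {for (a, (b, c)), continuous f} -> {for c, continuous (fun z => f (a, (b, z)))}.
Proof.
move=> h.
have c1 : (fun _ : T3 => a) @ nbhs c --> a by exact: cvg_cst.
have c2 : (fun _ : T3 => b) @ nbhs c --> b by exact: cvg_cst.
exact: (cvg_comp _ _ (cvg_pair c1 (cvg_pair c2 (@cvg_id _ (nbhs c)))) h).
Qed.

Section density_integral.
Local Open Scope ereal_scope.
Context (R : realType) (disp : measure_display) (T : measurableType disp).
Variables (mu nu : {measure set T -> \bar R}) (k : T -> R).
Hypothesis mk : measurable_fun setT k.
Hypothesis k0 : forall x, (0 <= k x)%R.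
Hypothesis nuE : forall B, measurable B -> nu B = \int[mu]_(x in B) (k x)%:E.
Import HBNNSimple.

Lemma integral_density (f : T -> \bar R) : nnm f -> \int[nu]_x f x = \int[mu]_x ((k x)%:E * f x).
Proof.
move=> [mf f0]; pose f_ := nnsfun_approx measurableT mf.
transitivity (limn (fun n => \int[nu]_x (f_ n x)%:E)).
  rewrite -monotone_convergence//.
  - apply: eq_integral => y _; apply/esym/cvg_lim => //.
    exact: cvg_nnsfun_approx.
  - by move=> n; exact/measurable_EFinP/measurable_funP.
  - by move=> n y _; rewrite lee_fin.
  - by move=> y _ m n mn; rewrite lee_fin; exact/lefP/nd_nnsfun_approx.
rewrite [X in limn X](_ : _ = (fun n => \int[mu]_x ((k x)%:E * (f_ n x)%:E))); last first.
  apply/funext => n.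
  transitivity (\sum_(r \in range (f_ n)) \int[nu]_x (r * \1_(f_ n @^-1` [set r]) x)%:E).
    under eq_integral do rewrite fimfunE -fsumEFin//.
    rewrite ge0_integral_fsum//.
    - by move=> y; exact/measurable_EFinP/measurable_funM.
    - by move=> y x _; rewrite nnfun_muleindic_ge0.
  transitivity (\sum_(r \in range (f_ n)) \int[mu]_x ((k x)%:E * (r * \1_(f_ n @^-1` [set r]) x)%:E)).
    apply: eq_fsbigr => r rf.
    have r0 : (0 <= r)%R by move: rf; rewrite inE => -[x _ <-].
    have mr : measurable (f_ n @^-1` [set r]) by exact: measurable_funPTI.
    transitivity (r%:E * nu (f_ n @^-1` [set r])).
      have E1 := integral_indic nu measurableT mr; rewrite setIT in E1.
      rewrite -E1; under eq_integral do rewrite EFinM.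
      apply: (@ge0_integralZl _ _ _ nu setT measurableT (fun x => (\1_(f_ n @^-1` [set r]) x)%:E)) => //.
      by apply/measurable_EFinP.
    rewrite nuE// integral_mkcond -ge0_integralZl//; last 2 first.
    - apply/(measurable_restrictT _ _).1 => //.
      by apply: measurable_funTS; exact/measurable_EFinP.
    - by move=> x _; rewrite patchE; case: ifP => // _; rewrite lee_fin.
    apply: eq_integral => x _; rewrite patchE indicE; case: ifPn => xr.
      by rewrite mulr1 muleC.
    by rewrite !mulr0 !mule0.
  rewrite -ge0_integral_fsum//.
  - apply: eq_integral => x _; rewrite -ge0_mule_fsumr; last by move=> r; rewrite nnfun_muleindic_ge0.
    by rewrite fsumEFin// -fimfunE.
  - by move=> r; apply: emeasurable_funM; [exact/measurable_EFinP|exact/measurable_EFinP/measurable_funM].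
  - by move=> r x _; apply: mule_ge0; [rewrite lee_fin|exact: nnfun_muleindic_ge0].
rewrite -monotone_convergence//.
- apply: eq_integral => y _; apply/cvg_lim => //.
  by apply: cvgeZl => //; exact: cvg_nnsfun_approx.
- by move=> n; apply: emeasurable_funM; [exact/measurable_EFinP|exact/measurable_EFinP/measurable_funP].
- by move=> n y _; rewrite mule_ge0// lee_fin.
- move=> y _ m n mn; apply: lee_wpmul2l; first by rewrite lee_fin.
  by rewrite lee_fin; exact/lefP/nd_nnsfun_approx.
Qed.

End density_integral.

Lemma measurable_set1_rV (R : realType) d (z : 'rV[R]_d) : measurable ([set z] : set (borelRd R d)).
Proof.
have := measurable_enormB z measurableT (measurable_itv `]-oo, 0]); rewrite setTI.
congr measurable; apply/seteqP; split=> y /=; last by move=> ->; rewrite in_itv/= subrr enorm0.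
rewrite in_itv/= => h; apply/eqP; rewrite -subr_eq0; apply/eqP/enorm_eq0/eqP.
by rewrite eq_le h enorm_ge0.
Qed.

Lemma lebesgueRd_set1 (R : realType) d (z : borelRd R d) : (0 < d)%N -> lebesgueRd [set z] = 0%E.
Proof.
move=> d0; rewrite (_ : [set z] = [set x : 'rV[R]_d | forall i, [set z 0 i] (x 0 i)]); last first.
  by apply/seteqP; split=> x /= => [->//|xz]; apply/rowP.
rewrite (lebesgueRd_box (A := fun i => [set z 0 i])); last by move=> i; exact: measurable_set1.
rewrite (bigD1 (Ordinal d0))//= lebesgue_measure_set1 mul0e//.
Qed.

Section law.
Context (R : realType) (d : nat) (disp : measure_display) (Omega : measurableType disp).
Variables (P : 'rV[R]_d -> probability Omega R) (X : R -> Omega -> 'rV[R]_d).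
Variables (phi : R -> R) (p : R -> 'rV[R]_d -> 'rV[R]_d -> R).
Hypothesis d0 : (0 < d)%N.
Hypothesis phi_cbf : complete_bernstein phi.
Hypothesis X_levy : levy_process P X.
Hypothesis X_exponent : has_characteristic_exponent P X phi.
Hypothesis p_density : transition_density P X p.
Local Notation V := (borelRd R d).
Local Notation mu := (@lebesgueRd R d).

Let p0 := density_ge0 p_density.

Lemma measurable_X t : 0 <= t -> measurable_fun setT (X t : Omega -> V).
Proof. exact: levy_measurable X_levy t. Qed.

Lemma measurable_p t x : 0 < t -> measurable_fun setT (fun y : V => p t x y).
Proof.
move=> t0; apply: continuous_measurable_rV => y.
have h := density_continuous p_density (x := x) (y := y) t0.
exact: (continuous_slice h).
Qed.

Lemma law_integral t x (f : V -> \bar R) : 0 < t -> nnm f ->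
  (\int[P x]_w f (X t w) = \int[mu]_y ((p t x y)%:E * f y))%E.
Proof.
move=> t0 nf; have mX := measurable_X (ltW t0).
pose nu := measure_function_pushforward__canonical__measure_function_Measure (P x) mX.
have H := @integral_density R _ V mu nu (p t x) (measurable_p x t0) (fun y => p0 x y t0) _ f nf.
rewrite -H; last by move=> B mB; rewrite -(density_law p_density x t0 mB).
have [mf f0] := nf.
by rewrite /nu/= ge0_integral_pushforward.
Qed.

Lemma p_mass t x : 0 < t -> (\int[mu]_y (p t x y)%:E = 1)%E.
Proof.
by move=> t0; rewrite -(density_law p_density x t0 measurableT); exact: probability_setT.
Qed.

Lemma X0_ae x : {ae P x, forall w, X 0 w = x}.
Proof.
have mX := measurable_X (lexx 0).
have mS : measurable [set w | X 0 w = x].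
  rewrite -[X in measurable X]setTI; apply: (mX measurableT [set x : V]).
  exact: measurable_set1_rV.
exists (~` [set w | X 0 w = x]); split; first exact: measurableC.
- by rewrite probability_setC// (levy_start X_levy) subee.
- by move=> w.
Qed.

Lemma law_integral0 t x (f : V -> \bar R) : 0 < t -> nnm f ->
  (\int[P x]_w f (X t w - X 0 w)%R = \int[mu]_y ((p t x y)%:E * f (y - x)%R))%E.
Proof.
move=> t0 nf; have [mf f0] := nf.
have msub (z : V) : measurable_fun setT (fun y : V => y - z : V).
  by apply: measurable_rowB => //; exact: measurable_cst.
have nf' : nnm (fun y : V => f (y - x)) by split=> //; exact: measurableT_comp mf (msub x).
rewrite -(law_integral x t0 nf'); have [N [mN PN NX]] := X0_ae x.
have mX := measurable_X (ltW t0); have mX0 := measurable_X (lexx 0).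
apply: ge0_ae_eq_integral => //.
- by apply: measurableT_comp mf _; exact: measurable_rowB.
- by apply: measurableT_comp mf _; exact: measurableT_comp (msub x) mX.
- by exists N; split=> // w /= nw; apply: NX => /= h; apply: nw => _; rewrite h.
Qed.

(** Characteristic function of X t - X 0. At 0 it is set to 1, where the function of
    [radmon_exp_bernstein] may take another value; the two agree off a null set. *)
Definition Psi (t : R) (xi : V) : R := if xi == 0 then 1 else expR (- (t * phi (dot xi xi))).

Lemma Psi_int (t : R) : 0 <= t -> exists psi : V -> R, radmon psi /\ forall xi, xi != 0 -> psi xi = Psi t xi.
Proof.
move=> t0; have [e0 h] := radmon_exp_bernstein d phi_cbf t0.
by eexists; split; [exact: h|move=> xi xi0; rewrite /Psi !ifN].
Qed.

Definition nGau (b : R) := Num.sqrt (pi / b) ^+ d.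

Lemma nGau_gt0 b : 0 < b -> 0 < nGau b.
Proof. by move=> b0; rewrite exprn_gt0// sqrtr_gt0 divr_gt0// pi_gt0. Qed.

(** The shape 1 + 1 * cos (0 + ...) is that of [ge0_integral_Gau_cos]: a nonnegative integrand,
    ready for Tonelli in [gaussian_fourier]. *)
Lemma E_cos t x xi c : 0 <= t -> xi != 0 ->
  (\int[P x]_w (1 + 1 * cos (0 + dot xi (X t w - X 0 w - c)))%:E = (1 + cos (dot xi c) * Psi t xi)%:E)%E.
Proof.
move=> t0 xi0; have [hc hs] := X_exponent x xi0 t0.
have mX := measurable_X t0; have mX0 := measurable_X (lexx 0).
have mY : measurable_fun setT (fun w => X t w - X 0 w : V) by exact: measurable_rowB.
have md : measurable_fun setT (fun w => dot xi (X t w - X 0 w)).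
  by apply: measurable_dot => //; exact: measurable_cst.
have mc : measurable_fun setT (fun w => cos (dot xi (X t w - X 0 w))).
  by apply: measurableT_comp md; exact: continuous_measurable_fun (@continuous_cos R).
have ms : measurable_fun setT (fun w => sin (dot xi (X t w - X 0 w))).
  by apply: measurableT_comp md; exact: continuous_measurable_fun (@continuous_sin R).
have bint (g : Omega -> R) M : measurable_fun setT g -> (forall w, `|g w| <= M) -> (P x).-integrable setT (EFin \o g).
  move=> mg bg; apply: measurable_bounded_integrable => //; first by rewrite fin_num_fun_lty//; exact: fin_num_measure.
  by exists M; split; [exact: num_real|move=> y My w _; exact: le_trans (bg w) (ltW My)].
have ic := bint _ 1 mc (fun w => abs_cos_le1 _).
have is_ := bint _ 1 ms (fun w => abs_sin_le1 _).
have i1 : (P x).-integrable setT (EFin \o (fun=> 1)) by apply: (bint _ 1) => // w; rewrite normr1.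
transitivity (\int[P x]_w ((1%:E + ((cos (dot xi c))%:E * (cos (dot xi (X t w - X 0 w)))%:E)) +
    ((sin (dot xi c))%:E * (sin (dot xi (X t w - X 0 w)))%:E)))%E.
  apply: eq_integral => w _; rewrite -!EFinM -!EFinD; congr EFin.
  by rewrite mul1r add0r dotDr dotNr cosB; ring.
rewrite integralD//=; last 2 first.
- by apply: integrableD => //; exact: integrableZl.
- exact: integrableZl.
rewrite integralD//=; last exact: integrableZl.
rewrite !integralZl//= hc hs mule0 adde0 integral_cst//= probability_setT mule1 -EFinM -EFinD.
by rewrite /Psi ifN// enorm_sqr.
Qed.

Definition AG (b t : R) (x c : 'rV[R]_d) : \bar R := (\int[P x]_w (Gau b (X t w - X 0 w - c))%:E)%E.

Lemma measurable_incr t : 0 <= t -> measurable_fun setT (fun w => X t w - X 0 w : V).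
Proof. by move=> t0; apply: measurable_rowB; exact: measurable_X. Qed.

Lemma measurable_Gau_shift (b : R) (c : 'rV[R]_d) : measurable_fun setT (fun y : V => Gau b (y - c)).
Proof.
apply: (measurableT_comp (measurable_Gau (d := d) b)).
by apply: measurable_rowB => //; exact: measurable_cst.
Qed.

(** Gau a xi (1 + cos(xi . (X_t - X_0 - c))) is integrated over xi and over the path in both orders.
    With a = 1/(4 b), integrating xi first produces [Gau b] at X_t - X_0 - c; integrating the path
    first produces the characteristic function. The finite term nGau a, common to both results,
    cancels. *)
Lemma gaussian_fourier b t x (c : 'rV[R]_d) (psi : V -> R) : 0 < b -> 0 <= t -> bmeas psi ->
  (forall xi, xi != 0 -> psi xi = Psi t xi) ->
  ((nGau (1 / (4 * b)))%:E * AG b t x c = (Fint (1 / (4 * b)) c psi)%:E)%E.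
Proof.
move=> b0 t0 bpsi psiE; set a := 1 / (4 * b).
have a0 : 0 < a by rewrite divr_gt0// mulr_gt0.
have n0 := nGau_gt0 a0.
have ab z : dot z z / (4 * a) = b * dot z z by rewrite /a; field; rewrite gt_eqF.
have mY := measurable_incr t0.
have mYc : measurable_fun setT (fun w => X t w - X 0 w - c : V).
  by apply: measurable_rowB => //; exact: measurable_cst.
pose F (z : V * Omega) := (Gau a z.1 * (1 + 1 * cos (0 + dot z.1 (X t z.2 - X 0 z.2 - c))))%:E.
have B1 : -1 <= (1 : R) <= 1 by apply/andP; split; lra.
have pos s : 0 <= 1 + 1 * cos s by have := cos_geN1 s; lra.
have mF : measurable_fun setT F.
  apply/measurable_EFinP; apply: measurable_funM.
    by apply: (measurableT_comp (measurable_Gau (d := d) a)); exact: measurable_fst.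
  apply: measurable_funD => //; apply: measurable_funM => //.
  apply: (measurableT_comp (continuous_measurable_fun (@continuous_cos R))).
  apply: measurable_funD => //; apply: measurable_dot; first exact: measurable_fst.
  exact: measurableT_comp mYc measurable_snd.
have F0 z : (0 <= F z)%E by rewrite lee_fin mulr_ge0// Gau_ge0.
have FT := fubini_tonelli F mF F0 (m1 := mu) (m2 := P x).
have Gfin : AG b t x c \is a fin_num.
  rewrite ge0_fin_numE ?integral_ge0//; last by move=> w _; rewrite lee_fin Gau_ge0.
  apply: (@le_lt_trans _ _ (\int[P x]_w 1%:E)%E).
    apply: ge0_le_integral => //; first by move=> w _; rewrite lee_fin Gau_ge0.
      by apply/measurable_EFinP; exact: (measurableT_comp (measurable_Gau (d := d) b)).
    by move=> w _; rewrite lee_fin Gau_le1// ltW.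
  by rewrite integral_cst//= probability_setT mule1 ltry.
have L : (\int[P x]_w \int[mu]_xi F (xi, w) = (nGau a)%:E + (nGau a)%:E * AG b t x c)%E.
  transitivity (\int[P x]_w ((nGau a)%:E * (1 + Gau b (X t w - X 0 w - c))%:E))%E.
    apply: eq_integral => w _; rewrite /F/=.
    rewrite (ge0_integral_Gau_cos 0 (X t w - X 0 w - c) a0 B1) cos0 mulr1 mul1r EFinM.
    by rewrite /nGau /Gau ab.
  rewrite ge0_integralZl//=; last 3 first.
  - apply/measurable_EFinP; apply: measurable_funD => //.
    exact: (measurableT_comp (measurable_Gau (d := d) b)).
  - by move=> w _; rewrite lee_fin addr_ge0// Gau_ge0.
  - by rewrite lee_fin ltW.
  rewrite -[in RHS](mule1 (nGau a)%:E) -muleA mul1e -ge0_muleDr//; last first.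
    by apply: integral_ge0 => w _; rewrite lee_fin Gau_ge0.
  congr (_ * _)%E; under eq_integral do rewrite EFinD.
  rewrite ge0_integralD//=.
  - by rewrite integral_cst//= probability_setT mule1.
  - by move=> w _; rewrite lee_fin Gau_ge0.
  - by apply/measurable_EFinP; exact: (measurableT_comp (measurable_Gau (d := d) b)).
have Rr : (\int[mu]_xi \int[P x]_w F (xi, w) = (nGau a)%:E + (Fint a c psi)%:E)%E.
  have iG := integrable_Gau d a0; have iF := integrable_Fint c a0 bpsi.
  transitivity (\int[mu]_xi ((Gau a xi)%:E + (Gau a xi * (cos (dot xi c) * psi xi))%:E))%E.
    apply: ae_eq_integral => //.
    - exact: (measurable_fun_fubini_tonelli_F (m2 := P x)).
    - by apply: emeasurable_funD; [case/integrableP: iG|case/integrableP: iF].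
    exists [set 0 : V]; split => //=.
    - exact: measurable_set1_rV.
    - exact: lebesgueRd_set1.
    move=> xi /= H; apply: contrapT => xi0; apply: H => _.
    have {}xi0 : xi != 0 by apply/eqP.
    under eq_integral do rewrite /F/= EFinM.
    rewrite ge0_integralZl//=; last 2 first.
    - apply/measurable_EFinP; apply: measurable_funD => //; apply: measurable_funM => //.
      apply: (measurableT_comp (continuous_measurable_fun (@continuous_cos R))).
      apply: measurable_funD => //; apply: measurable_dot => //; exact: measurable_cst.
    - by rewrite lee_fin Gau_ge0.
    by rewrite E_cos// -EFinM -EFinD psiE//; congr EFin; ring.
  rewrite integralD//= integral_Gau//; congr (_ + _)%E.
  by rewrite /Fint /Rintegral fineK//; exact: integrable_fin_num iF.
have := FT; rewrite /fubini_F/= Rr => E1.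
have : ((nGau a)%:E + (nGau a)%:E * AG b t x c = (nGau a)%:E + (Fint a c psi)%:E)%E by rewrite -L E1.
by move: Gfin; case: (AG b t x c) => // A _; rewrite -!EFinM -!EFinD => -[] /addrI ->.
Qed.

Lemma AG_density b t x (c : 'rV[R]_d) : 0 < t -> 0 < b ->
  AG b t x c = (\int[mu]_y (p t x y * Gau b (y - (x + c)))%:E)%E.
Proof.
move=> t0 b0; have nf : nnm (fun y : V => (Gau b (y - c))%:E).
  by split=> [|y]; [apply/measurable_EFinP; exact: measurable_Gau_shift|rewrite lee_fin Gau_ge0].
rewrite /AG (law_integral0 x t0 nf); apply: eq_integral => y _.
by rewrite -EFinM; congr (_ * Gau b _)%:E; rewrite opprD addrA.
Qed.

Lemma integral_Gau_shift b (z : 'rV[R]_d) : 0 < b -> (\int[mu]_y (Gau b (y - z))%:E = (nGau b)%:E)%E.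
Proof.
move=> b0; rewrite -(integral_Gau d b0); apply: (@ge0_integral_shiftRd _ _ (- z) (fun y => (Gau b y)%:E)).
- by apply/measurable_EFinP; exact: measurable_Gau.
- by move=> y; rewrite lee_fin Gau_ge0.
Qed.

Lemma nGau_inv b : 1 <= b -> (nGau b)^-1 <= (1 + b) ^+ d.
Proof.
move=> b1; have b0 : 0 < b by lra.
rewrite /nGau -exprVn lerXn2r ?nnegrE ?invr_ge0 ?sqrtr_ge0//; first by lra.
have -> : (Num.sqrt (pi / b))^-1 = Num.sqrt (b / pi) by rewrite -sqrtrV ?invf_div ?divr_ge0 ?pi_ge0// ltW.
have p1 : 1 <= pi :> R by apply: le_trans (pi_ge2 R); lra.
have h : b / pi <= (1 + b) ^+ 2.
  by apply: (@le_trans _ _ b); [rewrite ler_pdivrMr ?ler_peMr ?pi_gt0//; lra|nra].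
have := ler_wsqrtr h; rewrite sqrtr_sqr ger0_norm//; lra.
Qed.

Lemma tail_small (k delta e : R) : 0 < delta -> 0 < e -> 0 <= k -> exists2 B, 1 <= B &
  forall b, B <= b -> k * (1 + b) ^+ d * expR (- (b * delta)) <= e.
Proof.
move=> d_gt0 e_gt0 k0.
pose c := k * 2 ^+ d * (d.+1)`!%:R / delta ^+ d.+1.
have f0 : 0 < (d.+1)`!%:R :> R by rewrite ltr0n fact_gt0.
have dd0 : 0 < delta ^+ d.+1 by rewrite exprn_gt0.
have c0 : 0 <= c by rewrite divr_ge0 ?mulr_ge0// ltW.
exists (1 + c / e); first by rewrite lerDl divr_ge0// ltW.
move=> b Bb; have b1 : 1 <= b by apply: le_trans Bb; rewrite lerDl divr_ge0// ltW.
have b0 : 0 < b by lra.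
have be : c <= e * b by rewrite mulrC -ler_pdivrMr//; lra.
have h := @expR_ge1Dxn R (b * delta) d (mulr_ge0 (ltW b0) (ltW d_gt0)).
have bd0 : 0 < (b * delta) ^+ d.+1 by rewrite exprn_gt0// mulr_gt0.
have h1 : (b * delta) ^+ d.+1 / (d.+1)`!%:R <= expR (b * delta) by lra.
have h2 : expR (- (b * delta)) <= (d.+1)`!%:R / (b * delta) ^+ d.+1.
  by rewrite expRN -[leRHS]invf_div lef_pV2 ?posrE ?expR_gt0 ?divr_gt0.
have h3 : (1 + b) ^+ d <= (2 * b) ^+ d by rewrite lerXn2r ?nnegrE; lra.
apply: (@le_trans _ _ (k * (2 * b) ^+ d * ((d.+1)`!%:R / (b * delta) ^+ d.+1))).
  apply: ler_pM; rewrite ?expR_ge0//; first by rewrite mulr_ge0// exprn_ge0//; lra.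
  exact: ler_wpM2l.
rewrite (_ : _ * _ = c / b); last first.
  by rewrite /c (exprMn_comm d (mulrC _ _)) (exprMn_comm d.+1 (mulrC _ _)) (exprS b); field; rewrite !gt_eqF// exprn_gt0.
by rewrite ler_pdivrMr.
Qed.

(** [Gau b] over [nGau b] is an approximate unit for large b, and p is continuous at x + c. Far from
    that point no bound on p is used: above, its mass 1 meets an exponentially small Gaussian;
    below, half of the exponent b gives smallness and the other half integrability. *)
Lemma gauss_approx t x (c : 'rV[R]_d) e : 0 < t -> 0 < e -> exists2 B, 1 <= B & forall b, B <= b ->
  exists A, [/\ AG b t x c = A%:E, A <= nGau b * (p t x (x + c) + e) & nGau b * (p t x (x + c) - e) <= A].
Proof.
move=> t0 e_gt0; set z := x + c; set pz := p t x z.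
have pz0 : 0 <= pz by exact: p0.
have e20 : 0 < e / 2 by rewrite divr_gt0.
have [delta delta0 hd] : exists2 delta, 0 < delta & forall y, enorm (y - z) < delta -> `|p t x y - pz| < e / 2.
  have h := continuous_slice (density_continuous p_density (x := x) (y := z) t0).
  have /cvgrPdist_lt /(_ _ e20) : p t x y @[y --> z] --> p t x z by exact: h.
  move=> /nbhs_ballP[delta /= delta0 hd]; exists delta => // y yz.
  rewrite distrC; apply: hd; split=> // i j; rewrite (ord1 i) /ball/=.
  apply: le_lt_trans yz; rewrite distrC.
  by have := coord_le_enorm (y - z) j; rewrite !mxE.
pose dl := delta ^+ 2; have dl0 : 0 < dl by rewrite exprn_gt0.
have dl2 : 0 < dl / 2 by rewrite divr_gt0.
have s2 : 0 <= pz * Num.sqrt 2 ^+ d by rewrite mulr_ge0 ?exprn_ge0 ?sqrtr_ge0.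
have [B1 B11 H1] := tail_small dl0 e20 ler01.
have [B2 B21 H2] := tail_small dl2 e20 s2.
exists (Num.max B1 B2); first by rewrite le_max B11.
move=> b; rewrite ge_max => /andP[bB1 bB2].
have b1 : 1 <= b by lra.
have b0 : 0 < b by lra.
have n0 := nGau_gt0 b0; have ni := nGau_inv b1.
have b20 : 0 < b / 2 by rewrite divr_gt0.
have mG bb : measurable_fun setT (fun y : V => Gau bb (y - z)) by exact: measurable_Gau_shift.
have mp := measurable_p x t0.
have np : nnm (fun y : V => (p t x y)%:E) by split=> [|y]; [exact/measurable_EFinP|rewrite lee_fin p0].
have nG bb : nnm (fun y : V => (Gau bb (y - z))%:E).
  by split=> [|y]; [apply/measurable_EFinP; exact: mG|rewrite lee_fin Gau_ge0].
have up : (AG b t x c <= (nGau b * (pz + e))%:E)%E.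
  rewrite AG_density//.
  apply: (@le_trans _ _ (\int[mu]_y ((pz + e / 2)%:E * (Gau b (y - z))%:E + (expR (- (b * dl)))%:E * (p t x y)%:E)%E)%E).
    apply: ge0_le_integral => //.
    - by move=> y _; rewrite lee_fin mulr_ge0 ?p0 ?Gau_ge0.
    - by apply/measurable_EFinP; apply: measurable_funM => //; exact: mG.
    - by apply/measurable_EFinP; apply: measurable_funD; apply: measurable_funM.
    move=> y _; rewrite -!EFinM -EFinD lee_fin.
    have g0 := Gau_ge0 b (y - z); have py := p0 x y t0.
    have [yz|yz] := ltP (enorm (y - z)) delta.
      have := hd y yz; rewrite ltr_distl => /andP[_ h].
      have : p t x y * Gau b (y - z) <= (pz + e / 2) * Gau b (y - z) by rewrite ler_wpM2r// ltW.
      by have := mulr_ge0 (expR_ge0 (- (b * dl))) py; lra.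
    have : Gau b (y - z) <= expR (- (b * dl)).
      rewrite /Gau ler_expR lerN2 ler_pM2l// /dl -enorm_sqr ler_sqr// ?nnegrE ?enorm_ge0// ltW//.
    move=> h; have : p t x y * Gau b (y - z) <= p t x y * expR (- (b * dl)) by rewrite ler_wpM2l.
    have : 0 <= (pz + e / 2) * Gau b (y - z) by rewrite mulr_ge0// addr_ge0// ltW.
    by lra.
  rewrite ge0_integralD//; last 4 first.
  - by move=> y _; rewrite mule_ge0 ?lee_fin ?Gau_ge0// addr_ge0// ltW.
  - by apply: emeasurable_funM => //; exact/measurable_EFinP.
  - by move=> y _; rewrite mule_ge0 ?lee_fin ?expR_ge0 ?p0.
  - by apply: emeasurable_funM => //; exact/measurable_EFinP.
  rewrite (nnm_intZ mu _ (nG b)); last by rewrite lee_fin addr_ge0// ltW.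
  rewrite (nnm_intZ mu _ np); last by rewrite lee_fin expR_ge0.
  rewrite p_mass// mule1 integral_Gau_shift// -EFinM -EFinD lee_fin.
  have : expR (- (b * dl)) <= nGau b * (e / 2).
    rewrite -ler_pdivrMl//; apply: le_trans (H1 _ bB1); rewrite mul1r.
    by rewrite ler_wpM2r ?expR_ge0.
  by lra.
have nn : nGau (b / 2) = Num.sqrt 2 ^+ d * nGau b.
  rewrite /nGau -(exprMn_comm d (mulrC _ _)) -sqrtrM//; congr (Num.sqrt _ ^+ d); field.
  by rewrite gt_eqF.
have lo : ((nGau b * (pz - e / 2))%:E <= AG b t x c + (pz * expR (- (b * (dl / 2))) * nGau (b / 2))%:E)%E.
  have [pe|pe] := leP (pz - e / 2) 0.
    apply: (@le_trans _ _ 0%:E); first by rewrite lee_fin mulr_ge0_le0// ltW.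
    apply: adde_ge0; first by apply: integral_ge0 => w _; rewrite lee_fin Gau_ge0.
    by rewrite lee_fin !mulr_ge0 ?expR_ge0// ltW// nGau_gt0.
  rewrite AG_density// mulrC EFinM -(integral_Gau_shift z b0).
  rewrite EFinM -(integral_Gau_shift z b20).
  have pk : 0 <= pz * expR (- (b * (dl / 2))) by rewrite mulr_ge0 ?expR_ge0.
  rewrite -(nnm_intZ mu _ (nG b)) ?lee_fin ?(ltW pe)// -(nnm_intZ mu _ (nG (b / 2))) ?lee_fin//.
  rewrite -ge0_integralD//; last 4 first.
  - by move=> y _; rewrite lee_fin mulr_ge0 ?p0 ?Gau_ge0.
  - by apply/measurable_EFinP; apply: measurable_funM => //; exact: mG.
  - by move=> y _; rewrite mule_ge0 ?lee_fin ?Gau_ge0.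
  - by apply: emeasurable_funM => //; exact/measurable_EFinP.
  apply: ge0_le_integral => //.
  - by move=> y _; rewrite mule_ge0 ?lee_fin ?Gau_ge0// ltW.
  - by apply: emeasurable_funM => //; exact/measurable_EFinP.
  - apply: emeasurable_funD; first by apply/measurable_EFinP; apply: measurable_funM => //; exact: mG.
    by apply: emeasurable_funM => //; exact/measurable_EFinP.
  move=> y _; rewrite -!EFinM -EFinD lee_fin.
  have g0 := Gau_ge0 b (y - z); have g20 := Gau_ge0 (b / 2) (y - z); have py := p0 x y t0.
  have [yz|yz] := ltP (enorm (y - z)) delta.
    have := hd y yz; rewrite ltr_distl => /andP[h _].
    have : (pz - e / 2) * Gau b (y - z) <= p t x y * Gau b (y - z) by rewrite ler_wpM2r// ltW.
    by have := mulr_ge0 pk g20; lra.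
  have gg : Gau b (y - z) <= expR (- (b * (dl / 2))) * Gau (b / 2) (y - z).
    rewrite [X in Gau X _](splitr b) GauD ler_wpM2r//.
    rewrite /Gau ler_expR lerN2 (_ : b * (dl / 2) = b / 2 * dl); last by field.
    rewrite ler_pM2l// /dl -enorm_sqr ler_sqr// ?nnegrE ?enorm_ge0// ltW//.
  have : (pz - e / 2) * Gau b (y - z) <= pz * (expR (- (b * (dl / 2))) * Gau (b / 2) (y - z)).
    by apply: ler_pM => //; [exact: ltW|lra].
  by have := mulr_ge0 py g0; lra.
have A0 : (0 <= AG b t x c)%E by apply: integral_ge0 => w _; rewrite lee_fin Gau_ge0.
move: up lo A0; case: (AG b t x c) => [A| |]//; rewrite ?lee_fin -?EFinD ?lee_fin => up lo A0.
exists A; split=> //.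
have : pz * expR (- (b * (dl / 2))) * nGau (b / 2) <= nGau b * (e / 2).
  have -> : pz * expR (- (b * (dl / 2))) * nGau (b / 2) = nGau b * (pz * Num.sqrt 2 ^+ d * expR (- (b * (dl / 2)))).
    by rewrite nn; ring.
  rewrite ler_pM2l//; apply: le_trans (H2 _ bB2); rewrite ler_wpM2r ?expR_ge0//.
  by rewrite ler_peMr// exprn_ege1//; lra.
by lra.
Qed.

(** The Fourier side of [gaussian_fourier] depends on c but not on x and decreases in |c|, so the
    Gaussian means are ordered, and large b orders the densities. The starting points being
    arbitrary, translation invariance is included. *)
Theorem density_radial t x x' (c c' : 'rV[R]_d) : 0 < t -> dot c c <= dot c' c' ->
  p t x' (x' + c') <= p t x (x + c).
Proof.
move=> t0 cc; apply/ler_addgt0Pr => e e_gt0.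
have e20 : 0 < e / 2 by rewrite divr_gt0.
have [B1 B11 H1] := gauss_approx x c t0 e20.
have [B2 B21 H2] := gauss_approx x' c' t0 e20.
set b := Num.max B1 B2; have b1 : B1 <= b by rewrite le_max lexx.
have b2 : B2 <= b by rewrite le_max lexx orbT.
have b0 : 0 < b by lra.
have [psi [rpsi psiE]] := Psi_int (ltW t0).
have [A [AE Au _]] := H1 _ b1; have [A' [AE' _ Al]] := H2 _ b2.
have [bpsi mono] := rpsi.
have F1 := gaussian_fourier x c b0 (ltW t0) bpsi psiE.
have F2 := gaussian_fourier x' c' b0 (ltW t0) bpsi psiE.
have a0 : 0 < 1 / (4 * b) by rewrite divr_gt0// mulr_gt0.
have n1 := nGau_gt0 a0; have n0 := nGau_gt0 b0.
have := mono _ _ _ a0 cc; rewrite -lee_fin -F1 -F2 AE AE' -!EFinM lee_fin ler_pM2l// => AA.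
have : nGau b * (p t x' (x' + c') - e / 2) <= nGau b * (p t x (x + c) + e / 2) by lra.
by rewrite ler_pM2l//; lra.
Qed.

Lemma density_mono t x y x' y' : 0 < t -> enorm (x - y) <= enorm (x' - y') -> p t x' y' <= p t x y.
Proof.
move=> t0 h; have -> : y = x + (y - x) by rewrite addrC subrK.
have -> : y' = x' + (y' - x') by rewrite addrC subrK.
apply: density_radial => //; rewrite -!enorm_sqr ler_sqr ?nnegrE ?enorm_ge0//.
by rewrite enormB (enormB y').
Qed.

Lemma density_eq t x y x' y' : 0 < t -> enorm (x - y) = enorm (x' - y') -> p t x' y' = p t x y.
Proof. by move=> t0 h; apply/eqP; rewrite eq_le !density_mono// h. Qed.

(** A crude form of Fourier inversion: the factor (2 pi)^-d is dropped, being at most 1. *)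
Lemma density_le_integral t x y : 0 < t -> ((p t x y)%:E <= \int[mu]_xi (Psi t xi)%:E)%E.
Proof.
move=> t0; apply/lee_addgt0Pr => e e_gt0.
have -> : y = x + (y - x) by rewrite addrC subrK.
set c := y - x.
have [B B1 H] := gauss_approx x c t0 e_gt0.
have b0 : 0 < B by lra.
have [A [AE _ Al]] := H _ (lexx B).
have [psi [[bpsi _] psiE]] := Psi_int (ltW t0).
have F1 := gaussian_fourier x c b0 (ltW t0) bpsi psiE.
have a0 : 0 < 1 / (4 * B) by rewrite divr_gt0// mulr_gt0.
have n1 := nGau_gt0 a0; have n0 := nGau_gt0 b0.
have nn : 1 <= nGau (1 / (4 * B)) * nGau B.
  have E1 : Num.sqrt (pi / (1 / (4 * B))) * Num.sqrt (pi / B) = 2 * pi.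
    rewrite -sqrtrM; last by rewrite divr_ge0 ?pi_ge0 ?ltW.
    have -> : pi / (1 / (4 * B)) * (pi / B) = (2 * pi) ^+ 2 by field; rewrite gt_eqF.
    by rewrite sqrtr_sqr ger0_norm ?mulr_ge0 ?pi_ge0.
  rewrite /nGau -(exprMn_comm d (mulrC _ _)) E1 exprn_ege1//.
  by have := pi_ge2 R; lra.
have mPsi : measurable_fun setT (fun xi => (Psi t xi)%:E).
  have [mpsi _] := bpsi; apply/measurable_EFinP.
  rewrite (_ : Psi t = fun xi => psi xi + (1 - psi 0) * \1_[set (0 : V)] xi); last first.
    apply/funext => xi; rewrite indicE; have [->|xi0] := eqVneq xi 0.
      by rewrite mem_set// /Psi eqxx /= mulr1 addrC subrK.
    by rewrite memNset ?mulr0 ?addr0 ?psiE//; exact/eqP.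
  apply: measurable_funD => //; apply: measurable_funM => //.
  by apply: measurable_indic; exact: measurable_set1_rV.
have Psi0 xi : 0 <= Psi t xi by rewrite /Psi; case: ifP => // _; exact: expR_ge0.
have FB : ((Fint (1 / (4 * B)) c psi)%:E <= \int[mu]_xi (Psi t xi)%:E)%E.
  have iF := integrable_Fint c a0 bpsi.
  rewrite /Fint /Rintegral fineK; last exact: integrable_fin_num iF.
  apply: (le_trans (lee_abs _)); apply: (le_trans (le_abse_integral _ _ _)) => //.
    by case/integrableP: iF.
  rewrite [leRHS](_ : _ = \int[mu]_xi `|(psi xi)%:E|)%E; last first.
    apply: ae_eq_integral => //.
      by apply: measurableT_comp => //; apply/measurable_EFinP; case: bpsi.
    exists [set 0 : V]; split => //=; [exact: measurable_set1_rV|exact: lebesgueRd_set1|].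
    move=> xi /= h; apply: contrapT => xi0; apply: h => _; rewrite psiE; last exact/eqP.
    by rewrite ger0_norm.
  apply: ge0_le_integral => //.
  - by apply: measurableT_comp => //; case/integrableP: iF.
  - by apply: measurableT_comp => //; apply/measurable_EFinP; case: bpsi.
  move=> xi _ /=; rewrite lee_fin !normrM mulrA ler_piMl// -[leRHS]mul1r ler_pM//.
    by rewrite ger0_norm ?Gau_ge0// Gau_le1// ltW.
  exact: abs_cos_le1.
apply: le_trans (leeD2r e%:E FB); rewrite -EFinD lee_fin.
have F1' : Fint (1 / (4 * B)) c psi = nGau (1 / (4 * B)) * A by move: F1; rewrite AE -EFinM => -[].
have [pe|pe] := leP (p t x (x + c)) e.
  apply: (le_trans pe); rewrite lerDr F1' mulr_ge0// ?(ltW n1)//.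
  by rewrite -lee_fin -AE; apply: integral_ge0 => w _; rewrite lee_fin Gau_ge0.
rewrite F1' -lerBlDr; apply: (@le_trans _ _ (nGau (1 / (4 * B)) * (nGau B * (p t x (x + c) - e)))).
  by rewrite mulrA ler_peMl// subr_ge0 ltW.
by rewrite ler_pM2l.
Qed.

End law.

(** * Global scaling *)

Section phi_scaling.
Variables (R : realType) (phi : R -> R).
Hypothesis phi_gt0 : forall l, 0 < l -> 0 < phi l.

Record wscale (C alpha beta : R) : Prop := WScale {
  ws_C : 1 <= C ; ws_alpha : 0 < alpha ; ws_beta1 : beta < 1 ; ws_beta0 : 0 <= beta ;
  ws_ub : forall s s', 0 < s -> s <= s' -> phi s' <= C * (s' / s) `^ beta * phi s ;
  ws_lb : forall s s', 0 < s -> s <= s' -> (s' / s) `^ alpha * phi s <= C * phi s' }.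

Variables delta1 delta2 delta3 delta4 a1 a2 a3 a4 : R.
Hypotheses (delta12 : [/\ 0 < delta1, delta1 <= delta2 & delta2 < 1])
    (delta34 : [/\ 0 < delta3, delta3 <= delta4 & delta4 < 1])
    (a_gt0 : [/\ 0 < a1, 0 < a2, 0 < a3 & 0 < a4])
    (scaling_infty : forall l t : R, 1 <= l -> 1 <= t ->
       a1 * l `^ delta1 * phi t <= phi (l * t) <= a2 * l `^ delta2 * phi t)
    (scaling_zero : forall l t : R, 0 < l <= 1 -> 0 < t <= 1 ->
       a3 * l `^ delta4 * phi t <= phi (l * t) <= a4 * l `^ delta3 * phi t).

Let powV (l g : R) : 0 < l -> l `^ g * (l^-1) `^ g = 1.
Proof. by move=> l0; rewrite -powRM ?invr_ge0 ?ltW// mulfV ?gt_eqF// powR1. Qed.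

(** The hypotheses compare arguments on the same side of 1, below 1 with inverted ratios. Across 1
    two such bounds are chained through phi 1, after replacing the exponents by the weaker of the
    two. *)
Lemma wscaleP : exists C, wscale C (Num.min delta1 delta3) (Num.max delta2 delta4).
Proof.
have [d10 d12 d21] := delta12; have [d30 d34 d41] := delta34; have [a10 a20 a30 a40] := a_gt0.
set al := Num.min _ _; set be := Num.max _ _.
have hU1 s s' : 1 <= s -> s <= s' -> phi s' <= a2 * (s' / s) `^ be * phi s.
  move=> s1 ss'; have s0 : 0 < s by lra.
  have l1 : 1 <= s' / s by rewrite ler_pdivlMr ?mul1r.
  have /andP[_ h] := scaling_infty l1 s1; rewrite divfK ?gt_eqF// in h.
  apply: (le_trans h); rewrite ler_pM2r ?phi_gt0// ler_pM2l//.
  by apply: ler_powR => //; rewrite le_max lexx.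
have hL1 s s' : 1 <= s -> s <= s' -> (s' / s) `^ al * phi s <= a1^-1 * phi s'.
  move=> s1 ss'; have s0 : 0 < s by lra.
  have l1 : 1 <= s' / s by rewrite ler_pdivlMr ?mul1r.
  have /andP[h _] := scaling_infty l1 s1; rewrite divfK ?gt_eqF// in h.
  rewrite ler_pdivlMl//; apply: le_trans h; rewrite mulrA ler_pM2r ?phi_gt0// ler_pM2l//.
  by apply: ler_powR => //; rewrite ge_min lexx.
have hU0 s s' : 0 < s -> s <= s' -> s' <= 1 -> phi s' <= a3^-1 * (s' / s) `^ be * phi s.
  move=> s0 ss' s1; have s'0 : 0 < s' by lra.
  have l1 : 1 <= s' / s by rewrite ler_pdivlMr ?mul1r.
  have l2 : 0 < s / s' <= 1 by rewrite divr_gt0//= ler_pdivrMr ?mul1r.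
  have s'1 : 0 < s' <= 1 by rewrite s'0.
  have /andP[h _] := scaling_zero l2 s'1; rewrite divfK ?gt_eqF// in h.
  have e1 := powV delta4 (divr_gt0 s0 s'0); rewrite invf_div in e1.
  have p1 : 0 < (s' / s) `^ delta4 by rewrite powR_gt0// divr_gt0.
  rewrite -mulrA ler_pdivlMl//; apply: (@le_trans _ _ ((s' / s) `^ delta4 * phi s)).
    rewrite -[leLHS]mul1r -e1 (_ : _ * (a3 * phi s') = (s' / s) `^ delta4 * (a3 * (s / s') `^ delta4 * phi s')); last by ring.
    by rewrite ler_pM2l.
  by rewrite ler_pM2r ?phi_gt0//; apply: ler_powR => //; rewrite le_max lexx orbT.
have hL0 s s' : 0 < s -> s <= s' -> s' <= 1 -> (s' / s) `^ al * phi s <= a4 * phi s'.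
  move=> s0 ss' s1; have s'0 : 0 < s' by lra.
  have l1 : 1 <= s' / s by rewrite ler_pdivlMr ?mul1r.
  have l2 : 0 < s / s' <= 1 by rewrite divr_gt0//= ler_pdivrMr ?mul1r.
  have s'1 : 0 < s' <= 1 by rewrite s'0.
  have /andP[_ h] := scaling_zero l2 s'1; rewrite divfK ?gt_eqF// in h.
  have e1 := powV delta3 (divr_gt0 s0 s'0); rewrite invf_div in e1.
  have p1 : 0 < (s' / s) `^ delta3 by rewrite powR_gt0// divr_gt0.
  apply: (@le_trans _ _ ((s' / s) `^ delta3 * phi s)).
    by rewrite ler_pM2r ?phi_gt0//; apply: ler_powR => //; rewrite ge_min lexx orbT.
  rewrite -[leRHS]mul1r -e1 (_ : _ * (a4 * phi s') = (s' / s) `^ delta3 * (a4 * (s / s') `^ delta3 * phi s')); last by ring.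
  by rewrite ler_pM2l.
have pm (s s' g : R) : 0 < s -> 0 < s' -> (s' / s) `^ g = (s' / 1) `^ g * (1 / s) `^ g.
  by move=> s0 s'0; rewrite -powRM ?divr_ge0 ?ltW// divr1 mulrA mulr1.
pose CU := Num.max 1 a2 * Num.max 1 a3^-1; pose CL := Num.max 1 a1^-1 * Num.max 1 a4.
have m1 (a : R) : 1 <= Num.max 1 a by rewrite le_max lexx.
have ma (a : R) : a <= Num.max 1 a by rewrite le_max lexx orbT.
have cl (a b c y : R) : a <= b -> 0 <= c -> 0 <= y -> a * c * y <= b * c * y.
  by move=> ab c0 y0; rewrite !ler_wpM2r.
have CU1 : 1 <= CU by rewrite mulr_ege1.
have CL1 : 1 <= CL by rewrite mulr_ege1.
have CUa : a2 <= CU by rewrite (le_trans (ma a2))// ler_peMr// (le_trans ler01).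
have CUb : a3^-1 <= CU by rewrite (le_trans (ma a3^-1))// ler_peMl// (le_trans ler01).
have CLa : a1^-1 <= CL by rewrite (le_trans (ma a1^-1))// ler_peMr// (le_trans ler01).
have CLb : a4 <= CL by rewrite (le_trans (ma a4))// ler_peMl// (le_trans ler01).
have mx1 := m1.
exists (CU * CL); split.
- by rewrite mulr_ege1.
- by rewrite lt_min d10.
- by rewrite gt_max d21.
- by rewrite le_max (le_trans (ltW d10) d12).
- move=> s s' s0 ss'; have s'0 : 0 < s' by lra.
  apply: (@le_trans _ _ (CU * (s' / s) `^ be * phi s)); last first.
    by apply: cl; rewrite ?powR_ge0 ?(ltW (phi_gt0 _))// ler_peMr// (le_trans ler01).
  have ps := ltW (phi_gt0 s0).
  have [s1|s1] := leP 1 s; first by apply: (le_trans (hU1 _ _ s1 ss')); apply: cl; rewrite ?powR_ge0.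
  have [s'1|s'1] := leP s' 1.
    by apply: (le_trans (hU0 _ _ s0 ss' s'1)); apply: cl; rewrite ?powR_ge0.
  have h1 := hU1 1 s' (lexx 1) (ltW s'1); have h0 := hU0 s 1 s0 (ltW s1) (lexx 1).
  apply: (le_trans h1); rewrite (pm _ _ _ s0 s'0).
  have c0 : 0 <= a2 * (s' / 1) `^ be by rewrite mulr_ge0 ?powR_ge0// ltW.
  apply: (le_trans (ler_wpM2l c0 h0)).
  rewrite (_ : _ * (_ * _) = a2 * a3^-1 * ((s' / 1) `^ be * (1 / s) `^ be) * phi s); last by ring.
  apply: cl => //; last by rewrite mulr_ge0 ?powR_ge0.
  by apply: ler_pM => //; rewrite ?invr_ge0 ltW.
- move=> s s' s0 ss'; have s'0 : 0 < s' by lra.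
  have ps' := ltW (phi_gt0 s'0).
  apply: (@le_trans _ _ (CL * phi s')); last by rewrite ler_wpM2r// ler_peMl// (le_trans ler01).
  have [s1|s1] := leP 1 s; first by apply: (le_trans (hL1 _ _ s1 ss')); rewrite ler_wpM2r.
  have [s'1|s'1] := leP s' 1.
    by apply: (le_trans (hL0 _ _ s0 ss' s'1)); rewrite ler_wpM2r.
  have h1 := hL1 1 s' (lexx 1) (ltW s'1); have h0 := hL0 s 1 s0 (ltW s1) (lexx 1).
  rewrite (pm _ _ _ s0 s'0) -mulrA; apply: (le_trans (ler_wpM2l (powR_ge0 _ _) h0)).
  rewrite mulrCA; apply: (le_trans (ler_wpM2l (ltW a40) h1)); rewrite mulrA ler_wpM2r//.
  by rewrite mulrC; apply: ler_pM => //; rewrite ?invr_ge0 ltW.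
Qed.

End phi_scaling.

(** Up to constants, the rate at which the process makes displacements of size r. *)
Definition ph (R : realType) (phi : R -> R) (r : R) := phi (r ^- 2).

Section phi_consequences.
Variables (R : realType) (phi : R -> R) (C alpha beta : R).
Hypothesis phi_gt0 : forall l, 0 < l -> 0 < phi l.
Hypothesis W : wscale phi C alpha beta.

Local Notation ph := (ph phi).

Lemma phi_le s s' : 0 < s -> s <= s' -> phi s <= C * phi s'.
Proof.
move=> s0 ss'; have [_ a0 _ _ _ h] := W; apply: le_trans (h _ _ s0 ss').
rewrite ler_peMl ?(ltW (phi_gt0 _))//.
rewrite -(powRr0 (s' / s)); apply: ler_powR; last exact: ltW.
by rewrite ler_pdivlMr ?mul1r.
Qed.

Lemma phi_lin s s' : 0 < s -> s <= s' -> phi s' <= C * (s' / s) * phi s.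
Proof.
move=> s0 ss'; have [C1 a0 b1 b0 h _] := W; apply: (le_trans (h _ _ s0 ss')).
rewrite ler_pM2r ?phi_gt0// ler_pM2l; last by lra.
by apply: ler1_powR; [rewrite ler_pdivlMr ?mul1r|exact: ltW].
Qed.

Lemma phi_lin1 a s : 0 < a -> 0 < s -> phi s <= C * phi a * (1 + s / a).
Proof.
move=> a0 s0; have [C1 _ _ _ _ _] := W; have pa := phi_gt0 a0.
have c0 : 0 < C by lra.
have cp : 0 <= C * phi a by rewrite mulr_ge0// ltW.
have sa : 0 <= s / a by rewrite divr_ge0 ?ltW.
have [h|h] := leP s a.
  by apply: (le_trans (phi_le s0 h)); rewrite ler_peMr// lerDl.
apply: (le_trans (phi_lin a0 (ltW h))); rewrite mulrAC ler_wpM2l// lerDr//.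
Qed.

Lemma ph_gt0 r : 0 < r -> 0 < ph r.
Proof. by move=> r0; apply: phi_gt0; rewrite invr_gt0 exprn_gt0. Qed.

Lemma ph_dec r s : 0 < r -> r <= s -> ph s <= C * ph r.
Proof.
move=> r0 rs; have s0 : 0 < s by lra.
apply: phi_le; first by rewrite invr_gt0 exprn_gt0.
by rewrite lef_pV2 ?posrE ?exprn_gt0// lerXn2r ?nnegrE// ltW.
Qed.

Lemma ph_dbl r s : 0 < r -> r <= s -> ph r <= C * (s / r) ^+ 2 * ph s.
Proof.
move=> r0 rs; have s0 : 0 < s by lra.
have -> : (s / r) ^+ 2 = r ^- 2 / s ^- 2 by rewrite expr_div_n invrK mulrC.
apply: phi_lin; first by rewrite invr_gt0 exprn_gt0.
by rewrite lef_pV2 ?posrE ?exprn_gt0// lerXn2r ?nnegrE// ltW.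
Qed.

Lemma powR_big (g k : R) : 0 < g -> exists2 A, 1 <= A & k <= A `^ g.
Proof.
move=> g0; pose k1 := Num.max 1 k.
have k11 : 1 <= k1 by rewrite le_max lexx.
exists (k1 `^ g^-1).
  by rewrite -(powRr0 k1); apply: ler_powR => //; rewrite invr_ge0 ltW.
by rewrite -powRrM mulVf ?gt_eqF// powRr1 ?le_max ?ler01// lexx orbT.
Qed.

End phi_consequences.

(** * Heat kernel bounds *)

Section bounds.
Context (R : realType) (d : nat) (disp : measure_display) (Omega : measurableType disp).
Variables (P : 'rV[R]_d -> probability Omega R) (X : R -> Omega -> 'rV[R]_d).
Variables (phi : R -> R) (p : R -> 'rV[R]_d -> 'rV[R]_d -> R).
Hypothesis d0 : (0 < d)%N.
Hypothesis phi_gt0 : forall l, 0 < l -> 0 < phi l.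
Hypothesis phi_cbf : complete_bernstein phi.
Hypothesis X_levy : levy_process P X.
Hypothesis X_exponent : has_characteristic_exponent P X phi.
Hypothesis p_density : transition_density P X p.
Variables (C alpha beta : R).
Hypothesis W : wscale phi C alpha beta.
Local Notation V := (borelRd R d).
Local Notation mu := (@lebesgueRd R d).
Local Notation ph := (ph phi).

Let p0 := density_ge0 p_density.
Let C1 : 1 <= C := ws_C W.
Let C0 : 0 < C := lt_le_trans ltr01 C1.
Let mp t x (t0 : 0 < t) := measurable_p p_density x t0.

Lemma one_sub_exp_ge (u : R) : 0 <= u -> u / (1 + u) <= 1 - expR (- u).
Proof.
move=> u0; have h := expR_ge1Dx u; have e0 := expR_gt0 u.
have u1 : 0 < 1 + u by lra.
rewrite expRN lerBrDr -lerBrDl; have -> : 1 - u / (1 + u) = (1 + u)^-1 by field; rewrite gt_eqF.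
by rewrite lef_pV2.
Qed.

Lemma min1_le_exp (u : R) : 0 <= u -> Num.min 1 u <= 2 * (1 - expR (- u)).
Proof.
move=> u0; have h := one_sub_exp_ge u0.
have u1 : 0 < 1 + u by lra.
apply: (@le_trans _ _ (2 * (u / (1 + u)))); last by rewrite ler_pM2l.
rewrite mulrA ler_pdivlMr//; have [h1|h1] := leP 1 u; [lra|nra].
Qed.

Lemma Psi_ge0 t (xi : V) : 0 <= Psi phi t xi.
Proof. by rewrite /Psi; case: ifP => // _; exact: expR_ge0. Qed.

Lemma measurable_Psi t : 0 <= t -> measurable_fun setT (Psi phi t : V -> R).
Proof.
move=> t0; have [psi [[[mpsi _] _] psiE]] := Psi_int d phi_cbf t0.
rewrite (_ : Psi phi t = fun xi => psi xi + (1 - psi 0) * \1_[set (0 : V)] xi); last first.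
  apply/funext => xi; rewrite indicE; have [->|xi0] := eqVneq xi 0.
    by rewrite mem_set// /Psi eqxx /= mulr1 addrC subrK.
  by rewrite memNset ?mulr0 ?addr0 ?psiE//; exact/eqP.
apply: measurable_funD => //; apply: measurable_funM => //.
by apply: measurable_indic; exact: measurable_set1_rV.
Qed.

Lemma Psi_le1 t (xi : V) : 0 <= t -> Psi phi t xi <= 1.
Proof.
move=> t0; rewrite /Psi; case: ifPn => // xi0; rewrite -expR0 ler_expR oppr_le0 mulr_ge0//.
by rewrite ltW// phi_gt0// dot_gt0.
Qed.

(* Both sides equal the Gaussian average of [1 - exp(-t phi(|xi|^2))]. *)
Lemma moment_fourier t x a : 0 < t -> 0 < a ->
  ((nGau d (1 / (4 * a)))%:E * \int[mu]_y (p t x y * (1 - Gau a (y - x)))%:E =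
  \int[mu]_xi (Gau (1 / (4 * a)) xi * (1 - Psi phi t xi))%:E)%E.
Proof.
move=> t0 a0; set b := 1 / (4 * a).
have b0 : 0 < b by rewrite divr_gt0// mulr_gt0.
have n0 := nGau_gt0 d b0; have t0' := ltW t0.
have [psi [[bpsi _] psiE]] := Psi_int d phi_cbf t0'.
have F := gaussian_fourier d0 X_levy X_exponent x 0 a0 t0' bpsi psiE.
rewrite (AG_density X_levy p_density x 0 t0 a0) -/b in F.
have iG := integrable_Gau d b0; have iF := integrable_Fint 0 b0 bpsi.
have mG : measurable_fun setT (fun y : V => Gau a (y - x)) by exact: measurable_Gau_shift.
have mps := measurable_Psi t0'.
have g1 (y : V) : 0 <= 1 - Gau a (y - x) by rewrite subr_ge0 Gau_le1// ltW.
have gi0 (xi : V) : 0 <= 1 - Psi phi t xi by rewrite subr_ge0 Psi_le1.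
have EA : (\int[mu]_y (p t x y * (1 - Gau a (y - x)))%:E + \int[mu]_y (p t x y * Gau a (y - (x + 0)))%:E = 1)%E.
  rewrite -(p_mass p_density x t0) -ge0_integralD//.
  - by apply: eq_integral => y _; rewrite addr0 -EFinD; congr EFin; ring.
  - by move=> y _; rewrite lee_fin mulr_ge0 ?p0.
  - apply/measurable_EFinP; apply: measurable_funM; first exact: mp.
    by apply: measurable_funB => //; exact: mG.
  - by move=> y _; rewrite lee_fin mulr_ge0 ?p0 ?Gau_ge0.
  - by apply/measurable_EFinP; apply: measurable_funM; [exact: mp|rewrite addr0; exact: mG].
have FE : ((Fint b 0 psi)%:E = \int[mu]_xi (Gau b xi * Psi phi t xi)%:E)%E.
  rewrite /Fint /Rintegral fineK; last exact: integrable_fin_num iF.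
  apply: ae_eq_integral => //.
  - by case/integrableP: iF.
  - by apply/measurable_EFinP; apply: measurable_funM => //; exact: measurable_Gau.
  exists [set 0 : V]; split => //=; [exact: measurable_set1_rV|exact: lebesgueRd_set1|].
  move=> xi /= h; apply: contrapT => xi0; apply: h => _; rewrite psiE; last exact/eqP.
  by rewrite dotC /dot big1 ?cos0 ?mul1r// => i _; rewrite mxE mul0r.
have EB : (\int[mu]_xi (Gau b xi * (1 - Psi phi t xi))%:E + \int[mu]_xi (Gau b xi * Psi phi t xi)%:E = (nGau d b)%:E)%E.
  rewrite -(integral_Gau d b0) -ge0_integralD//.
  - by apply: eq_integral => y _; rewrite -EFinD; congr EFin; ring.
  - by move=> y _; rewrite lee_fin mulr_ge0 ?Gau_ge0.
  - apply/measurable_EFinP; apply: measurable_funM; first exact: measurable_Gau.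
    by apply: measurable_funB => //; exact: mps.
  - by move=> y _; rewrite lee_fin mulr_ge0 ?Gau_ge0 ?Psi_ge0.
  - by apply/measurable_EFinP; apply: measurable_funM => //; exact: measurable_Gau.
rewrite -FE -F in EB.
have I1 : (0 <= \int[mu]_y (p t x y * (1 - Gau a (y - x)))%:E)%E.
  by apply: integral_ge0 => y _; rewrite lee_fin mulr_ge0 ?p0.
have I2 : (0 <= \int[mu]_y (p t x y * Gau a (y - (x + 0)))%:E)%E.
  by apply: integral_ge0 => y _; rewrite lee_fin mulr_ge0 ?p0 ?Gau_ge0.
have I3 : (0 <= \int[mu]_xi (Gau b xi * (1 - Psi phi t xi))%:E)%E.
  by apply: integral_ge0 => y _; rewrite lee_fin mulr_ge0 ?Gau_ge0.
move: EA EB I1 I2 I3; case: (\int[mu]_y (p t x y * (1 - Gau a (y - x)))%:E)%E => [A1| |]//;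
  case: (\int[mu]_y (p t x y * Gau a (y - (x + 0)))%:E)%E => [A2| |]//;
  case: (\int[mu]_xi (Gau b xi * (1 - Psi phi t xi))%:E)%E => [A3| |]//.
by rewrite -!EFinM -!EFinD => -[EA] [EB] _ _ _; congr EFin; rewrite -EB -(mulr1 (nGau d b)) in EA *; nra.
Qed.

Definition Kup := C * (1 + 8 * Num.sqrt 2 ^+ d).

Lemma Kup_gt0 : 0 < Kup.
Proof. by rewrite mulr_gt0// ltr_pwDl// mulr_ge0// exprn_ge0// sqrtr_ge0. Qed.

(** With s = |xi|^2, 1 - Psi is at most t phi(s), hence by [phi_lin1] at most C t phi(a) (1 + s/a).
    The factor s/a is at most 8 exp(s/(8 a)), which half of the Gaussian absorbs; the wider Gaussian
    costs the factor 2^(d/2) in [Kup]. *)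
Lemma moment_up t x a : 0 < t -> 0 < a ->
  (\int[mu]_y (p t x y * (1 - Gau a (y - x)))%:E <= (Kup * (t * phi a))%:E)%E.
Proof.
move=> t0 a0; have F := moment_fourier x t0 a0; set b := 1 / (4 * a) in F *.
have b0 : 0 < b by rewrite divr_gt0// mulr_gt0.
have b20 : 0 < b / 2 by rewrite divr_gt0.
have n0 := nGau_gt0 d b0; have t0' := ltW t0; have pa := phi_gt0 a0.
rewrite -(@lee_pmul2l _ (nGau d b)%:E)// ?lte_fin// F.
have k0 : 0 <= C * (t * phi a) by rewrite !mulr_ge0// ltW.
have nG bb : nnm (fun y : V => (Gau bb y)%:E).
  by split=> [|y]; [apply/measurable_EFinP; exact: measurable_Gau|rewrite lee_fin Gau_ge0].
have n8 := nnmZ (ler0n R 8) (nG (b / 2)).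
apply: (@le_trans _ _ (\int[mu]_xi ((C * (t * phi a))%:E * ((Gau b xi)%:E + 8%:E * (Gau (b / 2) xi)%:E)))%E).
  have [m1 m2] := nnmZ k0 (nnmD (nG b) n8).
  apply: ge0_le_integral => //.
  - by move=> xi _; rewrite lee_fin mulr_ge0 ?Gau_ge0// subr_ge0 Psi_le1.
  - apply/measurable_EFinP; apply: measurable_funM; first exact: measurable_Gau.
    by apply: measurable_funB => //; exact: measurable_Psi.
  move=> xi _; rewrite -[X in (_ <= X)%E]/((C * (t * phi a) * (Gau b xi + 8 * Gau (b / 2) xi))%:E) lee_fin.
  have g0 := Gau_ge0 b xi; have g20 := Gau_ge0 (b / 2) xi.
  have [->|xi0] := eqVneq xi 0.
    by rewrite /Psi eqxx subrr mulr0 mulr_ge0// addr_ge0 ?mulr_ge0// Gau_ge0.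
  set s := dot xi xi; have s0 : 0 < s by rewrite dot_gt0.
  have h1 : 1 - Psi phi t xi <= C * (t * phi a) * (1 + s / a).
    rewrite /Psi ifN//; have := expR_ge1Dx (- (t * phi s)); rewrite -/s => h.
    apply: (@le_trans _ _ (t * phi s)); first by lra.
    have -> : C * (t * phi a) * (1 + s / a) = t * (C * phi a * (1 + s / a)) by ring.
    by rewrite ler_pM2l//; exact: (phi_lin1 phi_gt0 W).
  apply: (le_trans (ler_wpM2l g0 h1)); rewrite mulrCA; apply: ler_wpM2l => //.
  rewrite mulrDr mulr1 lerD2l.
  have e1 : s / (8 * a) <= expR (s / (8 * a)) by have := expR_ge1Dx (s / (8 * a)); lra.
  have GE : Gau b xi = Gau (b / 2) xi * Gau (b / 2) xi by rewrite {1}(splitr b) GauD.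
  have G2 : Gau (b / 2) xi = (expR (s / (8 * a)))^-1.
    by rewrite /Gau -expRN -/s; congr (expR (- _)); rewrite /b; field; rewrite gt_eqF.
  rewrite GE -mulrA mulrCA mulrC ler_wpM2r//.
  rewrite G2 (_ : s * (_ / a) = s / a / expR (s / (8 * a))); last by ring.
  rewrite ler_pdivrMr ?expR_gt0//.
  have -> : s / a = 8 * (s / (8 * a)) by field; rewrite gt_eqF.
  by lra.
rewrite (nnm_intZ mu _ (nnmD (nG b) n8)) ?lee_fin// ge0_integralD//; last 4 first.
- by move=> xi _; case: (nG b).
- by case: (nG b).
- by move=> xi _; case: n8.
- by case: n8.
rewrite (nnm_intZ mu _ (nG (b / 2)))// !integral_Gau//.
rewrite -[X in (X <= _)%E]/((C * (t * phi a) * (Num.sqrt (pi / b) ^+ d + 8 * Num.sqrt (pi / (b / 2)) ^+ d))%:E) lee_fin.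
have nn : Num.sqrt (pi / (b / 2)) ^+ d = Num.sqrt 2 ^+ d * nGau d b.
  rewrite /nGau -(exprMn_comm d (mulrC _ _)) -sqrtrM//; congr (Num.sqrt _ ^+ d); field.
  by rewrite gt_eqF.
rewrite nn -/(nGau d b) le_eqVlt; apply/orP; left; apply/eqP; rewrite /Kup /nGau; ring.
Qed.

Definition Klo := expR (-1) / (4 * d.+1%:R * Num.sqrt pi) ^+ d / (C * (1 + C)).

Lemma Klo_gt0 : 0 < Klo.
Proof.
rewrite /Klo; apply: divr_gt0; last by rewrite mulr_gt0// addr_gt0.
by rewrite divr_gt0 ?expR_gt0// exprn_gt0// mulr_gt0 ?sqrtr_gt0 ?pi_gt0// mulr_gt0.
Qed.

(** Only the shell sqrt a <= |xi| < 2 sqrt a is kept: there the Gaussian is at least 1/e, phi is at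
    least phi(a)/C, and t phi(a) <= C keeps the bound u/(1 + u) for 1 - exp(-u) of order u. *)
Lemma moment_lo t x a : 0 < t -> 0 < a -> t * phi a <= C ->
  ((Klo * (t * phi a))%:E <= \int[mu]_y (p t x y * (1 - Gau a (y - x)))%:E)%E.
Proof.
move=> t0 a0 ta; have F := moment_fourier x t0 a0; set b := 1 / (4 * a) in F *.
have b0 : 0 < b by rewrite divr_gt0// mulr_gt0.
have n0 := nGau_gt0 d b0; have t0' := ltW t0; have pa := phi_gt0 a0.
rewrite -(@lee_pmul2l _ (nGau d b)%:E)// ?lte_fin// F.
pose sa := Num.sqrt a; have sa0 : 0 < sa by rewrite sqrtr_gt0.
have saE : sa ^+ 2 = a by rewrite sqr_sqrtr// ltW.
pose r := 2 * sa; have r0 : 0 < r by rewrite mulr_gt0.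
pose Sh := ([set y : 'rV[R]_d | r / 2 <= enorm y] `&` eball (0 : 'rV[R]_d) r : set V).
have mSh : measurable Sh by apply: measurableI; [exact: measurable_enorm_ge|exact: measurable_eball].
pose i0 : 'I_d := Ordinal d0.
pose e : 'rV[R]_d := (3 / 4 * r) *: delta_mx 0 i0.
have ee : enorm e = 3 / 4 * r.
  rewrite /enorm /e dotZl dotZr mulrA -expr2.
  have -> : dot (delta_mx 0 i0 : 'rV[R]_d) (delta_mx 0 i0) = 1.
    rewrite /dot (bigD1 i0)//= big1 ?addr0; first by rewrite !mxE !eqxx mulr1.
    by move=> i /negPf ii; rewrite !mxE ii andbF mul0r.
  by rewrite mulr1 sqrtr_sqr ger0_norm// mulr_ge0 ?divr_ge0// ltW.
have vol := lebesgue_shell_lb r0 ee.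
pose u := t * phi a / C; have u0 : 0 < u by rewrite divr_gt0// mulr_gt0.
pose k := expR (-1) * (u / (1 + C)).
have k0 : 0 <= k by rewrite mulr_ge0 ?expR_ge0// divr_ge0 ?(ltW u0)// addr_ge0// ltW.
apply: (@le_trans _ _ (\int[mu]_(xi in Sh) k%:E)%E).
  rewrite integral_cst//; apply: (@le_trans _ _ (k%:E * ((r / (4 * d.+1%:R)) ^+ d)%:E)%E); last first.
    by apply: lee_wpmul2l => //; rewrite lee_fin.
  rewrite -EFinM lee_fin le_eqVlt; apply/orP; left; apply/eqP.
  have -> : nGau d b = (r * Num.sqrt pi) ^+ d.
    rewrite /nGau; congr (_ ^+ d); rewrite /b.
    have -> : pi / (1 / (4 * a)) = (2 * sa) ^+ 2 * pi by rewrite exprMn saE; field; rewrite gt_eqF.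
    by rewrite sqrtrM ?sqr_ge0// sqrtr_sqr ger0_norm// ltW.
  rewrite /k /u /Klo !(exprMn_comm d (mulrC _ _)) !exprVn !(exprMn_comm d (mulrC _ _)) invfM.
  have dn : (d.+1%:R : R) ^+ d != 0 by rewrite expf_neq0// pnatr_eq0.
  have sp : Num.sqrt pi ^+ d != 0 :> R by rewrite expf_neq0// gt_eqF// sqrtr_gt0 pi_gt0.
  by field; rewrite dn sp !gt_eqF// ?exprn_gt0// addr_gt0.
apply: (@le_trans _ _ (\int[mu]_(xi in Sh) (Gau b xi * (1 - Psi phi t xi))%:E)%E); last first.
  apply: ge0_subset_integral => //.
  - apply/measurable_EFinP; apply: measurable_funM; first exact: measurable_Gau.
    by apply: measurable_funB => //; exact: measurable_Psi.
  - by move=> xi _; rewrite lee_fin mulr_ge0 ?Gau_ge0// subr_ge0 Psi_le1.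
apply: ge0_le_integral => //.
- apply: measurable_funTS; apply/measurable_EFinP; apply: measurable_funM; first exact: measurable_Gau.
  by apply: measurable_funB => //; exact: measurable_Psi.
move=> xi [/= xr]; rewrite /eball/= subr0 => xr'.
have xi_gt0 : 0 < enorm xi by apply: lt_le_trans xr; rewrite divr_gt0.
have xi0 : xi != 0 by apply: contraTneq xi_gt0 => ->; rewrite enorm0 ltxx.
have s1 : a <= dot xi xi.
  rewrite -saE -enorm_sqr ler_sqr ?nnegrE ?enorm_ge0 ?(ltW sa0)//.
  by apply: le_trans xr; rewrite /r; lra.
have s2 : dot xi xi <= 4 * a.
  rewrite -saE -enorm_sqr (_ : 4 * sa ^+ 2 = r ^+ 2); last by rewrite /r; ring.
  by rewrite ler_sqr ?nnegrE ?enorm_ge0 ?(ltW r0)// ltW.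
rewrite lee_fin /k; apply: ler_pM; rewrite ?expR_ge0//.
- by rewrite divr_ge0 ?(ltW u0)// addr_ge0// ltW.
- by rewrite /Gau ler_expR lerN2 /b mul1r ler_pdivrMl ?mulr1// mulr_gt0.
rewrite /Psi ifN//; set v := t * phi (dot xi xi).
have uv : u <= v.
  rewrite /u /v ler_pdivrMr// -mulrA ler_pM2l// mulrC.
  exact: (phi_le phi_gt0 W).
have v0 : 0 <= v by apply: le_trans uv; exact: ltW.
apply: (@le_trans _ _ (u / (1 + u))).
  rewrite ler_pM2l// lef_pV2 ?posrE ?addr_gt0// lerD2l.
  by rewrite /u ler_pdivrMr// (le_trans ta)// ler_peMl// ltW.
apply: (le_trans (one_sub_exp_ge (ltW u0))).
by rewrite lerD2l lerN2 ler_expR lerN2.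
Qed.

Lemma measurable_min2 x s : measurable_fun setT (fun y : V => Num.min 1 (enorm (x - y) ^+ 2 / s ^+ 2)).
Proof.
apply: measurable_minr => //; apply: measurable_funM => //; apply: measurable_funX.
by apply: measurable_enorm; apply: measurable_rowB => //; exact: measurable_cst.
Qed.

Lemma min2_ge0 (x y : 'rV[R]_d) s : 0 <= Num.min 1 (enorm (x - y) ^+ 2 / s ^+ 2).
Proof. by rewrite le_min ler01 divr_ge0 ?sqr_ge0. Qed.

Lemma moment_min t x s : 0 < t -> 0 < s ->
  (\int[mu]_y (p t x y * Num.min 1 (enorm (x - y) ^+ 2 / s ^+ 2))%:E <= (2 * Kup * (t * ph s))%:E)%E.
Proof.
move=> t0 s0; have a0 : 0 < s ^- 2 by rewrite invr_gt0 exprn_gt0.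
have mG : measurable_fun setT (fun y : V => Gau (s ^- 2) (y - x)) by exact: measurable_Gau_shift.
have g1 (y : V) : 0 <= 1 - Gau (s ^- 2) (y - x) by rewrite subr_ge0 Gau_le1// ltW.
have m1 : measurable_fun setT (fun y : V => p t x y * (1 - Gau (s ^- 2) (y - x))).
  by apply: measurable_funM; [exact: mp|apply: measurable_funB => //; exact: mG].
have n1 : nnm (fun y : V => (p t x y * (1 - Gau (s ^- 2) (y - x)))%:E).
  by split=> [|y]; [exact/measurable_EFinP|rewrite lee_fin mulr_ge0 ?p0].
apply: (@le_trans _ _ (\int[mu]_y (2%:E * (p t x y * (1 - Gau (s ^- 2) (y - x)))%:E))%E).
  apply: ge0_le_integral => //.
  - by move=> y _; rewrite lee_fin mulr_ge0 ?p0 ?min2_ge0.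
  - apply/measurable_EFinP; apply: measurable_funM; first exact: mp.
    exact: measurable_min2.
  - by have [] := nnmZ (ler0n R 2) n1.
  move=> y _; rewrite -EFinM lee_fin mulrCA ler_wpM2l ?p0//.
  apply: (le_trans (min1_le_exp _)); first by rewrite divr_ge0 ?sqr_ge0.
  rewrite ler_pM2l// lerD2l lerN2 /Gau ler_expR lerN2 enormB enorm_sqr.
  by rewrite mulrC.
rewrite (nnm_intZ mu _ n1)// -mulrA EFinM; apply: lee_wpmul2l => //.
exact: moment_up.
Qed.

Lemma tail_bound t x r : 0 < t -> 0 < r ->
  (\int[mu]_(y in [set y : V | (r <= enorm (x - y)%R)%R]) (p t x y)%:E <= (2 * Kup * (t * ph r))%:E)%E.
Proof.
move=> t0 r0; apply: le_trans (moment_min x t0 r0).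
have mS : measurable ([set y : V | (r <= enorm (x - y)%R)%R]).
  have me : measurable_fun setT (fun y : V => enorm (x - y)).
    by apply: measurable_enorm; apply: measurable_rowB => //; exact: measurable_cst.
  have := me measurableT _ (measurable_itv `[r, +oo[); rewrite setTI.
  by congr measurable; apply/seteqP; split => y /=; rewrite in_itv/= andbT.
have m1 : measurable_fun setT (fun y : V => (p t x y * Num.min 1 (enorm (x - y) ^+ 2 / r ^+ 2))%:E).
  apply/measurable_EFinP; apply: measurable_funM; first exact: mp.
  exact: measurable_min2.
apply: (@le_trans _ _ (\int[mu]_(y in [set y : V | (r <= enorm (x - y)%R)%R]) (p t x y * Num.min 1 (enorm (x - y) ^+ 2 / r ^+ 2))%:E)%E).
  apply: ge0_le_integral => //.
  - by move=> y _; rewrite lee_fin p0.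
  - by apply: measurable_funTS; apply/measurable_EFinP; exact: mp.
  - exact: measurable_funTS.
  move=> y /= ry; rewrite lee_fin ler_peMr ?p0// le_min lexx/= ler_pdivlMr ?exprn_gt0// mul1r.
  by rewrite ler_sqr ?nnegrE ?enorm_ge0// ltW.
apply: ge0_subset_integral => // y _.
by rewrite lee_fin mulr_ge0 ?p0 ?min2_ge0.
Qed.

Lemma density_shift t x y : 0 < t -> p t x y = p t 0 (x - y).
Proof.
move=> t0; apply: (density_eq d0 phi_cbf X_levy X_exponent p_density) => //.
by rewrite sub0r enormN.
Qed.

Lemma density_sym t x y : 0 < t -> p t x y = p t y x.
Proof.
by move=> t0; apply: (density_eq d0 phi_cbf X_levy X_exponent p_density) => //; rewrite enormB.
Qed.

Definition K1 := 8 * Kup * C * (4 * d.+1%:R) ^+ d.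

(** Monotonicity turns a tail into a pointwise bound: p at distance r is at most its mean over the
    shell from r/2 to r, whose mass is at most the tail at r/2. *)
Lemma density_ub t x y : 0 < t -> x != y -> p t x y <= K1 * (t * (ph (enorm (x - y)) / enorm (x - y) ^+ d)).
Proof.
move=> t0 xy; rewrite density_shift//; set z := x - y; set r := enorm z.
have r0 : 0 < r by apply: enorm_gt0; rewrite subr_eq0.
have r20 : 0 < r / 2 by rewrite divr_gt0.
pose e := (3 / 4) *: z; have ee : enorm e = 3 / 4 * r.
  by rewrite /enorm /e dotZl dotZr mulrA -expr2 sqrtrM ?sqr_ge0// sqrtr_sqr ger0_norm.
have vol := lebesgue_shell_lb r0 ee.
pose Sh := ([set y : 'rV[R]_d | r / 2 <= enorm y] `&` eball (0 : 'rV[R]_d) r : set V).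
have mS2 : measurable ([set y : V | r / 2 <= enorm (0 - y)]).
  by under eq_set do rewrite sub0r enormN; exact: measurable_enorm_ge.
have mSh : measurable Sh by apply: measurableI; [exact: measurable_enorm_ge|exact: measurable_eball].
have T := tail_bound 0 t0 r20.
have h1 : ((p t 0 z)%:E * ((r / (4 * d.+1%:R)) ^+ d)%:E <= (2 * Kup * (t * ph (r / 2)))%:E)%E.
  apply: le_trans T; apply: (@le_trans _ _ (\int[mu]_(y in Sh) (p t 0 z)%:E)%E).
    by rewrite integral_cst//; apply: lee_wpmul2l => //; rewrite lee_fin p0.
  apply: (@le_trans _ _ (\int[mu]_(y in Sh) (p t 0 y)%:E)%E).
    apply: ge0_le_integral => //.
    - by move=> w _; rewrite lee_fin p0.
    - by apply: measurable_funTS; apply/measurable_EFinP; exact: mp.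
    move=> w [_]; rewrite /eball/= subr0 => wr; rewrite lee_fin.
    by apply: (density_mono d0 phi_cbf X_levy X_exponent p_density) => //; rewrite !sub0r !enormN ltW.
  apply: ge0_subset_integral => //.
  - by apply: measurable_funTS; apply/measurable_EFinP; exact: mp.
  - by move=> w _; rewrite lee_fin p0.
  by move=> w [/= h _]; rewrite sub0r enormN.
move: h1; rewrite -EFinM lee_fin => h1.
have hd : ph (r / 2) <= C * 4 * ph r.
  have r2r : r / 2 <= r by rewrite ler_pdivrMr// ler_peMr ?ler1n// ltW.
  have := ph_dbl phi_gt0 W r20 r2r; rewrite (_ : (r / (r / 2)) ^+ 2 = 4)//.
  by field; rewrite gt_eqF.
have K0 := Kup_gt0.
have dn : (0 : R) < (4 * d.+1%:R) ^+ d by rewrite exprn_gt0// mulr_gt0.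
have rd : 0 < r ^+ d by rewrite exprn_gt0.
have h2 : p t 0 z * (r / (4 * d.+1%:R)) ^+ d <= 8 * Kup * C * (t * ph r).
  apply: (le_trans h1); rewrite (_ : 8 * Kup * C * (t * ph r) = 2 * Kup * (t * (C * 4 * ph r))); last by ring.
  by rewrite ler_pM2l ?mulr_gt0// ler_pM2l.
rewrite /K1 (_ : 8 * Kup * C * _ * _ = (8 * Kup * C * (t * ph r)) / (r / (4 * d.+1%:R)) ^+ d); last first.
  by rewrite expr_div_n; field; rewrite !gt_eqF.
by rewrite ler_pdivlMr// exprn_gt0// divr_gt0// mulr_gt0.
Qed.

(** The moment at scale A r is at least a multiple of A^(-2 beta) t ph r. The part |w| < r
    contributes at most a multiple of A^-2 t ph r, no more than half of it since beta < 1 and A is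
    large; the part |w| >= L r is small since alpha > 0 and L is large. What remains sits in the
    shell from r to L r, where p is at most its value at distance r. *)
Lemma density_lb : exists2 K, 1 <= K & forall t x y, 0 < t -> x != y -> t * ph (enorm (x - y)) <= 1 ->
  t * (ph (enorm (x - y)) / enorm (x - y) ^+ d) <= K * p t x y.
Proof.
have K0 := Kup_gt0; have L0 := Klo_gt0.
have b1 : 0 < 2 - 2 * beta by have := ws_beta1 W; lra.
pose c := Klo / C; have c0 : 0 < c by rewrite divr_gt0.
have [A A1 hA] := powR_big (4 * Kup / c) b1.
have A0 : 0 < A by lra.
pose c2 := c / 2 * A `^ (- (2 * beta)); have c20 : 0 < c2 := mulr_gt0 (divr_gt0 c0 (ltr0Sn R 1)) (powR_gt0 _ A0).
have al2 : 0 < 2 * alpha by rewrite mulr_gt0// (ws_alpha W).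
have [L L1 hL] := powR_big (4 * Kup * C / c2) al2.
have L0' : 0 < L by lra.
pose K := Num.max 1 (2 / c2 * (2 * L) ^+ d).
exists K; first by rewrite le_max lexx.
move=> t x y t0 xy; rewrite (density_shift x y t0); set z := x - y; set r := enorm z => tph.
have r0 : 0 < r by apply: enorm_gt0; rewrite subr_eq0.
have p_r := ph_gt0 phi_gt0 r0; have tp : 0 < t * ph r by rewrite mulr_gt0.
pose a := (A * r) ^- 2; have a0 : 0 < a by rewrite invr_gt0 exprn_gt0// mulr_gt0.
have rA : r <= A * r by rewrite ler_peMl// ltW.
have ta : t * phi a <= C.
  have h : phi a <= C * ph r := ph_dec phi_gt0 W r0 rA.
  apply: (@le_trans _ _ (t * (C * ph r))); first by rewrite ler_pM2l.
  by rewrite mulrCA ler_piMr// ltW.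
have ML := moment_lo 0 t0 a0 ta.
pose Far s := ([set y : V | s <= enorm (0 - y)] : set V).
have mFar s : measurable (Far s).
  by rewrite /Far; under eq_set do rewrite sub0r enormN; exact: measurable_enorm_ge.
have mpt := mp 0 t0; have mept : measurable_fun setT (fun y : V => (p t 0 y)%:E) by exact/measurable_EFinP.
have pp (w : V) : (0 <= (p t 0 w)%:E)%E by rewrite lee_fin p0.
have MM := moment_min 0 t0 r0.
have mm : measurable_fun setT (fun y : V => (p t 0 y * Num.min 1 (enorm (0 - y) ^+ 2 / r ^+ 2))%:E).
  by apply/measurable_EFinP; apply: measurable_funM => //; exact: measurable_min2.
have nmm : nnm (fun y : V => (p t 0 y * Num.min 1 (enorm (0 - y) ^+ 2 / r ^+ 2))%:E).
  by split=> // w; rewrite lee_fin mulr_ge0 ?p0 ?min2_ge0.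
have A2 : 0 <= A ^- 2 by rewrite invr_ge0 exprn_ge0// ltW.
have mind : measurable_fun setT (fun y : V => (\1_(Far r) y : R)) by exact: measurable_indic.
have S1 : (\int[mu]_w (p t 0 w * (1 - Gau a (w - 0)))%:E <=
    (A ^- 2)%:E * (2 * Kup * (t * ph r))%:E + \int[mu]_(w in Far r) (p t 0 w)%:E)%E.
  apply: (@le_trans _ _ (\int[mu]_w ((A ^- 2)%:E * (p t 0 w * Num.min 1 (enorm (0 - w) ^+ 2 / r ^+ 2))%:E +
     (p t 0 w * \1_(Far r) w)%:E)%E)%E).
    apply: ge0_le_integral => //.
    - by move=> w _; rewrite lee_fin mulr_ge0 ?p0// subr_ge0 Gau_le1// ltW.
    - apply/measurable_EFinP; apply: measurable_funM => //; apply: measurable_funB => //.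
      exact: measurable_Gau_shift.
    - apply: emeasurable_funD; first by have [] := nnmZ A2 nmm.
      by apply/measurable_EFinP; exact: measurable_funM.
    move=> w _; rewrite -EFinM -EFinD lee_fin subr0 sub0r enormN.
    have gw : 1 - Gau a w <= 1 by have := Gau_ge0 a w; lra.
    have pw := p0 0 w t0; rewrite indicE; have [wr|wr] := leP r (enorm w).
      rewrite mem_set /Far/= ?sub0r ?enormN// mulr1.
      have : p t 0 w * (1 - Gau a w) <= p t 0 w by rewrite ler_piMr.
      have : 0 <= A ^- 2 * (p t 0 w * Num.min 1 (enorm w ^+ 2 / r ^+ 2)).
        by apply: mulr_ge0 => //; apply: mulr_ge0 => //; rewrite le_min ler01 divr_ge0 ?sqr_ge0.
      by lra.
    rewrite memNset /Far/= ?sub0r ?enormN; last by apply/negP; rewrite -ltNge.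
    rewrite mulr0 addr0 mulrCA ler_wpM2l// min_r; last first.
      by rewrite ler_pdivrMr ?exprn_gt0// mul1r ler_sqr ?nnegrE ?enorm_ge0 ?(ltW r0)// ltW.
    have := expR_ge1Dx (- (a * dot w w)); rewrite -/(Gau a w) -enorm_sqr => h.
    have -> : A ^- 2 * (enorm w ^+ 2 / r ^+ 2) = a * enorm w ^+ 2.
      by rewrite /a exprMn; field; rewrite !gt_eqF.
    by lra.
  rewrite ge0_integralD//; last 4 first.
  - by move=> w _; rewrite mule_ge0// lee_fin; case: nmm => _ /(_ w); rewrite lee_fin.
  - by have [] := nnmZ A2 nmm.
  - by move=> w _; rewrite lee_fin mulr_ge0 ?p0.
  - by apply/measurable_EFinP; exact: measurable_funM.
  rewrite (nnm_intZ mu _ nmm) ?lee_fin//; apply: leeD; first by apply: lee_wpmul2l => //; rewrite lee_fin.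
  rewrite [leRHS]integral_mkcond; apply: ge0_le_integral => //.
  - by move=> w _; rewrite lee_fin mulr_ge0 ?p0.
  - by apply/measurable_EFinP; exact: measurable_funM.
  - by apply/(measurable_restrictT _ _).1 => //; exact: measurable_funTS.
  by move=> w _; rewrite patchE indicE; case: ifP => _; rewrite ?mulr1 ?mulr0.
have LR : 0 < L * r by rewrite mulr_gt0.
have T2 := tail_bound 0 t0 LR; rewrite -/(Far (L * r)) in T2.
pose Sh := (Far r `&` eball (0 : 'rV[R]_d) (L * r) : set V).
have mSh : measurable Sh by apply: measurableI => //; exact: measurable_eball.
have S2 : (\int[mu]_(w in Far r) (p t 0 w)%:E <= \int[mu]_(w in Sh) (p t 0 w)%:E + \int[mu]_(w in Far (L * r)%R) (p t 0 w)%:E)%E.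
  rewrite -ge0_integral_setU//; last 2 first.
  - exact: measurable_funTS.
  - by apply/disj_setPS => w [[_ +]]; rewrite /eball /Far/= subr0 sub0r enormN => ? ?; lra.
  apply: ge0_subset_integral => //; first exact: measurableU.
    exact: measurable_funTS.
  move=> w wr; have [h|h] := ltP (enorm w) (L * r); [left; split=> //|right].
    by rewrite /eball/= subr0.
  by rewrite /Far/= sub0r enormN.
have S3 : (\int[mu]_(w in Sh) (p t 0 w)%:E <= (p t 0 z * (2 * (L * r)) ^+ d)%:E)%E.
  apply: (@le_trans _ _ (\int[mu]_(w in Sh) (p t 0 z)%:E)%E).
    apply: ge0_le_integral => //; first exact: measurable_funTS.
    move=> w [wr _]; rewrite lee_fin.
    by apply: (density_mono d0 phi_cbf X_levy X_exponent p_density) => //; rewrite sub0r enormN.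
  rewrite integral_cst// EFinM; apply: lee_wpmul2l => //.
  apply: le_trans (lebesgue_eball_ub (0 : 'rV[R]_d) LR).
  by apply: le_measure; rewrite ?inE//; [exact: measurable_eball|move=> w []].
have phA : A `^ (- (2 * beta)) * ph r <= C * phi a.
  have h1 : a <= r ^- 2 by rewrite /a lef_pV2 ?posrE ?exprn_gt0 ?mulr_gt0// lerXn2r ?nnegrE// ltW// mulr_gt0.
  have := ws_ub W a0 h1; rewrite -/(ph r).
  have -> : (r ^- 2 / a) = A ^+ 2 by rewrite /a exprMn; field; rewrite !gt_eqF.
  have -> : (A ^+ 2) `^ beta = A `^ (2 * beta) by rewrite -(powR_mulrn _ (ltW A0)) -powRrM.
  move=> h; rewrite powRN mulrC ler_pdivrMr ?powR_gt0//; apply: (le_trans h).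
  by rewrite le_eqVlt; apply/orP; left; apply/eqP; ring.
have phL : ph (L * r) * L `^ (2 * alpha) <= C * ph r.
  have h1 : (L * r) ^- 2 <= r ^- 2.
    by rewrite lef_pV2 ?posrE ?exprn_gt0 ?mulr_gt0// lerXn2r ?nnegrE ?(ltW r0) ?(ltW LR)// ler_peMl// ltW.
  have a0' : 0 < (L * r) ^- 2 by rewrite invr_gt0 exprn_gt0.
  have := ws_lb W a0' h1.
  have -> : r ^- 2 / (L * r) ^- 2 = L ^+ 2 by rewrite exprMn; field; rewrite !gt_eqF.
  have -> : (L ^+ 2) `^ alpha = L `^ (2 * alpha) by rewrite -(powR_mulrn _ (ltW L0')) -powRrM.
  by rewrite mulrC.
have pe0 : 0 < A `^ (- (2 * beta)) by rewrite powR_gt0.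
have eA : A ^- 2 * (2 * Kup) <= c / 2 * A `^ (- (2 * beta)).
  have -> : A `^ (- (2 * beta)) = A `^ (2 - 2 * beta) * A ^- 2.
    rewrite -(powR_invn 2 (ltW A0)) -powRD; first by congr (_ `^ _); ring.
    by rewrite (gt_eqF A0) implybT.
  have -> : c / 2 * (A `^ (2 - 2 * beta) * A ^- 2) = A ^- 2 * (c / 2 * A `^ (2 - 2 * beta)) by ring.
  by apply: ler_wpM2l => //; move: hA; rewrite ler_pdivrMr// => h; lra.
have eL : 2 * Kup * ph (L * r) <= c2 / 2 * ph r.
  have LL : 0 < L `^ (2 * alpha) by rewrite powR_gt0.
  rewrite -(ler_pM2r LL); apply: (@le_trans _ _ (2 * Kup * (C * ph r))).
    by rewrite -[leLHS]mulrA ler_pM2l// mulr_gt0.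
  move: hL; rewrite ler_pdivrMr// => h.
  have h' : 4 * Kup * C * ph r <= L `^ (2 * alpha) * c2 * ph r by rewrite ler_pM2r.
  lra.
have R1 : Klo * (t * phi a) >= c * A `^ (- (2 * beta)) * (t * ph r).
  have -> : Klo * (t * phi a) = Klo / C * t * (C * phi a) by field; rewrite gt_eqF.
  have -> : c * A `^ (- (2 * beta)) * (t * ph r) = Klo / C * t * (A `^ (- (2 * beta)) * ph r) by rewrite /c; ring.
  by rewrite ler_pM2l// mulr_gt0.
have F0 : (0 <= \int[mu]_(w in Sh) (p t 0 w)%:E)%E by apply: integral_ge0.
have F1 : (0 <= \int[mu]_(w in Far (L * r)%R) (p t 0 w)%:E)%E by apply: integral_ge0.
have F2 : (0 <= \int[mu]_(w in Far r) (p t 0 w)%:E)%E by apply: integral_ge0.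
have ML' := le_trans ML S1.
move: ML' S2 S3 T2 F0 F1 F2; case: (\int[mu]_(w in Sh) _)%E => [f0| |]//;
  case: (\int[mu]_(w in Far (L * r)%R) _)%E => [f1| |]//;
  case: (\int[mu]_(w in Far r) _)%E => [f2| |]//.
rewrite -!EFinM -!EFinD !lee_fin => ML' S2 S3 T2 F0 F1 F2.
have U1 : c / 2 * A `^ (- (2 * beta)) * (t * ph r) <= f2.
  have h : A ^- 2 * (2 * Kup) * (t * ph r) <= c / 2 * A `^ (- (2 * beta)) * (t * ph r) by rewrite ler_pM2r.
  lra.
have U2 : f1 <= c2 / 2 * (t * ph r).
  apply: (le_trans T2); have h : t * (2 * Kup * ph (L * r)) <= t * (c2 / 2 * ph r) by rewrite ler_pM2l.
  lra.
have U3 : c2 / 2 * (t * ph r) <= p t 0 z * (2 * (L * r)) ^+ d.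
  by rewrite -/c2 in U1; lra.
have rd : 0 < r ^+ d by rewrite exprn_gt0.
apply: (@le_trans _ _ (2 / c2 * (2 * L) ^+ d * p t 0 z)); last first.
  by rewrite ler_wpM2r ?p0// le_max lexx orbT.
rewrite mulrA ler_pdivrMr//.
have -> : 2 / c2 * (2 * L) ^+ d * p t 0 z * r ^+ d = 2 / c2 * (p t 0 z * (2 * (L * r)) ^+ d).
  by rewrite mulrA (exprMn_comm d (mulrC (2 * L) r)); ring.
apply: (@le_trans _ _ (2 / c2 * (c2 / 2 * (t * ph r)))); last by rewrite ler_pM2l// divr_gt0.
by rewrite le_eqVlt; apply/orP; left; apply/eqP; field; rewrite gt_eqF.
Qed.

Lemma geometric_series_le (c : R) : 0 <= c -> (\sum_(0 <= n <oo) (c * 2 ^- n)%:E <= (2 * c)%:E)%E.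
Proof.
move=> c0; have pos n : (0 <= (c * 2 ^- n)%:E)%E by rewrite lee_fin mulr_ge0// invr_ge0 exprn_ge0.
apply: lime_le; first by apply: is_cvg_nneseries => n _ _; exact: pos.
apply: nearW => n; rewrite sumEFin lee_fin.
have -> : \sum_(0 <= k < n) c * 2 ^- k = 2 * c - 2 * c * 2 ^- n.
  elim: n => [|n IH]; first by rewrite big_geq// expr0 invr1 mulr1 subrr.
  rewrite big_nat_recr//= IH exprS; field.
  by rewrite expf_neq0// pnatr_eq0.
by rewrite gerBl mulr_ge0 ?mulr_ge0// invr_ge0 exprn_ge0.
Qed.

(** Chosen so that 2 alpha NN >= d + 1: the NN-th term of the exponential series then gives exp(-s
    phi(|xi|^2)) a decay of order d + 1. *)
Definition NN : nat := (Num.truncn (d.+1%:R / (2 * alpha))).+1.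

Definition Keps (eta : R) := (1 + NN`!%:R * (C / eta) ^+ NN) * 2 ^+ d.+1 * 2 ^+ d * 2.

Lemma Keps_ge0 eta : 0 < eta -> 0 <= Keps eta.
Proof.
move=> e0; have h : 0 <= NN`!%:R * (C / eta) ^+ NN by rewrite mulr_ge0// exprn_ge0// divr_ge0// ltW.
by rewrite !mulr_ge0 ?exprn_ge0// addr_ge0.
Qed.

(** p is at most the integral of [Psi]. The lower scaling of phi and eta <= s ph rho make [Psi]
    decay with order d + 1 in |xi| rho, and summing over the balls of radius 2^n / rho leaves a
    geometric series. *)
Lemma density_diag eta s rho x y : 0 < eta -> 0 < s -> 0 < rho -> eta <= s * ph rho ->
  p s x y * rho ^+ d <= Keps eta.
Proof.
move=> eta0 s0 rho0 hs; have a0 := ws_alpha W.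
pose K := NN`!%:R * (C / eta) ^+ NN.
have f0 : 0 < NN`!%:R :> R by rewrite ltr0n fact_gt0.
have Ce0 : 0 < C / eta by rewrite divr_gt0.
have K0 : 0 < K by rewrite mulr_gt0// exprn_gt0.
have NNa : d.+1%:R <= 2 * alpha * NN%:R.
  by rewrite mulrC -ler_pdivrMr ?mulr_gt0// ltW// truncnS_gt.
have decay (xi : V) : 1 <= enorm xi * rho -> Psi phi s xi <= K / (enorm xi * rho) ^+ d.+1.
  set u := enorm xi * rho => u1; have u0 : 0 < u by lra.
  have xg : 0 < enorm xi by have := enorm_ge0 xi; rewrite le_eqVlt => /orP[/eqP e|//]; move: u0; rewrite /u -e mul0r ltxx.
  have xi0 : xi != 0 by apply: contraTneq xg => ->; rewrite enorm0 ltxx.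
  rewrite /Psi ifN// -enorm_sqr; set v := s * phi (enorm xi ^+ 2).
  have r0 : 0 < rho ^- 2 by rewrite invr_gt0 exprn_gt0.
  have h1 : rho ^- 2 <= enorm xi ^+ 2.
    by rewrite -[leLHS]mul1r ler_pdivrMr ?exprn_gt0// -exprMn -/u exprn_ege1.
  have := ws_lb W r0 h1; have -> : enorm xi ^+ 2 / rho ^- 2 = u ^+ 2 by rewrite invrK /u exprMn.
  have -> : (u ^+ 2) `^ alpha = u `^ (2 * alpha) by rewrite -(powR_mulrn _ (ltW u0)) -powRrM.
  rewrite -/(ph rho) => h2.
  have up : 0 < u `^ (2 * alpha) by rewrite powR_gt0.
  have vl : eta / C * u `^ (2 * alpha) <= v.
    apply: (@le_trans _ _ (s * ph rho / C * u `^ (2 * alpha))).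
      by rewrite ler_pM2r// ler_pM2r// invr_gt0.
    rewrite /v (_ : s * ph rho / C * _ = s * (u `^ (2 * alpha) * ph rho / C)); last by ring.
    by rewrite ler_pM2l// ler_pdivrMr// [leRHS]mulrC.
  set z := eta / C * u `^ (2 * alpha) in vl.
  have z0 : 0 < z by rewrite mulr_gt0// divr_gt0.
  have h3 := @expR_ge1Dxn R z NN.-1 (ltW z0); rewrite prednK// in h3.
  have zN : 0 < z ^+ NN / NN`!%:R by rewrite divr_gt0// exprn_gt0.
  have h4 : z ^+ NN / NN`!%:R <= expR z by lra.
  apply: (@le_trans _ _ (expR (- z))); first by rewrite ler_expR lerN2.
  rewrite expRN; apply: (@le_trans _ _ (z ^+ NN / NN`!%:R)^-1); first by rewrite lef_pV2 ?posrE ?expR_gt0.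
  have h5 : u ^+ d.+1 <= (u `^ (2 * alpha)) ^+ NN.
    by rewrite -(powR_mulrn _ (powR_ge0 _ _)) -powRrM -(powR_mulrn _ (ltW u0)); apply: ler_powR.
  have ud : 0 < u ^+ d.+1 by rewrite exprn_gt0.
  have U0 : 0 < (u `^ (2 * alpha)) ^+ NN by rewrite exprn_gt0.
  have -> : (z ^+ NN / NN`!%:R)^-1 = K / (u `^ (2 * alpha)) ^+ NN.
    rewrite /z /K (exprMn_comm NN (mulrC _ _)) !expr_div_n; field.
    by rewrite !gt_eqF// ?exprn_gt0.
  by rewrite ler_pM2l// lef_pV2.
pose c := (1 + K) * 2 ^+ d.+1.
have c0 : 0 <= c by rewrite mulr_ge0 ?exprn_ge0// addr_ge0// ltW.
pose B n := eball (0 : 'rV[R]_d) (2 ^+ n / rho) : set V.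
have mB n : measurable (B n) by exact: measurable_eball.
pose g n (xi : V) : \bar R := ((c / (2 ^+ n) ^+ d.+1)%:E * (\1_(B n) xi)%:E)%E.
have cn0 n : 0 <= c / (2 ^+ n) ^+ d.+1 by rewrite divr_ge0// !exprn_ge0.
have ng n : nnm (g n).
  apply: nnmZ => //; split=> [|w]; last by rewrite lee_fin.
  by apply/measurable_EFinP; exact: measurable_indic.
have pw (xi : V) : ((Psi phi s xi)%:E <= \sum_(0 <= n <oo) g n xi)%E.
  have ex : exists n, enorm xi * rho < 2 ^+ n.
    have [n hn] := expr_unbounded (1 + enorm xi * rho) (@ltr01 R); exists n.
    by apply: lt_le_trans hn; rewrite ltrDr.
  case: (ex_minnP ex) => n hn mn.
  apply: (@le_trans _ _ (g n xi)); last first.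
    have gp k : (0 <= g k xi)%E by case: (ng k).
    apply: le_trans (nneseries_lim_ge n.+1 _); last by move=> k _ _; exact: gp.
    by rewrite big_nat_recr//= leeDr// sume_ge0.
  have Bn : B n xi by rewrite /B /eball/= subr0 ltr_pdivlMr.
  rewrite /g indicE mem_set// mule1 lee_fin.
  case: n hn mn Bn => [|n] hn mn Bn.
    rewrite expr0 expr1n divr1; apply: (le_trans (Psi_le1 _ (ltW s0))).
    by rewrite /c mulr_ege1 ?exprn_ege1 ?ler1n// lerDl ltW.
  have un : 2 ^+ n <= enorm xi * rho by rewrite leNgt; apply/negP => /mn; rewrite ltnn.
  have p2 : 0 < (2 : R) ^+ n by rewrite exprn_gt0.
  apply: (le_trans (decay xi _)); first by apply: le_trans un; rewrite exprn_ege1// ler1n.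
  apply: (@le_trans _ _ (K / (2 ^+ n) ^+ d.+1)).
    by rewrite ler_pM2l// lef_pV2 ?posrE ?exprn_gt0// ?(lt_le_trans p2)// lerXn2r ?nnegrE ?(ltW p2)// (le_trans (ltW p2)).
  rewrite [(2 ^+ n.+1)]exprS (exprMn_comm d.+1 (mulrC _ _)) /c invfM mulrA mulfK ?expf_neq0 ?pnatr_eq0//.
  by rewrite ler_pM2r ?invr_gt0 ?exprn_gt0// lerDr.
have := density_le_integral d0 phi_cbf X_levy X_exponent p_density x y s0 => h.
have h2 : (\int[mu]_xi (Psi phi s xi)%:E <= \sum_(0 <= n <oo) \int[mu]_xi g n xi)%E.
  rewrite -integral_nneseries//.
  - apply: ge0_le_integral => //.
    + by move=> w _; rewrite lee_fin Psi_ge0.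
    + by apply/measurable_EFinP; exact: measurable_Psi (ltW s0).
    + by apply: ge0_emeasurable_sum => n; [move=> w _ _; case: (ng n)|case: (ng n)].
  - by move=> n; case: (ng n).
  - by move=> n w _; case: (ng n).
have h3 : (\sum_(0 <= n <oo) \int[mu]_xi g n xi <= \sum_(0 <= n <oo) (c * 2 ^+ d / rho ^+ d * 2 ^- n)%:E)%E.
  apply: lee_nneseries => [n _ _|n _]; first by apply: integral_ge0 => w _; case: (ng n).
  have nB : nnm (fun xi : V => (\1_(B n) xi : R)%:E).
    by split=> [|w]; [apply/measurable_EFinP; exact: measurable_indic|rewrite lee_fin].
  rewrite /g (nnm_intZ mu _ nB) ?lee_fin//.
  have E1 := integral_indic mu measurableT (mB n); rewrite setIT in E1; rewrite E1.
  have r2 : 0 < 2 ^+ n / rho by rewrite divr_gt0// exprn_gt0.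
  apply: (@le_trans _ _ ((c / (2 ^+ n) ^+ d.+1)%:E * ((2 * (2 ^+ n / rho)) ^+ d)%:E)%E).
    by apply: lee_wpmul2l; [rewrite lee_fin|exact: lebesgue_eball_ub].
  rewrite -EFinM lee_fin le_eqVlt; apply/orP; left; apply/eqP.
  rewrite (exprMn_comm d (mulrC 2 (2 ^+ n / rho))) expr_div_n exprS; field.
  by rewrite !expf_neq0// ?pnatr_eq0// gt_eqF.
have rd : 0 < rho ^+ d by rewrite exprn_gt0.
have cc : 0 <= c * 2 ^+ d / rho ^+ d by exact: divr_ge0 (mulr_ge0 c0 (exprn_ge0 d (ler0n R 2))) (ltW rd).
have := le_trans h (le_trans h2 (le_trans h3 (geometric_series_le cc))).
rewrite lee_fin => h4; rewrite -ler_pdivlMr//; apply: (le_trans h4).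
by rewrite le_eqVlt; apply/orP; left; apply/eqP; rewrite /Keps /c /K; ring.
Qed.

End bounds.

(** * The skeleton walk *)

Section independence.
Context (R : realType) (d d1 d2 : measure_display) (Omega : measurableType d)
  (T1 : measurableType d1) (T2 : measurableType d2) (Pr : probability Omega R).
Local Open Scope ereal_scope.

Lemma indep_integral (Z : Omega -> T1) (J : Omega -> T2) (F : T1 * T2 -> \bar R) :
  measurable_fun setT Z -> measurable_fun setT J ->
  (forall A B, measurable A -> measurable B ->
    Pr (Z @^-1` A `&` J @^-1` B) = Pr (Z @^-1` A) * Pr (J @^-1` B)) ->
  nnm F -> \int[Pr]_w F (Z w, J w) = \int[Pr]_w \int[Pr]_w' F (Z w, J w').
Proof.
move=> mZ mJ ind [mF F0].
have mZJ : measurable_fun setT (fun w => (Z w, J w)) by exact: measurable_fun_pair.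
pose Z' : {mfun Omega >-> T1} := mfun_Sub (mem_set mZ).
pose J' : {mfun Omega >-> T2} := mfun_Sub (mem_set mJ).
pose ZJ' : {mfun Omega >-> (T1 * T2)%type} := mfun_Sub (mem_set mZJ).
have ZE : (Z' : Omega -> T1) = Z := mfun_valP _.
have JE : (J' : Omega -> T2) = J := mfun_valP _.
have ZJE : (ZJ' : Omega -> T1 * T2) = (fun w => (Z w, J w)) := mfun_valP _.
pose m1 := distribution Pr Z'; pose m2 := distribution Pr J'; pose m := distribution Pr ZJ'.
have U : forall S, measurable S -> (m1 \x m2) S = m S.
  apply: product_measure_unique => A B mA mB.
  change (Pr (ZJ' @^-1` (A `*` B)) = Pr (Z' @^-1` A) * Pr (J' @^-1` B)).
  by rewrite ZJE ZE JE; exact: ind.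
have -> : \int[Pr]_w F (Z w, J w) = \int[m]_z F z.
  by rewrite ge0_integral_distribution//; apply: eq_integral => w _ /=; rewrite ZJE.
rewrite -(eq_measure_integral m (m1 := (m1 \x m2)%E)); last by move=> A mA _; exact: U.
rewrite (fubini_tonelli1 F mF F0) ge0_integral_distribution//; last 2 first.
- exact: measurable_fun_fubini_tonelli_F.
- by move=> y; apply: integral_ge0.
apply: eq_integral => w _; change (\int[m2]_y F (Z' w, y) = \int[Pr]_w' F (Z w, J w')).
rewrite ZE ge0_integral_distribution//.
exact: measurableT_comp mF (measurable_pair1 _).
Qed.

End independence.

(** * Markov property at the grid times *)

Section markov.
Context (R : realType) (d : nat) (disp : measure_display) (Omega : measurableType disp).
Variables (P : 'rV[R]_d -> probability Omega R) (X : R -> Omega -> 'rV[R]_d).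
Variables (phi : R -> R) (p : R -> 'rV[R]_d -> 'rV[R]_d -> R).
Hypothesis d0 : (0 < d)%N.
Hypothesis phi_cbf : complete_bernstein phi.
Hypothesis X_levy : levy_process P X.
Hypothesis X_exponent : has_characteristic_exponent P X phi.
Hypothesis p_density : transition_density P X p.
Local Notation V := (borelRd R d).
Local Notation mu := (@lebesgueRd R d).
Variables (x : V) (eps : R).
Hypothesis eps0 : 0 < eps.

Let p0 := density_ge0 p_density.
Let mX t (t0 : 0 <= t) := measurable_X X_levy t0.
Let ne n : 0 <= n%:R * eps. Proof. by rewrite mulr_ge0// ltW. Qed.

Definition incr (i : nat) (w : Omega) : V := X (i.+1%:R * eps) w - X (i%:R * eps) w.

(** A pi-system in the very form of the independence hypothesis of [levy_process]. *)
Definition past (n : nat) : set (set Omega) := [set E | exists B : nat -> set V,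
  (forall i, measurable (B i)) /\ E = [set w | forall i, (i < n)%N -> B i (incr i w)]].

(** The walk starts at x exactly, not just almost surely, and is thus a function of the increments
    alone. *)
Definition pos (n : nat) (w : Omega) : V := x + (X (n%:R * eps) w - X 0 w).

Lemma pos0 w : pos 0 w = x.
Proof. by rewrite /pos mul0r subrr addr0. Qed.

Lemma measurable_incr_step i : measurable_fun setT (incr i).
Proof. by apply: measurable_rowB; exact: mX. Qed.

Lemma measurable_pos n : measurable_fun setT (pos n).
Proof.
apply: measurable_rowD; first exact: measurable_cst.
by apply: measurable_rowB; exact: mX.
Qed.

Lemma past_measurable n E : past n E -> measurable E.
Proof.
move=> [B [mB ->]]; rewrite (_ : [set _ | _] = \bigcap_(i in [set i | (i < n)%N]) (incr i @^-1` B i)).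
  apply: bigcap_measurableType => i _; rewrite -[X in measurable X]setTI.
  exact: measurable_incr_step.
by apply/seteqP; split.
Qed.

Lemma pastT n : past n setT.
Proof. by exists (fun=> setT); split => //; apply/seteqP; split. Qed.

Lemma pastI n : setI_closed (past n).
Proof.
move=> _ _ [B [mB ->]] [B' [mB' ->]]; exists (fun i => B i `&` B' i); split.
  by move=> i; exact: measurableI.
apply/seteqP; split => w /=; first by move=> [h h'] i ni; split; [exact: h|exact: h'].
by move=> h; split => i ni; have [] := h i ni.
Qed.

Definition Past n E := <<s past n >> E.

Lemma Past_measurable n E : Past n E -> measurable E.
Proof.
move=> h; apply: (h measurable); split; last by move=> F; exact: past_measurable.
exact: sigma_algebra_measurable.
Qed.

(** For a fixed event F on the later increment, P(E and F) and P(E) P(F) are finite measures in E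
    that agree on the pi-system [past]. *)
Lemma Past_indep n m E (B : set V) : Past n E -> measurable B ->
  (P x (E `&` [set w | B (X ((n + m)%:R * eps) w - X (n%:R * eps) w)%R]) =
   P x E * P x [set w | B (X (m%:R * eps) w - X 0 w)%R])%E.
Proof.
move=> hE mB; pose J w : V := X ((n + m)%:R * eps) w - X (n%:R * eps) w.
have mJ : measurable_fun setT J by apply: measurable_rowB; exact: mX.
have mF : measurable [set w | B (J w)].
  by rewrite -[X in measurable X]setTI; exact: mJ.
have JE : P x [set w | B (J w)] = P x [set w | B (X (m%:R * eps) w - X 0 w)].
  have := levy_stationary_increments X_levy x (s := n%:R * eps) (t := m%:R * eps) (ne n) (ne m) mB.
  by rewrite -mulrDl -natrD.
rewrite -JE.
have fP : P x [set w | B (J w)] \is a fin_num by exact: fin_num_measure.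
have k0 : (0 <= fine (P x [set w | B (J w)]))%R by exact: fine_ge0.
pose m2 := mscale (NngNum k0) (P x).
suff : mrestr (P x) mF E = m2 E.
  by rewrite /m2 /mrestr /mscale/= fineK// => ->; rewrite muleC.
apply: (@g_sigma_algebra_measure_unique _ _ _ (past n) _ (fun=> setT)) => //.
- by move=> F; exact: past_measurable.
- by move=> _; exact: pastT.
- by apply/seteqP; split => // w _; exists 0%N.
- exact: pastI.
- move=> F [B' [mB' ->]].
  change (P x ([set w | forall i, (i < n)%N -> B' i (incr i w)] `&` [set w | B (J w)]) =
    (fine (P x [set w | B (J w)]))%:E * P x [set w | forall i, (i < n)%N -> B' i (incr i w)])%E.
  rewrite fineK//.
  (* The times 0, eps, ..., n eps, then (n + m) eps, repeated so that the sequence is nondecreasing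
     throughout. *)
  pose t i : R := if (i <= n)%N then i%:R * eps else (n + m)%:R * eps.
  pose B2 i := if (i < n)%N then B' i else B.
  have t0 : 0 <= t 0%N by rewrite /t leq0n mul0r.
  have tS i : t i <= t i.+1.
    rewrite /t; case: ltnP => h.
      by rewrite ltnW// ler_pM2r// ler_nat.
    case: ifP => // h'; rewrite ler_pM2r// ler_nat.
    by rewrite (leq_trans h') ?leq_addr.
  have mB2 i : measurable (B2 i) by rewrite /B2; case: ifP.
  have H := levy_independent_increments X_levy x n.+1 t0 tS mB2.
  have H' := levy_independent_increments X_levy x n t0 tS mB2.
  rewrite big_ord_recr/= -H' in H.
  have En : [set w | B2 n (X (t n.+1) w - X (t n) w)] = [set w | B (J w)].
    by apply/seteqP; split => w /=; rewrite /B2 /t ltnn leqnn.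
  have En' : [set w | forall i, (i < n)%N -> B2 i (X (t i.+1) w - X (t i) w)] =
      [set w | forall i, (i < n)%N -> B' i (incr i w)].
    apply/seteqP; split => w /= h i ni; have := h i ni; rewrite /B2 /t /incr ni ltnW//.
  rewrite En En' in H; rewrite muleC -H; congr (P x _).
  apply/seteqP; split => w /=.
    move=> [h1 h2] i; rewrite ltnS leq_eqVlt => /orP[/eqP ->|ni].
      by rewrite /B2 /t ltnn leqnn.
    by have := h1 i ni; rewrite /B2 /t /incr ni ltnW.
  move=> h; split.
    by move=> i ni; have := h i (ltnW ni); rewrite /B2 /t /incr ni ltnW.
  by have := h n (ltnSn n); rewrite /B2 /t ltnn leqnn.
- move=> k; change (P x (setT `&` [set w | B (J w)]) < +oo)%E.
  by rewrite setTI ltey_eq fP.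
Qed.

Lemma Past_incr n i B : (i < n)%N -> measurable B -> Past n (incr i @^-1` B).
Proof.
move=> ni mB; apply: sub_sigma_algebra; exists (fun j => if j == i then B else setT); split.
  by move=> j; case: ifP.
apply/seteqP; split => w /=; first by move=> h j _; case: eqP => // ->.
by move=> /(_ i ni); rewrite eqxx.
Qed.

Lemma Past_pos n k B : (k <= n)%N -> measurable B -> Past n (pos k @^-1` B).
Proof.
move=> kn mB; suff h : measurable_fun setT (pos k : g_sigma_algebraType (past n) -> V).
  by have := h measurableT B mB; rewrite setTI.
elim: k kn => [|k IH] kn.
  rewrite (_ : pos 0 = cst x); first exact: measurable_cst.
  by apply/funext => w; rewrite /pos mul0r subrr addr0.
rewrite (_ : pos k.+1 = fun w => pos k w + incr k w); last first.
  by apply/funext => w; rewrite /pos /incr -addrA; congr (_ + _); rewrite addrC addrA addrNK.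
apply: measurable_rowD; first exact: IH (ltnW kn).
by move=> _ S mS; rewrite setTI; exact: Past_incr.
Qed.

Lemma PastI n A B : Past n A -> Past n B -> Past n (A `&` B).
Proof. exact: (@measurableI _ (g_sigma_algebraType (past n))). Qed.
Lemma PastC n A : Past n A -> Past n (~` A).
Proof. exact: (@measurableC _ (g_sigma_algebraType (past n))). Qed.
Lemma PastT n : Past n setT.
Proof. exact: (@measurableT _ (g_sigma_algebraType (past n))). Qed.

(** The earlier position [pos j] is carried along because the test function of [stay_bump] is
    centred at it. *)
Lemma Past_markov2 j n m E (f : V * V -> \bar R) : (j <= n)%N -> Past n E -> (0 < m)%N -> nnm f ->
  (\int[P x]_(w in E) f (pos j w, pos (n + m) w) =
   \int[P x]_(w in E) \int[mu]_z ((p (m%:R * eps) (pos n w) z)%:E * f (pos j w, z)))%E.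
Proof.
move=> jn hE m0 nf; have [mf f0] := nf; have mE := Past_measurable hE.
have t0 : 0 < m%:R * eps by rewrite mulr_gt0// ltr0n.
pose J w : V := X ((n + m)%:R * eps) w - X (n%:R * eps) w.
have mJ : measurable_fun setT J by apply: measurable_rowB; exact: mX.
have mP := measurable_pos.
pose b w := w \in E.
have bE : b @^-1` [set true] = E.
  by apply/seteqP; split => w /= h; [exact: set_mem|exact: mem_set].
have mb : measurable_fun setT b by apply: (@measurable_fun_bool _ _ _ _ true); rewrite setTI bE.
pose Z w : bool * (V * V) := (b w, (pos j w, pos n w)).
have mZ : measurable_fun setT Z.
  by apply: measurable_fun_pair => //; apply: measurable_fun_pair; exact: mP.
pose F (z : (bool * (V * V)) * V) : \bar R :=
  if z.1.1 then f (z.1.2.1, z.1.2.2 + z.2)%R else 0%E.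
have m12 : measurable_fun setT (fun z : (bool * (V * V)) * V => z.1.2).
  exact: measurableT_comp measurable_snd measurable_fst.
have nF : nnm F.
  split=> [|z]; last by rewrite /F; case: ifP.
  apply: measurable_fun_ifT => //.
  - exact: measurableT_comp measurable_fst measurable_fst.
  - apply: measurableT_comp mf _; apply: measurable_fun_pair.
      exact: measurableT_comp measurable_fst m12.
    apply: measurable_rowD; last exact: measurable_snd.
    exact: measurableT_comp measurable_snd m12.
have ZP A : measurable A -> Past n (Z @^-1` A).
  move=> mA; suff h : measurable_fun setT (Z : g_sigma_algebraType (past n) -> bool * (V * V)).
    by have := h measurableT A mA; rewrite setTI.
  apply: measurable_fun_pair.
    by apply: (@measurable_fun_bool _ _ _ _ true); rewrite setTI bE.
  by apply: measurable_fun_pair => _ S mS; rewrite setTI; exact: Past_pos.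
have I := @indep_integral R _ _ _ _ _ _ (P x) Z J F mZ mJ _ nF.
rewrite integral_mkcond [RHS]integral_mkcond.
transitivity (\int[P x]_w F (Z w, J w))%E.
  apply: eq_integral => w _; rewrite patchE /F/= /b; case: ifP => // _; congr (f (_, _)).
  by rewrite /pos /J -addrA; congr (_ + _); rewrite addrC addrA addrNK.
rewrite I; last first.
  move=> A B mA mB; have h := Past_indep m (ZP A mA) mB.
  rewrite (_ : J @^-1` B = [set w | B (X ((n + m)%:R * eps) w - X (n%:R * eps) w)])// h; congr (_ * _)%E.
  have := levy_stationary_increments X_levy x (s := n%:R * eps) (t := m%:R * eps) (ne n) (ne m) mB.
  by rewrite -mulrDl -natrD.
apply: eq_integral => w _; rewrite patchE /F/= -/(b w) /b; case: ifP => _; last by rewrite integral0_eq.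
pose fj (z : V) := f (pos j w, z).
have nfa (a : V) : nnm (fun z : V => fj (a + z)%R).
  split=> [|z]; last exact: f0.
  apply: measurableT_comp mf _; apply: measurable_fun_pair; first exact: measurable_cst.
  by apply: measurable_rowD => //; exact: measurable_cst.
transitivity (\int[P x]_w' fj (pos n w + (X (m%:R * eps) w' - X 0 w'))%R)%E.
  pose J1 w' : V := X (m%:R * eps) w' - X 0 w'.
  have mJ1 : measurable_fun setT J1 by apply: measurable_rowB; exact: mX.
  pose J' : {mfun Omega >-> V} := mfun_Sub (mem_set mJ).
  pose J1' : {mfun Omega >-> V} := mfun_Sub (mem_set mJ1).
  have JE : (J' : Omega -> V) = J := mfun_valP _.
  have J1E : (J1' : Omega -> V) = J1 := mfun_valP _.
  have [ma a0] := nfa (pos n w).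
  transitivity (\int[distribution (P x) J']_z fj (pos n w + z)%R)%E.
    by rewrite ge0_integral_distribution//; apply: eq_integral => w' _ /=; rewrite JE.
  rewrite (eq_measure_integral (distribution (P x) J1')); last first.
    move=> A mA _; change (P x (J' @^-1` A) = P x (J1' @^-1` A)); rewrite JE J1E.
    have := levy_stationary_increments X_levy x (s := n%:R * eps) (t := m%:R * eps) (ne n) (ne m) mA.
    by rewrite -mulrDl -natrD.
  by rewrite ge0_integral_distribution//; apply: eq_integral => w' _ /=; rewrite J1E.
rewrite (law_integral0 X_levy p_density x t0 (nfa (pos n w))).
pose h (y : V) := ((p (m%:R * eps) x y)%:E * fj (pos n w + (y - x))%R)%E.
have mp : measurable_fun setT (fun y : V => p (m%:R * eps) x y) := measurable_p p_density x t0.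
have mh : measurable_fun setT h.
  apply: emeasurable_funM; first exact/measurable_EFinP.
  have := (nfa (pos n w - x)).1; congr measurable_fun; apply/funext => y.
  by congr fj; apply/rowP => i; rewrite !mxE; ring.
rewrite -(ge0_integral_shiftRd (x - pos n w) (f := h))//; last first.
  by move=> y; rewrite mule_ge0// ?lee_fin ?p0// f0.
apply: eq_integral => z _; rewrite /h.
have -> : pos n w + (z + (x - pos n w) - x) = z.
  by apply/rowP => i; rewrite !mxE; ring.
congr (_%:E * _)%E; apply: (density_eq d0 phi_cbf X_levy X_exponent p_density) => //.
by congr enorm; apply/rowP => i; rewrite !mxE; ring.
Qed.

Lemma Past_markov n m E (f : V -> \bar R) : Past n E -> (0 < m)%N -> nnm f ->
  (\int[P x]_(w in E) f (pos (n + m) w) =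
   \int[P x]_(w in E) \int[mu]_z ((p (m%:R * eps) (pos n w) z)%:E * f z))%E.
Proof.
move=> hE m0 [mf f0]; apply: (@Past_markov2 0 n m E (fun z => f z.2)) => //.
by split=> [|z //]; exact: measurableT_comp mf measurable_snd.
Qed.

End markov.

Lemma continuous_enorm (R : realType) d (y : 'rV[R]_d) : continuous (fun z : 'rV[R]_d => enorm (z - y)).
Proof.
move=> z; have FF : Filter (nbhs z) := nbhs_filter z.
apply: (@continuous_comp _ _ _ (fun z : 'rV[R]_d => dot (z - y) (z - y)) Num.sqrt); last exact: sqrt_continuous.
suff H (s : seq 'I_d) : (fun z0 : 'rV[R]_d => \sum_(i <- s) (z0 - y) 0 i * (z0 - y) 0 i) @ nbhs z -->
    \sum_(i <- s) (z - y) 0 i * (z - y) 0 i by exact: H.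
elim: s => [|i s IH].
  have -> : (fun z0 : 'rV[R]_d => \sum_(i <- [::]) (z0 - y) 0 i * (z0 - y) 0 i) = cst 0.
    by apply/funext => z0; rewrite big_nil.
  by rewrite big_nil; exact: (@cvg_cst _ (0 : R) _ (nbhs z) FF).
under eq_fun do rewrite big_cons; rewrite big_cons; apply: (cvgD (FF := FF) _ IH).
have h : (fun z0 : 'rV[R]_d => (z0 - y) 0 i) @ nbhs z --> (z - y) 0 i.
  rewrite !mxE; under eq_fun do rewrite !mxE.
  apply: (cvgD (FF := FF)); first exact: coord_continuous.
  exact: (@cvg_cst _ (- y 0 i : R) _ (nbhs z) FF).
exact: (cvgM (FF := FF) h h).
Qed.

Lemma enorm_ball (R : realType) d (y z : 'rV[R]_d) e : enorm (z - y) < e -> ball y e z.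
Proof.
move=> h; split; first by apply: le_lt_trans h; exact: enorm_ge0.
move=> i j; rewrite ord1 /ball/= distrC.
by apply: le_lt_trans h; have := coord_le_enorm (z - y) j; rewrite !mxE.
Qed.

Lemma cvg_enorm0 (R : realType) d (T : Type) (F : set_system T) (FF : Filter F) (f : T -> 'rV[R]_d) (y : 'rV[R]_d) :
  (enorm (f t - y) @[t --> F] --> (0 : R)) <-> f @ F --> y.
Proof.
split=> h.
  apply/cvg_ballP => e e0.
  have /cvgrPdist_lt/(_ e e0) h2 := h.
  by near=> t; apply: enorm_ball; have : `|0 - enorm (f t - y)| < e; [near: t; exact: h2|rewrite sub0r normrN ger0_norm ?enorm_ge0].
have h2 := cvg_comp _ _ h (@continuous_enorm R d y y).
by rewrite subrr enorm0 in h2.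
Unshelve. all: by end_near.
Qed.

(** * Pointwise Chapman-Kolmogorov equation *)

Section chapman.
Context (R : realType) (d : nat) (disp : measure_display) (Omega : measurableType disp).
Variables (P : 'rV[R]_d -> probability Omega R) (X : R -> Omega -> 'rV[R]_d).
Variables (phi : R -> R) (p : R -> 'rV[R]_d -> 'rV[R]_d -> R).
Hypothesis d0 : (0 < d)%N.
Hypothesis phi_gt0 : forall l, 0 < l -> 0 < phi l.
Hypothesis phi_cbf : complete_bernstein phi.
Hypothesis X_levy : levy_process P X.
Hypothesis X_exponent : has_characteristic_exponent P X phi.
Hypothesis p_density : transition_density P X p.
Local Notation V := (borelRd R d).
Local Notation mu := (@lebesgueRd R d).
Let p0 := density_ge0 p_density.
Let pshift := density_shift d0 phi_cbf X_levy X_exponent p_density.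
Let psym := density_sym d0 phi_cbf X_levy X_exponent p_density.
Let pmono := density_mono d0 phi_cbf X_levy X_exponent p_density.

Lemma measurable_p2 t : 0 < t -> measurable_fun setT (fun z : V * V => p t z.1 z.2).
Proof.
move=> t0; rewrite (_ : (fun z : V * V => p t z.1 z.2) = (fun y : V => p t 0 y) \o (fun z : V * V => z.1 - z.2)).
  apply: measurableT_comp (measurable_p p_density 0 t0) _.
  by apply: measurable_rowB; [exact: measurable_fst|exact: measurable_snd].
by apply/funext => z /=; exact: pshift.
Qed.

Lemma nnm_p t x : 0 < t -> nnm (fun y : V => (p t x y)%:E).
Proof. by move=> t0; split=> [|y]; [apply/measurable_EFinP; exact: (measurable_p p_density x t0)|rewrite lee_fin p0]. Qed.

Lemma density_max t x y : 0 < t -> p t x y <= p t 0 0.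
Proof. by move=> t0; apply: pmono => //; rewrite subrr enorm0 enorm_ge0. Qed.

Section grid.
Variables (eps : R).
Hypothesis eps0 : 0 < eps.
Local Notation pos := (pos X).

Let ne n : (0 < n)%N -> 0 < n%:R * eps. Proof. by move=> n0; rewrite mulr_gt0// ltr0n. Qed.

Lemma pos_law n x (f : V -> \bar R) : (0 < n)%N -> nnm f ->
  (\int[P x]_w f (pos x eps n w) = \int[mu]_y ((p (n%:R * eps) x y)%:E * f y))%E.
Proof.
move=> n0 [mf f0]; pose f' (z : V) := f (x + z).
have nf' : nnm f'.
  split=> [|z]; last exact: f0.
  by apply: measurableT_comp mf _; apply: measurable_rowD => //; exact: measurable_cst.
rewrite (law_integral0 X_levy p_density x (ne n0) nf'); apply: eq_integral => y _.
by rewrite /f' addrC subrK.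
Qed.

Lemma CK_int n m x (f : V -> \bar R) : (0 < n)%N -> (0 < m)%N -> nnm f ->
  (\int[mu]_z ((p ((n + m)%:R * eps) x z)%:E * f z) =
  \int[mu]_w ((p (n%:R * eps) x w)%:E * \int[mu]_z ((p (m%:R * eps) w z)%:E * f z)))%E.
Proof.
move=> n0 m0 nf; have nm0 : (0 < n + m)%N by rewrite addn_gt0 n0.
have nQ := nnm_QU mu (measurable_p2 (ne m0)) (fun x y => p0 x y (ne m0)) measurableT nf.
rewrite -(pos_law x n0 nQ) -(pos_law x nm0 nf).
by have := Past_markov d0 phi_cbf X_levy X_exponent p_density x eps0 (@PastT _ _ _ _ X eps n) m0 nf.
Qed.

(** [CK_int] gives equality for almost every endpoint. Balls have positive measure, so y is a limit
    of endpoints where it holds; both sides are continuous in the endpoint, the integral by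
    dominated convergence and [density_max]. *)
Lemma CK n m x y : (0 < n)%N -> (0 < m)%N ->
  ((p ((n + m)%:R * eps) x y)%:E =
  \int[mu]_w ((p (n%:R * eps) x w)%:E * (p (m%:R * eps) w y)%:E))%E.
Proof.
move=> n0 m0; have nm0 : (0 < n + m)%N by rewrite addn_gt0 n0.
pose s := n%:R * eps; pose t := m%:R * eps; pose st := (n + m)%:R * eps.
have s0 : 0 < s := ne n0; have t0 : 0 < t := ne m0; have st0 : 0 < st := ne nm0.
pose g1 (z : V) : \bar R := (p st x z)%:E.
pose F (z : V * V) : \bar R := ((p s x z.1)%:E * (p t z.1 z.2)%:E)%E.
have mF : measurable_fun setT F.
  apply: emeasurable_funM; last by apply/measurable_EFinP; exact: measurable_p2.
  exact: measurableT_comp (nnm_p x s0).1 measurable_fst.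
have F0 z : (0 <= F z)%E by rewrite mule_ge0// lee_fin p0.
pose g2 (z : V) : \bar R := (\int[mu]_w F (w, z))%E.
have mg2 : measurable_fun setT g2 by exact: (@measurable_fun_fubini_tonelli_G _ _ _ _ _ mu F mF F0).
have ae : ae_eq mu setT g1 g2.
  apply: integral_ae_eq => //.
    apply/integrableP; split; first exact: (nnm_p x st0).1.
    under eq_integral do rewrite gee0_abs ?lee_fin ?p0//.
    by rewrite (p_mass p_density x st0) ltry.
  move=> E _ mE.
  have nE : nnm (fun z : V => (\1_E z : R)%:E).
    by split=> [|z]; [apply/measurable_EFinP; exact: measurable_indic|rewrite lee_fin].
  have H := CK_int x n0 m0 nE.
  transitivity (\int[mu]_z ((p st x z)%:E * (\1_E z)%:E))%E.
    rewrite integral_mkcond; apply: eq_integral => z _; rewrite patchE indicE.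
    by case: ifP => _; rewrite ?mule1 ?mule0.
  rewrite H.
  pose G (z : V * V) : \bar R := (F z * (\1_E z.2)%:E)%E.
  have mG : measurable_fun setT G.
    by apply: emeasurable_funM => //; exact: measurableT_comp nE.1 measurable_snd.
  have G0 z : (0 <= G z)%E by rewrite mule_ge0// lee_fin.
  have FT := fubini_tonelli (m1 := mu) (m2 := mu) G mG G0.
  transitivity (\int[mu]_w \int[mu]_z G (w, z))%E.
    apply: eq_integral => w _; rewrite -(nnm_intZ mu); last 2 first.
    - by rewrite lee_fin p0.
    - exact: (nnm_qf (measurable_p2 t0) (fun a b => p0 a b t0) w nE).
    by apply: eq_integral => z _; rewrite /G /F/= muleA.
  rewrite FT [RHS]integral_mkcond; apply: eq_integral => z _.
  rewrite patchE /g2 /G/=; case: ifPn => zE.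
    by apply: eq_integral => w _; rewrite indicE zE mule1.
  by apply: integral0_eq => w _; rewrite indicE (negPf zE) mule0.
have ex k : exists z : V, enorm (z - y) < k.+1%:R^-1 /\ g1 z = g2 z.
  apply: contrapT => nex; case: ae => N [mN N0 h].
  have k0 : 0 < k.+1%:R^-1 :> R by rewrite invr_gt0 ltr0n.
  have sub : eball y (k.+1%:R^-1) `<=` N.
    move=> z zy; apply: h => /= h'; apply: nex; exists z; split=> //; exact: h'.
  have := lebesgue_eball_lb y k0; apply/negP; rewrite -ltNge.
  apply: (@le_lt_trans _ _ (mu N)); first by apply: le_measure => //; rewrite inE//; exact: measurable_eball.
  by rewrite N0 lte_fin exprn_gt0// divr_gt0.
have [z_ hz] := choice ex.
have cz : z_ @ \oo --> (y : 'rV[R]_d).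
  apply/cvg_enorm0; apply: (@squeeze_cvgr _ _ _ _ (fun=> 0) (fun k => k.+1%:R^-1)).
  - by apply: nearW => k; rewrite enorm_ge0/= ltW// (hz k).1.
  - exact: cvg_cst.
  - exact: cvg_harmonic.
have c1 : g1 \o z_ @ \oo --> g1 y.
  apply: (@cvg_comp _ _ _ _ EFin _ (nbhs (p st x y))) => //.
  have h := density_continuous p_density (x := x) (y := y) st0.
  exact: (cvg_comp _ _ cz (continuous_slice h)).
have c2 : g2 \o z_ @ \oo --> g2 y.
  have [] := @dominated_cvg_R R _ V mu (fun k w => p s x w * p t w (z_ k)) (fun w => p s x w * p t w y)
     (fun w => p s x w * p t 0 0).
  - move=> k; apply: measurable_funM; first exact: (measurable_p p_density x s0).
    rewrite (_ : (fun w : V => _) = fun w => p t (z_ k) w); first exact: (measurable_p p_density (z_ k) t0).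
    by apply/funext => w; exact: psym.
  - move=> w; apply: cvgM; first exact: cvg_cst.
    have h := density_continuous p_density (x := w) (y := y) t0.
    exact: (cvg_comp _ _ cz (continuous_slice h)).
  - rewrite (_ : EFin \o _ = fun w : V => ((p t 0 0)%:E * (p s x w)%:E)%E); last first.
      by apply/funext => w /=; rewrite mulrC.
    apply: integrableZl => //; apply/integrableP; split; first exact: (nnm_p x s0).1.
    under eq_integral do rewrite gee0_abs ?lee_fin ?p0//.
    by rewrite (p_mass p_density x s0) ltry.
  - move=> k w; rewrite ger0_norm ?mulr_ge0 ?p0// ler_wpM2l ?p0//.
    exact: density_max.
  by move=> _.
have E12 : g1 \o z_ = g2 \o z_ by apply/funext => k; exact: (hz k).2.
rewrite -[LHS]/(g1 y) -[RHS]/(g2 y); apply/esym.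
have := cvg_lim (@ereal_hausdorff R) c2; rewrite -E12 => <-.
exact: cvg_lim c1.
Qed.

End grid.
End chapman.

(** * Killed walk: Hunt's formula and displacements after exit *)

Section hunt.
Context (R : realType) (d : nat) (disp : measure_display) (Omega : measurableType disp).
Variables (P : 'rV[R]_d -> probability Omega R) (X : R -> Omega -> 'rV[R]_d).
Variables (phi : R -> R) (p : R -> 'rV[R]_d -> 'rV[R]_d -> R).
Hypothesis d0 : (0 < d)%N.
Hypothesis phi_gt0 : forall l, 0 < l -> 0 < phi l.
Hypothesis phi_cbf : complete_bernstein phi.
Hypothesis X_levy : levy_process P X.
Hypothesis X_exponent : has_characteristic_exponent P X phi.
Hypothesis p_density : transition_density P X p.
Variables (C alpha beta : R).
Hypothesis W : wscale phi C alpha beta.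
Local Notation V := (borelRd R d).
Local Notation mu := (@lebesgueRd R d).
Local Notation ph := (ph phi).
Let p0 := density_ge0 p_density.
Let pshift := density_shift d0 phi_cbf X_levy X_exponent p_density.
Let psym := density_sym d0 phi_cbf X_levy X_exponent p_density.
Let mp2 t (t0 : 0 < t) := measurable_p2 d0 phi_cbf X_levy X_exponent p_density t0.
Let np t x (t0 : 0 < t) := nnm_p p_density x t0.

(** The value 0 at n = 0 is a default: [w_iter] asks for n > 0 and the condition of [w_P] fails at n
    = 0. *)
Definition stepP (eps : R) (n : nat) : R := if n is 0 then 0 else p (n%:R * eps) 0 0.

Lemma QUn_step (eps : R) (B : set V) (f : V -> \bar R) n x : 0 < eps -> measurable B -> nnm f ->
  (QUn mu (p eps) B n.+1 f x <= \int[mu]_(z in B) ((p (n.+1%:R * eps) x z)%:E * f z))%E.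
Proof.
move=> e0 mB nf; have q0 := fun a b => p0 a b e0.
have nfB := nnm_restr mB nf.
elim: n x => [|n IH] x; first by rewrite mul1r.
have t0 : 0 < n.+1%:R * eps by rewrite mulr_gt0// ltr0n.
have t1 : 0 < n.+2%:R * eps by rewrite mulr_gt0// ltr0n.
rewrite -[leLHS]/(QU mu (p eps) B (QUn mu (p eps) B n.+1 f) x).
pose g (w : V) : \bar R := (\int[mu]_(z in B) ((p (n.+1%:R * eps) w z)%:E * f z))%E.
have ng : nnm g := nnm_QU mu (mp2 t0) (fun a b => p0 a b t0) mB nf.
apply: (@le_trans _ _ (QU mu (p eps) B g x)).
  by apply: (QU_le mu (mp2 e0) q0) => //; exact: (nnm_QUn mu (mp2 e0) q0).
apply: (@le_trans _ _ (QU mu (p eps) setT g x)); first exact: (QUS mu (mp2 e0) q0).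
have CK1 := CK_int d0 phi_cbf X_levy X_exponent p_density e0 x (ltn0Sn 0) (ltn0Sn n) nfB.
rewrite [leRHS]integral_mkcond le_eqVlt; apply/orP; left; apply/eqP.
transitivity (\int[mu]_z ((p (n.+2%:R * eps) x z)%:E * (f \_ B) z))%E; last first.
  by apply: eq_integral => z _; rewrite !patchE; case: ifP => // _; rewrite mule0.
rewrite [n.+2]/(1 + n.+1)%N CK1 mul1r; apply: eq_integral => w _; congr (_ * _)%E.
rewrite /g integral_mkcond; apply: eq_integral => z _.
by rewrite !patchE; case: ifP => // _; rewrite mule0.
Qed.

(** The condition on eps is the smallness that [density_lb] asks for at distances at least rho; the
    other bounds hold at every scale. *)
Lemma walk_exists : exists2 Cw, 1 <= Cw & scale Cw ph /\ (forall eps rho, 0 < eps -> 0 < rho ->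
  Cw * (eps * ph rho) <= 1 -> walk Cw rho ph (Keps d C alpha) eps (p eps) (stepP eps)).
Proof.
have [Kd Kd1 hKd] := density_lb d0 phi_gt0 phi_cbf X_levy X_exponent p_density W.
have C1 := ws_C W; have C0 : 0 < C := lt_le_trans ltr01 C1.
have Ku := Kup_gt0 d W.
have K10 : 0 < K1 d C.
  by rewrite /K1 mulr_gt0 ?exprn_gt0 ?mulr_gt0.
pose Cw := C + K1 d C + Kd + 2 * Kup d C.
have h1 : C <= Cw by rewrite /Cw; lra.
have h2 : K1 d C <= Cw by rewrite /Cw; lra.
have h3 : Kd <= Cw by rewrite /Cw; lra.
have h4 : 2 * Kup d C <= Cw by rewrite /Cw; lra.
have Cw0 : 0 < Cw by lra.
exists Cw; first by lra.
have php r : 0 < r -> 0 < ph r := @ph_gt0 _ _ phi_gt0 r.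
have nup r : 0 < r -> 0 < ph r / r ^+ d by move=> r0; rewrite divr_gt0 ?php ?exprn_gt0.
split.
  split=> //; first by lra.
  - move=> r s r0 rs; apply: (le_trans (ph_dec phi_gt0 W r0 rs)).
    by rewrite ler_pM2r ?php.
  - move=> r s r0 rs; have s0 : 0 < s by lra.
    apply: (le_trans (ph_dbl phi_gt0 W r0 rs)).
    by rewrite ler_pM2r ?php// ler_wpM2r ?sqr_ge0.
move=> eps rho e0 r0 hr.
split=> //.
- exact: mp2.
- by move=> x y; exact: p0.
- by move=> x y; exact: psym.
- by move=> x; exact: (p_mass p_density x e0).
- move=> x f [mf f0]; pose g (y : V) := ((p eps x y)%:E * f (x + (x - y))%R)%E.
  have mg : measurable_fun setT (fun y : V => (p eps x y)%:E * f y)%E.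
    by apply: emeasurable_funM => //; exact: (np x e0).1.
  rewrite -(@ge0_integral_affineRd R d (-1) (x + x) (fun y => (p eps x y)%:E * f y)%E)//; last 2 first.
  + by right.
  + by move=> y; rewrite mule_ge0// lee_fin p0.
  apply: eq_integral => y _.
  have -> : -1 *: y + (x + x) = x + (x - y) by apply/rowP => i; rewrite !mxE; ring.
  congr (_%:E * _)%E; apply: (density_eq d0 phi_cbf X_levy X_exponent p_density) => //.
  by rewrite enormB; congr enorm; apply/rowP => i; rewrite !mxE; ring.
- move=> x y xy; apply: (le_trans (density_ub d0 phi_gt0 phi_cbf X_levy X_exponent p_density W e0 xy)).
  have xy0 : 0 < enorm (x - y) by apply: enorm_gt0; rewrite subr_eq0.
  by rewrite ler_pM2r// mulr_gt0// nup.
- move=> x y xy; have xy0 : 0 < enorm (x - y) by lra.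
  have xny : x != y by apply: contraTneq xy0 => ->; rewrite subrr enorm0 ltxx.
  apply: (@le_trans _ _ (Kd * p eps x y)); last by rewrite ler_wpM2r ?p0.
  apply: hKd => //; apply: le_trans hr.
  have := ph_dec phi_gt0 W r0 xy => h.
  rewrite mulrCA ler_pM2l//; apply: (le_trans h).
  by rewrite ler_pM2r// php.
- move=> x s s0; apply: (le_trans (moment_min d0 phi_gt0 phi_cbf X_levy X_exponent p_density W x e0 s0)).
  by rewrite lee_fin ler_pM2r// mulr_gt0// php.
- move=> [//|n] B f x _ mB nf; have t0 : 0 < n.+1%:R * eps by rewrite mulr_gt0// ltr0n.
  apply: (le_trans (QUn_step n x e0 mB nf)).
  have [mf f0] := nf; have s0 : (0 <= (stepP eps n.+1)%:E)%E by rewrite lee_fin p0.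
  have nfB := nnm_restr mB nf.
  rewrite integral_mkcond [X in (_ <= _ * X)%E]integral_mkcond -(nnm_intZ mu s0 nfB).
  apply: ge0_le_integral => //.
  + by move=> z _; apply: erestrict_ge0 => w _; rewrite mule_ge0// lee_fin p0.
  + have := nnm_restr mB (nnm_qf (mp2 t0) (fun a b => p0 a b t0) x nf); by case.
  + by have [] := nnmZ s0 nfB.
  move=> z _; rewrite !patchE; case: ifP => _; last by rewrite mule0.
  by apply: lee_wpmul2r => //; rewrite lee_fin; exact: (density_max d0 phi_cbf X_levy X_exponent p_density).
- move=> eta s [|n] eta0 s0 hn; first by rewrite mul0r in hn; lra.
  apply: (density_diag d0 phi_gt0 phi_cbf X_levy X_exponent p_density W) => //.
    by rewrite mulr_gt0// ltr0n.
  by rewrite -mulrA.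
- by move=> [//|n]; apply: p0; rewrite mulr_gt0// ltr0n.
Qed.

Section grid.
Variables (x : V) (eps : R).
Hypothesis eps0 : 0 < eps.
Local Notation pos := (pos X x eps).
Local Notation Past := (Past X eps).
Let ne n : (0 < n)%N -> 0 < n%:R * eps. Proof. by move=> n0; rewrite mulr_gt0// ltr0n. Qed.
Let mpos n : measurable_fun setT (pos n) := measurable_pos X_levy x eps0 n.
Let mk := Past_markov d0 phi_cbf X_levy X_exponent p_density x eps0.
Let mk2 := Past_markov2 d0 phi_cbf X_levy X_exponent p_density x eps0.
Let Pm := Past_measurable X_levy eps0.

Section exit.
Variable U : set V.
Hypothesis mU : measurable U.

(** Index 0 is left out, as [exit_time] looks at positive times only. *)
Definition alive (k : nat) : set Omega := [set w | forall i, (0 < i <= k)%N -> U (pos i w)].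

Definition exitat (j : nat) : set Omega :=
  [set w | [/\ (0 < j)%N, forall i, (0 < i < j)%N -> U (pos i w) & ~ U (pos j w)]].

Lemma alive0 : alive 0 = setT.
Proof. by apply/seteqP; split=> // w _ [|i]. Qed.

Lemma aliveS k : alive k.+1 = alive k `&` pos k.+1 @^-1` U.
Proof.
apply/seteqP; split=> w /=.
  by move=> h; split=> [i /andP[i0 ik]|]; apply: h; rewrite ?i0 ?ltnS ?leqnn// ltnW.
move=> [h1 h2] i /andP[i0]; rewrite leq_eqVlt => /orP[/eqP ->//|].
by rewrite ltnS => ik; apply: h1; rewrite i0.
Qed.

Lemma exitatS k : exitat k.+1 = alive k `&` ~` (pos k.+1 @^-1` U).
Proof.
apply/seteqP; split=> w /=.
  by move=> [_ h1 h2]; split=> // i /andP[i0 ik]; apply: h1; rewrite i0 ltnS.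
by move=> [h1 h2]; split=> // i /andP[i0 ik]; apply: h1; rewrite i0 -ltnS.
Qed.

Lemma Past_alive k n : (k <= n)%N -> Past n (alive k).
Proof.
elim: k => [|k IH] kn; first by rewrite alive0; exact: PastT.
rewrite aliveS; apply: PastI; first exact: IH (ltnW kn).
exact: Past_pos.
Qed.

Lemma Past_exitat k n : (k <= n)%N -> Past n (exitat k).
Proof.
case: k => [|k] kn.
  rewrite (_ : exitat 0 = set0); last by apply/seteqP; split=> w // -[].
  by rewrite -setCT; apply: PastC; exact: PastT.
rewrite exitatS; apply: PastI; first exact: Past_alive (ltnW kn).
by apply: PastC; exact: Past_pos.
Qed.

Lemma exitat_disjoint : trivIset setT exitat.
Proof.
apply/trivIsetP => i j _ _ ij; apply/seteqP; split=> // w [[i0 hi1 hi2] [j0 hj1 hj2]].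
case: (ltngtP i j) ij => // ij _.
- by apply: hi2; apply: hj1; rewrite i0.
- by apply: hj2; apply: hi1; rewrite j0.
Qed.

Lemma alive_QUn k (f : V -> \bar R) : nnm f ->
  (\int[P x]_(w in alive k) f (pos k w) = QUn mu (p eps) U k f x)%E.
Proof.
elim: k f => [|k IH] f nf.
  have E : pos 0 = cst x by apply/funext => w; exact: pos0.
  rewrite alive0 E (eq_integral (cst (f x)))//.
  by rewrite integral_cst//= probability_setT mule1.
have nfU := nnm_restr mU nf.
have nQ := nnm_QU mu (mp2 eps0) (fun a b => p0 a b eps0) mU nf.
rewrite QUnSr -(IH _ nQ) aliveS.
transitivity (\int[P x]_(w in alive k) (f \_ U) (pos k.+1 w))%E.
  rewrite integral_mkcond [RHS]integral_mkcond; apply: eq_integral => w _.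
  rewrite !patchE in_setI; case: (w \in alive k) => //=.
have H := mk (Past_alive (leqnn k)) (ltn0Sn 0) nfU; rewrite addn1 mul1r in H.
rewrite H; apply: eq_integral => w _; rewrite /QU [RHS]integral_mkcond.
by apply: eq_integral => z _; rewrite !patchE; case: ifP => // _; rewrite mule0.
Qed.

(** Induction on n: a walk alive after n steps either survives the next one or exits there, and the
    Markov property with the pointwise Chapman-Kolmogorov equation carries the density over that
    step. *)
Lemma hunt_aux k y n : (n <= k)%N ->
  ((p (k.+1%:R * eps) x y)%:E = \int[P x]_(w in alive n) (p ((k.+1 - n)%:R * eps) (pos n w) y)%:E +
   \sum_(1 <= j < n.+1) \int[P x]_(w in exitat j) (p ((k.+1 - j)%:R * eps) (pos j w) y)%:E)%E.
Proof.
have pm t : 0 < t -> nnm (fun z : V => (p t z y)%:E).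
  move=> t0; have := np y t0; congr nnm; apply/funext => z; congr EFin; exact: psym.
elim: n => [_|n IH nk].
  have E : pos 0 = cst x by apply/funext => w; exact: pos0.
  rewrite big_geq// adde0 alive0 subn0 E (eq_integral (cst (p (k.+1%:R * eps) x y)%:E))//.
  by rewrite integral_cst//= probability_setT mule1.
rewrite big_nat_recr//= addeA [in RHS]addeAC IH; last exact: ltnW.
congr (_ + _)%E.
have sk : (0 < k.+1 - n)%N by rewrite subn_gt0 ltnS ltnW.
have skS : (k.+1 - n = 1 + (k.+1 - n.+1))%N by rewrite subnS add1n prednK.
have sk' : (0 < k.+1 - n.+1)%N by rewrite subn_gt0 ltnS.
have nf := pm _ (ne sk').
have H := mk (Past_alive (leqnn n)) (ltn0Sn 0) nf; rewrite addn1 mul1r in H.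
transitivity (\int[P x]_(w in alive n) (p ((k.+1 - n.+1)%:R * eps) (pos n.+1 w) y)%:E)%E.
  rewrite H; apply: eq_integral => w _; rewrite skS.
  by rewrite (CK d0 phi_cbf X_levy X_exponent p_density eps0)// mul1r.
rewrite [X in integral _ X _](_ : alive n = alive n.+1 `|` exitat n.+1); last first.
  by rewrite aliveS exitatS -setIUr setUv setIT.
rewrite ge0_integral_setU//.
- exact: Pm (Past_alive (leqnn _)).
- exact: Pm (Past_exitat (leqnn _)).
- by apply: measurable_funTS; exact: measurableT_comp nf.1 (mpos n.+1).
- by move=> w _; case: nf.
- by apply/disj_setPS => w; rewrite aliveS exitatS => -[[_ h] [_ h']].
Qed.

(* The mean of [hit k y] is what the skeleton walk loses by being killed: the
   discrete counterpart of the integral in [killed_density]. *)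
Definition hit (k : nat) (y : V) (w : Omega) : \bar R :=
  (\sum_(1 <= j < k.+1) (\1_(exitat j) w)%:E * (p ((k.+1 - j)%:R * eps) (pos j w) y)%:E)%E.

Lemma measurable_hit k y : measurable_fun setT (hit k y).
Proof.
rewrite /hit; under eq_fun do rewrite big_nat; under eq_fun do rewrite big_mkcond/=.
apply: emeasurable_sum => j; have [h|h] := boolP (0 < j < k.+1)%N; last first.
  exact: measurable_cst.
case/andP: h => j1 jk.
apply: emeasurable_funM.
  by apply/measurable_EFinP; apply: measurable_indic; exact: Pm (Past_exitat (leqnn _)).
have t0 : 0 < (k.+1 - j)%:R * eps by apply: ne; rewrite subn_gt0.
have pm : measurable_fun setT (fun z : V => (p ((k.+1 - j)%:R * eps) z y)%:E).
  have := (np y t0).1; congr measurable_fun; apply/funext => z; congr EFin; exact: psym.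
exact: measurableT_comp pm (mpos j).
Qed.

Lemma hit_ge0 k y w : (0 <= hit k y w)%E.
Proof.
rewrite /hit big_nat; apply: sume_ge0 => j /andP[_ jk].
by rewrite mule_ge0// lee_fin p0// ne// subn_gt0.
Qed.

(** Killing happens at the steps 1 to k; the last step, to y, is free, hence k + 1 on the left. *)
Lemma hunt k y :
  ((p (k.+1%:R * eps) x y)%:E = QUn mu (p eps) U k (fun z => (p eps z y)%:E) x +
   \int[P x]_w hit k y w)%E.
Proof.
have nf : nnm (fun z : V => (p eps z y)%:E).
  have := np y eps0; congr nnm; apply/funext => z; congr EFin; exact: psym.
rewrite (hunt_aux y (leqnn k)) -(alive_QUn k nf) subSnn mul1r; congr (_ + _)%E.
have pm j : (j < k.+1)%N -> nnm (fun w => (p ((k.+1 - j)%:R * eps) (pos j w) y)%:E).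
  move=> jk; have t0 : 0 < (k.+1 - j)%:R * eps by apply: ne; rewrite subn_gt0.
  split=> [|w]; last by rewrite lee_fin p0.
  have h := (np y t0).1.
  rewrite (_ : (fun w => _) = (fun z : V => (p ((k.+1 - j)%:R * eps) y z)%:E) \o pos j).
    exact: measurableT_comp h (mpos j).
  by apply/funext => w /=; congr EFin; exact: psym.
pose g j w := if (1 <= j < k.+1)%N then ((\1_(exitat j) w)%:E * (p ((k.+1 - j)%:R * eps) (pos j w) y)%:E)%E else 0%E.
transitivity (\sum_(1 <= j < k.+1) \int[P x]_w g j w)%E.
  rewrite big_nat [RHS]big_nat; apply: eq_bigr => j hj; rewrite integral_mkcond.
  by apply: eq_integral => w _; rewrite /g hj patchE indicE; case: ifP => _; rewrite ?mul1e ?mul0e.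
rewrite -ge0_integral_sum//.
- by apply: eq_integral => w _; rewrite /hit big_nat [RHS]big_nat; apply: eq_bigr => j hj; rewrite /g hj.
- move=> j; rewrite /g; have [h|h] := boolP (0 < j < k.+1)%N; last exact: measurable_cst.
  case/andP: h => _ jk; apply: emeasurable_funM; last exact: (pm j jk).1.
  by apply/measurable_EFinP; apply: measurable_indic; exact: Pm (Past_exitat (leqnn _)).
- move=> j w _; rewrite /g; case: ifP => [/andP[_ jk]|//].
  by rewrite mule_ge0//; exact: (pm j jk).2.
Qed.

End exit.

Lemma Past_le a b A : (a <= b)%N -> Past a A -> Past b A.
Proof.
move=> ab; apply: smallest_sub; first exact: smallest_sigma_algebra.
move=> _ [B [mB ->]]; apply: sub_sigma_algebra.
exists (fun i => if (i < a)%N then B i else setT); split.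
  by move=> i; case: ifP.
apply/seteqP; split => w /=.
  by move=> H i ib; case: ifP => // ia; exact: H.
by move=> H i ia; have := H i (leq_trans ia ab); rewrite ia.
Qed.

Section stay.
Variables (Cw rho : R).
Hypothesis sc : scale Cw ph.
Hypothesis Hw : walk Cw rho ph (Keps d C alpha) eps (p eps) (stepP eps).
Variable del : R.
Hypothesis del0 : 0 < del.

Definition stay (n k : nat) : set Omega :=
  [set w | forall i, (i <= k)%N -> enorm (pos (n + i) w - pos n w) < del].

Let e := 17 * (Cw * (eps * ph del)).
Let h (z : V * V) : \bar R := (bump z.1 del z.2)%:E.

Let e_ge0 : 0 <= e.
Proof.
have := sc_C sc => C1; have p1 := sc_pos sc del0.
by rewrite /e mulr_ge0// mulr_ge0; [|lra|rewrite mulr_ge0// ltW].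
Qed.

Let nh : nnm h.
Proof.
split=> [|z]; last by rewrite lee_fin bump_ge0.
have := measurable_bump (0 : 'rV[R]_d) del => mb.
have E : h = (fun w : V => (bump 0 del w)%:E) \o (fun z : V * V => z.2 - z.1).
  by apply/funext => z; rewrite /h /bump /= subr0.
rewrite E; apply: measurableT_comp; first exact/measurable_EFinP.
by apply: measurable_rowB; [exact: measurable_snd|exact: measurable_fst].
Qed.

Lemma stayS n k : stay n k.+1 = stay n k `&` [set w | enorm (pos (n + k.+1) w - pos n w) < del].
Proof.
apply/seteqP; split=> w /=.
  by move=> hh; split=> [i ik|]; apply: hh => //; exact: leqW.
by move=> [h1 h2] i; rewrite leq_eqVlt => /orP[/eqP->//|]; rewrite ltnS; exact: h1.
Qed.

Lemma Past_near a b : Past (maxn a b) [set w | enorm (pos b w - pos a w) < del].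
Proof.
have m1 k : (k <= maxn a b)%N -> measurable_fun setT (pos k : g_sigma_algebraType (past X eps (maxn a b)) -> V).
  by move=> kn _ S mS; rewrite setTI; exact: Past_pos.
have := measurable_enorm (measurable_rowB (m1 _ (leq_maxr a b)) (m1 _ (leq_maxl a b))).
move=> /(_ measurableT _ (measurable_itv `]-oo, del[)); rewrite setTI.
by congr measurable; apply/seteqP; split => w /=; rewrite in_itv.
Qed.

Lemma Past_stay n k m : (n + k <= m)%N -> Past m (stay n k).
Proof.
elim: k m => [|k IH] m nk.
  rewrite (_ : stay n 0 = setT); first exact: PastT.
  by apply/seteqP; split=> // w _ [|i]//; rewrite addn0 subrr enorm0.
rewrite stayS; apply: PastI; first by apply: IH; apply: leq_trans nk; rewrite addnS.
apply: (@Past_le (maxn n (n + k.+1))); last exact: Past_near.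
by rewrite geq_max nk (leq_trans _ nk)// leq_addr.
Qed.

(** The bump centred at the position at time n is 1 there and loses at most e per step in mean. It
    vanishes once the walk is at distance del, so restricting to [stay] costs nothing. *)
Lemma stay_bump n k E : Past n E ->
  (P x E <= \int[P x]_(w in E `&` stay n k) h (pos n w, pos (n + k) w) + (k%:R * e)%:E * P x E)%E.
Proof.
move=> hE; have mE := Pm hE.
have mh m : measurable_fun setT (fun w => h (pos n w, pos m w)).
  by apply: measurableT_comp nh.1 _; apply: measurable_fun_pair; exact: mpos.
elim: k => [|k IH].
  rewrite mul0r mul0e adde0 (_ : E `&` stay n 0 = E); last first.
    apply/seteqP; split=> w; first by case.
    by move=> Ew; split=> // -[|i]//; rewrite addn0 subrr enorm0.
  rewrite (eq_integral (cst 1%E)); first by rewrite integral_cst// mul1e.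
  by move=> w _; rewrite /h/= addn0 bump_center.
apply: (le_trans IH).
have PE : Past (n + k) (E `&` stay n k).
  by apply: PastI; [exact: Past_le (leq_addr _ _) hE|exact: Past_stay].
have mEk := Pm PE.
pose g w := (\int[mu]_z ((p eps (pos (n + k) w) z)%:E * h (pos n w, z)))%E.
have nhw w : nnm (fun z : V => h (pos n w, z)).
  by split=> [|z]; [exact: measurableT_comp nh.1 (measurable_pair1 _)|exact: nh.2].
have gE : (\int[P x]_(w in E `&` stay n k) g w =
    \int[P x]_(w in E `&` stay n k.+1) h (pos n w, pos (n + k.+1) w))%E.
  have H := mk2 (leq_addr k n) PE (ltn0Sn 0) nh; rewrite addn1 mul1r in H.
  rewrite -H integral_mkcond [RHS]integral_mkcond; apply: eq_integral => w _.
  rewrite !patchE stayS setIA [in RHS]in_setI addnS; case: (w \in E `&` stay n k) => //=.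
  case: ifPn => // /negP hn; rewrite /h/= bump_out// leNgt; apply/negP => hh; apply: hn.
  by apply/mem_set; rewrite /=.
have mg : measurable_fun setT g.
  pose G (z : V * V) := (\int[mu]_w ((p eps z.2 w)%:E * h (z.1, w)))%E.
  have GE : g = G \o (fun w => (pos n w, pos (n + k) w)) by [].
  rewrite GE; apply: measurableT_comp; last by apply: measurable_fun_pair; exact: mpos.
  pose F (t : (V * V) * V) := ((p eps t.1.2 t.2)%:E * h (t.1.1, t.2))%E.
  have F0 t : (0 <= F t)%E by rewrite mule_ge0// ?lee_fin ?p0//; exact: nh.2.
  have mF : measurable_fun setT F.
    have m11 : measurable_fun setT (fun t : (V * V) * V => t.1.1).
      exact: measurableT_comp measurable_fst measurable_fst.
    have m12 : measurable_fun setT (fun t : (V * V) * V => t.1.2).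
      exact: measurableT_comp measurable_snd measurable_fst.
    apply: emeasurable_funM.
      apply/measurable_EFinP.
      exact: (measurableT_comp (f := fun z : V * V => p eps z.1 z.2) (mp2 eps0) (measurable_fun_pair m12 measurable_snd)).
    by apply: measurableT_comp nh.1 _; apply: measurable_fun_pair => //; exact: measurable_snd.
  exact: (@measurable_fun_fubini_tonelli_F _ _ _ _ _ mu F mF F0).
have g0 w : (0 <= g w)%E.
  by apply: integral_ge0 => z _; rewrite mule_ge0// ?lee_fin ?p0//; exact: nh.2.
have k0' : (0 <= (k%:R * e)%:E)%E by rewrite lee_fin; exact: mulr_ge0 (ler0n R k) e_ge0.
have e0' : (0 <= e%:E)%E by rewrite lee_fin.
have -> : ((k.+1%:R * e)%:E * P x E = (k%:R * e)%:E * P x E + e%:E * P x E)%E.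
  by rewrite -ge0_muleDl// -EFinD -natr1 mulrDl mul1r.
rewrite [leRHS]addeA [leRHS]addeAC leeD2r// -gE.
apply: (@le_trans _ _ (\int[P x]_(w in E `&` stay n k) (g w + e%:E))%E).
  apply: ge0_le_integral => //.
  - by move=> w _; exact: nh.2.
  - exact: measurable_funTS.
  - by apply: measurable_funTS; apply: emeasurable_funD.
  move=> w _; rewrite /h/= /g.
  by have [_ +] := bump_drift Hw (pos n w) (pos (n + k) w) del0.
rewrite ge0_integralD//; last exact: measurable_funTS.
rewrite leeD2l// integral_cst//; apply: lee_wpmul2l; first by rewrite lee_fin.
by apply: le_measure; rewrite ?inE.
Qed.

Lemma stay_prob n k E : Past n E ->
  (P x (E `&` ~` stay n k) <= (k%:R * e)%:E * P x E)%E.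
Proof.
move=> hE; have mE := Pm hE; have mS : measurable (stay n k) := Pm (Past_stay (leqnn _)).
have H := stay_bump k hE.
have H2 : (\int[P x]_(w in E `&` stay n k) h (pos n w, pos (n + k) w) <= P x (E `&` stay n k))%E.
  apply: (@le_trans _ _ (\int[P x]_(w in E `&` stay n k) 1)%E).
    apply: ge0_le_integral => //.
    - exact: measurableI.
    - by move=> w _; exact: nh.2.
    - apply: measurable_funTS; apply: measurableT_comp nh.1 _.
      by apply: measurable_fun_pair; exact: mpos.
    - by move=> w _; rewrite lee_fin bump_le1.
  by rewrite integral_cst ?mul1e//; exact: measurableI.
have EE : P x E = (P x (E `&` stay n k) + P x (E `&` ~` stay n k))%E.
  rewrite -measureU//; first by rewrite -setIUr setUv setIT.
  - exact: measurableI.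
  - by apply: measurableI => //; exact: measurableC.
  - by rewrite setIACA setICr setI0.
have f1 : P x (E `&` stay n k) \is a fin_num by apply: fin_num_measure; exact: measurableI.
have := le_trans H (leeD2r _ H2); rewrite {1}EE leeD2lE//.
Qed.

(** The exits at the various steps j are disjoint events, each in the past of j, so summing
    [stay_prob] over j costs at most the total probability 1. This plays the role of the strong
    Markov property at the exit time. *)
Lemma exit_move (U : set V) k : measurable U ->
  (P x (\bigcup_j (exitat U j `&` ~` stay j k)) <= (k%:R * e)%:E)%E.
Proof.
move=> mU; have mX j : measurable (exitat U j) := Pm (Past_exitat mU (leqnn j)).
have mS j : measurable (stay j k) := Pm (Past_stay (leqnn _)).
have mXS j : measurable (exitat U j `&` ~` stay j k) by apply: measurableI => //; exact: measurableC.
have tI := @exitat_disjoint U.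
have ke : 0 <= k%:R * e by rewrite mulr_ge0.
apply: (@le_trans _ _ (\sum_(0 <= j <oo) P x (exitat U j `&` ~` stay j k))%E).
  by apply: measure_sigma_subadditive => //; exact: bigcupT_measurable.
apply: (@le_trans _ _ (\sum_(0 <= j <oo) (k%:R * e)%:E * P x (exitat U j))%E).
  apply: lee_nneseries => // j _; apply: stay_prob; exact: Past_exitat.
rewrite nneseriesZl//.
have <- : P x (\bigcup_j exitat U j) = (\sum_(0 <= j <oo) P x (exitat U j))%E.
  by rewrite measure_semi_bigcup//; exact: bigcupT_measurable.
rewrite -[leRHS]mule1; apply: lee_wpmul2l; first by rewrite lee_fin.
exact: probability_le1 (bigcupT_measurable _ mX).
Qed.

End stay.
End grid.
End hunt.

(** * Exit times along dyadic grids *)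

Lemma cvgnP (R : realType) (u : nat -> R) (l : R) :
  (forall e, 0 < e -> exists M, forall m, (M <= m)%N -> `|u m - l| < e) -> u @ \oo --> l.
Proof.
move=> h; apply/cvgrPdist_lt => e e0; have [M hM] := h e e0.
by exists M => // m /= Mm; rewrite distrC; exact: hM.
Qed.

Lemma pow2V_small (R : realType) (e : R) : 0 < e -> exists M, forall m, (M <= m)%N -> 2 ^- m < e.
Proof.
move=> e0; have [M hM] := expr_unbounded (1 + e^-1) (@ltr01 R).
exists M => m Mm; have e1 : e^-1 < 2 ^+ m.
  apply: (@lt_le_trans _ _ (2 ^+ M)); last by rewrite ler_eXn2l// ltr1n.
  by apply: lt_le_trans hM; lra.
by rewrite -[e]invrK ltf_pV2 ?posrE ?exprn_gt0 ?invr_gt0.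
Qed.

Lemma grid_ceil (R : realType) (s eps : R) : 0 <= s -> 0 < eps ->
  exists i, s < i.+1%:R * eps <= s + eps.
Proof.
move=> s0 e0; exists (Num.truncn (s / eps)).
have se : 0 <= s / eps by rewrite divr_ge0// ltW.
have /andP[h1 h2] := truncn_itv se.
apply/andP; split; first by rewrite -ltr_pdivrMr.
by rewrite -natr1 mulrDl mul1r lerD2r -ler_pdivlMr.
Qed.

Lemma open_enorm (R : realType) d (O : set 'rV[R]_d) z : open O -> O z ->
  exists2 e, 0 < e & forall z', enorm (z' - z) < e -> O z'.
Proof.
move=> oO Oz; have /nbhs_ballP[e /= e0 he] : nbhs z O by exact: open_nbhs_nbhs.
by exists e => // z' h; apply: he; exact: enorm_ball.
Qed.

Section pathwise.
Context (R : realType) (d : nat) (disp : measure_display) (Omega : measurableType disp).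
Variables (P : 'rV[R]_d -> probability Omega R) (X : R -> Omega -> 'rV[R]_d).
Variables (phi : R -> R) (p : R -> 'rV[R]_d -> 'rV[R]_d -> R).
Hypothesis d0 : (0 < d)%N.
Hypothesis phi_gt0 : forall l, 0 < l -> 0 < phi l.
Hypothesis phi_cbf : complete_bernstein phi.
Hypothesis X_levy : levy_process P X.
Hypothesis X_exponent : has_characteristic_exponent P X phi.
Hypothesis p_density : transition_density P X p.
Variables (C alpha beta : R).
Hypothesis W : wscale phi C alpha beta.
Local Notation V := (borelRd R d).
Local Notation mu := (@lebesgueRd R d).
Local Notation ph := (ph phi).
Local Notation eps m := (2 ^- m : R).
Let p0 := density_ge0 p_density.
Let eps_gt0 m : 0 < eps m. Proof. by rewrite invr_gt0 exprn_gt0. Qed.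

Variable x : V.

Record cadlag_path (w : Omega) : Prop := CadlagPath {
  cp0 : X 0 w = x ;
  cpr : forall t, 0 <= t -> forall e, 0 < e ->
    exists2 h, 0 < h & forall s, t <= s < t + h -> enorm (X s w - X t w) < e ;
  cpl : forall t, 0 < t -> exists L : 'rV[R]_d, forall e, 0 < e ->
    exists2 h, 0 < h & forall s, t - h < s < t -> enorm (X s w - L) < e }.

Lemma cadlag_ae : {ae P x, forall w, cadlag_path w}.
Proof.
have h1 := X0_ae X_levy x; have h2 := levy_cadlag X_levy x.
have h : {ae P x, forall w, X 0 w = x /\
  ((forall t : R, 0 <= t -> X^~ w @ t^'+ --> X t w) /\ (forall t : R, 0 < t -> cvg (X^~ w @ t^'-)))}.
  exact: filterS2 h1 h2.
apply: filterS h => w [w0 [wr wl]]; split=> //.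
- move=> t t0 e e0; have /cvg_enorm0 h := wr t t0.
  have /cvgrPdist_lt/(_ e e0) := h.
  rewrite /at_right => -[r /= r0 hr]; exists r => // s /andP[ts str].
  move: ts; rewrite le_eqVlt => /orP[/eqP <-|ts]; first by rewrite subrr enorm0.
  have hb : ball_ Num.norm t r s by rewrite /ball_/= ltr0_norm ?subr_lt0// opprB; lra.
  by have := hr s hb ts; rewrite sub0r normrN ger0_norm ?enorm_ge0.
- move=> t t0; have := wl t t0 => /cvg_ex[L hL]; exists L => e e0.
  have /cvg_enorm0 h := hL.
  have /cvgrPdist_lt/(_ e e0) := h.
  rewrite /at_left => -[r /= r0 hr]; exists r => // s /andP[ts str].
  have hb : ball_ Num.norm t r s by rewrite /ball_/= gtr0_norm ?subr_gt0//; lra.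
  by have := hr s hb str; rewrite sub0r normrN ger0_norm ?enorm_ge0.
Qed.

Local Notation et := (exit_time X).

Lemma et_le (U : set 'rV[R]_d) w s : 0 < s -> ~ U (X s w) -> (et U w <= s%:E)%E.
Proof. by move=> s0 h; apply: ereal_inf_lbound; exists s. Qed.

Lemma et_lt (U : set 'rV[R]_d) w r : (et U w < r%:E)%E -> exists s, [/\ 0 < s, s < r & ~ U (X s w)].
Proof.
by move=> /ereal_inf_lt[_ /= [s [s0 h] <-]]; rewrite lte_fin => sr; exists s.
Qed.

Lemma et_ge0 (U : set 'rV[R]_d) w : (0 <= et U w)%E.
Proof. by apply: le_ereal_inf_tmp => _ [s [s0 _] <-]; rewrite lee_fin ltW. Qed.

Lemma et_mono (U U' : set 'rV[R]_d) w : U `<=` U' -> (et U w <= et U' w)%E.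
Proof.
by move=> UU; apply: ereal_inf_le_tmp => _ [s [s0 h] <-]; exists s => //; split=> // /UU.
Qed.

Lemma et_finite (U : set 'rV[R]_d) w : et U w = +oo%E \/ exists2 T, et U w = T%:E & 0 <= T.
Proof.
have := et_ge0 U w; case: (et U w) => [T| |]//; last by left.
by rewrite lee_fin => T0; right; exists T.
Qed.

Lemma pos_cadlag e n w : cadlag_path w -> pos X x e n w = X (n%:R * e) w.
Proof. by move=> h; rewrite /pos (cp0 h) addrC subrK. Qed.

(** As U is closed, a path outside U at time s stays outside for a while by right continuity, and a
    fine grid has a point there. An exit seen on the grid is never earlier than the true one. *)
Lemma grid_exit (U : set 'rV[R]_d) w T : closed U -> cadlag_path w -> et U w = T%:E ->
  forall e, 0 < e -> exists M, forall m, (M <= m)%N ->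
    exists2 j, exitat X x (eps m) U j w & T <= j%:R * eps m < T + e.
Proof.
move=> cU gw eT e e0.
have T0 : 0 <= T by have := et_ge0 U w; rewrite eT lee_fin.
have [s [s0 sT nU]] : exists s, [/\ 0 < s, s < T + e / 2 & ~ U (X s w)].
  by apply: et_lt; rewrite eT lte_fin; lra.
have oU : open (~` U) by exact: closed_openC.
have [rho rho0 hrho] := open_enorm oU nU.
have [h h0 hh] := cpr gw (ltW s0) rho0.
have [M hM] := @pow2V_small R (Num.min h (e / 2)) ltac:(by rewrite lt_min h0 divr_gt0).
exists M => m Mm; have := hM m Mm; rewrite lt_min => /andP[mh me].
have [i /andP[i1 i2]] := grid_ceil (ltW s0) (eps_gt0 m).
have nUi : ~ U (X (i.+1%:R * eps m) w) by apply: hrho; apply: hh; apply/andP; split; lra.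
have ex : exists j, `[< (0 < j)%N /\ ~ U (X (j%:R * eps m) w) >] by exists i.+1; apply/asboolP.
case: (ex_minnP ex) => j /asboolP[j0 nUj] minj; exists j.
  split=> //; last by rewrite pos_cadlag.
  move=> a /andP[a0 aj]; rewrite pos_cadlag//; apply: contrapT => nUa.
  by have : (j <= a)%N by [apply: minj; apply/asboolP]; rewrite leqNgt aj.
have jm0 : 0 < j%:R * eps m by rewrite mulr_gt0// ltr0n.
rewrite -lee_fin -eT et_le//=.
have ji : (j <= i.+1)%N by apply: minj; apply/asboolP.
apply: (@le_lt_trans _ _ (i.+1%:R * eps m)); first by rewrite ler_pM2r// ler_nat.
lra.
Qed.

Lemma exit_closure (U : set 'rV[R]_d) w T : cadlag_path w -> et U w = T%:E ->
  forall e, 0 < e -> exists2 z, ~ U z & enorm (z - X T w) < e.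
Proof.
move=> gw eT e e0; have T0 : 0 <= T by have := et_ge0 U w; rewrite eT lee_fin.
have [h h0 hh] := cpr gw T0 e0.
have [s [s0 sT nU]] : exists s, [/\ 0 < s, s < T + h & ~ U (X s w)].
  by apply: et_lt; rewrite eT lte_fin; lra.
exists (X s w) => //; apply: hh; rewrite sT andbT -lee_fin -eT; exact: et_le.
Qed.

Section target.
Variables (y : V) (del : R).
Hypothesis del0 : 0 < del.

Definition Kfar := K1 d C * (C * ph del / del ^+ d).

Let ph0 r : 0 < r -> 0 < ph r := @ph_gt0 _ _ phi_gt0 r.

Lemma Kfar_ge0 : 0 <= Kfar.
Proof.
have C0 : 0 < C := lt_le_trans ltr01 (ws_C W).
rewrite /Kfar; apply: mulr_ge0; last by rewrite divr_ge0 ?exprn_ge0 ?(ltW del0)// mulr_ge0 ?(ltW C0)// ltW// ph0.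
by rewrite /K1 !mulr_ge0 ?exprn_ge0 ?mulr_ge0// ?(ltW C0)// ltW// (Kup_gt0 d W).
Qed.

Lemma far_bound (s : R) (z : 'rV[R]_d) : 0 < s -> del <= enorm (z - y) -> p s z y <= Kfar * s.
Proof.
move=> s0 zy; have C0 : 0 < C := lt_le_trans ltr01 (ws_C W).
have r0 : 0 < enorm (z - y) := lt_le_trans del0 zy.
have zny : z != y by apply: contraTneq r0 => ->; rewrite subrr enorm0 ltxx.
apply: (le_trans (density_ub d0 phi_gt0 phi_cbf X_levy X_exponent p_density W s0 zny)).
have k0 : 0 <= K1 d C by rewrite /K1 !mulr_ge0 ?exprn_ge0 ?mulr_ge0// ?(ltW C0)// ltW// (Kup_gt0 d W).
rewrite /Kfar -mulrA ler_wpM2l// mulrC ler_wpM2r ?(ltW s0)//.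
apply: ler_pM; rewrite ?invr_ge0 ?exprn_ge0 ?(ltW r0)//; first by rewrite ltW// ph0.
  exact: (ph_dec phi_gt0 W del0 zy).
by rewrite lef_pV2 ?posrE ?exprn_gt0// lerXn2r ?nnegrE ?(ltW r0) ?(ltW del0).
Qed.

(** Extension of p(s, z, y) by 0 to s <= 0. It is continuous in (s, z) while z stays away from y,
    because there p is at most a multiple of s. *)
Definition density0 (s : R) (z : 'rV[R]_d) : R := if 0 < s then p s z y else 0.

Lemma density0_ge0 (s : R) (z : 'rV[R]_d) : 0 <= density0 s z.
Proof. by rewrite /density0; case: ifP => // s0; exact: p0. Qed.

Lemma density0_bound (s : R) (z : 'rV[R]_d) : del <= enorm (z - y) -> density0 s z <= Kfar * Num.max s 0.
Proof.
move=> zy; rewrite /density0; case: ifPn => s0; last by rewrite max_r ?mulr0// leNgt.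
have -> : Num.max s 0 = s by apply/max_idPl; exact: ltW.
exact: (far_bound s0 zy).
Qed.

Lemma density0_cont (s : R) (z : 'rV[R]_d) : del <= enorm (z - y) -> forall e, 0 < e ->
  exists2 rho, 0 < rho & forall (s' : R) (z' : 'rV[R]_d), `|s' - s| < rho -> enorm (z' - z) < rho -> del <= enorm (z' - y) ->
    `|density0 s' z' - density0 s z| < e.
Proof.
move=> zy e e0; have [s0|s0] := ltP 0 s; last first.
  have k0 := Kfar_ge0.
  have rho0 : 0 < e / (1 + Kfar) by rewrite divr_gt0//; lra.
  exists (e / (1 + Kfar)) => // s' z' hs hz hy.
  rewrite /density0 [0 < s]ltNge s0 /= subr0 ger0_norm; last exact: density0_ge0.
  apply: (le_lt_trans (density0_bound _ hy)).
  have : Num.max s' 0 < e / (1 + Kfar).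
    by rewrite gt_max rho0 andbT; move: hs; rewrite ltr_norml => /andP[_ h]; lra.
  rewrite ltr_pdivlMr ?mulrDr ?mulr1; last by lra.
  have : 0 <= Num.max s' 0 by rewrite le_max lexx orbT.
  nra.
have := density_continuous p_density (x := z) (y := y) s0.
move=> /cvgrPdist_lt/(_ e e0); rewrite /=.
move=> [[A B] /= [nA [[B1 B2] /= [nB1 nB2] hB]] hAB].
have /nbhs_ballP[r1 /= r10 h1] := nA.
have /nbhs_ballP[r2 /= r20 h2] := nB1.
have y2 : B2 y by exact: nbhs_singleton.
exists (Num.min (Num.min r1 r2) s); first by rewrite !lt_min r10 r20.
move=> s' z'; rewrite !lt_min => /andP[/andP[s1 _] s3] /andP[/andP[_ z2] _] _.
have s'0 : 0 < s' by move: s3; rewrite ltr_norml => /andP[+ _]; lra.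
rewrite /density0 s'0 s0 distrC.
apply: (hAB (s', (z', y))); split=> /=; first by apply: h1; rewrite /ball/= distrC.
by apply: (hB (z', y)); split=> //=; apply: h2; exact: enorm_ball.
Qed.

(** The integrand of [killed_density], extended by 0 to all paths. *)
Definition Kill (U : set 'rV[R]_d) (t : R) (w : Omega) : R :=
  if (et U w < t%:E)%E then p (t - fine (et U w)) (X (fine (et U w)) w) y else 0.

Lemma KillE U t w T : et U w = T%:E -> Kill U t w = density0 (t - T) (X T w).
Proof. by move=> eT; rewrite /Kill eT lte_fin /= /density0 subr_gt0. Qed.

Lemma Kill_oo U t w : et U w = +oo%E -> Kill U t w = 0.
Proof. by move=> e; rewrite /Kill e ltNge leey. Qed.

Lemma Kill_late U t w : (t%:E <= et U w)%E -> Kill U t w = 0.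
Proof. by rewrite /Kill leNgt => /negPf ->. Qed.

Lemma Kill_ge0 U t w : 0 <= Kill U t w.
Proof.
have [e|[T e _]] := et_finite U w; last by rewrite (KillE _ e) density0_ge0.
by rewrite /Kill e ltNge leey.
Qed.

Lemma hit_eq e U k w j : exitat X x e U j w -> (j <= k)%N ->
  hit X p x e U k y w = (p ((k.+1 - j)%:R * e) (pos X x e j w) y)%:E.
Proof.
move=> hj jk; have j0 : (0 < j)%N by case: hj.
rewrite /hit (bigD1_seq j) ?iota_uniq//=; last by rewrite mem_index_iota j0 ltnS.
rewrite big1 ?adde0; first by rewrite indicE mem_set// mul1e.
move=> i ij; rewrite indicE memNset ?mul0e// => hi.
have := exitat_disjoint (U := U) (X := X) (x := x) (eps := e) => /trivIsetP/(_ i j I I ij).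
by move/seteqP => [+ _] => /(_ w); apply.
Qed.

Lemma hit_eq0 e U k w : (forall j, (j <= k)%N -> ~ exitat X x e U j w) -> hit X p x e U k y w = 0%E.
Proof.
move=> h; rewrite /hit big_nat big1// => j /andP[_ jk].
by rewrite indicE memNset ?mul0e//; exact: h.
Qed.

Section farset.
Variable U : set V.
Hypothesis U_far : forall z, ~ U z -> del <= enorm (z - y).

Lemma exit_far w T : cadlag_path w -> et U w = T%:E -> del <= enorm (X T w - y).
Proof.
move=> gw eT; rewrite leNgt; apply/negP => h.
have h0 : 0 < del - enorm (X T w - y) by lra.
have [z nU hz] := exit_closure gw eT h0.
have := U_far nU; have := enormB_triangle z (X T w) y; lra.
Qed.

Lemma hit_density0 e k w j : 0 < e -> cadlag_path w -> exitat X x e U j w ->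
  hit X p x e U k y w = (density0 (k.+1%:R * e - j%:R * e) (X (j%:R * e) w))%:E.
Proof.
move=> e0 gw hj; have [jk|kj] := leqP j k.
  rewrite (hit_eq hj jk) pos_cadlag// /density0 subr_gt0 ltr_pM2r// ltr_nat ltnS jk.
  by rewrite -mulrBl natrB// ltnW.
rewrite hit_eq0; first by rewrite /density0 subr_gt0 ltr_pM2r// ltr_nat ltnS leqNgt kj.
move=> i ik hi; have ij : i != j by rewrite neq_ltn (leq_ltn_trans ik kj).
have := exitat_disjoint (U := U) (X := X) (x := x) (eps := e) => /trivIsetP/(_ i j I I ij).
by move/seteqP => [+ _] => /(_ w); apply.
Qed.

Lemma hit_le e k w : 0 < e -> (hit X p x e U k y w <= (Kfar * (k.+1%:R * e))%:E)%E.
Proof.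
move=> e0; have k0 := Kfar_ge0.
have [[j jk hj]|h] := pselect (exists2 j, (j <= k)%N & exitat X x e U j w); last first.
  rewrite hit_eq0 ?lee_fin; first by rewrite mulr_ge0// mulr_ge0// ltW.
  by move=> j jk hj; apply: h; exists j.
rewrite (hit_eq hj jk) lee_fin; have [j0 _ nU] := hj.
have t0 : 0 < (k.+1 - j)%:R * e by rewrite mulr_gt0// ltr0n subn_gt0.
apply: (le_trans (far_bound t0 (U_far nU))); rewrite ler_wpM2l//.
by rewrite ler_pM2r// ler_nat leq_subr.
Qed.

Lemma hit_fin e k w : 0 < e -> hit X p x e U k y w \is a fin_num.
Proof.
move=> e0; rewrite fin_numE; apply/andP; split; last first.
  by rewrite lt_eqF// (le_lt_trans (hit_le k w e0))// ltry.
by rewrite gt_eqF// (lt_le_trans _ (hit_ge0 p_density x e0 U k y w))// ltNy0.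
Qed.

(** Chosen so that the time (k + 1) eps of [hunt] lies just above t. *)
Definition kgrid (m : nat) (t : R) : nat := Num.truncn (t / eps m).

Lemma kgridP m t : 0 <= t -> t < (kgrid m t).+1%:R * eps m <= t + eps m.
Proof.
move=> t0; have te : 0 <= t / eps m by rewrite divr_ge0// ltW.
have /andP[h1 h2] := truncn_itv te.
apply/andP; split; first by rewrite -ltr_pdivrMr.
by rewrite -natr1 mulrDl mul1r lerD2r -ler_pdivlMr.
Qed.

(** If the path exits at T, the grid exit times tend to T from the right, where the path is
    continuous, and the exit position is away from y. The case T = t is no exception, since
    [density0] is continuous at s = 0 too. *)
Lemma cvg_hit t w : closed U -> cadlag_path w -> 0 <= t ->
  fine (hit X p x (eps m) U (kgrid m t) y w) @[m --> \oo] --> Kill U t w.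
Proof.
move=> cU gw t0; apply: cvgnP => e e0.
have [eU|[T eT T0]] := et_finite U w.
  exists 0%N => m _; rewrite hit_eq0; first by rewrite (Kill_oo _ eU) subrr normr0.
  move=> j _ [j0 _]; rewrite pos_cadlag// => nU.
  have jm0 : 0 < j%:R * eps m by rewrite mulr_gt0// ltr0n.
  by have := et_le jm0 nU; rewrite eU leye_eq.
have [rho rho0 hrho] := density0_cont (t - T) (exit_far gw eT) e0.
have [h h0 hh] := cpr gw T0 rho0.
have q0 : 0 < Num.min h (rho / 2) by rewrite lt_min h0 divr_gt0.
have [M1 hM1] := grid_exit cU gw eT q0.
have [M2 hM2] := @pow2V_small R (rho / 2) ltac:(by rewrite divr_gt0).
exists (maxn M1 M2) => m; rewrite geq_max => /andP[m1 m2].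
have [j hj /andP[j1 j2]] := hM1 m m1.
have j3 : j%:R * eps m < T + h by apply: lt_le_trans j2 _; rewrite lerD2l ge_min lexx.
have j4 : j%:R * eps m < T + rho / 2 by apply: lt_le_trans j2 _; rewrite lerD2l ge_min lexx orbT.
rewrite (hit_density0 _ (eps_gt0 m) gw hj) (KillE _ eT) /=.
have /andP[k1 k2] := kgridP m t0; have e2 := hM2 m m2.
apply: hrho.
- by rewrite ltr_norml; apply/andP; split; lra.
- by apply: hh; rewrite j1.
- by have [_ _] := hj; rewrite pos_cadlag//; exact: U_far.
Qed.

End farset.
End target.

(** * Exhaustion of the open set by closed sets *)

Section shrink.
Variable D : set 'rV[R]_d.
Hypothesis oD : open D.

Definition inner_set (n : nat) : set 'rV[R]_d := [set z | forall v, enorm (v - z) < n.+1%:R^-1 -> D v].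

Lemma inner_setPn n z : ~ inner_set n z -> exists2 v, ~ D v & enorm (v - z) < n.+1%:R^-1.
Proof.
move=> h; apply: contrapT => h2; apply: h => v hv; apply: contrapT => nD.
by apply: h2; exists v.
Qed.

Lemma closed_inner_set n : closed (inner_set n).
Proof.
rewrite -[inner_set n]setCK; apply: open_closedC.
rewrite openE => z /inner_setPn[v nD hv].
have : \forall w \near z, enorm (w - v) < n.+1%:R^-1.
  rewrite enormB in hv.
  have /cvgrPdist_lt/(_ (n.+1%:R^-1 - enorm (z - v))) h := @continuous_enorm R d v z.
  have h0 : 0 < n.+1%:R^-1 - enorm (z - v) by rewrite subr_gt0.
  apply: filterS (h h0) => w; rewrite distrC => /(le_lt_trans (ler_norm _)).
  by rewrite ltrD2r.
apply: filterS => w hw; rewrite /= /inner_set /= => /(_ v); rewrite enormB => /(_ hw).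
exact: nD.
Qed.

Lemma measurable_inner_set n : measurable (inner_set n : set V).
Proof.
rewrite -[inner_set n]setCK; apply: measurableC; apply: sub_sigma_algebra.
exact: closed_openC (@closed_inner_set n).
Qed.

Lemma inner_set_sub n : inner_set n `<=` D.
Proof. by move=> z; apply; rewrite subrr enorm0 invr_gt0 ltr0n. Qed.

Lemma inner_set_mono n m : (n <= m)%N -> inner_set n `<=` inner_set m.
Proof.
move=> nm z h v hv; apply: h; apply: lt_le_trans hv _.
by rewrite lef_pV2 ?posrE ?ltr0n// ler_nat.
Qed.

Lemma invn_small (e : R) : 0 < e -> exists n, n.+1%:R^-1 < e.
Proof.
move=> e0; have [i /andP[h _]] := grid_ceil (ltW (divr_gt0 ltr01 e0)) (@ltr01 R).
exists i; rewrite mulr1 in h.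
by rewrite -[e]invrK ltf_pV2 ?posrE ?ltr0n ?invr_gt0// -div1r.
Qed.

Lemma invn_le (n m : nat) : (n <= m)%N -> m.+1%:R^-1 <= n.+1%:R^-1 :> R.
Proof. by move=> nm; rewrite lef_pV2 ?posrE ?ltr0n// ler_nat. Qed.

Lemma inner_set_far y : D y -> exists2 del, 0 < del & exists n0, forall n, (n0 <= n)%N ->
  inner_set n y /\ forall z, ~ inner_set n z -> del <= enorm (z - y).
Proof.
move=> Dy; have [e e0 he] := open_enorm oD Dy.
have e20 : 0 < e / 2 by rewrite divr_gt0.
exists (e / 2) => //; have [n0 hn0] := invn_small e20; exists n0 => n nn.
have n1 := invn_le nn; split.
  move=> v hv; apply: he; apply: lt_trans hv _; apply: le_lt_trans n1 _; apply: lt_trans hn0 _; lra.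
move=> z /inner_setPn[v nD hv0].
have hv : enorm (v - z) < e / 2 := lt_trans (lt_le_trans hv0 n1) hn0.
have : e <= enorm (v - y) by rewrite leNgt; apply/negP => h; apply: nD; exact: he.
have := enormB_triangle v z y; lra.
Qed.

(* Quasi-left-continuity along the exit times of the inner sets. *)
Definition no_jump (w : Omega) : Prop := forall (T : nat -> R) s, 0 < s ->
  (forall n, et (inner_set n) w = (T n)%:E) -> (forall n, T n < s) ->
  (forall e, 0 < e -> exists n, s - e < T n) ->
  forall e, 0 < e -> exists2 h, 0 < h & forall r, s - h < r < s -> enorm (X r w - X s w) < e.

(** The exit times of the inner sets increase to some s, and [no_jump] makes the positions at these
    times converge to X s. These positions are arbitrarily close to points within 1/(n+1) of the
    complement of D, so X s is not in D and s is the exit time of D. *)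
Lemma exit_limit w (B : R) : cadlag_path w -> no_jump w -> D x ->
  (forall n, (et (inner_set n) w <= B%:E)%E) ->
  exists T : nat -> R, exists s, [/\ forall n, et (inner_set n) w = (T n)%:E, et D w = s%:E,
    forall e, 0 < e -> exists n0, forall n, (n0 <= n)%N -> s - e < T n <= s &
    forall e, 0 < e -> exists n0, forall n, (n0 <= n)%N -> enorm (X (T n) w - X s w) < e].
Proof.
move=> gw nj Dx hB.
have exT n : exists t : R, et (inner_set n) w = t%:E.
  by have [e|[t e _]] := et_finite (inner_set n) w; [have := hB n; rewrite e leye_eq|exists t].
have [T hT] := choice exT.
have TB n : T n <= B by rewrite -lee_fin -hT.
have T0 n : 0 <= T n by rewrite -lee_fin -hT et_ge0.
have Tm n m : (n <= m)%N -> T n <= T m.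
  by move=> nm; rewrite -lee_fin -!hT; apply: et_mono; exact: inner_set_mono.
pose A := [set T n | n in [set: nat]]; have supA : has_sup A.
  by split; [exists (T 0%N), 0%N|exists B => _ [n _ <-]].
pose s := sup A.
have Ts n : T n <= s by apply: (ub_le_sup supA.2); exists n.
have sT e : 0 < e -> exists n, s - e < T n.
  by move=> e0; have [_ [n _ <-] h] := sup_adherent e0 supA; exists n.
have s0 : 0 <= s := le_trans (T0 0%N) (Ts 0%N).
have near e : 0 < e -> exists n0, forall n, (n0 <= n)%N -> enorm (X (T n) w - X s w) < e.
  move=> e0; have [[n0 hn0]|h] := pselect (exists n0, T n0 = s).
    exists n0 => n nn; have -> : T n = s by apply/eqP; rewrite eq_le Ts -hn0 Tm.
    by rewrite subrr enorm0.
  have Tlt n : T n < s.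
    by rewrite lt_neqAle Ts andbT; apply/eqP => hn; apply: h; exists n.
  have s1 : 0 < s := le_lt_trans (T0 0%N) (Tlt 0%N).
  have [r r0 hr] := nj T s s1 hT Tlt sT e e0.
  have [n0 hn0] := sT r r0; exists n0 => n nn; apply: hr; rewrite Tlt andbT.
  exact: lt_le_trans hn0 (Tm _ _ nn).
have nDs : ~ D (X s w).
  move=> Ds; have [e e0 he] := open_enorm oD Ds.
  have e3 : 0 < e / 3 by rewrite divr_gt0.
  have [n0 hn0] := near _ e3; have [n1 hn1] := invn_small e3.
  pose n := maxn n0 n1.
  have [z nz hz] := exit_closure gw (hT n) e3.
  have [v nDv hv] := inner_setPn nz; apply: nDv; apply: he.
  have h1 := hn0 n (leq_maxl _ _).
  have h2 : n.+1%:R^-1 <= n1.+1%:R^-1 :> R by apply: invn_le; exact: leq_maxr.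
  have hv' : enorm (v - z) < e / 3 := lt_trans (lt_le_trans hv h2) hn1.
  apply: le_lt_trans (enormB_triangle v z _) _.
  apply: le_lt_trans (lerD (lexx _) (enormB_triangle z (X (T n) w) _)) _.
  rewrite (_ : e = e / 3 + (e / 3 + e / 3)); last by field.
  by apply: ltrD => //; exact: ltrD.
(* [exit_time] ignores time 0, so s must be positive to count; at time 0 the path is at x, inside
   D. *)
have s1 : 0 < s.
  rewrite lt_neqAle s0 andbT; apply/eqP => h; apply: nDs.
  by rewrite -h (cp0 gw).
exists T, s; split=> //.
- apply/eqP; rewrite eq_le et_le//=.
  rewrite leNgt; apply/negP => h.
  have [t et_t t0] : exists2 t, et D w = t%:E & 0 <= t.
    by have [e|//] := et_finite D w; move: h; rewrite e ltNge leey.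
  rewrite et_t lte_fin in h; have [n] := sT (s - t) ltac:(by rewrite subr_gt0).
  have : T n <= t by rewrite -lee_fin -hT -et_t; apply: et_mono; exact: inner_set_sub.
  lra.
- move=> e e0; have [n0 hn0] := sT e e0; exists n0 => n nn; rewrite Ts andbT.
  exact: lt_le_trans hn0 (Tm _ _ nn).
Qed.

Lemma cvg_Kill y t w : cadlag_path w -> no_jump w -> D x -> D y ->
  Kill y (inner_set n) t w @[n --> \oo] --> Kill y D t w.
Proof.
move=> gw nj Dx Dy; apply: cvgnP => e e0.
have [del del0 [n0 far]] := inner_set_far Dy.
(* If some inner set is left no earlier than t, all terms from there on vanish, and so does the
   limit. Otherwise all the exit times are bounded by t, as [exit_limit] requires. *)
have [[n hn]|hb] := pselect (exists n, (t%:E <= et (inner_set n) w)%E).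
  exists n => m nm.
  have tD : (t%:E <= et D w)%E := le_trans hn (et_mono w (@inner_set_sub n)).
  have tm : (t%:E <= et (inner_set m) w)%E := le_trans hn (et_mono w (inner_set_mono nm)).
  by rewrite (Kill_late _ tD) (Kill_late _ tm) subrr normr0.
have hb' n : (et (inner_set n) w <= t%:E)%E.
  by rewrite leNgt; apply/negP => h; apply: hb; exists n; exact: ltW.
have [T [s [hT hs Ts Xs]]] := exit_limit gw nj Dx hb'.
have fars : del <= enorm (X s w - y).
  apply: (@exit_far y del D _ w s gw hs) => z nDz.
  by apply: (far n0 (leqnn _)).2 => h; apply: nDz; exact: inner_set_sub h.
have [rho rho0 hrho] := density0_cont del0 (t - s) fars e0.
have [n1 hn1] := Ts rho rho0; have [n2 hn2] := Xs rho rho0.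
exists (maxn n0 (maxn n1 n2)) => n; rewrite !geq_max => /andP[nn0 /andP[nn1 nn2]].
rewrite (KillE _ _ (hT n)) (KillE _ _ hs); apply: hrho.
- have /andP[h1 h2] := hn1 n nn1; rewrite ltr_norml; apply/andP; split; lra.
- exact: hn2.
- by apply: (@exit_far y del (inner_set n) _ w _ gw (hT n)) => z; exact: (far n nn0).2.
Qed.

End shrink.
End pathwise.

(** * Convergence of the killed densities *)

Section nonmeasurable.
Context (R : realType) (disp : measure_display) (T : measurableType disp).
Variable mu : {measure set T -> \bar R}.
Import HBNNSimple.

(* [f] and [g] are not assumed measurable. *)
Lemma ge0_le_integral_null (N : set T) (f g : T -> \bar R) : measurable N -> mu N = 0%E ->
  (forall x, 0 <= f x)%E -> (forall x, 0 <= g x)%E -> (forall x, ~ N x -> f x <= g x)%E ->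
  (\int[mu]_x f x <= \int[mu]_x g x)%E.
Proof.
move=> mN N0 f0 g0 fg; rewrite [leLHS]ge0_integralTE//; apply: ge_ereal_sup => _ [h hf <-].
have mNC := measurableC mN.
pose h' := proj_nnsfun h mNC.
have h'E x : h' x = h x * \1_(~` N) x by rewrite /h'/= mindicE.
rewrite [leRHS]ge0_integralTE//.
apply: (@le_trans _ _ (sintegral mu h')); last first.
  apply: ereal_sup_ubound; exists h' => //= x; rewrite mindicE.
  have [Nx|nNx] := pselect (N x).
    by rewrite memNset ?mulr0//; apply/not_andP => -[].
  by rewrite mem_set// mulr1; apply: le_trans (fg _ nNx); exact: hf.
rewrite -!integralT_nnsfun le_eqVlt; apply/orP; left; apply/eqP.
apply: ge0_ae_eq_integral => //.
- exact/measurable_EFinP.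
- exact/measurable_EFinP.
- by move=> x _; rewrite lee_fin.
- by move=> x _; rewrite lee_fin.
exists N; split=> // x /= nx; apply: contrapT => nNx; apply: nx => _.
by congr EFin; rewrite mindicE mem_set// mulr1.
Qed.

Lemma ge0_eq_integral_null (N : set T) (f g : T -> \bar R) : measurable N -> mu N = 0%E ->
  (forall x, 0 <= f x)%E -> (forall x, 0 <= g x)%E -> (forall x, ~ N x -> f x = g x)%E ->
  (\int[mu]_x f x = \int[mu]_x g x)%E.
Proof.
move=> mN N0 f0 g0 fg; apply/eqP; rewrite eq_le; apply/andP; split;
  by apply: (ge0_le_integral_null mN N0) => // x nx; rewrite fg.
Qed.

(** The limit f will be an integrand built from exit times, whose measurability is not known. Off N
    it is a limit of measurable functions, so multiplying by the indicator of the complement of N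
    gives both the convergence and a measurable version. *)
Lemma bounded_cvg_null (N : set T) (f_ : nat -> T -> R) (f : T -> R) (k : R) :
  mu setT = 1%E -> measurable N -> mu N = 0%E ->
  (forall n, measurable_fun setT (f_ n)) -> (forall n x, 0 <= f_ n x <= k) -> (forall x, 0 <= f x) ->
  (forall x, ~ N x -> f_ n x @[n --> \oo] --> f x) ->
  ((\int[mu]_x (f_ n x)%:E)%E @[n --> \oo] --> (\int[mu]_x (f x)%:E)%E) /\
  (\int[mu]_x (f x)%:E)%E \is a fin_num /\ measurable_fun setT (fun x => f x * \1_(~` N) x).
Proof.
move=> mu1 mN N0 mf f0k f0 cf.
pose g_ n x := f_ n x * \1_(~` N) x; pose g x := f x * \1_(~` N) x.
have mg n : measurable_fun setT (g_ n).
  by apply: measurable_funM => //; apply: measurable_indic; exact: measurableC.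
have k0 : 0 <= k.
  have [//|h] := leP 0 k; have /eqP := mu1.
  suff -> : setT = N by rewrite N0 eq_sym onee_eq0.
  apply/seteqP; split=> // x _; have /andP[h1 h2] := f0k 0%N x.
  by have := le_trans h1 h2; rewrite leNgt h.
have ik : mu.-integrable setT (EFin \o (fun=> k)).
  apply/integrableP; split; first exact: measurable_cst.
  rewrite (eq_integral (cst k%:E)); last by move=> x _; rewrite /= ger0_norm.
  by rewrite integral_cst// mu1 mule1 ltry.
have cg x : g_ n x @[n --> \oo] --> g x.
  rewrite /g_ /g; have [Nx|nNx] := pselect (N x).
    rewrite indicE memNset; last by move=> h; exact: h.
    by rewrite mulr0; under eq_fun do rewrite mulr0; exact: cvg_cst.
  rewrite indicE mem_set// mulr1; under eq_fun do rewrite mulr1; exact: cf.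
have bg n x : `|g_ n x| <= k.
  have /andP[h1 h2] := f0k n x; rewrite /g_ indicE; case: (x \in _).
    by rewrite mulr1 ger0_norm.
  by rewrite mulr0 normr0.
have [ig c] := dominated_cvg_R mg cg ik bg.
have E : (\int[mu]_x (g x)%:E = \int[mu]_x (f x)%:E)%E.
  apply: (ge0_eq_integral_null mN N0) => [x|x|x nN]; rewrite ?lee_fin ?mulr_ge0//.
  by rewrite /g indicE mem_set// mulr1.
split; last first.
  split; first by rewrite -E; exact: integrable_fin_num.
  by case/integrableP: ig => + _; move/measurable_EFinP.
rewrite -E; apply: cvg_trans c; apply: near_eq_cvg; apply: nearW => n.
apply: (ge0_eq_integral_null mN N0) => [x|x|x nN]; rewrite ?lee_fin ?mulr_ge0//.
- by case/andP: (f0k n x).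
- by case/andP: (f0k n x).
- by rewrite /g_ indicE mem_set// mulr1.
Qed.

Lemma liminf_measure_le (A : nat -> set T) (c : \bar R) M0 : (forall m, measurable (A m)) ->
  (forall m, (M0 <= m)%N -> mu (A m) <= c)%E ->
  (mu (\bigcup_M \bigcap_(m in [set m | (M <= m)%N]) A m) <= c)%E.
Proof.
move=> mA hA; pose F M := \bigcap_(m in [set m | (M <= m)%N]) A m.
have mF M : measurable (F M) by apply: bigcap_measurableType => m _; exact: mA.
have ndF : nondecreasing_seq F.
  by move=> a b ab; apply/subsetPset => w h m /= bm; apply: h => /=; exact: leq_trans bm.
have cF := nondecreasing_cvg_mu mF (bigcupT_measurable _ mF) ndF.
rewrite -(cvg_lim _ (cF R mu))//; apply: lime_le; first by apply/cvg_ex; eexists; exact: cF.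
apply: nearW => M /=; apply: le_trans (hA (maxn M M0) (leq_maxr _ _)).
by apply: le_measure; rewrite ?inE// => w h; apply: h => /=; exact: leq_maxl.
Qed.

End nonmeasurable.

Lemma three_lt (R : realType) (u v : R) : u < v / 3 -> v < u + (u + u) -> False.
Proof. lra. Qed.

(** * Limits along the grids, then along the inner sets *)

Section killed_limit.
Context (R : realType) (d : nat) (disp : measure_display) (Omega : measurableType disp).
Variables (P : 'rV[R]_d -> probability Omega R) (X : R -> Omega -> 'rV[R]_d).
Variables (phi : R -> R) (p : R -> 'rV[R]_d -> 'rV[R]_d -> R).
Hypothesis d0 : (0 < d)%N.
Hypothesis phi_gt0 : forall l, 0 < l -> 0 < phi l.
Hypothesis phi_cbf : complete_bernstein phi.
Hypothesis X_levy : levy_process P X.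
Hypothesis X_exponent : has_characteristic_exponent P X phi.
Hypothesis p_density : transition_density P X p.
Variables (C alpha beta : R).
Hypothesis W : wscale phi C alpha beta.
Local Notation V := (borelRd R d).
Local Notation mu := (@lebesgueRd R d).
Local Notation ph := (ph phi).
Local Notation eps m := (2 ^- m : R).
Local Notation et := (exit_time X).
Let p0 := density_ge0 p_density.
Let eps_gt0 m : 0 < eps m. Proof. by rewrite invr_gt0 exprn_gt0. Qed.
Variable x : V.
Variable D : set 'rV[R]_d.
Hypothesis oD : open D.
Local Notation Dn := (inner_set D).

(** On the grid of step 2^-m, a displacement of at least 1/(l+1) within time 2^-i after the exit
    from the n-th inner set: 2^(m-i) steps, when i <= m. *)
Let jump_ev (n m l i : nat) : set Omega :=
  \bigcup_j (exitat X x (eps m) (Dn n) j `&` ~` stay X x (eps m) (l.+1%:R^-1) j (2 ^ (m - i))%N).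

Let measurable_jump_ev n m l i : measurable (jump_ev n m l i).
Proof.
apply: bigcupT_measurable => j; apply: measurableI.
  exact: (Past_measurable X_levy (eps_gt0 m) (Past_exitat x (measurable_inner_set D n) (leqnn j))).
have l0 : 0 < l.+1%:R^-1 :> R by rewrite invr_gt0.
exact/measurableC/(Past_measurable X_levy (eps_gt0 m) (Past_stay x l0 (leqnn (j + 2 ^ (m - i))))).
Qed.

(** If the left limit L at s differs from X s, then for n and m large the grid exit from the n-th
    inner set comes just before s, with the walk near L, while just after s the walk is near X s. So
    for some l, [jump_ev] holds for every i and all large n, m. As its probability is at most c l
    2^-i, uniformly in n and m, such paths form a null set. *)
Lemma no_jump_ae : {ae P x, forall w, cadlag_path X x w -> no_jump X D w}.
Proof.
have [Cw Cw1 [sc hw]] := walk_exists d0 phi_gt0 phi_cbf X_levy X_exponent p_density W.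
have ph0 r : 0 < r -> 0 < ph r := @ph_gt0 _ _ phi_gt0 r.
have Cw0 : 0 < Cw by lra.
have q0 : 0 < (Cw * ph 1)^-1 by rewrite invr_gt0 mulr_gt0// ph0.
have [m0 hm0] := pow2V_small q0.
pose del l : R := l.+1%:R^-1; have del0 l : 0 < del l by rewrite invr_gt0.
pose c l := 17 * (Cw * ph (del l)).
have c0 l : 0 < c l by rewrite mulr_gt0// mulr_gt0// ph0.
have PJ n m l i : (maxn i m0 <= m)%N -> (P x (jump_ev n m l i) <= (c l * 2 ^- i)%:E)%E.
  rewrite geq_max => /andP[im m0m].
  have e1 : Cw * (eps m * ph 1) <= 1.
    have := hm0 m m0m => /ltW h; rewrite mulrCA -ler_pdivlMr ?mulr_gt0 ?ph0// div1r//.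
  have Hw := hw (eps m) 1 (eps_gt0 m) ltr01 e1.
  have := exit_move d0 phi_cbf X_levy X_exponent p_density x (eps_gt0 m) sc Hw (del0 l) (2 ^ (m - i)) (measurable_inner_set D n).
  move/le_trans; apply; rewrite lee_fin le_eqVlt; apply/orP; left; apply/eqP.
  have -> : (2 ^ (m - i))%:R * (17 * (Cw * (eps m * ph (del l)))) = c l * ((2 ^ (m - i))%:R * eps m) :> R.
    by rewrite /c; ring.
  congr (_ * _); rewrite natrX -{2}(subnK im) exprD invfM mulrA mulfV ?mul1r ?expf_neq0//.
pose Bad l i := \bigcup_N \bigcap_(n in [set n | (N <= n)%N])
   \bigcup_M \bigcap_(m in [set m | (M <= m)%N]) jump_ev n m l i.
have mB1 n l i : measurable (\bigcup_M \bigcap_(m in [set m | (M <= m)%N]) jump_ev n m l i).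
  by apply: bigcupT_measurable => M; apply: bigcap_measurableType => m _; exact: measurable_jump_ev.
have mBad l i : measurable (Bad l i).
  by apply: bigcupT_measurable => M; apply: bigcap_measurableType => m _; exact: mB1.
have PB l i : (P x (Bad l i) <= (c l * 2 ^- i)%:E)%E.
  apply: (@liminf_measure_le _ _ _ _ _ _ 0%N) => [n|n _]; first exact: mB1.
  apply: (@liminf_measure_le _ _ _ _ _ _ (maxn i m0)) => [m|m hm]; first exact: measurable_jump_ev.
  exact: PJ.
pose NN := \bigcup_l \bigcap_i Bad l i.
have mcap l : measurable (\bigcap_i Bad l i) by apply: bigcapT_measurable => i.
have cap0 l : P x (\bigcap_i Bad l i) = 0%E.
  apply/eqP; rewrite eq_le measure_ge0 andbT; apply/lee_addgt0Pr => e e0; rewrite add0e.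
  have [i hi] := @pow2V_small R (e / c l) ltac:(by rewrite divr_gt0).
  apply: (@le_trans _ _ (P x (Bad l i))); first by apply: le_measure; rewrite ?inE// => w; apply.
  apply: (le_trans (PB l i)); rewrite lee_fin ltW// mulrC -ltr_pdivlMr//; exact: hi.
have mNN : measurable NN by exact: bigcupT_measurable.
have NN0 : P x NN = 0%E.
  apply/eqP; rewrite eq_le measure_ge0 andbT.
  apply: (@le_trans _ _ (\sum_(0 <= l <oo) P x (\bigcap_i Bad l i))%E).
    by apply: measure_sigma_subadditive.
  by rewrite eseries0.
exists NN; split=> // w /= nw; apply: contrapT => nN; apply: nw => gw.
move=> T s s0 hT Ts sT e e0.
have Tm n m : (n <= m)%N -> T n <= T m.
  by move=> nm; rewrite -lee_fin -!hT; apply: et_mono; exact: inner_set_mono.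
have [L hL] := cpl gw s0.
have [LX|LX] := eqVneq (enorm (L - X s w)) 0.
  have /eqP := enorm_eq0 LX; rewrite subr_eq0 => /eqP <-; exact: hL.
have a0 : 0 < enorm (L - X s w) by rewrite lt_neqAle eq_sym LX enorm_ge0.
have a3 : 0 < enorm (L - X s w) / 3 by rewrite divr_gt0.
have [l hl] := invn_small a3; rewrite -/(del l) in hl.
exfalso; apply: nN; exists l => // i _.
have [h1 h10 hh1] := hL _ (del0 l).
have i0 : 0 < (2 : R) ^- i / 2 by rewrite divr_gt0.
have mn0 : 0 < Num.min h1 (2 ^- i / 2) by rewrite lt_min h10.
have [n0 hn0] := sT _ mn0; exists n0 => // n /= nn.
have Tn1 : s - h1 < T n.
  apply: lt_le_trans (Tm _ _ nn); apply: le_lt_trans hn0.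
  by rewrite lerD2l lerN2 ge_min lexx.
have Tn2 : s - 2 ^- i / 2 < T n.
  apply: lt_le_trans (Tm _ _ nn); apply: le_lt_trans hn0.
  by rewrite lerD2l lerN2 ge_min lexx orbT.
have sTn : 0 < s - T n by rewrite subr_gt0.
have [M1 hM1] := grid_exit (@closed_inner_set _ _ D n : closed (Dn n)) gw (hT n) sTn.
have [h2 h20 hh2] := cpr gw (ltW s0) (del0 l).
have mn1 : 0 < Num.min h2 (2 ^- i / 2) by rewrite lt_min h20.
have [M2 hM2] := pow2V_small mn1.
exists (maxn i (maxn M1 M2)) => // m /=; rewrite !geq_max => /andP[im /andP[m1 m2]].
have [j hj /andP[j1 j2]] := hM1 m m1.
have := hM2 m m2; rewrite lt_min => /andP[e1 e2].
have [b /andP[b1 b2]] := grid_ceil (ltW s0) (eps_gt0 m).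
have j3 : j%:R * eps m < s by lra.
have jb : (j <= b.+1)%N.
  by rewrite -(ler_nat R) -(ler_pM2r (eps_gt0 m)) ltW// (lt_trans j3).
(* The grid exit is at most 2^-i / 2 before s, and the first grid time beyond s is at most 2^-i / 2
   after it. *)
have ab : (b.+1 - j <= 2 ^ (m - i))%N.
  rewrite -(ler_nat R) -(ler_pM2r (eps_gt0 m)) natrB// mulrBl natrX.
  have -> : 2 ^+ (m - i) * eps m = 2 ^- i.
    by rewrite -{2}(subnK im) exprD invfM mulrA mulfV ?mul1r// expf_neq0.
  lra.
exists j => //; split=> // st.
have := st _ ab; rewrite subnKC// !pos_cadlag// => h3.
have h4 : enorm (X (j%:R * eps m) w - L) < del l.
  by apply: hh1; apply/andP; split=> //; exact: lt_le_trans Tn1 j1.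
have h5 : enorm (X (b.+1%:R * eps m) w - X s w) < del l.
  apply: hh2; rewrite (ltW b1)/=; apply: (le_lt_trans b2); rewrite ltrD2l//.
have : enorm (L - X s w) < del l + (del l + del l).
  apply: le_lt_trans (enormB_triangle L (X (j%:R * eps m) w) _) _.
  apply: ltrD; first by rewrite enormB.
  apply: le_lt_trans (enormB_triangle _ (X (b.+1%:R * eps m) w) _) _.
  by apply: ltrD => //; rewrite enormB.
exact: (three_lt hl).
Qed.

Section target.
Variables (y : V) (del : R).
Hypothesis del0 : 0 < del.

Section farset.
Variable U : set V.
Hypothesis mU : measurable U.
Hypothesis U_far : forall z, ~ U z -> del <= enorm (z - y).

Lemma killed_density_Kill t : killed_density P X p U t x y = ((p t x y)%:E - \int[P x]_w (Kill X p y U t w)%:E)%E.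
Proof.
rewrite /killed_density; congr (_ - _)%E; rewrite integral_mkcond; apply: eq_integral => w _.
rewrite patchE /Kill; case: ifP => h.
  by rewrite ifT//; move/set_mem: h.
by rewrite ifF//; apply/negP => h'; move/negP: h; apply; apply/mem_set.
Qed.

Lemma Kill_le t w : cadlag_path X x w -> 0 <= t -> Kill X p y U t w <= Kfar d phi C del * t.
Proof.
move=> gw t0; have kf := Kfar_ge0 d phi_gt0 W del0.
have [e|[T e T0]] := et_finite X U w; first by rewrite (Kill_oo _ _ _ e) mulr_ge0.
rewrite (KillE _ _ _ e).
apply: (le_trans (density0_bound d0 phi_gt0 phi_cbf X_levy X_exponent p_density W del0 _ (exit_far U_far gw e))).
by rewrite ler_wpM2l// ge_max t0 andbT; lra.
Qed.

Lemma cvg_hit_int t (N : set Omega) : measurable N -> P x N = 0%E ->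
  (forall w, ~ N w -> cadlag_path X x w) -> closed U -> 0 <= t ->
  ((\int[P x]_w hit X p x (eps m) U (kgrid m t) y w)%E @[m --> \oo] -->
  (\int[P x]_w (Kill X p y U t w)%:E)%E) /\ (\int[P x]_w (Kill X p y U t w)%:E)%E \is a fin_num /\
  measurable_fun setT (fun w => Kill X p y U t w * \1_(~` N) w).
Proof.
move=> mN N0 hN cU t0.
have hf m w := hit_fin d0 phi_gt0 phi_cbf X_levy X_exponent p_density W x del0 U_far (kgrid m t) w (eps_gt0 m).
have hle m w := hit_le d0 phi_gt0 phi_cbf X_levy X_exponent p_density W x del0 U_far (kgrid m t) w (eps_gt0 m).
have kf := Kfar_ge0 d phi_gt0 W del0.
have mh m := measurable_hit d0 phi_cbf X_levy X_exponent p_density x (eps_gt0 m) mU (kgrid m t) y.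
have hE m w : hit X p x (eps m) U (kgrid m t) y w = (fine (hit X p x (eps m) U (kgrid m t) y w))%:E.
  by rewrite fineK.
pose f_ m w := fine (hit X p x (eps m) U (kgrid m t) y w).
have Hm n : measurable_fun setT (f_ n).
  apply/measurable_EFinP; rewrite (_ : EFin \o _ = hit X p x (eps n) U (kgrid n t) y)//.
  by apply/funext => w /=; rewrite -hE.
have Hb n w : 0 <= f_ n w <= Kfar d phi C del * (t + 1).
  rewrite -!lee_fin -hE (hit_ge0 p_density x (eps_gt0 n))/=.
  apply: (le_trans (hle n w)); rewrite lee_fin ler_wpM2l//.
  have /andP[_ h] := kgridP n t0; apply: (le_trans h); rewrite lerD2l.
  by rewrite invf_le1 ?exprn_gt0// exprn_ege1// ler1n.
have H0 w : 0 <= Kill X p y U t w := Kill_ge0 p_density y U t w.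
have Hc w : ~ N w -> f_ n w @[n --> \oo] --> Kill X p y U t w.
  by move=> nNw; exact: (cvg_hit d0 phi_gt0 phi_cbf X_levy X_exponent p_density W del0 U_far cU (hN w nNw) t0).
have [c f] := bounded_cvg_null (probability_setT (P x)) mN N0 Hm Hb H0 Hc.
by split=> //; under eq_fun do under eq_integral do rewrite hE.
Qed.

(** By [hunt] the killed kernel is p minus the mean of [hit]; p converges by continuity and the mean
    by [cvg_hit_int]. *)
Lemma cvg_QUn t : closed U -> 0 < t ->
  (QUn mu (p (eps m)) U (kgrid m t) (fun z => (p (eps m) z y)%:E) x) @[m --> \oo] -->
  killed_density P X p U t x y.
Proof.
move=> cU t0; have [N [mN N0 hN]] := cadlag_ae X_levy x.
have hN' w : ~ N w -> cadlag_path X x w by move=> nN; apply: contrapT => h; apply: nN; exact: hN.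
have [c [f _]] := cvg_hit_int mN N0 hN' cU (ltW t0).
rewrite killed_density_Kill.
have s0 m : 0 < (kgrid m t).+1%:R * eps m by rewrite mulr_gt0// ltr0n.
have fh m : (\int[P x]_w hit X p x (eps m) U (kgrid m t) y w)%E \is a fin_num.
  have H := hunt d0 phi_cbf X_levy X_exponent p_density x (eps_gt0 m) mU (kgrid m t) y.
  rewrite ge0_fin_numE; last by apply: integral_ge0 => w _; exact: (hit_ge0 p_density x (eps_gt0 m)).
  apply: (@le_lt_trans _ _ ((p ((kgrid m t).+1%:R * eps m) x y)%:E)); last exact: ltry.
  rewrite H leeDr//.
  have mp2 := measurable_p2 d0 phi_cbf X_levy X_exponent p_density (eps_gt0 m).
  have q0 a b := p0 a b (eps_gt0 m).
  have nf : nnm (fun z : V => (p (eps m) z y)%:E).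
    have := nnm_p p_density y (eps_gt0 m); congr nnm; apply/funext => z; congr EFin.
    exact: (density_sym d0 phi_cbf X_levy X_exponent p_density).
  exact: (nnm_QUn mu mp2 q0 mU (kgrid m t) nf).2.
rewrite [X in X @ _ --> _](_ : _ = fun m => ((p ((kgrid m t).+1%:R * eps m) x y)%:E -
   \int[P x]_w hit X p x (eps m) U (kgrid m t) y w)%E); last first.
  apply/funext => m.
  by rewrite (hunt d0 phi_cbf X_levy X_exponent p_density x (eps_gt0 m) mU) addeK.
have cs : (kgrid m t).+1%:R * eps m @[m --> \oo] --> t.
  apply: cvgnP => e e0; have [M hM] := pow2V_small e0; exists M => m Mm.
  have /andP[h1 h2] := kgridP m (ltW t0); have h3 := hM m Mm.
  by rewrite ltr_norml; apply/andP; split; lra.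
have h := density_continuous p_density (x := x) (y := y) t0.
have c1 : (fun _ : nat => (x, y) : 'rV[R]_d * 'rV[R]_d) @ \oo --> ((x, y) : 'rV[R]_d * 'rV[R]_d) by exact: cvg_cst.
have c2 : p ((kgrid m t).+1%:R * eps m) x y @[m --> \oo] --> p t x y := cvg_comp _ _ (cvg_pair cs c1) h.
apply: cvgeB c; first by rewrite fin_num_adde_defl// fin_numN.
by apply: cvg_EFin; [exact: nearW|exact: c2].
Qed.

End farset.
End target.

Lemma cvg_killed t y : 0 < t -> D x -> D y ->
  killed_density P X p (Dn n) t x y @[n --> \oo] --> killed_density P X p D t x y.
Proof.
move=> t0 Dx Dy; have [del del0 [n0 far]] := inner_set_far oD Dy.
have [N1 [mN1 N10 hN1]] := cadlag_ae X_levy x.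
have [N2 [mN2 N20 hN2]] := no_jump_ae.
have hN1' w : ~ N1 w -> cadlag_path X x w by move=> nN; apply: contrapT => h; apply: nN; exact: hN1.
have hN2' w : ~ N1 w -> ~ N2 w -> no_jump X D w.
  by move=> n1 n2; apply: contrapT => h; apply: n2; apply: hN2 => /= h'; apply: h; exact/h'/hN1'.
have cD n : closed (Dn n) by exact: closed_inner_set.
have KI n : (n0 <= n)%N -> _ :=
  fun nn => cvg_hit_int del0 (measurable_inner_set D n) (far n nn).2 mN1 N10 hN1' (cD n) (ltW t0).
pose N := N1 `|` N2.
have mN : measurable N by exact: measurableU.
have N0 : P x N = 0%E by rewrite /N measureU0.
have kf := Kfar_ge0 d phi_gt0 W del0.
(* The indicator makes the integrands measurable; it is dropped at the end at the price of a null
   set. *)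
pose f_ n w := Kill X p y (Dn (n + n0)) t w * \1_(~` N1) w.
have Hm n : measurable_fun setT (f_ n) := (KI _ (leq_addl _ _)).2.2.
have Hb n w : 0 <= f_ n w <= Kfar d phi C del * t.
  have K0 := Kill_ge0 p_density y (Dn (n + n0)) t w.
  rewrite /f_ indicE mulr_ge0//=; have [h|h] := pselect (N1 w).
    rewrite memNset; last by move=> h'; exact: h'.
    by rewrite mulr0 mulr_ge0// ltW.
  rewrite mem_set// mulr1; apply: (Kill_le del0 (far _ (leq_addl _ _)).2 (hN1' w h) (ltW t0)).
have H0 w : 0 <= Kill X p y D t w := Kill_ge0 p_density y D t w.
have Hc w : ~ N w -> f_ n w @[n --> \oo] --> Kill X p y D t w.
  move=> nNw; have n1 : ~ N1 w by move=> h; apply: nNw; left.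
  have n2 : ~ N2 w by move=> h; apply: nNw; right.
  have E : f_^~ w = (fun n => Kill X p y (Dn (n + n0)) t w).
    by apply/funext => n; rewrite /f_ indicE mem_set// mulr1.
  have h := cvg_Kill d0 phi_gt0 phi_cbf X_levy X_exponent p_density W oD (hN1' w n1) (hN2' w n1 n2) Dx Dy.
  have ht : Kill X p y (Dn n) t w @[n --> \oo] --> Kill X p y D t w := h t.
  by rewrite -(cvg_shiftn n0) in ht; rewrite E.
have [c [f _]] := bounded_cvg_null (probability_setT (P x)) mN N0 Hm Hb H0 Hc.
rewrite -(cvg_shiftn n0).
rewrite killed_density_Kill; under eq_fun do rewrite killed_density_Kill.
apply: cvgeB; [by rewrite fin_num_adde_defl// fin_numN|exact: cvg_cst|].
apply: cvg_trans c; apply: near_eq_cvg; apply: nearW => n.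
apply: (ge0_eq_integral_null mN1 N10) => [w|w|w nN]; rewrite ?lee_fin ?mulr_ge0//; try exact: Kill_ge0 p_density y _ t w.
by rewrite /f_ indicE mem_set// mulr1.
Qed.

End killed_limit.

(** * Green functions as limits *)

Section decay.
Context (R : realType).
Local Notation leb := (@lebesgue_measure R).
Variable gam : R.
Hypothesis gam1 : 1 < gam.

(** Profile of the majorants in time: integrable over all t > 0 since gam > 1, and nonincreasing, so
    that evaluating p at the next grid time does no harm. *)
Definition tdecay (t : R) : R := if t <= 1 then 1 else t `^ (- gam).

Lemma tdecay_ge0 t : 0 <= tdecay t.
Proof. by rewrite /tdecay; case: ifP => // _; exact: powR_ge0. Qed.

Lemma measurable_tdecay : measurable_fun setT tdecay.
Proof.
apply: measurable_fun_ifT => //; exact: measurable_fun_ler.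
Qed.

Lemma tdecay_decr s t : s <= t -> tdecay t <= tdecay s.
Proof.
move=> st; rewrite /tdecay; case: ifPn => t1; case: ifPn => s1 //.
- by rewrite (le_trans st t1) in s1.
- have t1' : 1 < t by rewrite ltNge.
  rewrite -(powRr0 t); apply: ler_powR; [exact: ltW|rewrite oppr_le0; have := gam1; lra].
- have s0 : 0 < s by rewrite -ltNge in s1; lra.
  have t0 : 0 < t by lra.
  rewrite !powRN lef_pV2 ?posrE ?powR_gt0//.
  by apply: ge0_ler_powR; rewrite ?nnegrE ?(ltW s0) ?(ltW t0)//; have := gam1; lra.
Qed.

Lemma powR_cvg0 : x `^ (1 - gam) @[x --> +oo] --> (0 : R).
Proof.
apply/cvgrPdist_lt => e e0.
have g0 : 0 < gam - 1 by have := gam1; lra.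
have [A A1 hA] := powR_big (1 + e^-1) g0.
exists A; split; first exact: num_real.
move=> t At; have t0 : 0 < t by lra.
rewrite sub0r normrN ger0_norm ?powR_ge0//.
have -> : 1 - gam = - (gam - 1) by ring.
rewrite powRN -[ltRHS]invrK ltf_pV2 ?posrE ?invr_gt0 ?powR_gt0//.
apply: (@lt_le_trans _ _ (1 + e^-1)); first by lra.
apply: (le_trans hA); apply: ge0_ler_powR; rewrite ?nnegrE; lra.
Qed.

Lemma integral_powR : (\int[leb]_(t in `[1%R, +oo[) (t `^ (- gam))%:E = ((gam - 1)^-1)%:E)%E.
Proof.
have g0 : gam - 1 != 0 by rewrite gt_eqF// subr_gt0.
pose F (t : R) := t `^ (1 - gam) * (- (gam - 1)^-1).
have dP (t a : R) : 0 < t -> is_derive t 1 (fun s : R => s `^ a) (a * t `^ (a - 1)) by exact: is_derive1_powR.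
have cP (t a : R) : 0 < t -> {for t, continuous (fun s : R => s `^ a)}.
  move=> t0; have [h _] := dP t a t0.
  by apply: differentiable_continuous; exact/derivable1_diffP.
have dF (t : R) : 0 < t -> is_derive t 1 F (t `^ (- gam)).
  move=> t0; have h := dP t (1 - gam) t0.
  have -> : t `^ (- gam) = (- (gam - 1)^-1) *: ((1 - gam) * t `^ (1 - gam - 1)).
    have -> : 1 - gam - 1 = - gam by ring.
    by rewrite /GRing.scale/=; field.
  have -> : F = (- (gam - 1)^-1) \*: (fun s : R => s `^ (1 - gam)).
    by apply/funext => s; rewrite /F /= mulrC.
  exact: is_deriveZ.
rewrite (@ge0_continuous_FTC2y _ _ F 1 0).
- by rewrite /F powR1 mul1r sub0e -EFinN opprK.
- by move=> t _; exact: powR_ge0.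
- apply: continuous_in_subspaceT => t; rewrite inE/= in_itv/= andbT => t1.
  by apply: cP; lra.
- have -> : (0 : R) = 0 * (- (gam - 1)^-1) by rewrite mul0r.
  by apply: cvgM; [exact: powR_cvg0|exact: cvg_cst].
- by move=> t t1; have [] : is_derive t 1 F (t `^ (- gam)) by apply: dF; lra.
- apply: cvg_at_right_filter.
  have [h _] := dF 1 ltr01.
  by apply: differentiable_continuous; exact/derivable1_diffP.
- move=> t; rewrite in_itv/= andbT => t1; rewrite derive1E.
  have h : is_derive t 1 F (t `^ (- gam)) by apply: dF; lra.
  by rewrite derive_val.
Qed.

Lemma integral_tdecay : exists2 k : R, 0 <= k & (\int[leb]_(t in `]0%R, +oo[) (tdecay t)%:E = k%:E)%E.
Proof.
have k0 : 0 <= 1 + (gam - 1)^-1 by rewrite addr_ge0// invr_ge0 subr_ge0 ltW.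
exists (1 + (gam - 1)^-1) => //.
have mt (A : set (measurableTypeR R)) : measurable_fun A (EFin \o tdecay).
  by apply: measurable_funTS; apply/measurable_EFinP; exact: measurable_tdecay.
have U : `]0%R, +oo[%classic = `]0%R, 1%R] `|` `]1%R, +oo[ :> set R.
  apply/seteqP; split=> t /=; rewrite !in_itv/= !andbT.
    by move=> t0; rewrite t0/=; case: (leP t 1) => h; [left|right].
  by move=> [/andP[]//|t1]; lra.
rewrite U ge0_integral_setU//; last 2 first.
- by move=> t _; rewrite lee_fin tdecay_ge0.
- apply/disj_setPS => t []/=; rewrite !in_itv/= andbT => /andP[_ h1] h2.
  by have := lt_le_trans h2 h1; rewrite ltxx.
rewrite EFinD; congr (_ + _)%E.
  rewrite (eq_integral (cst 1%E)).
    by rewrite integral_cst//= lebesgue_measure_itv/= lte_fin ltr01 oppr0 adde0 mul1e.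
  by move=> t; rewrite inE/= in_itv/= => /andP[_ t1]; rewrite /tdecay t1.
transitivity (\int[leb]_(t in `]1%R, +oo[) (t `^ (- gam))%:E)%E.
  apply: eq_integral; move=> t; rewrite inE/= in_itv/= andbT => t1; by rewrite /tdecay leNgt t1.
rewrite integral_itv_obnd_cbnd; first exact: integral_powR.
by apply: measurable_funTS; apply/measurable_EFinP; exact: measurable_powR.
Qed.

Lemma integrable_tdecay (k : R) : leb.-integrable `]0%R, +oo[ (fun t => (k * tdecay t)%:E).
Proof.
have [c c0 hc] := integral_tdecay.
rewrite (_ : (fun t => _) = fun t => (k%:E * (tdecay t)%:E)%E); last by apply/funext => t; rewrite EFinM.
apply: integrableZl => //; apply/integrableP; split.
  by apply: measurable_funTS; apply/measurable_EFinP; exact: measurable_tdecay.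
by under eq_integral do rewrite gee0_abs ?lee_fin ?tdecay_ge0//; rewrite hc ltry.
Qed.

End decay.

(** * Sums over a grid as integrals in time *)

Section step_sum.
Context (R : realType).
Local Notation leb := (@lebesgue_measure R).
Local Notation eps m := (2 ^- m : R).
Let eps_gt0 m : 0 < eps m. Proof. by rewrite invr_gt0 exprn_gt0. Qed.

Let Ik m (k : nat) : set R := `[k%:R * eps m, k.+1%:R * eps m[.

Let kgrid_in m k t : 0 <= t -> (t \in Ik m k) = (k == kgrid m t).
Proof.
move=> t0; have te : 0 <= t / eps m by rewrite divr_ge0// ltW.
apply/idP/idP.
  rewrite inE /Ik/= in_itv/= => /andP[h1 h2].
  rewrite -ler_pdivlMr// in h1; rewrite -ltr_pdivrMr// in h2.
  by rewrite eq_sym /kgrid; apply/eqP; apply: truncn_def; rewrite h1.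
move=> /eqP ->; rewrite inE /Ik/= in_itv/=.
have /andP[h1 h2] := truncn_itv te.
by rewrite -ler_pdivlMr// -ltr_pdivrMr// /kgrid h1.
Qed.

Lemma kgrid_sum m (a : nat -> \bar R) t : (forall k, 0 <= a k)%E -> 0 <= t ->
  a (kgrid m t) = (\sum_(0 <= k <oo) a k * (\1_(Ik m k) t)%:E)%E.
Proof.
move=> a0 t0; rewrite (@nneseriesD1 _ _ (kgrid m t))//; last first.
  by move=> k _; rewrite mule_ge0// lee_fin.
rewrite indicE kgrid_in// eqxx mule1 eseries0 ?adde0// => k _ /= /negPf kk.
by rewrite indicE kgrid_in// kk mule0.
Qed.

Lemma measurable_kgrid m (a : nat -> \bar R) : (forall k, 0 <= a k)%E ->
  measurable_fun (`]0%R, +oo[ : set (measurableTypeR R)) (fun t : R => a (kgrid m t)).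
Proof.
move=> a0; apply: (eq_measurable_fun (fun t => \sum_(0 <= k <oo) a k * (\1_(Ik m k) t)%:E)%E).
  by move=> t; rewrite inE/= in_itv/= andbT => t0; rewrite -kgrid_sum// ltW.
apply: ge0_emeasurable_sum => [k t _ _|k _]; first by rewrite mule_ge0// lee_fin.
apply: measurable_funTS; apply: measurable_funeM.
by apply/measurable_EFinP; apply: measurable_indic; exact: measurable_itv.
Qed.

(** The step times a sum over the grid is the integral of a step function. This puts eps times the
    Green function of the walk under the same integral in t as [green]. *)
Lemma integral_kgrid m (a : nat -> \bar R) : (forall k, 0 <= a k)%E ->
  (\int[leb]_(t in `]0%R, +oo[) a (kgrid m t) = (eps m)%:E * \sum_(0 <= k <oo) a k)%E.
Proof.
move=> a0; rewrite integral_itv_obnd_cbnd; last exact: measurable_kgrid.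
transitivity (\int[leb]_(t in `[0%R, +oo[) (\sum_(0 <= k <oo) a k * (\1_(Ik m k) t)%:E))%E.
  apply: eq_integral; by move=> t; rewrite inE/= in_itv/= andbT => t0; rewrite -kgrid_sum.
have mI k : measurable (Ik m k) by exact: measurable_itv.
rewrite integral_nneseries//; last 2 first.
- move=> k; apply: measurable_funTS; apply: measurable_funeM.
  by apply/measurable_EFinP; apply: measurable_indic; exact: measurable_itv.
- by move=> k t _; rewrite mule_ge0// lee_fin.
rewrite -nneseriesZl//; apply: eq_eseriesr => k _.
rewrite ge0_integralZl//; last first.
  by apply: measurable_funTS; apply/measurable_EFinP; apply: measurable_indic; exact: measurable_itv.
have E1 := integral_indic leb (measurable_itv `[0%R, +oo[) (mI k).
rewrite muleC E1 setIidl; last first.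
  move=> t; rewrite /Ik/= !in_itv/= andbT => /andP[h _]; apply: le_trans h.
  by rewrite mulr_ge0// ltW.
congr (_ * _)%E; change (leb (Ik m k) = (eps m)%:E).
rewrite /Ik lebesgue_measure_itv/= lte_fin ltr_pM2r// ltr_nat ltnSn -EFinB; congr EFin.
by rewrite -mulrBl -natrB// subSnn mul1r.
Qed.

End step_sum.

Section kernel_domain.
Local Open Scope ereal_scope.
Context (R : realType) (disp : measure_display) (T : measurableType disp).
Variable mu : {sigma_finite_measure set T -> \bar R}.
Variable q : T -> T -> R.
Hypothesis mq : measurable_fun setT (fun z : T * T => q z.1 z.2).
Hypothesis q0 : forall x y, (0 <= q x y)%R.
Hypothesis qsym : forall x y, q x y = q y x.

Lemma RU_subset (U A : set T) f y : measurable U -> measurable A -> nnm f -> U `<=` A -> U y ->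
  RU mu q U f y <= RU mu q A f y.
Proof.
move=> mU mA nf UA Uy.
have nR := nnm_RU mu mq q0 mA nf.
apply: (@RU_super _ _ _ mu q mq q0 U mU f (RU mu q A f)) => // w _.
rewrite [leRHS](RUE mu mq q0 mA w nf) leeD2l//.
exact: (QUS mu mq q0 w mU mA nR UA).
Qed.

(** Duality of the iterates turns the expected lifetime in U of the walk from x into the mass of its
    Green function; the 1 is the start. *)
Lemma RU1E (U : set T) x : measurable U ->
  RU mu q U (fun=> 1) x = 1 + \int[mu]_(y in U) RU mu q U (fun z => (q x z)%:E) y.
Proof.
move=> mU; have n1 : nnm (fun=> 1 : \bar R) (T := T) by apply: nnm_cst.
have nx := nnm_q mq q0 x.
rewrite (RUE mu mq q0 mU x n1); congr (_ + _).
have nk k := nnm_QUn mu mq q0 mU k n1.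
have nqk k := nnm_QUn mu mq q0 mU k nx.
transitivity (\sum_(0 <= k <oo) \int[mu]_(y in U) ((q x y)%:E * QUn mu q U k (fun=> 1) y)).
  rewrite -integral_nneseries//.
  - apply: eq_integral => y _; rewrite nneseriesZl//.
    by move=> k _; have [_] := nk k; exact.
  - by move=> k; apply: measurable_funTS; have [] := nnm_qf mq q0 x (nk k).
  - by move=> k y _; have [_] := nnm_qf mq q0 x (nk k); exact.
rewrite integral_nneseries//; last 2 first.
- by move=> k; apply: measurable_funTS; have [] := nqk k.
- by move=> k y _; have [_] := nqk k; exact.
apply: eq_eseriesr => k _.
rewrite (QUn_dual mu mq q0 qsym k mU n1 nx).
by apply: eq_integral => y _; rewrite mule1.
Qed.

End kernel_domain.

(** Fatness at scale 2 rho gives a ball of radius 2 kappa rho. Half of the radius is given up, so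
    that the rest lies in the inner set as soon as 1/(n+1) < kappa rho0, for all rho >= rho0 at
    once. *)
Lemma fat_inner_balls (R : realType) (d : nat) (D : set 'rV[R]_d) (R0 kappa : R) : 0 < kappa <= 1 ->
  kappa_fat_at_infinity D R0 kappa -> forall rho0, R0 <= rho0 ->
  exists n0, forall n rho, (n0 <= n)%N -> rho0 <= rho -> exists a : 'rV[R]_d,
    [/\ eball a (kappa * rho) `<=` inner_set D n, eball a (kappa * rho) `<=` [set y | 2 * rho <= enorm y] &
    enorm a + kappa * rho <= (2 * kappa^-1 + 1) * rho].
Proof.
move=> /andP[k0 k1] [R00 fat] rho0 Rr; have r0 : 0 < rho0 by lra.
have [n0 hn0] := invn_small (mulr_gt0 k0 r0).
exists n0 => n rho nn rr.
have [|a [aD an]] := fat (2 * rho); first lra.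
have rho_gt0 : 0 < rho by lra.
have kr : 0 < kappa * rho by rewrite mulr_gt0.
have kle : kappa * rho <= rho by rewrite ler_piMl// ltW.
have k2r : kappa * (2 * rho) = kappa * rho + kappa * rho by ring.
exists a; split.
- move=> z za v vz; suff [] : (D `&` [set y | 2 * rho < enorm y]) v by [].
  apply: aD; rewrite /eball/= k2r; apply: (le_lt_trans (enormB_triangle v z a)).
  apply: ltrD => //; apply: (lt_le_trans vz); apply: (le_trans (invn_le R nn)).
  apply: (le_trans (ltW hn0)); by rewrite ler_pM2l.
- move=> z za; suff [_ /=] : (D `&` [set y | 2 * rho < enorm y]) z by exact: ltW.
  by apply: aD; rewrite /eball/= k2r; apply: (lt_trans za); rewrite ltrDl.
- rewrite mulrDl mul1r; apply: lerD => //.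
  by rewrite -mulrA mulrCA; exact: ltW.
Qed.

(** Divided by g(y) g(y'), the hypothesis is the Cauchy condition for f/g. The product form can be
    obtained as a limit before g is known to be positive. *)
Lemma cvg_ratio (R : realType) (T : Type) (F : set_system T) (FF : ProperFilter F) (f g : T -> R) :
  F [set y | 0 < g y] ->
  (forall eta, 0 < eta -> exists2 A, F A & forall y y', A y -> A y' ->
     f y * g y' <= g y * f y' + eta * (g y * g y')) ->
  exists l : R, f y / g y @[y --> F] --> l.
Proof.
move=> Fg cauchy_fg; apply/cvg_ex; apply: cauchy_cvg; apply: cauchy_exP => e e0.
have [A FA hA] := cauchy_fg (e / 2) (divr_gt0 e0 (@ltr0n R 2)).
have FAg : F (A `&` [set y | 0 < g y]) by exact: filterI.
have [y0 [Ay0 g0]] := filter_ex FAg.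
exists (f y0 / g y0); apply: (@filterS _ F _ _ _ _ FAg); move=> y [Ay gy]; rewrite /= in g0 gy.
rewrite /=.
have h1 := hA _ _ Ay Ay0; have h2 := hA _ _ Ay0 Ay; move: h1 h2 g0 gy => /=.
move: (f y) (g y) (f y0) (g y0) => a b a0 b0 h1 h2 b00 b0'.
have bb : 0 < b * b0 by rewrite mulr_gt0.
rewrite /ball/= ltr_norml.
have -> : a0 / b0 - a / b = (b * a0 - a * b0) / (b * b0).
  by field; rewrite !gt_eqF.
rewrite ltr_pdivlMr// ltr_pdivrMr// mulNr.
have eb := mulr_gt0 e0 bb; move: h1 h2 eb; rewrite (mulrC b0 b) (mulrC a0 b) (mulrC b0 a).
rewrite !(mulrAC e 2^-1).
move: (e * (b * b0)) (a * b0) (b * a0) => u v w h1 h2 u0.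
by apply/andP; split; lra.
Qed.

(** Fatness provides points of D of arbitrarily large norm. *)
Lemma within_pinfty_proper (R : realType) (d : nat) (D : set 'rV[R]_d) R0 kappa :
  0 < kappa -> kappa_fat_at_infinity D R0 kappa -> ProperFilter (within D (@enorm_pinfty R d)).
Proof.
move=> k0 [R00 fat].
have FF : Filter (@enorm_pinfty R d).
  apply: filter_from_filter; first by exists 0.
  move=> i j _ _; exists (Num.max i j) => // y /=; rewrite gt_max => /andP[? ?]; split=> //.
have FW := within_filter D FF.
apply: Build_ProperFilter => // -[r _ r0].
have [|a [aD _]] := fat (Num.max R0 r); first by rewrite le_max lexx.
have [Da /= ra] : (D `&` [set y | Num.max R0 r < enorm y]) a.
  apply: aD; rewrite /eball/= subrr enorm0 mulr_gt0//; apply: (lt_le_trans R00).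
  by rewrite le_max lexx.
by apply: (r0 a) => //=; apply: le_lt_trans ra; rewrite le_max lexx orbT.
Qed.

(** * Green functions of the grid walks and their limits *)

Section green_limit.
Context (R : realType) (d : nat) (disp : measure_display) (Omega : measurableType disp).
Variables (P : 'rV[R]_d -> probability Omega R) (X : R -> Omega -> 'rV[R]_d).
Variables (phi : R -> R) (p : R -> 'rV[R]_d -> 'rV[R]_d -> R).
Hypothesis d0 : (0 < d)%N.
Hypothesis phi_gt0 : forall l, 0 < l -> 0 < phi l.
Hypothesis phi_cbf : complete_bernstein phi.
Hypothesis X_levy : levy_process P X.
Hypothesis X_exponent : has_characteristic_exponent P X phi.
Hypothesis p_density : transition_density P X p.
Variables (C alpha beta : R).
Hypothesis W : wscale phi C alpha beta.
Hypothesis beta0 : 0 < beta.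
Hypothesis beta_d : 2 * beta < d%:R.
Local Notation V := (borelRd R d).
Local Notation mu := (@lebesgueRd R d).
Local Notation leb := (@lebesgue_measure R).
Local Notation ph := (ph phi).
Local Notation eps m := (2 ^- m : R).
Let p0 := density_ge0 p_density.
Let eps_gt0 m : 0 < eps m. Proof. by rewrite invr_gt0 exprn_gt0. Qed.
Let psym := density_sym d0 phi_cbf X_levy X_exponent p_density.
Let mp2 t (t0 : 0 < t) := measurable_p2 d0 phi_cbf X_levy X_exponent p_density t0.

Definition gam : R := d%:R / (2 * beta).

Lemma gam1 : 1 < gam.
Proof. by rewrite /gam ltr_pdivlMr ?mul1r// mulr_gt0. Qed.

Local Notation tdec := (tdecay gam).

Definition Kt := Keps d C alpha (phi 1 / C).

Lemma Kt_ge0 : 0 <= Kt.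
Proof. by apply: (Keps_ge0 d W); rewrite divr_gt0 ?phi_gt0// (lt_le_trans ltr01 (ws_C W)). Qed.

(** [density_diag] is applied at rho = t^(1/(2 beta)): upper scaling gives t ph rho >= phi 1 / C,
    and rho^d = t^gam. *)
Lemma density_time t x y : 1 < t -> p t x y <= Kt * tdec t.
Proof.
move=> t1; have t0 : 0 < t by lra.
have C0 : 0 < C := lt_le_trans ltr01 (ws_C W).
pose rho := t `^ (1 / (2 * beta)).
have b20 : 0 < 2 * beta by rewrite mulr_gt0.
have ib : 0 <= 1 / (2 * beta) by rewrite divr_ge0// ltW.
have rho1 : 1 <= rho by rewrite -(powRr0 t); apply: ler_powR => //; exact: ltW.
have rho0 : 0 < rho by lra.
have r2 : rho ^- 2 <= 1 by rewrite invf_le1 ?exprn_gt0// exprn_ege1.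
have r20 : 0 < rho ^- 2 by rewrite invr_gt0 exprn_gt0.
have h := ws_ub W r20 r2.
have e1 : (1 / rho ^- 2) `^ beta = t.
  rewrite div1r invrK -(powR_mulrn _ (ltW rho0)) -!powRrM.
  have -> : 1 / (2 * beta) * (2%:R * beta) = 1 by field; rewrite gt_eqF.
  by rewrite powRr1// ltW.
rewrite e1 in h.
have h2 : phi 1 / C <= t * ph rho by rewrite ler_pdivrMr// mulrC mulrA.
have eta0 : 0 < phi 1 / C by rewrite divr_gt0// phi_gt0.
have := density_diag d0 phi_gt0 phi_cbf X_levy X_exponent p_density W x y eta0 t0 rho0 h2.
have rd : rho ^+ d = t `^ gam.
  by rewrite -(powR_mulrn _ (ltW rho0)) -powRrM /gam; congr (_ `^ _); field; rewrite gt_eqF.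
rewrite rd -ler_pdivlMr ?powR_gt0// -powRN.
by rewrite /tdecay [t <= 1]leNgt t1.
Qed.

Definition Kmaj (del : R) := Kt + Kfar d phi C del.

(** Away from the diagonal p is at most a multiple of t for small t, so a single multiple of
    [tdecay] majorizes it for all t. *)
Lemma density_maj del x y t : 0 < del -> del <= enorm (x - y) -> 0 < t ->
  p t x y <= Kmaj del * tdec t.
Proof.
move=> del0 xy t0; have k1 := Kt_ge0; have k2 := Kfar_ge0 d phi_gt0 W del0.
have td := tdecay_ge0 gam t; rewrite /Kmaj mulrDl.
have [t1|t1] := leP t 1; last first.
  by apply: (le_trans (density_time x y t1)); rewrite lerDl mulr_ge0.
apply: (@le_trans _ _ (Kfar d phi C del * t)).
  exact: (far_bound d0 phi_gt0 phi_cbf X_levy X_exponent p_density W del0).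
have -> : tdec t = 1 by rewrite /tdecay t1.
rewrite mulr1; apply: (@le_trans _ _ (Kfar d phi C del)); first by rewrite ler_piMr.
by rewrite mulr1 lerDr.
Qed.

Section kernel.
Variables (e : R) (U : set V).
Hypothesis e0 : 0 < e.
Hypothesis mU : measurable U.
Let q0 a b := p0 a b e0.
Let mq := mp2 e0.

Lemma nnm_pl y : nnm (fun z : V => (p e z y)%:E).
Proof.
have := nnm_p p_density y e0; congr nnm; apply/funext => z; congr EFin; exact: psym.
Qed.

(** Reversal of the path. It identifies the Green function as a function of its second argument, the
    form of the walk estimates, with the series of the killed kernels started at x. *)
Lemma QUn_swap k x y :
  QUn mu (p e) U k (fun z => (p e z y)%:E) x = QUn mu (p e) U k (fun z => (p e x z)%:E) y.
Proof.
case: k => [//|k]; have nx := nnm_p p_density x e0.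
rewrite -[LHS]/(\int[mu]_(w in U) ((p e x w)%:E * QUn mu (p e) U k (fun z => (p e z y)%:E) w))%E.
have qsym a b : p e a b = p e b a by exact: psym.
rewrite (QUn_dual mu mq q0 qsym k mU (nnm_pl y) nx).
rewrite -[RHS]/(\int[mu]_(w in U) ((p e y w)%:E * QUn mu (p e) U k (fun z => (p e x z)%:E) w))%E.
by apply: eq_integral => w _; rewrite muleC psym.
Qed.

Lemma QUn_le_density k x y :
  (QUn mu (p e) U k (fun z => (p e z y)%:E) x <= (p (k.+1%:R * e) x y)%:E)%E.
Proof.
rewrite (hunt d0 phi_cbf X_levy X_exponent p_density x e0 mU k y) leeDl//.
by apply: integral_ge0 => w _; exact: (hit_ge0 p_density x e0).
Qed.

Lemma QUn_ge0 k x y : (0 <= QUn mu (p e) U k (fun z => (p e z y)%:E) x)%E.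
Proof. exact: (nnm_QUn mu mq q0 mU k (nnm_pl y)).2. Qed.

Definition chain_green (x y : V) : \bar R := RU mu (p e) U (fun z => (p e x z)%:E) y.

Lemma chain_greenE x y :
  chain_green x y = (\sum_(0 <= k <oo) QUn mu (p e) U k (fun z => (p e z y)%:E) x)%E.
Proof. by apply: eq_eseriesr => k _; rewrite QUn_swap. Qed.

End kernel.

Lemma chain_green_kgrid m U x y : measurable U ->
  ((eps m)%:E * chain_green (eps m) U x y =
  \int[leb]_(t in `]0%R, +oo[) QUn mu (p (eps m)) U (kgrid m t) (fun z => (p (eps m) z y)%:E) x)%E.
Proof.
move=> mU; rewrite chain_greenE//.
by rewrite (integral_kgrid m (a := fun k => QUn mu (p (eps m)) U k (fun z => (p (eps m) z y)%:E) x))// => k; exact: QUn_ge0.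
Qed.

Lemma QUn_maj del m U x y t : measurable U -> 0 < del -> del <= enorm (x - y) -> 0 < t ->
  (QUn mu (p (eps m)) U (kgrid m t) (fun z => (p (eps m) z y)%:E) x <= (Kmaj del * tdec t)%:E)%E.
Proof.
move=> mU del0 xy t0; apply: (le_trans (QUn_le_density (eps_gt0 m) mU _ x y)).
have /andP[h1 h2] := kgridP m (ltW t0).
have s0 : 0 < (kgrid m t).+1%:R * eps m by rewrite mulr_gt0// ltr0n.
rewrite lee_fin; apply: (le_trans (density_maj del0 xy s0)).
have k0 : 0 <= Kmaj del by rewrite addr_ge0 ?Kt_ge0// (Kfar_ge0 d phi_gt0 W del0).
by rewrite ler_wpM2l//; apply: (tdecay_decr gam1); exact: ltW.
Qed.

Definition Itd : R := fine (\int[leb]_(t in `]0%R, +oo[) (tdec t)%:E)%E.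

Lemma ItdE : (\int[leb]_(t in `]0%R, +oo[) (tdec t)%:E = Itd%:E)%E /\ 0 <= Itd.
Proof. by rewrite /Itd; have [k k0 ->] := integral_tdecay gam1; rewrite fineK. Qed.

Lemma int_maj k : 0 <= k -> (\int[leb]_(t in `]0%R, +oo[) (k * tdec t)%:E = (k * Itd)%:E)%E.
Proof.
move=> k0; rewrite EFinM -ItdE.1 -ge0_integralZl//.
- by apply: measurable_funTS; apply/measurable_EFinP; exact: measurable_tdecay.
- by move=> t _; rewrite lee_fin tdecay_ge0.
Qed.

Lemma chain_green_ub del m U x y : measurable U -> 0 < del -> del <= enorm (x - y) ->
  ((eps m)%:E * chain_green (eps m) U x y <= (Kmaj del * Itd)%:E)%E.
Proof.
move=> mU del0 xy; rewrite chain_green_kgrid//.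
have k0 : 0 <= Kmaj del by rewrite addr_ge0 ?Kt_ge0// (Kfar_ge0 d phi_gt0 W del0).
rewrite -int_maj//; apply: ge0_le_integral => //.
- by move=> t _; exact: QUn_ge0.
- apply: (measurable_kgrid m (a := fun k => QUn mu (p (eps m)) U k (fun z => (p (eps m) z y)%:E) x)) => k.
  exact: QUn_ge0.
- apply: measurable_funTS; apply/measurable_EFinP; apply: measurable_funM => //.
  exact: measurable_tdecay.
by move=> t; rewrite /= in_itv/= andbT => t0; exact: QUn_maj.
Qed.

Section limits.
Variables (x y : V).
Hypothesis xy : x != y.
Let del1 := enorm (x - y).
Let del10 : 0 < del1. Proof. by apply: enorm_gt0; rewrite subr_eq0. Qed.
Let k0 : 0 <= Kmaj del1. Proof. by rewrite addr_ge0 ?Kt_ge0// (Kfar_ge0 d phi_gt0 W del10). Qed.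

(** Dominated convergence in t, the majorant being a multiple of [tdecay]. The killed density is
    measurable in t because it is a pointwise limit of step functions. *)
Lemma cvg_chain_green (U : set V) del : 0 < del -> measurable U -> closed U ->
  (forall z, ~ U z -> del <= enorm (z - y)) ->
  [/\ (((eps m)%:E * chain_green (eps m) U x y)%E @[m --> \oo] --> green P X p U x y),
   measurable_fun (`]0%R, +oo[ : set (measurableTypeR R)) (fun t => killed_density P X p U t x y) &
   forall t, 0 < t -> (0 <= killed_density P X p U t x y <= (Kmaj del1 * tdec t)%:E)%E].
Proof.
move=> del0 mU cU far.
pose f_ m (t : measurableTypeR R) := QUn mu (p (eps m)) U (kgrid m t) (fun z => (p (eps m) z y)%:E) x.
have mf_ m : measurable_fun (`]0%R, +oo[ : set (measurableTypeR R)) (f_ m).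
  apply: (measurable_kgrid m (a := fun k => QUn mu (p (eps m)) U k (fun z => (p (eps m) z y)%:E) x)) => k.
  exact: QUn_ge0.
have cf (t : R) : (`]0%R, +oo[%classic : set R) t -> f_ ^~ t @ \oo --> killed_density P X p U t x y.
  rewrite /= in_itv/= andbT => t0.
  exact: (cvg_QUn d0 phi_gt0 phi_cbf X_levy X_exponent p_density W del0 mU far cU t0).
pose f (t : measurableTypeR R) := killed_density P X p U t x y.
have mf : measurable_fun (`]0%R, +oo[ : set (measurableTypeR R)) f.
  have h := @emeasurable_fun_cvg _ _ _ _ f_ f mf_; apply: h => t ht; exact: (cf t ht).
have bf t : 0 < t -> forall m, (0 <= f_ m t <= (Kmaj del1 * tdec t)%:E)%E.
  move=> t0 m; apply/andP; split; first exact: QUn_ge0.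
  exact: QUn_maj.
have acf : {ae leb, forall t : measurableTypeR R, (`]0%R, +oo[%classic : set (measurableTypeR R)) t -> f_ ^~ t @ \oo --> f t}.
  by apply: aeW => t ht; exact: (cf t ht).
have abf : {ae leb, forall (t : measurableTypeR R) n, (`]0%R, +oo[%classic : set (measurableTypeR R)) t -> (`|f_ n t| <= (Kmaj del1 * tdec t)%:E)%E}.
  apply: aeW => t n; rewrite /= in_itv/= andbT => t0; have /andP[h1 h2] := bf t t0 n.
  by rewrite gee0_abs.
have [_ _ h] := @dominated_convergence _ _ _ leb _ (measurable_itv `]0%R, +oo[) f_
   f (fun t => (Kmaj del1 * tdec t)%:E) mf_ mf acf (integrable_tdecay gam1 _) abf.
split=> //.
- rewrite /green; under eq_fun do rewrite chain_green_kgrid//.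
  exact: h.
- move=> t t0; have ct : f_ ^~ t @ \oo --> killed_density P X p U t x y by apply: cf; rewrite /= in_itv/= t0.
  rewrite -(cvg_lim _ ct)//; apply/andP; split.
    apply: lime_ge; first by apply/cvg_ex; eexists; exact: ct.
    by apply: nearW => m; have /andP[] := bf t t0 m.
  apply: lime_le; first by apply/cvg_ex; eexists; exact: ct.
  by apply: nearW => m; have /andP[] := bf t t0 m.
Qed.

Lemma cvg_green (D : set 'rV[R]_d) : open D -> D x -> D y ->
  green P X p (inner_set D n) x y @[n --> \oo] --> green P X p D x y.
Proof.
move=> oD Dx Dy; have [del del0 [n0 far]] := inner_set_far oD Dy.
rewrite -(cvg_shiftn n0).
have H n := cvg_chain_green del0 (measurable_inner_set D (n + n0)) (@closed_inner_set _ _ D (n + n0))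
  (far (n + n0) (leq_addl _ _)).2.
pose f_ n (t : measurableTypeR R) := killed_density P X p (inner_set D (n + n0)) t x y.
have mf_ n : measurable_fun (`]0%R, +oo[ : set (measurableTypeR R)) (f_ n) by have [] := H n.
have cf (t : R) : (`]0%R, +oo[%classic : set R) t -> f_ ^~ t @ \oo --> killed_density P X p D t x y.
  rewrite /= in_itv/= andbT => t0.
  have h := cvg_killed d0 phi_gt0 phi_cbf X_levy X_exponent p_density W oD t0 Dx Dy.
  by rewrite -(cvg_shiftn n0) in h.
pose f (t : measurableTypeR R) := killed_density P X p D t x y.
have mf : measurable_fun (`]0%R, +oo[ : set (measurableTypeR R)) f.
  have h := @emeasurable_fun_cvg _ _ _ _ f_ f mf_; apply: h => t ht; exact: (cf t ht).
have acf : {ae leb, forall t : measurableTypeR R, (`]0%R, +oo[%classic : set (measurableTypeR R)) t -> f_ ^~ t @ \oo --> f t}.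
  by apply: aeW => t ht; exact: (cf t ht).
have abf : {ae leb, forall (t : measurableTypeR R) n, (`]0%R, +oo[%classic : set (measurableTypeR R)) t -> (`|f_ n t| <= (Kmaj del1 * tdec t)%:E)%E}.
  apply: aeW => t n; rewrite /= in_itv/= andbT => t0; have [_ _ /(_ t t0)/andP[h1 h2]] := H n.
  by rewrite gee0_abs.
have [_ _ h] := @dominated_convergence _ _ _ leb _ (measurable_itv `]0%R, +oo[) f_
   f (fun t => (Kmaj del1 * tdec t)%:E) mf_ mf acf (integrable_tdecay gam1 _) abf.
exact: h.
Qed.

End limits.

Lemma density_mass t x (A : set V) : 0 < t -> measurable A -> (\int[mu]_(y in A) (p t x y)%:E <= 1)%E.
Proof.
move=> t0 mA; rewrite -(density_law p_density x t0 mA); apply: probability_le1.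
rewrite -[X in measurable X]setTI; exact: (levy_measurable X_levy (ltW t0)).
Qed.

Definition Kball (r : R) := 1 + Kt * (2 * r) ^+ d.

Lemma Kball_ge1 r : 0 < r -> 1 <= Kball r.
Proof.
move=> r0; rewrite lerDl; apply: mulr_ge0; first exact: Kt_ge0.
by rewrite exprn_ge0// mulr_ge0// ltW.
Qed.

Lemma density_ball t x r (A : set V) : 0 < t -> 0 < r -> measurable A -> A `<=` eball 0 r ->
  (\int[mu]_(y in A) (p t x y)%:E <= (Kball r * tdec t)%:E)%E.
Proof.
move=> t0 r0 mA Ar; have K1 := Kball_ge1 r0.
have [t1|t1] := leP t 1.
  apply: (le_trans (density_mass x t0 mA)); rewrite lee_fin.
  by rewrite /tdecay t1 mulr1.
have td := tdecay_ge0 gam t.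
have kt : 0 <= Kt * tdec t by rewrite mulr_ge0// Kt_ge0.
apply: (@le_trans _ _ (\int[mu]_(y in A) (Kt * tdec t)%:E)%E).
  apply: ge0_le_integral => //.
  - by move=> y _; rewrite lee_fin p0.
  - by apply: measurable_funTS; have [] := nnm_p p_density x t0.
  - move=> y _; rewrite lee_fin.
    exact: (density_time x y t1).
rewrite integral_cst//.
have mb : measurable (eball (0 : 'rV[R]_d) r : set V) by exact: measurable_eball.
apply: (@le_trans _ _ ((Kt * tdec t)%:E * ((2 * r) ^+ d)%:E)%E).
  rewrite lee_wpmul2l//; apply: le_trans (lebesgue_eball_ub (0 : 'rV[R]_d) r0).
  by apply: le_measure; rewrite ?inE.
rewrite -EFinM lee_fin mulrAC; apply: ler_wpM2r => //.
by rewrite /Kball lerDr.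
Qed.

Lemma chain_green_mass m (U A : set V) x r : measurable U -> measurable A -> 0 < r -> A `<=` eball 0 r ->
  ((eps m)%:E * \int[mu]_(y in A) chain_green (eps m) U x y <= (Kball r * Itd)%:E)%E.
Proof.
move=> mU mA r0 Ar; have K0 : 0 <= Kball r by have := Kball_ge1 r0; lra.
have e0 := eps_gt0 m.
have nk k := nnm_QUn mu (mp2 e0) (fun a b => p0 a b e0) mU k (nnm_p p_density x e0).
rewrite /chain_green /RU integral_nneseries//; last 2 first.
- by move=> k; apply: measurable_funTS; have [] := nk k.
- by move=> k y _; have [_] := nk k.
have s0 k : 0 < k.+1%:R * eps m by rewrite mulr_gt0// ltr0n.
pose a k := (\int[mu]_(y in A) (p (k.+1%:R * eps m) x y)%:E)%E.
have a0 k : (0 <= a k)%E by apply: integral_ge0 => y _; rewrite lee_fin p0.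
apply: (@le_trans _ _ ((eps m)%:E * \sum_(0 <= k <oo) a k)%E).
  rewrite lee_wpmul2l ?lee_fin ?(ltW e0)//; apply: lee_nneseries => k _.
    by move=> _; apply: integral_ge0 => y _; have [_] := nk k.
  apply: ge0_le_integral => //.
  - by move=> y _; have [_] := nk k.
  - by apply: measurable_funTS; have [] := nk k.
  - by apply: measurable_funTS; have [] := nnm_p p_density x (s0 k).
  - move=> y _; rewrite -(QUn_swap e0 mU).
    exact: (QUn_le_density e0 mU).
rewrite -(integral_kgrid m (a := a))//.
rewrite -(int_maj K0); apply: ge0_le_integral => //.
- exact: (measurable_kgrid m (a := a)).
- apply: measurable_funTS; apply/measurable_EFinP; apply: measurable_funM => //.
  exact: measurable_tdecay.
move=> t; rewrite /= in_itv/= andbT => t0.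
apply: (le_trans (density_ball x (s0 _) r0 mA Ar)); rewrite lee_fin ler_wpM2l//.
have /andP[h2 _] := kgridP m (ltW t0).
by apply: (tdecay_decr gam1); exact: ltW.
Qed.

Definition KI (r : R) := 1 + Kball r * Itd.

(** Of order 1/eps, the number of grid steps per unit of time. The lower bound [chain_iu_lb] has the
    same order, so eps cancels in ratios. *)
Lemma chain_Iu_ub m (U : set V) x r : measurable U -> 0 < r ->
  (Iu (p (eps m)) U x r <= (KI r / eps m)%:E)%E.
Proof.
move=> mU r0; have e0 := eps_gt0 m; have mB : measurable (eball (0 : 'rV[R]_d) r : set V) by exact: measurable_eball.
have h := @chain_green_mass m U (U `&` eball 0 r) x r mU (measurableI _ _ mU mB) r0 (@subIsetr _ _ _).
have e1 : eps m <= 1 by rewrite invf_le1 ?exprn_gt0// exprn_ege1// ler1n.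
rewrite /KI mulrDl EFinD div1r; apply: leeD.
  by rewrite lee_fin invf_ge1.
rewrite mulrC EFinM; move: h; rewrite /chain_green.
by rewrite -lee_pdivlMl ?invr_gt0// => h; rewrite -?(invrK (eps m)) //.
Qed.

Lemma chain_Iu_fin m (U : set V) x r : measurable U -> Iu (p (eps m)) U x r \is a fin_num.
Proof.
move=> mU; have r1 : 0 < Num.max r 1 by rewrite lt_max ltr01 orbT.
have e0 := eps_gt0 m.
rewrite ge0_fin_numE; last first.
  rewrite /Iu adde_ge0// integral_ge0// => y _.
  by have [] := nnm_RU mu (mp2 e0) (fun a b => p0 a b e0) mU (nnm_p p_density x e0).
apply: (@le_lt_trans _ _ (Iu (p (eps m)) U x (Num.max r 1))).
  rewrite /Iu leeD2l//; apply: ge0_subset_integral => //.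
  - by apply: measurableI => //; exact: measurable_eball.
  - by apply: measurableI => //; exact: measurable_eball.
  - by apply: measurable_funTS; have [] := nnm_RU mu (mp2 e0) (fun a b => p0 a b e0) mU (nnm_p p_density x e0).
  - by move=> y _; have [] := nnm_RU mu (mp2 e0) (fun a b => p0 a b e0) mU (nnm_p p_density x e0).
  - by move=> y [Uy yr]; split=> //; rewrite /eball/= lt_max; apply/orP; left.
by apply: (le_lt_trans (chain_Iu_ub m x mU r1)); rewrite ltry.
Qed.

Lemma chain_iu_ub m (U : set V) x r : measurable U -> 0 < r ->
  iu (p (eps m)) U x r <= KI r / eps m.
Proof.
move=> mU r0; have h := chain_Iu_ub m x mU r0.
by rewrite -lee_fin /iu fineK//; exact: chain_Iu_fin.
Qed.

(** The walk from x makes of order 1/eps steps in a ball about x contained in U, by [RU_ball_lb]. *)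
Lemma chain_iu_lb m (U : set V) x r s Cw rmin Ceta Pn : scale Cw ph ->
  walk Cw rmin ph Ceta (eps m) (p (eps m)) Pn -> measurable U ->
  0 < s -> eball x s `<=` U -> enorm x + s <= r ->
  (16 * (17 * (Cw * ph s)))^-1 / eps m <= iu (p (eps m)) U x r.
Proof.
move=> sc w mU s0 xU xr; have e0 := eps_gt0 m.
have mB : measurable (eball x s : set V) by exact: measurable_eball.
have nx := nnm_p p_density x e0.
have xx : enorm (x - x) < s / 2 by rewrite subrr enorm0 divr_gt0.
have q0 a b := p0 a b e0.
have qsym a b : p (eps m) a b = p (eps m) b a by exact: psym.
have h := RU_ball_lb sc w s0 xx.
rewrite (RU1E mu (mp2 e0) q0 qsym x mB) in h.
rewrite -lee_fin /iu fineK; last exact: chain_Iu_fin.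
have -> : (16 * (17 * (Cw * ph s)))^-1 / eps m = (16 * (17 * (Cw * (eps m * ph s))))^-1.
  by rewrite -invfM; congr (_^-1); ring.
apply: (le_trans h); rewrite /Iu leeD2l//.
have nR A (mA : measurable A) := nnm_RU mu (mp2 e0) q0 mA nx.
apply: (@le_trans _ _ (\int[mu]_(y in eball x s) RU mu (p (eps m)) U (fun z => (p (eps m) x z)%:E) y)%E).
  apply: ge0_le_integral => //.
  - by move=> y _; have [_] := nR _ mB.
  - by apply: measurable_funTS; have [] := nR _ mB.
  - by apply: measurable_funTS; have [] := nR _ mU.
  - by move=> y By; exact: (RU_subset mu (mp2 e0) q0).
apply: ge0_subset_integral => //.
- by apply: measurableI => //; exact: measurable_eball.
- by apply: measurable_funTS; have [] := nR _ mU.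
- by move=> y _; have [_] := nR _ mU.
move=> y; rewrite /eball/= => yx; split; first exact: xU.
by have := enorm_le_sub y x; rewrite subr0 => hh; apply: (le_lt_trans hh); apply: lt_le_trans xr; rewrite ltrD2l.
Qed.

Lemma theta_lb rho0 b Cw Ceta e q Pn (w : V) : scale Cw ph -> walk Cw rho0 ph Ceta e q Pn ->
  2 * rho0 <= enorm w -> enorm w + rho0 <= b ->
  ((e * (ph b / (Cw ^+ 2 * b ^+ d) * (rho0 / d.+1%:R) ^+ d))%:E <= theta q rho0 w)%E.
Proof.
move=> sc wk w2 wb; have r0 := w_rmin wk; have e0 := w_eps wk.
have C1 := sc_C sc; have C0 : 0 < Cw by lra.
have b0 : 0 < b by lra.
have pb := sc_pos sc b0.
pose k := e * (ph b / (Cw ^+ 2 * b ^+ d)).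
have k0 : 0 < k by rewrite mulr_gt0// divr_gt0// mulr_gt0 ?exprn_gt0.
have kq (z : 'rV[R]_d) : enorm z < rho0 -> k <= q w z.
  move=> zr; have h1 := enorm_le_sub w z; have h2 := enorm_triangle w (- z).
  rewrite enormN in h2.
  have a1 : rho0 <= enorm ((w : 'rV[R]_d) - z) by lra.
  have a2 : enorm ((w : 'rV[R]_d) - z) <= b by lra.
  have lb := w_lb wk a1; move: lb; rewrite /nu; move: (enorm _) a1 a2 => a a1 a2 lb.
  have a0 : 0 < a by lra.
  have hd := sc_dec sc a0 a2.
  rewrite -(ler_pM2l C0); apply: le_trans lb.
  have -> : Cw * k = e * (ph b / Cw * (b ^- d)).
    by rewrite /k; field; rewrite !expf_neq0 ?gt_eqF.
  rewrite ler_pM2l//; apply: ler_pM.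
  - by rewrite divr_ge0// ltW.
  - by rewrite invr_ge0 exprn_ge0// ltW.
  - by rewrite ler_pdivrMr// mulrC.
  - rewrite lef_pV2 ?posrE ?exprn_gt0//; apply: lerXn2r => //; rewrite nnegrE; exact: ltW.
rewrite mulrA -/k /theta /QU.
have mB : measurable (eball (0 : 'rV[R]_d) rho0 : set V) by exact: measurable_eball.
apply: (@le_trans _ _ (k%:E * mu (eball (0 : 'rV[R]_d) rho0))%E).
  rewrite EFinM; apply: lee_wpmul2l; first by rewrite lee_fin ltW.
  exact: lebesgue_eball_lb.
rewrite -integral_cst//; apply: ge0_le_integral => //.
- by move=> z _; rewrite lee_fin ltW.
- have n1 : nnm (fun=> 1%E : \bar R) (T := V) by apply: nnm_cst.
  by apply: measurable_funTS; have [] := nnm_qf (w_meas wk) (w_ge0 wk) w n1.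
move=> z; rewrite /eball/= subr0 mule1 lee_fin => zr; exact: kq.
Qed.

(** [u_lb] bounds the Green function below by a multiple of iu times [HH]. The factor iu is at least
    of order 1/eps. [HH] is at least the time spent near y, of order 1/eps, times the chance eps t0
    of a jump into the ball about the origin. So eps times the Green function is bounded below
    independently of m and U. *)
Lemma chain_green_lb Cw rho0 s s1 (x y : V) : scale Cw ph -> 0 < rho0 -> 0 < s -> 0 < s1 ->
  enorm x + s1 <= rho0 -> 2 * rho0 + s <= enorm y ->
  exists2 c, 0 < c & forall m (U : set V) Ceta Pn,
    walk Cw rho0 ph Ceta (eps m) (p (eps m)) Pn -> measurable U ->
    eball x s1 `<=` U -> eball y s `<=` U ->
    (c%:E <= (eps m)%:E * chain_green (eps m) U x y)%E.
Proof.
move=> sc r0 s0 s10 xs ys.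
have C0 : 0 < Cw by apply: lt_le_trans (sc_C sc).
pose b := enorm y + s + rho0.
have b0 : 0 < b by rewrite !addr_gt0//; lra.
pose t0 := ph b / (Cw ^+ 2 * b ^+ d) * (rho0 / d.+1%:R) ^+ d.
have t00 : 0 < t0.
  by rewrite mulr_gt0 ?exprn_gt0 ?divr_gt0 ?mulr_gt0 ?exprn_gt0 ?ltr0n// (sc_pos sc).
pose c1 := (16 * (17 * (Cw * ph s1)))^-1.
pose c2 := (16 * (17 * (Cw * ph s)))^-1.
have c10 : 0 < c1 by rewrite invr_gt0 !mulr_gt0// (sc_pos sc).
have c20 : 0 < c2 by rewrite invr_gt0 !mulr_gt0// (sc_pos sc).
pose k := k2 d Cw * rho0 ^+ d.
have k0 : 0 < k by rewrite mulr_gt0 ?exprn_gt0// (lt_le_trans ltr01)// (k2_ge1 d sc).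
have cc : 0 < c1 * (t0 * c2) by exact: (mulr_gt0 c10 (mulr_gt0 t00 c20)).
exists (c1 * (t0 * c2) / k); first exact: (divr_gt0 cc k0).
move=> m U Ceta Pn wk mU xU yU; have e0 := eps_gt0 m.
have q0 a b := p0 a b e0.
have xr : enorm x < rho0 by lra.
have fin := chain_Iu_fin m x ^~ mU.
have yy : enorm (y - y) < s / 2 by rewrite subrr enorm0 divr_gt0.
have Uy : U y by apply: yU; rewrite /eball/= subrr enorm0.
have yout : (U `&` [set y : V | 2 * rho0 <= enorm y]) y by split=> //=; lra.
have h := u_lb sc wk mU fin (lexx _) xr yout.
have i1 := chain_iu_lb sc wk mU s10 xU xs.
rewrite -/c1 in i1.
have mB : measurable (eball y s : set V) by exact: measurable_eball.
have Bsub : eball y s `<=` (U `&` [set y : V | 2 * rho0 <= enorm y]).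
  move=> z yz; split; first exact: yU.
  have := enorm_le_sub y z; rewrite enormB; move: yz; rewrite /eball/= => yz hh; lra.
have mO : measurable (U `&` [set y : V | 2 * rho0 <= enorm y]).
  by apply: measurableI => //; exact: measurable_enorm_ge.
have nth := nnm_theta wk rho0.
have n1 : nnm (fun=> 1%E : \bar R) (T := V) by apply: nnm_cst.
have By : eball y s y by rewrite /eball/= subrr enorm0.
have H : ((t0 * c2)%:E <= HH (p (eps m)) U rho0 y)%E.
  rewrite /HH; apply: (le_trans _ (RU_subset mu (mp2 e0) q0 mB mO nth Bsub By)).
  have tz : 0 <= eps m * t0 by rewrite mulr_ge0// ltW.
  apply: (@le_trans _ _ (RU mu (p (eps m)) (eball y s) (fun=> ((eps m * t0)%:E * 1)%E) y)).
    rewrite (RUZ mu (mp2 e0) q0 mB y n1 tz).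
    have h2 := RU_ball_lb sc wk s0 yy.
    apply: (@le_trans _ _ ((eps m * t0)%:E * ((16 * (17 * (Cw * (eps m * ph s))))^-1)%:E)%E); last first.
      by rewrite lee_wpmul2l// lee_fin.
    rewrite -EFinM lee_fin /c2 le_eqVlt; apply/orP; left; apply/eqP.
    have hs := sc_pos sc s0; field; rewrite !gt_eqF//=.
  apply: (RU_le mu (mp2 e0) q0 mB _ nth _ By).
    exact: nnmZ.
  move=> w Bw; have [_ /= w2] := Bsub w Bw; rewrite mule1; apply: (theta_lb sc wk w2).
  by rewrite /b lerD2r; apply: (le_trans (enorm_le_sub w y)); rewrite lerD2l ltW.
have iz : 0 <= iu (p (eps m)) U x rho0 by apply: le_trans i1; rewrite divr_ge0// ltW.
have h3 : ((c1 / eps m)%:E * (t0 * c2)%:E <= k%:E * chain_green (eps m) U x y)%E.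
  apply: le_trans h; apply: lee_pmul => //; rewrite lee_fin.
  - by rewrite divr_ge0// ltW.
  - by rewrite mulr_ge0// ltW.
have -> : c1 * (t0 * c2) / k = (eps m / k) * ((c1 / eps m) * (t0 * c2)).
  by field; rewrite !gt_eqF.
have -> : ((eps m)%:E * chain_green (eps m) U x y)%E = ((eps m / k)%:E * (k%:E * chain_green (eps m) U x y))%E.
  by rewrite muleA -EFinM divfK// gt_eqF.
by rewrite EFinM lee_wpmul2l// lee_fin divr_ge0// ltW.
Qed.

Definition gchain m (U : set V) (x y : V) : R := fine ((eps m)%:E * chain_green (eps m) U x y)%E.

Lemma chain_green_ge0 m (U : set V) x y : measurable U -> (0 <= chain_green (eps m) U x y)%E.
Proof.
move=> mU; have e0 := eps_gt0 m.
by have [_] := nnm_RU mu (mp2 e0) (fun a b => p0 a b e0) mU (nnm_p p_density x e0); exact.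
Qed.

Lemma gchain_ge0 m (U : set V) x y : measurable U -> 0 <= gchain m U x y.
Proof. by move=> mU; rewrite fine_ge0// mule_ge0 ?lee_fin ?(ltW (eps_gt0 m))// chain_green_ge0. Qed.

Lemma gchainE m (U : set V) x y : measurable U -> x != y ->
  ((eps m)%:E * chain_green (eps m) U x y)%E = (gchain m U x y)%:E.
Proof.
move=> mU xy; rewrite /gchain fineK//.
have del0 : 0 < enorm (x - y) by apply: enorm_gt0; rewrite subr_eq0.
rewrite ge0_fin_numE; last by rewrite mule_ge0 ?lee_fin ?(ltW (eps_gt0 m))// chain_green_ge0.
apply: le_lt_trans (ltry _); exact: (chain_green_ub m mU del0 (lexx _)).
Qed.

(** Bounds of the ratio between two constants at most eta apart, used at y and at y', multiply out
    to this inequality without any division. *)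
Lemma chain_cross (D : set 'rV[R]_d) R0 kappa (x1 x2 : V) eta : open D -> D x1 -> D x2 ->
  0 < kappa <= 1 -> kappa_fat_at_infinity D R0 kappa -> 0 < eta ->
  exists r n0 M, forall n m y y', (n0 <= n)%N -> (M <= m)%N ->
    inner_set D n y -> inner_set D n y' -> r <= enorm y -> r <= enorm y' ->
    gchain m (inner_set D n) x1 y * gchain m (inner_set D n) x2 y' <=
    gchain m (inner_set D n) x2 y * gchain m (inner_set D n) x1 y' +
      eta * (gchain m (inner_set D n) x2 y * gchain m (inner_set D n) x2 y').
Proof.
move=> oD D1 D2 kap fat eta0'.
have [s1 s10 [n1 h1]] := inner_set_far oD D1.
have [s2 s20 [n2 h2]] := inner_set_far oD D2.
pose s := Num.min s1 s2.
have s0 : 0 < s by rewrite lt_min s10.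
(* Beyond this radius every point is at distance at least 1 from both poles, and the balls of radius
   s about the poles lie within it. *)
pose rho0 := Num.max R0 (enorm x1 + enorm x2 + s + 1).
have rR : R0 <= rho0 by rewrite le_max lexx.
have n1x := enorm_ge0 x1; have n2x := enorm_ge0 x2.
have rx : enorm x1 + enorm x2 + s + 1 <= rho0 by rewrite le_max lexx orbT.
have r0 : 0 < rho0 by lra.
have [x1r x2r] : enorm x1 < rho0 /\ enorm x2 < rho0 by split; lra.
have [x1s x2s] : enorm x1 + s <= rho0 /\ enorm x2 + s <= rho0 by split; lra.
have [x1o x2o] : enorm x1 + 1 <= rho0 /\ enorm x2 + 1 <= rho0 by split; lra.
have [r5 r8] : rho0 <= 5 * rho0 /\ rho0 <= 8 * rho0 by split; lra.
have far (x z : V) : enorm x + 1 <= rho0 -> rho0 <= enorm z -> 1 <= enorm ((x : 'rV[R]_d) - z).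
  by move=> a b; rewrite enormB; have := enorm_le_sub z x; lra.
have f1 z : rho0 <= enorm z -> 1 <= enorm (x1 - z) by exact: far.
have f2 z : rho0 <= enorm z -> 1 <= enorm (x2 - z) by exact: far.
have [n3 h3] := fat_inner_balls kap fat rR.
have [Cw Cw1 [sc wk]] := walk_exists d0 phi_gt0 phi_cbf X_levy X_exponent p_density W.
have C0 : 0 < Cw by lra.
have ps := sc_pos sc s0; have pr := sc_pos sc r0.
pose A1 := Kmaj 1 * Itd.
pose c1 := (16 * (17 * (Cw * ph s)))^-1.
have c10 : 0 < c1 by rewrite invr_gt0 !mulr_gt0.
(* Constants that start the induction over scales. At distance at least 1 from the pole the Green
   function is at most A1/eps, while iu lies between c1/eps and KI/eps; eps cancels, so A0 and B0
   serve every grid. *)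
pose A0 := A1 * rho0 ^+ d / c1.
pose B0 := Num.max 1 (KI (8 * rho0) / c1).
pose L := 2 * kappa^-1 + 1.
have k0 : 0 < kappa by case/andP: kap.
have L1 : 1 <= L by rewrite lerDr mulr_ge0// invr_ge0 ltW.
have B1 : 1 <= B0 by rewrite le_max lexx.
have [r hr] := chain_oscillation d A0 Cw1 B1 r0 kap L1 eta0' (Keps_ge0 d W).
have e0gt := eta0_gt0 d sc.
have [M hM] := @pow2V_small R (Num.min 1 (eta0 d Cw) / (Cw * ph rho0))
  ltac:(by rewrite divr_gt0 ?mulr_gt0// lt_min ltr01).
exists (Num.max r rho0), (maxn n1 (maxn n2 n3)), M => n m y y'.
rewrite !geq_max => /and3P[nn1 nn2 nn3] mM Dy Dy' yr yr'.
pose g := gchain m (inner_set D n); rewrite -/g.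
have e0 := eps_gt0 m.
have em : Cw * (eps m * ph rho0) <= Num.min 1 (eta0 d Cw).
  by have := hM m mM; rewrite ltr_pdivlMr ?mulr_gt0// => /ltW; rewrite mulrCA.
have [em1 em2] : Cw * (eps m * ph rho0) <= 1 /\ Cw * (eps m * ph rho0) <= eta0 d Cw.
  by move: em; rewrite le_min => /andP[].
have w := wk (eps m) rho0 e0 r0 em1.
have mU := measurable_inner_set D n.
set U := inner_set D n in mU Dy Dy' g *.
have xU1 : eball x1 s `<=` U.
  move=> z zx; apply: contrapT => nz; have := (h1 n nn1).2 z nz.
  by rewrite leNgt (lt_le_trans zx)// ge_min lexx.
have xU2 : eball x2 s `<=` U.
  move=> z zx; apply: contrapT => nz; have := (h2 n nn2).2 z nz.
  by rewrite leNgt (lt_le_trans zx)// ge_min lexx orbT.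
have A10 : 0 <= A1.
  apply: mulr_ge0; last by have [] := ItdE.
  by rewrite addr_ge0 ?Kt_ge0// (Kfar_ge0 d phi_gt0 W ltr01).
have ub x z : 1 <= enorm ((x : 'rV[R]_d) - z) -> eball x s `<=` U -> enorm x + s <= rho0 ->
    (RU mu (p (eps m)) U (fun y => (p (eps m) x y)%:E) z <=
      (A0 / rho0 ^+ d * iu (p (eps m)) U x (5 * rho0))%:E)%E.
  move=> xz xU xs.
  have h := chain_green_ub m mU ltr01 xz.
  rewrite -lee_pdivlMl// -EFinM in h; apply: (le_trans h); rewrite lee_fin.
  have xs5 := le_trans xs r5.
  have := chain_iu_lb sc w mU s0 xU xs5.
  have -> : A0 / rho0 ^+ d = A1 / c1 by rewrite /A0; field; rewrite !gt_eqF// exprn_gt0.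
  rewrite -/c1 -/A1; move: (iu _ _ _ _) => I hI.
  apply: (@le_trans _ _ (A1 / c1 * (c1 / eps m))).
    by rewrite le_eqVlt; apply/orP; left; apply/eqP; field; rewrite !gt_eqF.
  by rewrite ler_wpM2l// divr_ge0// ltW.
have If x z := chain_Iu_fin m x z mU.
have iub : iu (p (eps m)) U x1 (8 * rho0) <= B0 * iu (p (eps m)) U x2 (8 * rho0).
  have hu := chain_iu_ub m x1 mU (lt_le_trans r0 r8).
  have xs8 := le_trans x2s r8.
  have := chain_iu_lb sc w mU s0 xU2 xs8.
  rewrite -/c1 => hl; apply: (le_trans hu).
  apply: (@le_trans _ _ (B0 * (c1 / eps m))); last by rewrite ler_wpM2l// (le_trans ler01 B1).
  rewrite mulrA ler_pM2r ?invr_gt0// -ler_pdivrMr//.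
  by rewrite le_max lexx orbT.
have [|||||||a [b [a0 ab ba hab]]] := hr rho0 (eps m) ph (p (eps m)) (stepP p (eps m)) U x1 x2 sc w mU (If x1) (If x2) (lexx _).
- exact: x1r.
- exact: x2r.
- exact: em2.
- by move=> z _ zr; apply: ub => //; exact: f1.
- by move=> z _ zr; apply: ub => //; exact: f2.
- exact: iub.
- by move=> rho rrho; exact: (h3 n rho nn3 rrho).
have ne x z : 1 <= enorm ((x : 'rV[R]_d) - z) -> x != z.
  by move=> h; apply: contraTneq h => ->; rewrite subrr enorm0 -ltNge ltr01.
have main z : U z -> Num.max r rho0 <= enorm z -> a * g x2 z <= g x1 z /\ g x1 z <= b * g x2 z.
  rewrite ge_max => Uz /andP[rz rz0]; have [l1 l2] := hab z Uz rz.
  have E1 := gchainE m mU (ne _ _ (f1 z rz0)); have E2 := gchainE m mU (ne _ _ (f2 z rz0)).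
  by split; rewrite -lee_fin EFinM -E1 -E2 muleCA lee_pmul2l.
have g0 x z := gchain_ge0 m x z mU.
have [_ u1] := main y Dy yr; have [l2 _] := main y' Dy' yr'.
have p1 := g0 x2 y; have p2 := g0 x2 y'; have p3 := g0 x1 y.
rewrite -/g in p1 p2 p3.
apply: (@le_trans _ _ (b * g x2 y * g x2 y')); first by rewrite ler_wpM2r.
apply: (@le_trans _ _ ((a + eta) * g x2 y * g x2 y')).
  by rewrite -!mulrA ler_wpM2r ?mulr_ge0// -lerBlDl.
rewrite mulrDl mulrDl -(mulrA eta) lerD2r (mulrC a) -mulrA.
by rewrite ler_wpM2l.
Qed.

Definition Kgr (x y : V) := Kmaj (enorm (x - y)) * Itd.

Lemma gchain_ub m (U : set V) x y : measurable U -> x != y -> gchain m U x y <= Kgr x y.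
Proof.
move=> mU xy; have del0 : 0 < enorm (x - y) by apply: enorm_gt0; rewrite subr_eq0.
rewrite -lee_fin -(gchainE m mU xy).
exact: (chain_green_ub m mU del0 (lexx _)).
Qed.

Lemma cvg_fine_bounded (u : nat -> R) (a : \bar R) k : (forall n, 0 <= u n <= k) ->
  (u n)%:E @[n --> \oo] --> a -> a \is a fin_num /\ u @ \oo --> fine a.
Proof.
move=> uk ua.
have ca : cvg ((u n)%:E @[n --> \oo]) by apply/cvg_ex; exists a.
have a1 : (0 <= a)%E.
  by rewrite -(cvg_lim _ ua)//; apply: lime_ge => //; apply: nearW => n; rewrite lee_fin; case/andP: (uk n).
have a2 : (a <= k%:E)%E.
  by rewrite -(cvg_lim _ ua)//; apply: lime_le => //; apply: nearW => n; rewrite lee_fin; case/andP: (uk n).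
have fa : a \is a fin_num by rewrite ge0_fin_numE// (le_lt_trans a2)// ltry.
split=> //; rewrite -(fineK fa) in ua; exact: (fine_cvg ua).
Qed.

Lemma green_limits (D : set 'rV[R]_d) (x y : V) : open D -> D x -> D y -> x != y ->
  [/\ exists n0, forall n, (n0 <= n)%N ->
        gchain m (inner_set D n) x y @[m --> \oo] --> fine (green P X p (inner_set D n) x y),
      fine (green P X p (inner_set D n) x y) @[n --> \oo] --> fine (green P X p D x y) &
      green P X p D x y \is a fin_num].
Proof.
move=> oD Dx Dy xy; have [del del0 [n0 hn0]] := inner_set_far oD Dy.
have H n : (n0 <= n)%N -> green P X p (inner_set D n) x y \is a fin_num /\
    gchain m (inner_set D n) x y @[m --> \oo] --> fine (green P X p (inner_set D n) x y).
  move=> nn; have mU := measurable_inner_set D n.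
  have [h _ _] := cvg_chain_green xy
    del0 mU (@closed_inner_set _ _ D n) (hn0 n nn).2.
  apply: (@cvg_fine_bounded _ _ (Kgr x y)).
    move=> m; rewrite (gchain_ge0 m _ _ mU) /=.
    exact: gchain_ub.
  move: h; under eq_fun do rewrite (gchainE _ mU xy).
  exact.
have c := cvg_green xy oD Dx Dy.
pose u n := fine (green P X p (inner_set D (n + n0)) x y).
have bu n : 0 <= u n <= Kgr x y.
  have nn : (n0 <= n + n0)%N by rewrite leq_addl.
  have [_ h] := H _ nn; have mU := measurable_inner_set D (n + n0).
  have c1 : (fun=> 0 : R) @ \oo --> (0 : R) by exact: cvg_cst.
  have c2 : (fun=> Kgr x y) @ \oo --> Kgr x y by exact: cvg_cst.
  apply/andP; split.
    apply: (ler_cvg_to c1 h); apply: nearW => m.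
    exact: (gchain_ge0 m _ _ mU).
  by apply: (ler_cvg_to h c2); apply: nearW => m; exact: gchain_ub.
have uE : (u n)%:E @[n --> \oo] --> green P X p D x y.
  rewrite -(cvg_shiftn n0) in c; move: c.
  rewrite (_ : (fun n => green P X p (inner_set D (n + n0)) x y) = fun n => (u n)%:E)//.
  by apply/funext => n; rewrite /u fineK//; have [] := H (n + n0)%N (leq_addl _ _).
have [fin cv] := cvg_fine_bounded bu uE.
split; [by exists n0 => n nn; exact: (H n nn).2| |exact: fin].
by rewrite -(cvg_shiftn n0).
Qed.

(** A non-strict inequality between products passes to the limit in m, then in n; the r of
    [chain_cross] depends on neither. *)
Lemma green_cross (D : set 'rV[R]_d) R0 kappa (x1 x2 : V) eta : open D -> D x1 -> D x2 ->
  0 < kappa <= 1 -> kappa_fat_at_infinity D R0 kappa -> 0 < eta ->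
  exists r, forall y y', D y -> D y' -> r <= enorm y -> r <= enorm y' ->
    let G x y := fine (green P X p D x y) in
    (G x1 y * G x2 y' <= G x2 y * G x1 y' + eta * (G x2 y * G x2 y')) : Prop.
Proof.
move=> oD D1 D2 kap fat eta0.
have [r [n0 [M H]]] := chain_cross
   oD D1 D2 kap fat eta0.
exists (Num.max r (enorm x1 + enorm x2 + 1)) => y y' Dy Dy'; rewrite !ge_max => /andP[yr yx] /andP[yr' yx'] G.
have n1 := enorm_ge0 x1; have n2 := enorm_ge0 x2.
have ne1 z : enorm x1 + enorm x2 + 1 <= enorm z -> x1 != z by move=> h; apply: contraTneq h => <-; rewrite -ltNge; lra.
have ne2 z : enorm x1 + enorm x2 + 1 <= enorm z -> x2 != z by move=> h; apply: contraTneq h => <-; rewrite -ltNge; lra.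
have [[k1 a1] b1 _] := green_limits oD D1 Dy (ne1 y yx).
have [[k2 a2] b2 _] := green_limits oD D2 Dy (ne2 y yx).
have [[k3 a3] b3 _] := green_limits oD D1 Dy' (ne1 y' yx').
have [[k4 a4] b4 _] := green_limits oD D2 Dy' (ne2 y' yx').
have [del5 del50 [k5 h5]] := inner_set_far oD Dy.
have [del6 del60 [k6 h6]] := inner_set_far oD Dy'.
have ceta : (fun=> eta) @ \oo --> eta by exact: cvg_cst.
apply: (ler_cvg_to (cvgM b1 b4) (cvgD (cvgM b2 b3) (cvgM ceta (cvgM b2 b4)))).
exists (maxn n0 (maxn k1 (maxn k2 (maxn k3 (maxn k4 (maxn k5 k6)))))) => // n /=.
rewrite !geq_max => /and5P[nn0 nk1 nk2 nk3 /and3P[nk4 nk5 nk6]].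
apply: (ler_cvg_to (cvgM (a1 n nk1) (a4 n nk4))
  (cvgD (cvgM (a2 n nk2) (a3 n nk3)) (cvgM ceta (cvgM (a2 n nk2) (a4 n nk4))))).
exists M => // m /= mM; apply: H => //; [exact: (h5 n nk5).1|exact: (h6 n nk6).1].
Qed.

(** Positivity could be lost in the limits; it is kept by the lower bound c of [chain_green_lb],
    uniform in m and n. *)
Lemma green_gt0 (D : set 'rV[R]_d) (x : V) : open D -> D x ->
  exists r, forall y, D y -> r <= enorm y -> 0 < fine (green P X p D x y).
Proof.
move=> oD Dx.
have [s1 s10 [n1 h1]] := inner_set_far oD Dx.
have [Cw Cw1 [sc wk]] := walk_exists d0 phi_gt0 phi_cbf X_levy X_exponent p_density W.
pose rho0 := enorm x + s1; have nx := enorm_ge0 x.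
have r0 : 0 < rho0 by rewrite /rho0; lra.
exists (2 * rho0 + 1) => y Dy yr.
have [s2 s20 [n2 h2]] := inner_set_far oD Dy.
pose s := Num.min 1 s2; have s0 : 0 < s by rewrite lt_min ltr01.
have s1' : s <= 1 by rewrite ge_min lexx.
have ys : 2 * rho0 + s <= enorm y by lra.
have [c c0 hc] := chain_green_lb
  sc r0 s0 s10 (lexx _) ys.
have xy : x != y by apply: contraTneq yr => <-; rewrite -ltNge /rho0; lra.
have [[k1 a1] b1 _] := green_limits oD Dx Dy xy.
apply: (lt_le_trans c0).
have ccst : (fun=> c) @ \oo --> c by exact: cvg_cst.
apply: (ler_cvg_to ccst b1); exists (maxn k1 (maxn n1 n2)) => // n /=.
rewrite !geq_max => /and3P[nk1 nn1 nn2].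
apply: (ler_cvg_to ccst (a1 n nk1)).
have pr := sc_pos sc r0; have C0 : 0 < Cw by lra.
have [M hM] := @pow2V_small R (Cw * ph rho0)^-1 ltac:(by rewrite invr_gt0 mulr_gt0).
exists M => // m /= mM; have e0 := eps_gt0 m; have mU := measurable_inner_set D n.
rewrite -lee_fin -(gchainE m mU xy).
apply: (hc m _ (Keps d C alpha) (stepP p (eps m))) => //.
- apply: wk => //; have /ltW := hM m mM.
  by rewrite -[X in _ <= X]div1r ler_pdivlMr ?mulr_gt0// mulrCA.
- move=> z zx; apply: contrapT => nz; have := (h1 n nn1).2 z nz.
  by rewrite leNgt zx.
- move=> z zx; apply: contrapT => nz; have := (h2 n nn2).2 z nz.
  by rewrite leNgt (lt_le_trans zx)// ge_min lexx orbT.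
Qed.

End green_limit.

Theorem theorem4p9 (R : realType) (d : nat) (d_ge1 : (1 <= d)%N)
    (phi : R -> R)
    (phi_gt0 : forall l : R, 0 < l -> 0 < phi l)
    (phi_cbf : complete_bernstein phi)
    (delta1 delta2 delta3 delta4 a1 a2 a3 a4 : R)
    (delta12 : [/\ 0 < delta1, delta1 <= delta2 & delta2 < 1])
    (delta34 : [/\ 0 < delta3, delta3 <= delta4 & delta4 < 1])
    (a_gt0 : [/\ 0 < a1, 0 < a2, 0 < a3 & 0 < a4])
    (scaling_infty : forall l t : R, 1 <= l -> 1 <= t ->
       a1 * l `^ delta1 * phi t <= phi (l * t) <= a2 * l `^ delta2 * phi t)
    (scaling_zero : forall l t : R, 0 < l <= 1 -> 0 < t <= 1 ->
       a3 * l `^ delta4 * phi t <= phi (l * t) <= a4 * l `^ delta3 * phi t)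
    (d_large : 2 * Num.max delta2 delta4 < d%:R)
    (disp : measure_display) (Omega : measurableType disp)
    (P : 'rV[R]_d -> probability Omega R) (X : R -> Omega -> 'rV[R]_d)
    (X_levy : levy_process P X)
    (X_rot : rotationally_invariant P X)
    (X_exponent : has_characteristic_exponent P X phi)
    (p : R -> 'rV[R]_d -> 'rV[R]_d -> R)
    (p_density : transition_density P X p)
    (kappa : R) (kappa_range : 0 < kappa <= 2^-1)
    (D : set 'rV[R]_d) (D_open : open D)
    (R0 : R) (R0_gt1 : 1 < R0)
    (D_fat : kappa_fat_at_infinity D R0 kappa)
    (x0 : 'rV[R]_d) (x0D : D x0) (x0_far : R0 < enorm x0) :
  forall x : 'rV[R]_d, D x ->
    exists l : R,
      martin_kernel P X p D x0 x y @[y --> within D (@enorm_pinfty R d)]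
        --> l%:E.
Proof.
move=> x Dx.
have [C W] := wscaleP phi_gt0 delta12 delta34 a_gt0 scaling_infty scaling_zero.
have beta0 : 0 < Num.max delta2 delta4.
  by case: delta12 => h1 h2 _; rewrite lt_max (lt_le_trans h1 h2).
have [k0 kh] : 0 < kappa /\ kappa <= 2^-1 by apply/andP.
have kap : 0 < kappa <= 1.
  by rewrite k0 (le_trans kh)// invf_le1// ler1n.
have PF := within_pinfty_proper k0 D_fat.
pose G z y := fine (green P X p D z y).
have ev r : within D (@enorm_pinfty R d) [set y | D y /\ r <= enorm y].
  by exists r => // y /= ry Dy; split=> //; exact: ltW.
have [r1 hr1] := green_gt0 d_ge1 phi_gt0 phi_cbf X_levy X_exponent p_density W beta0 d_large D_open x0D.
have Gpos : within D (@enorm_pinfty R d) [set y | 0 < G x0 y].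
  by apply: filterS (ev r1) => y [Dy yr]; exact: hr1.
have [|l hl] := @cvg_ratio R _ _ PF (G x) (G x0) Gpos.
  move=> eta eta0.
  have [r hr] := green_cross d_ge1 phi_gt0 phi_cbf X_levy X_exponent p_density W beta0 d_large
     D_open Dx x0D kap D_fat eta0.
  by exists [set y | D y /\ r <= enorm y]; [exact: ev|move=> y y' [Dy yr] [Dy' yr']; exact: hr].
(* [martin_kernel] is a quotient of extended reals. Far out both Green functions are finite and the
   denominator is positive, so it agrees there with the real quotient. *)
exists l; apply: cvg_trans (_ : ((G x y / G x0 y)%:E @[y --> within D (@enorm_pinfty R d)]) `=>` nbhs l%:E); last first.
  by apply: cvg_EFin => //; exact: nearW.
apply: near_eq_cvg.
have far : within D (@enorm_pinfty R d) ([set y | D y /\ enorm x + enorm x0 + 1 <= enorm y] `&`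
    [set y | 0 < G x0 y]) by apply: filterI => //; exact: ev.
apply: (@filterS _ (within D (@enorm_pinfty R d)) _ _ _ _ far) => y [[Dy yr] /= g0].
have nx := enorm_ge0 x; have nx0 := enorm_ge0 x0.
have xy : x != y by apply: contraTneq yr => <-; rewrite -ltNge; lra.
have x0y : x0 != y by apply: contraTneq yr => <-; rewrite -ltNge; lra.
have [_ _ f1] := green_limits d_ge1 phi_gt0 phi_cbf X_levy X_exponent p_density W beta0 d_large D_open Dx Dy xy.
have [_ _ f2] := green_limits d_ge1 phi_gt0 phi_cbf X_levy X_exponent p_density W beta0 d_large D_open x0D Dy x0y.
by rewrite /martin_kernel -(fineK f1) -(fineK f2) inver -!/(G _ _) gt_eqF// -EFinM.
Qed.
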